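(* Let $n\ge1$ and let $\sigma:\mathbb B^n\to\mathbb R$ be measurable such that either (a) $\sigma$ is bounded, $\sigma\in L^1(\mathbb B^n,(1-|z|^2)^{-n-1}dV(z))$, and $\psi:\mathbb R\to\mathbb R$ is continuous on $[\operatorname{ess\,inf}\sigma,\operatorname{ess\,sup}\sigma]$; or (b) $\sigma\ge0$, $\sigma\in L^1(\mathbb B^n,(1-|z|^2)^{-n-1}dV(z))\cap L^2(\mathbb B^n,(1-|z|^2)^{-n-1}dV(z))$, and $\psi\in C([0,\infty))$ (real-valued) satisfies $\lim_{x\to\infty}\psi(x)/x\in\mathbb R$. Then, as $\alpha\to\infty$, $$\frac{\pi^n\Gamma(\alpha+1)}{\Gamma(n+\alpha+1)}\operatorname{Tr}\bigl(T_\sigma^\alpha\psi(T_\sigma^\alpha)\bigr)\longrightarrow\int_{\mathbb B^n}\sigma(z)\psi(\sigma(z))(1-|z|^2)^{-n-1}\,dV(z).$$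
   Context: $\mathbb B^n$ is the open unit ball of $\mathbb C^n$ and $dV$ is Lebesgue (volume) measure on $\mathbb C^n$. For $\alpha>-1$, the weighted Bergman space $A_\alpha^2(\mathbb B^n)$ is the Hilbert space of holomorphic functions on $\mathbb B^n$ that are square-integrable with respect to $d\mu_\alpha(z)=\frac{\Gamma(n+\alpha+1)}{\pi^n\Gamma(\alpha+1)}(1-|z|^2)^\alpha\,dV(z)$, with the $L^2(\mu_\alpha)$ inner product. It is a reproducing kernel Hilbert space with kernel $K^\alpha(z,w)=(1-\langle z,w\rangle)^{-(n+1+\alpha)}$, and $k_z^\alpha(w)=K^\alpha(w,z)/\sqrt{K^\alpha(z,z)}$ are the normalized reproducing kernels. The Toeplitz operator on $A_\alpha^2(\mathbb B^n)$ with symbol $\sigma$ is the weakly defined operator $$T_\sigma^\alpha f=\frac{\Gamma(n+\alpha+1)}{\pi^n\Gamma(\alpha+1)}\int_{\mathbb B^n}\sigma(z)\langle f,k_z^\alpha\rangle k_z^\alpha(1-|z|^2)^{-n-1}\,dV(z),$$ and $\psi(T_\sigma^\alpha)$ is defined by functional calculus of the self-adjoint operator $T_\sigma^\alpha$. *)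

(* Defs.v *)
From HB Require Import structures.
From mathcomp Require Import all_boot all_order all_algebra.
From mathcomp Require Import complex.
From mathcomp Require Import all_classical all_reals all_analysis.
From mathcomp Require Import measurable_realfun ess_sup_inf.

Set Implicit Arguments.
Unset Strict Implicit.
Unset Printing Implicit Defensive.

Import Order.TTheory GRing.Theory Num.Theory.
Import numFieldNormedType.Exports.

Local Open Scope classical_set_scope.
Local Open Scope complex_scope.
Local Open Scope ring_scope.

(* R[i]^o rather than R[i], so that the topology, the normed module structure
   and the scaling are those of the complex field acting on itself. *)
Notation cplx R := (R[i]^o) (only parsing).
Notation Cn R n := ('rV[R[i]^o]_n) (only parsing).

(* Principal branch of w ^ s on the half-plane 0 < Re w, where the argument of
   w is atan (Im w / Re w). *)
Definition cpow (R : realType) (w : cplx R) (s : R) : cplx R :=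
  let theta := atan (complex.Im w / complex.Re w) in
  (ComplexField.Normc.normc w `^ s)%:C *
    (cos (s * theta) +i* sin (s * theta)).

Definition Gamma (R : realType) (x : R) : R :=
  \int[lebesgue_measure]_(t in `]0, +oo[) (t `^ (x - 1) * expR (- t)).

(* The library's sigma-finite instance for [m1 \x m2] is only inferred when m1
   and m2 are probabilities. *)
Lemma product_sigma_finite d1 d2 (T1 : measurableType d1)
    (T2 : measurableType d2) (R : realType)
    (m1 : {sigma_finite_measure set T1 -> \bar R})
    (m2 : {sigma_finite_measure set T2 -> \bar R}) :
  sigma_finite setT (m1 \x m2)%E.
Proof.
have /sigma_finiteP[F [TF ndF Foo]] := sigma_finiteT m1.
have /sigma_finiteP[G [TG ndG Goo]] := sigma_finiteT m2.
exists (fun n => F n `*` G n).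
  rewrite -setXTT TF TG predeqE => -[x y]; split.
    move=> [/= [n _ Fnx] [k _ Gky]]; exists (maxn n k) => //; split.
    - by move: x Fnx; exact/subsetPset/ndF/leq_maxl.
    - by move: y Gky; exact/subsetPset/ndG/leq_maxr.
  by move=> [n _ []/= ? ?]; split; exists n.
move=> k; have [? ?] := Foo k; have [? ?] := Goo k.
split; first exact: measurableX.
by rewrite product_measure1E// lte_mul_pinfty// ge0_fin_numE.
Qed.

Section LebesgueCn.
Variable R : realType.
Local Open Scope ereal_scope.

Local Notation RR := (measurableTypeR R * measurableTypeR R)%type.

Definition lebesgue2 : set RR -> \bar R :=
  (@lebesgue_measure R \x @lebesgue_measure R).

HB.instance Definition _ := Measure.on lebesgue2.
HB.instance Definition _ := Measure_isSigmaFinite.Build _ _ _ lebesgue2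
  (product_sigma_finite _ _).

Definition consT n (p : RR * n.-tuple RR) : n.+1.-tuple RR :=
  [the n.+1.-tuple RR of p.1 :: p.2].

Lemma measurable_consT n : measurable_fun setT (@consT n).
Proof. exact: measurable_cons. Qed.

Section step.
Variables (n : nat) (m : {sigma_finite_measure set (n.-tuple RR) -> \bar R}).

Definition vol_step : set (n.+1.-tuple RR) -> \bar R :=
  pushforward (lebesgue2 \x m) (@consT n).

Let vol_step0 : vol_step set0 = 0.
Proof. by rewrite /vol_step /pushforward preimage_set0 measure0. Qed.

Let vol_step_ge0 A : 0 <= vol_step A.
Proof. by rewrite /vol_step /pushforward; exact: measure_ge0. Qed.

Let measurable_pre (A : set (n.+1.-tuple RR)) :
  measurable A -> measurable (@consT n @^-1` A).
Proof.
by move=> mA; rewrite -[X in measurable X]setTI; exact: measurable_consT.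
Qed.

Let vol_step_sigma_additive : semi_sigma_additive vol_step.
Proof.
move=> F mF tF mUF; rewrite /vol_step /pushforward preimage_bigcup.
apply: measure_semi_sigma_additive => [k||]; first exact: measurable_pre.
- apply/trivIsetP => i j _ _ ij; rewrite -preimage_setI.
  by move/trivIsetP : tF => /(_ _ _ _ _ ij) ->//; rewrite preimage_set0.
- by rewrite -preimage_bigcup; exact: measurable_pre.
Qed.

HB.instance Definition _ := isMeasure.Build _ _ _ vol_step
  vol_step0 vol_step_ge0 vol_step_sigma_additive.

Let vol_step_sigma_finite : sigma_finite setT vol_step.
Proof.
have [F TF Foo] := product_sigma_finite lebesgue2 m.
pose u (x : n.+1.-tuple RR) : RR * n.-tuple RR := (thead x, [tuple of behead x]).
have Ku : cancel (@consT n) u by case=> a t; congr pair; exact/val_inj.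
have mu : measurable_fun setT u.
  apply/measurable_fun_pairP; split; last exact: measurable_behead.
  exact: measurable_tnth.
exists (fun k => u @^-1` F k) => [|k].
  by rewrite -preimage_bigcup -TF preimage_setT.
have [mFk Fkoo] := Foo k; split.
  by rewrite -[X in measurable X]setTI; exact: mu.
rewrite /vol_step /pushforward -comp_preimage.
by rewrite (_ : u \o _ = idfun) ?preimage_id//; apply/funext => x /=; rewrite Ku.
Qed.

HB.instance Definition _ := Measure_isSigmaFinite.Build _ _ _ vol_step
  vol_step_sigma_finite.
End step.

(* 2n-dimensional Lebesgue measure on the Borel (product) sigma-algebra *)
Fixpoint vol n : {sigma_finite_measure set (n.-tuple RR) -> \bar R} :=
  match n with
  | 0 => @dirac _ _ [tuple] R
  | n'.+1 => vol_step (vol n')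
  end.

(* Lebesgue measure on C^n: the completion of vol, defined on the Lebesgue
   measurable sets *)
Definition lebesgueCn n : set (caratheodory_type (vol n)^*%mu) -> \bar R :=
  @completed_measure_extension _ (n.-tuple RR) R (vol n).

HB.instance Definition _ n := Measure.on (@lebesgueCn n).

End LebesgueCn.

Section Ball.
Variables (R : realType) (n : nat).
Local Notation RR := (measurableTypeR R * measurableTypeR R)%type.
Local Notation C := (cplx R).
Local Notation Cn := (Cn R n).
Local Notation mu := (@lebesgueCn R n).

(* C^n is identified with (R x R)^n by real and imaginary parts. *)
Definition toCn (x : n.-tuple RR) : Cn :=
  \row_i ((tnth x i).1 +i* (tnth x i).2).

Definition dotCn (z w : Cn) : C := \sum_(i < n) z ord0 i * (w ord0 i)^*.

Definition sqnorm (z : Cn) : R := complex.Re (dotCn z z).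

Definition unit_ball : set Cn := [set z | sqnorm z < 1].

Definition ball_coords : set (caratheodory_type (vol R n)^*%mu) :=
  [set x | unit_ball (toCn x)].

Lemma measurable_ball_coords : measurable ball_coords.
Proof.
apply: sub_caratheodory; apply: sub_sigma_algebra.
pose f (x : n.-tuple RR) : R :=
  \sum_(i < n) ((tnth x i).1 ^+ 2 + (tnth x i).2 ^+ 2).
have mf : measurable_fun setT f.
  apply: measurable_sum => i; apply: measurable_funD.
  - apply: measurable_funX.
    by apply: (measurableT_comp measurable_fst); exact: measurable_tnth.
  - apply: measurable_funX.
    by apply: (measurableT_comp measurable_snd); exact: measurable_tnth.
rewrite (_ : ball_coords = f @^-1` `]-oo, 1[).
  by rewrite -[X in measurable X]setTI; exact: mf.
apply/seteqP; split => x;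
  rewrite /ball_coords /unit_ball /sqnorm /dotCn /= in_itv /=.
all: rewrite (_ : complex.Re _ = f x)// /f raddf_sum.
all: by apply: eq_bigr => i _; rewrite mxE/= mulrN opprK !expr2.
Qed.

Definition int_ball (F : Cn -> R) : R := \int[mu]_(x in ball_coords) F (toCn x).

Definition integrable_on_ball (F : Cn -> R) : Prop :=
  mu.-integrable ball_coords (fun x => (F (toCn x))%:E).

Definition cint_ball (F : Cn -> C) : C :=
  int_ball (fun z => complex.Re (F z)) +i* int_ball (fun z => complex.Im (F z)).

Definition measurable_on_ball (F : Cn -> R) : Prop :=
  measurable_fun ball_coords (F \o toCn).

Definition ess_inf_ball (F : Cn -> R) : \bar R :=
  ess_inf (mrestr mu measurable_ball_coords) (fun x => (F (toCn x))%:E).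

Definition ess_sup_ball (F : Cn -> R) : \bar R :=
  ess_sup (mrestr mu measurable_ball_coords) (fun x => (F (toCn x))%:E).

(* The density of the Moebius-invariant measure (1 - |z|^2)^(-n-1) dV(z) *)
Definition inv_density (z : Cn) : R := (1 - sqnorm z) ^- n.+1.

End Ball.
Arguments unit_ball {R n}.

Section Bergman.
Variables (R : realType) (n : nat) (alpha : R).
Local Notation C := (cplx R).
Local Notation Cn := (Cn R n).

Definition cst_alpha : R :=
  Gamma (n%:R + alpha + 1) / (pi ^+ n * Gamma (alpha + 1)).

Definition weight (z : Cn) : R := (1 - sqnorm z) `^ alpha.

(* A function on the ball is represented by its extension by 0 to C^n. *)
Definition bergman : set (Cn -> C) :=
  [set f : Cn -> C | [/\ forall z, unit_ball z -> differentiable f z,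
               forall z, ~ unit_ball z -> f z = 0 &
               integrable_on_ball (fun z => complex.Re (f z * (f z)^*) * weight z)]].

Definition bergman_ip (f g : Cn -> C) : C :=
  cst_alpha%:C * cint_ball (fun z => f z * (g z)^* * (weight z)%:C).

Definition bergman_kernel (z w : Cn) : C :=
  cpow (1 - dotCn z w) (- (n%:R + 1 + alpha)).

(* normalized reproducing kernel k_z, again extended by 0 *)
Definition normalized_kernel (z w : Cn) : C :=
  if w \in unit_ball
  then bergman_kernel w z / sqrtC (bergman_kernel z z) else 0.
End Bergman.

Section Hilbert.
Variables (R : realType) (V : lmodType R[i]) (H : set V) (ip : V -> V -> R[i]).
Local Notation C := (cplx R).

Definition hnorm (f : V) : R := Num.sqrt (complex.Re (ip f f)).

Definition bounded_op (T : V -> V) : Prop :=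
  [/\ forall f, H f -> H (T f),
      forall (a : C) f g, H f -> H g -> T (a *: f + g) = a *: T f + T g &
      exists M : R, forall f, H f -> hnorm (T f) <= M * hnorm f].

Definition selfadjoint (T : V -> V) : Prop :=
  forall f g, H f -> H g -> ip (T f) g = ip f (T g).

Definition spectrum (T : V -> V) : set C :=
  [set lambda | ~ exists2 S, bounded_op S &
     forall f, H f -> S (T f - lambda *: f) = f /\ T (S f) - lambda *: S f = f].

Definition poly_op (p : {poly R}) (T : V -> V) (f : V) : V :=
  \sum_(i < size p) (p`_i)%:C *: iter i T f.

(* Continuous functional calculus of a bounded self-adjoint operator T (whose
   spectrum is real): S = psi(T) when polynomials p_k tending to psi uniformly
   on the spectrum of T are such that p_k(T) tends to S in operator norm. *)
Definition is_funcalc (psi : R -> R) (T S : V -> V) : Prop :=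
  bounded_op S /\
  exists p : nat -> {poly R},
    (forall e : R, 0 < e -> \forall k \near \oo,
       forall x : R, spectrum T x%:C -> `|(p k).[x] - psi x| <= e) /\
    (forall e : R, 0 < e -> \forall k \near \oo,
       forall f, H f -> hnorm (poly_op (p k) T f - S f) <= e * hnorm f).

Definition funcalc (psi : R -> R) (T : V -> V) : V -> V :=
  xget (idfun : V -> V) [set S | is_funcalc psi T S].

Definition onb (e : nat -> V) : Prop :=
  [/\ forall j, H (e j),
      forall j k, ip (e j) (e k) = (j == k)%:R &
      forall f, H f -> (forall j, ip f (e j) = 0) -> f = 0].

(* The requirement on all orthonormal bases, hence on all their
   rearrangements, makes T a trace class operator. *)
Definition has_trace (T : V -> V) (t : C) : Prop :=
  forall e, onb e -> series (fun j => ip (T (e j)) (e j) : C) @ \oo --> t.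

Definition op_trace (T : V -> V) : C := xget 0 [set t | has_trace T t].
End Hilbert.

Section Toeplitz.
Variables (R : realType) (n : nat) (alpha : R) (sigma : 'rV[R[i]^o]_n -> R).
Local Notation C := (cplx R).
Local Notation Cn := (Cn R n).
Local Notation ip := (bergman_ip alpha).
Local Notation k := (normalized_kernel alpha).

Definition is_toeplitz (T : (Cn -> C) -> (Cn -> C)) : Prop :=
  bounded_op (bergman alpha) ip T /\
  forall f g, bergman alpha f -> bergman alpha g ->
    ip (T f) g = (cst_alpha n alpha)%:C *
      cint_ball (fun z => (sigma z)%:C * ip f (k z) * ip (k z) g *
                      (inv_density z)%:C).

Definition toeplitz : (Cn -> C) -> (Cn -> C) := xget (idfun : (Cn -> C) -> (Cn -> C)) is_toeplitz.
End Toeplitz.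

(* Main.v *)
(* Let e_k be an eigenbasis of T with eigenvalues l_k. Each |e_k(x)|^2 dmu is a
probability measure for which sigma has mean l_k, and their sum is K(x,x) dmu.
So Tr(T psi(T)) differs from the integral of sigma psi(sigma) K(x,x) by at most
the total variance of sigma, up to an arbitrarily small error (the modulus in
[tame]). That variance is at most half the integral of
(sigma x - sigma y)^2 |K(x,y)|^2, which, suitably normalized, vanishes in the
limit because the kernels concentrate on the diagonal. *)
From HB Require Import structures.
Require Import Defs.
From mathcomp Require Import all_boot all_order all_algebra.
From mathcomp Require Import complex.
From mathcomp Require Import all_classical all_reals all_analysis.
From mathcomp Require Import measurable_realfun ess_sup_inf.
From mathcomp Require Import ring lra.

Set Implicit Arguments.
Unset Strict Implicit.
Unset Printing Implicit Defensive.

Import Order.TTheory GRing.Theory Num.Theory.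
Import numFieldNormedType.Exports.

Local Open Scope classical_set_scope.
Local Open Scope complex_scope.
Local Open Scope ring_scope.

(** Trace, spectrum and functional calculus are defined by conditions, so an eigenbasis must be
    produced before anything can be computed: [T] is Hilbert-Schmidt with a bound given by the mass
    of [|sigma|], weak limits along an ultrafilter give maximising vectors, and a greedy choice
    makes the eigenvectors a total sequence. Concentration comes from comparing the weights [a] and
    [a + 1]. Both kernels have the same mass in each variable, and [theta a] times the second is
    [1 - |phi_x(y)|^2] times the first, [phi_x] being the Moebius involution. So, away from the
    boundary, [|x - y|^2] times the first is dominated by a difference of mass of order [n / a].
    This settles Lipschitz symbols; the others are reached because the energy is bounded by the
    second moment uniformly in [a]. Fubini lives on the Borel product sigma-algebra while [sigma] is
    only Lebesgue measurable, hence the passage to a Borel version. The reproducing property is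
    derived from rotation averages and Cauchy's formula on a circle. *)

Notation mfun := (measurable_fun setT).
Notation mR := measurableTypeR.
Notation RxR R := (mR R * mR R)%type.
Notation mfunM := measurable_funM.
Notation mfunX := measurable_funX.
Notation mfunB := measurable_funB.
Notation mcst := measurable_cst.
Notation mcomp := measurableT_comp.
Notation mEFinP := measurable_EFinP.

Notation normc := ComplexField.Normc.normc.
Notation cRe := complex.Re.
Notation cIm := complex.Im.

Lemma eqle d (T : porderType d) (x y : T) : x = y -> (x <= y)%O.
by move->. Qed.
Lemma half_gt0 (R : realFieldType) (e : R) : 0 < e -> 0 < e / 2.
by move=> e0; rewrite divr_gt0. Qed.

(** * Complex numbers in real coordinates: modulus, derivative, exponential, powers *)

Section ComplexNumbers.
Variable R : realType.
Notation C := R[i].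
Implicit Types (f g : C -> C) (a b z w : C) (s : R).

Lemma normcE2 z : normc z = Num.sqrt (cRe z ^+ 2 + cIm z ^+ 2).
by case: z. Qed.
Lemma sqr_normcE z : normc z ^+ 2 = cRe z ^+ 2 + cIm z ^+ 2.
by rewrite normcE2 sqr_sqrtr// addr_ge0// sqr_ge0. Qed.
Lemma normr_normc z : `|z| = (normc z)%:C.
by rewrite normcE2 normc_def. Qed.
Lemma nc_ge0 z : 0 <= normc z.
by rewrite normcE2 sqrtr_ge0. Qed.
Lemma normcM z w : normc (z * w) = normc z * normc w.
exact: ComplexField.Normc.normcM. Qed.
Lemma normc0 : normc (0 : R[i]) = 0.
exact: ComplexField.Normc.normc0. Qed.
Lemma normc1 : normc (1 : R[i]) = 1.
exact: ComplexField.Normc.normc1. Qed.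
Lemma normcV z : normc z^-1 = (normc z)^-1.
exact: ComplexField.Normc.normcV. Qed.
Lemma normcX z k : normc (z ^+ k) = normc z ^+ k.
by elim: k => [|k IH]; rewrite ?expr0 ?normc1// !exprS normcM IH. Qed.

Lemma normc_eq0 z : (normc z == 0) = (z == 0).
apply/eqP/eqP => [|->]; last exact: normc0.
exact: ComplexField.Normc.eq0_normc.
Qed.

Lemma normc_gt0 z : (0 < normc z) = (z != 0).
by rewrite lt_neqAle nc_ge0 andbT eq_sym normc_eq0. Qed.
Lemma normcD z w : normc (z + w) <= normc z + normc w.
exact: le_normcD. Qed.
Lemma normcN z : normc (- z) = normc z.
exact: normcN. Qed.
Lemma normcB z w : normc (z - w) = normc (w - z).
by rewrite -normcN opprB. Qed.

Lemma normc_small z : (forall e, 0 < e -> normc z <= e) -> z = 0.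
move=> h; apply/eqP; rewrite -normc_eq0 eq_le nc_ge0 andbT.
by apply/ler_addgt0Pr => e e0; rewrite add0r h.
Qed.

Lemma normc_small_eq z w : (forall e, 0 < e -> normc (z - w) <= e) -> z = w.
by move=> h; apply/eqP; rewrite -subr_eq0; apply/eqP/normc_small. Qed.
Lemma normcBD z w : normc (z - w) <= normc z + normc w.
by rewrite (le_trans (normcD _ _))// normcN. Qed.

Lemma normc_dist z w : `|normc z - normc w| <= normc (z - w).
have h (a b : R[i]) : normc a - normc b <= normc (a - b).
 by have := normcD (a - b) b; rewrite subrK lerBlDr.
by rewrite ler_norml h andbT lerNl opprB normcB h.
Qed.

Lemma normcR (x : R) : normc x%:C = `|x|.
by rewrite normcE2/= expr0n/= addr0 sqrtr_sqr. Qed.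
Lemma normcJ z : normc z^* = normc z.
by case: z => a b; rewrite !normcE2/= sqrrN. Qed.
Lemma normc_i (x : R) : normc (0 +i* x) = `|x|.
by rewrite normcE2/= expr0n/= add0r sqrtr_sqr. Qed.
Lemma normRe z : `|cRe z| <= normc z.
by rewrite normcE2 -sqrtr_sqr ler_wsqrtr// lerDl sqr_ge0. Qed.
Lemma normIm z : `|cIm z| <= normc z.
by rewrite normcE2 -sqrtr_sqr ler_wsqrtr// lerDr sqr_ge0. Qed.
Lemma Re_le_normc z : cRe z <= normc z.
exact: le_trans (ler_norm _) (normRe z). Qed.

Lemma normc_le_ReIm z : normc z <= `|cRe z| + `|cIm z|.
case: z => a b /=.
rewrite -[leRHS]ger0_norm ?addr_ge0// -sqrtr_sqr ler_wsqrtr// sqrrD.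
by rewrite !real_normK ?num_real// lerD2r lerDl mulrn_wge0// mulr_ge0.
Qed.

Lemma mulcJ z : z * z^* = (normc z ^+ 2)%:C.
rewrite sqr_normcE; case: z => a b /=; apply/eqP; rewrite eq_complex/=.
by apply/andP; split; apply/eqP; ring.
Qed.

Lemma ReD z w : cRe (z + w) = cRe z + cRe w. by case: z w => [? ?] []. Qed.
Lemma ImD z w : cIm (z + w) = cIm z + cIm w. by case: z w => [? ?] []. Qed.
Lemma ReN z : cRe (- z) = - cRe z. by case: z. Qed.
Lemma ImN z : cIm (- z) = - cIm z. by case: z. Qed.
Lemma ReM z w : cRe (z * w) = cRe z * cRe w - cIm z * cIm w.
by case: z w => [? ?] []. Qed.
Lemma ImM z w : cIm (z * w) = cRe z * cIm w + cIm z * cRe w.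
by case: z w => [? ?] []. Qed.
Lemma ReJ z : cRe z^* = cRe z. by case: z. Qed.
Lemma ImJ z : cIm z^* = - cIm z. by case: z. Qed.
Lemma ReZ (x : R) z : cRe (x%:C * z) = x * cRe z.
by rewrite ReM/= mul0r subr0. Qed.
Lemma ImZ (x : R) z : cIm (x%:C * z) = x * cIm z.
by rewrite ImM/= mul0r addr0. Qed.
Lemma eqc z w : cRe z = cRe w -> cIm z = cIm w -> z = w.
by move=> h k; apply/eqP; rewrite eq_complex h k !eqxx. Qed.

Lemma Re_sum (I : Type) (r : seq I) P (F : I -> R[i]) :
 cRe (\sum_(i <- r | P i) F i) = \sum_(i <- r | P i) cRe (F i).
by elim/big_rec2 : _ => // i x y _ <-; rewrite ReD. Qed.

Lemma Im_sum (I : Type) (r : seq I) P (F : I -> R[i]) :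
 cIm (\sum_(i <- r | P i) F i) = \sum_(i <- r | P i) cIm (F i).
by elim/big_rec2 : _ => // i x y _ <-; rewrite ImD. Qed.

Lemma conjcM z w : (z * w)^* = z^* * w^*. exact: rmorphM. Qed.
Lemma conjcD z w : (z + w)^* = z^* + w^*. exact: rmorphD. Qed.
Lemma conjcB z w : (z - w)^* = z^* - w^*. exact: rmorphB. Qed.
Lemma conjcN z : (- z)^* = - z^*. exact: rmorphN. Qed.
Lemma conjcV z : (z^-1)^* = (z^*)^-1. exact: fmorphV. Qed.
Lemma conjc_one : (1 : R[i])^* = 1. by apply: eqc => //=; rewrite oppr0. Qed.
Lemma conjcR (x : R) : (x%:C)^* = x%:C. exact: conjc_real. Qed.
Lemma RCM (x y : R) : (x * y)%:C = x%:C * y%:C :> R[i]. exact: rmorphM. Qed.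
Lemma RCD (x y : R) : (x + y)%:C = x%:C + y%:C :> R[i]. exact: rmorphD. Qed.
Lemma RCB (x y : R) : (x - y)%:C = x%:C - y%:C :> R[i]. exact: rmorphB. Qed.
Lemma RCN (x : R) : (- x)%:C = - x%:C :> R[i]. exact: rmorphN. Qed.
Lemma RCV (x : R) : (x^-1)%:C = (x%:C)^-1 :> R[i]. exact: fmorphV. Qed.
Lemma RC_eq0 (x : R) : (x%:C == 0 :> R[i]) = (x == 0).
by rewrite eq_complex/= eqxx andbT. Qed.

(** [a] is the derivative. Radii are real, and the non-strict inequality holds trivially at [w = z],
    so no punctured neighbourhood is needed. *)
Definition cdiff f a z := forall e : R, 0 < e -> exists2 d : R, 0 < d &
 forall w, normc (w - z) < d -> normc (f w - f z - a * (w - z)) <= e * normc (w - z).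

(** The balls of [R[i]] have radii in [R[i]], but a positive complex number has zero imaginary part,
    so these balls are the discs of real radius. *)
Lemma nbhs_normcP z (P : set (cplx R)) :
 nbhs (z : cplx R) P <-> exists2 d : R, 0 < d & forall w, normc (w - z) < d -> P w.
split.
 move=> /nbhs_ballP[/= e e0 eP]. have [r re] : exists r : R, e = r%:C.
  by case: e e0 {eP} => er ei; rewrite ltcE/= => /andP[/eqP-> _]; exists er.
 exists r; first by move: e0; rewrite re ltcR.
 move=> w wz; apply: eP; rewrite -ball_normE/= re normr_normc ltcR. by rewrite normcB.
move=> [d d0 dP]; apply/nbhs_ballP; exists d%:C; first by rewrite /= ltcR.
by move=> w; rewrite -ball_normE/= normr_normc ltcR normcB; exact: dP.
Qed.

Lemma cvg_normcP T (F : set_system T) {FF : Filter F} (f : T -> cplx R) (l : C) :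
 f @ F --> (l : cplx R) <-> forall e : R, 0 < e -> \forall x \near F, normc (f x - l) < e.
split=> [fl e e0|h].
 by apply: (fl [set w | normc (w - l) < e]); apply/nbhs_normcP; exists e.
move=> P /nbhs_normcP[d d0 dP]; near=> x; apply: dP; near: x; exact: h.
Unshelve. all: by end_near. Qed.

Lemma differentiable_cdiff f z :
 differentiable (f : cplx R -> cplx R) (z : cplx R) -> exists a, cdiff f a z.
move=> /derivable1_diffP/cvg_ex[a /cvg_normcP ha]; exists a => e e0.
have [d d0 dP] := (nbhs_normcP _ _).1 (ha e e0).
exists d => // w wz; have [->|wz0] := eqVneq w z.
 by rewrite !subrr mulr0 subr0 normc0 mulr0.
have h0 : w - z != 0 by rewrite subr_eq0.
have := dP (w - z); rewrite subr0 => /(_ wz h0)/ltW.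
rewrite /shift/= /GRing.scale/= mulr1 subrK => h.
rewrite (_ : _ - _ = (w - z) * ((w - z)^-1 * (f w - f z) - a)); last by field.
by rewrite normcM mulrC ler_wpM2r// nc_ge0.
Qed.

Lemma cdiff_differentiable f a z : cdiff f a z ->
 differentiable (f : cplx R -> cplx R) (z : cplx R).
move=> fz; apply/derivable1_diffP/cvg_ex; exists a; apply/cvg_normcP => e e0.
have [d d0 dP] := fz _ (divr_gt0 e0 (ltr0n _ 2)).
apply/nbhs_normcP; exists d => // h; rewrite subr0 => hd h0.
have := dP (h + z); rewrite addrK => /(_ hd) H.
rewrite /shift/= /GRing.scale/= mulr1.
have hp : 0 < normc h by rewrite normc_gt0.
apply: (@le_lt_trans _ _ (e / 2)); last by lra.
rewrite -(ler_pM2r hp) -normcM (le_trans _ H)//; apply: eqle.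
by congr normc; rewrite mulrBl mulrAC mulVf// mul1r.
Qed.

Lemma cdiff_cont f a z : cdiff f a z -> forall e : R, 0 < e ->
 exists2 d : R, 0 < d & forall w, normc (w - z) < d -> normc (f w - f z) < e.
move=> fa e e0; have [d d0 dP] := fa 1 ltr01.
have k0 : 0 < normc a + 1 by rewrite ltr_wpDl// nc_ge0.
exists (Num.min d (e / (normc a + 1))); first by rewrite lt_min d0 divr_gt0.
move=> w; rewrite lt_min => /andP[/dP H]; rewrite ltr_pdivlMr// => H2.
apply: le_lt_trans H2; rewrite -(subrK (a * (w - z)) (_ - f z)).
rewrite (le_trans (normcD _ _))// [normc (a * _)]normcM [leRHS]mulrDr mulr1.
by rewrite addrC (mulrC (normc a)) lerD2l (le_trans H)// mul1r.
Qed.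

Definition cexp z : C := (expR (cRe z))%:C * (cos (cIm z) +i* sin (cIm z)).

Lemma cexpD a b : cexp (a + b) = cexp a * cexp b.
rewrite /cexp ReD ImD expRD cosD sinD RCM; apply: eqc;
 rewrite !(ReM, ImM)/=; ring.
Qed.

Lemma cexp0 : cexp 0 = 1.
by rewrite /cexp/= expR0 cos0 sin0 mul1r. Qed.

Lemma normc_cexp z : normc (cexp z) = expR (cRe z).
rewrite /cexp normcM normcR normcE2/= cos2Dsin2 sqrtr1 mulr1.
by rewrite ger0_norm// expR_ge0.
Qed.

Lemma cexp_neq0 z : cexp z != 0.
by rewrite -normc_eq0 normc_cexp gt_eqF// expR_gt0. Qed.

Lemma cexpN z : cexp (- z) = (cexp z)^-1.
apply: (mulIf (cexp_neq0 z)); rewrite -cexpD addNr cexp0 mulVf// cexp_neq0//.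
Qed.

Lemma cexpJ z : cexp z^* = (cexp z)^*.
by rewrite /cexp ReJ ImJ cosN sinN; apply: eqc; rewrite !(ReM, ImM, ReJ, ImJ)/=; ring. Qed.
Lemma cexpR (x : R) : cexp x%:C = (expR x)%:C.
by rewrite /cexp/= cos0 sin0 mulr1. Qed.

Lemma derive_approx (f : R -> R) (x0 l : R) : is_derive x0 1 f l -> forall e : R, 0 < e ->
 exists2 d : R, 0 < d & forall x, `|x| < d -> `|f (x0 + x) - f x0 - l * x| <= e * `|x|.
move=> [fd <-] e e0.
have /cvgrPdist_le/(_ _ e0)/nbhs_ballP[/= d d0 dP] := fd.
exists d => // x xd; have [->|x0n] := eqVneq x 0.
 by rewrite addr0 subrr mulr0 subr0 normr0 mulr0.
have := dP x; rewrite -ball_normE/= sub0r normrN => /(_ xd x0n).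
rewrite /shift/= /GRing.scale/= mulr1 => h.
rewrite (_ : _ - _ = - (x * ('D_1 f x0 - x^-1 * (f (x + x0) - f x0)))).
 by rewrite normrN normrM mulrC ler_wpM2r.
by rewrite (addrC x0); field.
Qed.

(** With [u = cos y + i sin y] the remainder splits into the first-order errors of the real
    exponential and of cosine and sine, plus [x (u - 1)], which is of second order. *)
Lemma cdiff_cexp0 : cdiff cexp 1 0.
(* The three pieces cost [e1 |x|], [2 e1 |y|] and [3 e1 |x|], together at most [6 e1 |w|]. *)
move=> e e0; pose e1 := Num.min (e / 6) 1.
have e10 : 0 < e1 by rewrite lt_min ltr01 andbT; lra.
have e1e : e1 <= e / 6 by rewrite ge_min lexx.
have e11 : e1 <= 1 by rewrite ge_min lexx orbT.
have [d1 d10 H1] := derive_approx (is_derive_expR (0 : R)) e10.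
have [d2 d20 H2] := derive_approx (is_derive_cos (0 : R)) e10.
have [d3 d30 H3] := derive_approx (is_derive_sin (0 : R)) e10.
exists (Num.min (Num.min d1 d2) (Num.min d3 e1)); first by rewrite lt_min lt_min d10 d20/= lt_min d30/=.
move=> [x y]; rewrite !subr0 !lt_min => /andP[/andP[h1 h2] /andP[h3 h4]].
have xw := normRe (x +i* y); have yw := normIm (x +i* y); rewrite /= in xw yw.
set w := x +i* y in xw yw h1 h2 h3 h4 *.
have := H1 x (le_lt_trans xw h1); rewrite add0r expR0 mul1r => {}H1.
have := H2 y (le_lt_trans yw h2); rewrite add0r cos0 sin0 oppr0 mul0r subr0 => {}H2.
have := H3 y (le_lt_trans yw h3); rewrite add0r sin0 cos0 mul1r subr0 => {}H3.
rewrite cexp0 mul1r.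
pose u : C := cos y +i* sin y.
have nu : normc u = 1 by rewrite normcE2/= cos2Dsin2 sqrtr1.
have -> : cexp w - 1 - w = (expR x - 1 - x)%:C * u + (u - 1 - (0 +i* y)) + x%:C * (u - 1).
 by rewrite /w /cexp /u/=; apply: eqc; rewrite !(ReM, ImM, ReD, ImD, ReN, ImN)/=; ring.
have A : normc (u - 1 - (0 +i* y)) <= 2 * e1 * `|y|.
 rewrite (le_trans (normc_le_ReIm _))//= subr0 oppr0 addr0.
 by rewrite mulrAC mulr2n mulrDl mulrDl mul1r [_ * e1]mulrC lerD.
have B : normc (u - 1) <= 3 * `|y|.
 rewrite -(subrK (0 +i* y) (u - 1)) (le_trans (normcD _ _))// normc_i.
 have := A; have : e1 * `|y| <= 1 * `|y| by rewrite ler_wpM2r. lra.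
have wn := nc_ge0 w.
have B' : normc (u - 1) <= 3 * e1.
 have h5 : normc w < e1 by rewrite lt_min. by rewrite (le_trans B)// ler_pM2l// (le_trans yw)// ltW.
rewrite (le_trans (normcD _ _))// (le_trans (lerD (normcD _ _) (lexx _)))//.
rewrite !normcM !normcR nu mulr1.
have C1 : `|x| * normc (u - 1) <= normc w * (3 * e1) by rewrite ler_pM ?nc_ge0.
have C2 : e1 * `|x| <= e1 * normc w by rewrite ler_pM2l.
have C3 : 2 * e1 * `|y| <= 2 * e1 * normc w by rewrite ler_pM2l// mulr_gt0.
have C4 : e1 * normc w <= e / 6 * normc w by rewrite ler_wpM2r.
lra.
Qed.

Lemma cdiff_mul (f : C -> C) a c z : cdiff f a z -> cdiff (fun w => c * f w) (c * a) z.
move=> fa e e0.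
have c0 : 0 < normc c + 1 by rewrite ltr_wpDl// nc_ge0.
have [d d0 dP] := fa _ (divr_gt0 e0 c0); exists d => // w /dP H.
rewrite (_ : _ - _ = c * (f w - f z - a * (w - z))); last by ring.
rewrite normcM (le_trans (ler_wpM2l (nc_ge0 _) H))//.
rewrite mulrA ler_wpM2r ?nc_ge0// mulrCA ger_pMr// ler_pdivrMr// mul1r.
by rewrite lerDl.
Qed.

(* rescaling the variable: w = z0 * v *)
Lemma cdiff_scale (f : C -> C) a z0 v : z0 != 0 -> cdiff f a v ->
 cdiff (fun w => f (w / z0)) (a / z0) (v * z0).
move=> z00 fa e e0; have n0 : 0 < normc z0 by rewrite normc_gt0.
have [d d0 dP] := fa _ (mulr_gt0 e0 n0).
exists (d * normc z0); first by rewrite mulr_gt0.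
move=> w H; have E : w / z0 - v = (w - v * z0) / z0 by field.
have := dP (w / z0); rewrite E normcM normcV ltr_pdivrMr// => /(_ H).
rewrite mulfK// (_ : a / z0 * (w - v * z0) = a * ((w - v * z0) / z0)); last by field.
move=> /le_trans; apply.
by apply: eqle; field; rewrite gt_eqF.
Qed.

Lemma cdiff_cexp z : cdiff cexp (cexp z) z.
have := cdiff_mul (cexp z) cdiff_cexp0; rewrite mulr1 => H e e0.
have [d d0 dP] := H e e0; exists d => // w wz.
by have := dP (w - z); rewrite !subr0 cexp0 mulr1 -!cexpD addrCA subrr addr0 => /(_ wz).
Qed.

Definition carg w : R := atan (cIm w / cRe w).

Lemma carg_polar w : 0 < cRe w ->
 w = (normc w)%:C * (cos (carg w) +i* sin (carg w)).
move=> w0; have c0 : cos (carg w) != 0.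
 by rewrite gt_eqF// cos_gt0_pihalf// atan_gtNpi2 atan_ltpi2.
have nw : 0 < normc w by rewrite normc_gt0; apply: contraTneq w0 => ->; rewrite ltxx.
have s : sin (carg w) = cIm w / cRe w * cos (carg w).
 by have := atanK (cIm w / cRe w); rewrite /tan -/(carg w) => <-; rewrite divfK.
have c : cos (carg w) = cRe w / normc w.
 rewrite /carg cos_atan (_ : 1 + _ = (normc w / cRe w) ^+ 2).
  by rewrite sqrtr_sqr ger0_norm ?invf_div// divr_ge0// ltW.
 by rewrite !expr_div_n sqr_normcE; field; rewrite gt_eqF.
by apply: eqc; rewrite ?ReZ ?ImZ/= ?s c; field; rewrite !gt_eqF.
Qed.

Lemma cpow_cexp w s : 0 < cRe w ->
 cpow w s = cexp (s%:C * (ln (normc w) +i* carg w)).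
move=> w0; rewrite /cpow /cexp ReZ ImZ/= /powR ifF// gt_eqF// normc_gt0.
by apply: contraTneq w0 => ->; rewrite ltxx.
Qed.

(** When the product stays in the half-plane, the cosine of the sum of the two arguments is
    positive. The sum lies in []-pi, pi[], hence in []-pi/2, pi/2[], where [atan] inverts [tan]. *)
Lemma cargM a b : 0 < cRe a -> 0 < cRe b -> 0 < cRe (a * b) ->
 carg (a * b) = carg a + carg b.
move=> a0 b0 ab0.
have gt0 w : 0 < cRe w -> 0 < normc w.
 by move=> w0; rewrite normc_gt0; apply: contraTneq w0 => ->; rewrite ltxx.
have ar w : - (pi / 2) < carg w < pi / 2 by rewrite atan_gtNpi2 atan_ltpi2.
have : a * b = (normc (a * b))%:C *
  (cos (carg a + carg b) +i* sin (carg a + carg b)).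
 rewrite {1}(carg_polar a0) {1}(carg_polar b0) normcM cosD sinD RCM.
 by apply: eqc; rewrite !(ReM, ImM)/=; ring.
move=> E; have Er := congr1 (@complex.Re R) E; have Ei := congr1 (@complex.Im R) E.
rewrite ReZ/= in Er; rewrite ImZ/= in Ei.
have nab := gt0 _ ab0.
have c0 : 0 < cos (carg a + carg b) by rewrite -(pmulr_rgt0 _ nab) -Er.
have := ar a; have := ar b; move=> /andP[b1 b2] /andP[a1 a2].
have th : carg a + carg b \in `]- (pi / 2), pi / 2[.
 rewrite in_itv/=; apply/andP; split; rewrite ltNge; apply/negP => h; move: c0; rewrite ltNge => /negP; apply.
  have : 0 <= sin (- (carg a + carg b) - pi / 2) by apply: sin_ge0_pi; apply/andP; split; lra.
  by rewrite sinBpihalf cosN oppr_ge0.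
 have : 0 <= sin (carg a + carg b - pi / 2) by apply: sin_ge0_pi; apply/andP; split; lra.
 by rewrite sinBpihalf oppr_ge0.
rewrite {1}/carg Er Ei -[RHS]tanK// /tan; congr atan.
by field; rewrite !gt_eqF.
Qed.

Lemma Re_gt0_neq0 w : 0 < cRe w -> w != 0.
by apply: contraTneq => ->; rewrite ltxx. Qed.

Lemma cpowM a b s : 0 < cRe a -> 0 < cRe b -> 0 < cRe (a * b) ->
 cpow (a * b) s = cpow a s * cpow b s.
move=> a0 b0 ab0; rewrite !cpow_cexp// -cexpD; congr cexp.
rewrite cargM// normcM lnM ?posrE ?normc_gt0 ?Re_gt0_neq0//.
by apply: eqc; rewrite !(ReM, ImM, ReD, ImD)/=; ring.
Qed.

Lemma normc_cpow w s : 0 < cRe w -> normc (cpow w s) = normc w `^ s.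
move=> w0; rewrite cpow_cexp// normc_cexp ReZ/= /powR ifF// gt_eqF// normc_gt0.
exact: Re_gt0_neq0.
Qed.

Lemma cpow_neq0 w s : 0 < cRe w -> cpow w s != 0.
by move=> w0; rewrite cpow_cexp// cexp_neq0. Qed.

Lemma cpowJ w s : cpow w^* s = (cpow w s)^*.
rewrite /cpow conjcM conjcR ReJ ImJ normcJ mulNr atanN mulrN cosN sinN.
by congr (_ * _); apply: eqc.
Qed.

Lemma cpowR (x s : R) : 0 < x -> cpow x%:C s = (x `^ s)%:C.
move=> x0; rewrite /cpow normcR/= mul0r atan0 mulr0 cos0 sin0 gtr0_norm//.
by rewrite mulr1.
Qed.

Lemma cpow1 s : cpow 1 s = 1.
by rewrite (cpowR s (@ltr01 R)) powR1. Qed.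
Lemma cpowD w (s t : R) : 0 < cRe w -> cpow w (s + t) = cpow w s * cpow w t.
by move=> w0; rewrite !cpow_cexp// -cexpD; congr cexp; rewrite RCD mulrDl. Qed.
Lemma cpowN w s : 0 < cRe w -> cpow w (- s) = (cpow w s)^-1.
by move=> w0; rewrite !cpow_cexp// -cexpN; congr cexp; rewrite RCN mulNr. Qed.

Lemma cpow_1r w : 0 < cRe w -> cpow w 1 = w.
move=> w0; rewrite {2}(carg_polar w0) /cpow mul1r powRr1//; exact: nc_ge0.
Qed.

Lemma log_small (e : R) : 0 < e -> exists2 d, 0 < d & forall u : C, normc u < d ->
 0 < cRe (1 + u) /\ normc (ln (normc (1 + u)) +i* carg (1 + u)) <= e.
move=> e0; have e2 := half_gt0 e0.
have /cvgrPdist_le/(_ _ e2)/nbhs_ballP[d1 /= d10 H1] := continuous_ln (@ltr01 R).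
have /cvgrPdist_le/(_ _ e2)/nbhs_ballP[d2 /= d20 H2] := @continuous_atan R 0.
exists (Num.min (1 / 2) (Num.min d1 (d2 / 2))); first by rewrite !lt_min d10 !divr_gt0.
move=> u; rewrite !lt_min => /andP[u1 /andP[u2 u3]].
have xu := normRe u; have yu := normIm u.
have x1 : 1 / 2 < 1 + cRe u by have := ler_norm (- cRe u); rewrite normrN; lra.
have re0 : 0 < cRe (1 + u) by rewrite ReD/=; lra.
split => //; apply: (le_trans (normc_le_ReIm (ln (normc (1 + u)) +i* carg (1 + u)))).
rewrite (splitr e) /=; apply: lerD.
 have := H1 (normc (1 + u)); rewrite ln1 sub0r normrN; apply; rewrite /ball/=.
 by have := normc_dist 1 (1 + u); rewrite normc1 opprD addrA subrr sub0r normcN; lra.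
have := H2 (cIm (1 + u) / cRe (1 + u)); rewrite atan0 sub0r normrN; apply.
rewrite /ball/= sub0r normrN normrM normfV (gtr0_norm re0) ltr_pdivrMr// ReD ImD/= add0r.
have : d2 * (1 / 2) < d2 * (1 + cRe u) by rewrite ltr_pM2l.
by lra.
Qed.

(* As [w = exp (log w)], the derivative 1 of [exp] at 0 gives [log (1 + u) = u + o(u)]. *)
Lemma cdiff_cpow1 s : cdiff (fun w => cpow w s) s%:C 1.
move=> e e0; pose k := `|s| + 1; have k0 : 0 < k by rewrite ltr_wpDl.
have sk : `|s| <= k by rewrite lerDl.
pose t := Num.min (1 / 2) (e / (4 * k)).
have t0 : 0 < t by rewrite lt_min !divr_gt0// mulr_gt0.
have [t12 tk] : t <= 1 / 2 /\ t <= e / (4 * k) by split; rewrite ge_min lexx ?orbT.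
have [d0 d00 H0] := cdiff_cexp0 t0.
have k2 : 0 < 2 * k by rewrite mulr_gt0.
have [d d1 dP] := log_small (divr_gt0 d00 k2).
exists d => // w; rewrite -{2 3 4}(subrK 1 w) [_ + 1]addrC.
move: (w - 1) => u /dP[re0]; rewrite [1 + u - 1]addrAC subrr add0r; set L := _ +i* _ => Ls.
have nu := nc_ge0 u; have nL := nc_ge0 L.
have H z : normc z < d0 -> normc (cexp z - 1 - z) <= t * normc z.
 by move=> zd; have := H0 z; rewrite subr0 cexp0 mul1r; apply.
have kd : d0 / (2 * k) * k = d0 / 2 by field; rewrite gt_eqF.
have Ld : normc L < d0.
 apply: le_lt_trans Ls _; rewrite ltr_pdivrMr ?mulr_gt0// ltr_pMr//. by rewrite /k; have := normr_ge0 s; lra.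
have sL : normc (s%:C * L) < d0.
 rewrite normcM normcR; apply: (@le_lt_trans _ _ (k * (d0 / (2 * k)))); last by rewrite mulrC kd; lra.
 by rewrite ler_pM.
have LE : cexp L = 1 + u.
 by rewrite -[RHS](cpow_1r re0) cpow_cexp// mul1r.
have h1 := H _ Ld; rewrite LE [1 + u - 1]addrAC subrr add0r in h1.
have tL : t * normc L <= 1 / 2 * normc L by rewrite ler_wpM2r.
have L2 : normc L <= 2 * normc u.
 have := normcBD u (u - L); rewrite opprB addrC subrK; lra.
have h2 := H _ sL; rewrite cpow1 cpow_cexp//.
rewrite (_ : _ - _ - _ = (cexp (s%:C * L) - 1 - s%:C * L) - s%:C * (u - L)); last by ring.
apply: (le_trans (normcBD _ _)); rewrite normcM normcR in h2 *.
have h3 : `|s| * normc L <= k * (2 * normc u) by rewrite ler_pM.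
have h4 : `|s| * normc (u - L) <= k * (t * (2 * normc u)).
 by rewrite ler_pM ?nc_ge0// (le_trans h1)// ler_wpM2l// ltW.
have h5 : t * (`|s| * normc L) <= t * (k * (2 * normc u)) by rewrite ler_wpM2l// ltW.
apply: (le_trans (lerD h2 (lexx _))).
have h6 : t * (k * (4 * normc u)) <= e * normc u.
 rewrite (_ : t * _ = t * (4 * k) * normc u); last by ring. by rewrite ler_wpM2r// -ler_pdivlMr// mulr_gt0.
by rewrite [normc (s%:C * _)]normcM normcR; lra.
Qed.

Lemma cdiff_near (f g : C -> C) a z (d : R) : 0 < d ->
 (forall w, normc (w - z) < d -> f w = g w) -> cdiff f a z -> cdiff g a z.
move=> d0 fg fa e e0; have [d1 d10 H] := fa e e0.
exists (Num.min d d1) => [|w]; first by rewrite lt_min d0.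
rewrite lt_min => /andP[w1 w2]; rewrite -(fg _ w1) -fg ?subrr ?normc0//; exact: H.
Qed.

(** Homogeneity moves the point [z] to 1. The radius [Re z] keeps [w] in the right half-plane and
    the radius [|z|] keeps [w / z] there, so that [cpowM] applies. *)
Lemma cdiff_cpowE z s : 0 < cRe z -> cdiff (fun w => cpow w s) (cpow z s * (s%:C / z)) z.
move=> z0; have zn := Re_gt0_neq0 z0; have nz : 0 < normc z by rewrite normc_gt0.
have := cdiff_mul (cpow z s) (cdiff_scale zn (cdiff_cpow1 s)); rewrite mul1r => H.
apply: (@cdiff_near (fun w => cpow z s * cpow (w / z) s) _ _ _ (Num.min (cRe z) (normc z))) H.
 by rewrite lt_min z0 nz.
move=> w; rewrite lt_min => /andP[w1 w2]; rewrite -cpowM//; first by rewrite mulrC divfK.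
 have -> : w / z = 1 + (w - z) / z by field.
 rewrite ReD/=; have := normRe ((w - z) / z); rewrite normcM normcV.
 have : normc (w - z) / normc z < 1 by rewrite ltr_pdivrMr// mul1r.
 by move=> a b; have := le_lt_trans b a; rewrite ltr_norml => /andP[]; lra.
rewrite mulrC divfK//; have := le_lt_trans (normRe (w - z)) w1.
by rewrite ReD ReN ltr_norml => /andP[]; lra.
Qed.

Lemma cdiff_cpow z s : 0 < cRe z -> exists a, cdiff (fun w => cpow w s) a z.
by move=> /(cdiff_cpowE s) H; exists (cpow z s * (s%:C / z)). Qed.

End ComplexNumbers.

(** * Integrals of complex-valued functions *)

Section ComplexIntegral.
Context d (T : measurableType d) (R : realType) (mu : {measure set T -> \bar R}).
Notation C := R[i].
Implicit Types (D : set T) (f g : T -> C).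

Definition cint D g : C :=
 (\int[mu]_(x in D) cRe (g x)) +i* (\int[mu]_(x in D) cIm (g x)).

Definition cintg D g := mu.-integrable D (fun x => (cRe (g x))%:E) /\
 mu.-integrable D (fun x => (cIm (g x))%:E).

Definition cmeas D g := measurable_fun D (fun x => cRe (g x)) /\
 measurable_fun D (fun x => cIm (g x)).

Lemma eq_cint D f g : {in D, f =1 g} -> cint D f = cint D g.
by move=> fg; congr Complex; apply: eq_Rintegral => x /fg ->. Qed.

Lemma eq_cintegrable D f g : measurable D -> {in D, f =1 g} ->
 cintg D f -> cintg D g.
move=> mD fg [h1 h2]; split.
 by apply: eq_integrable h1 => // x /fg ->.
by apply: eq_integrable h2 => // x /fg ->.
Qed.

Section measurable_domain.
Variable D : set T.
Hypothesis mD : measurable D.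

Lemma cintg_measurable f : cintg D f -> cmeas D f.
by move=> [/measurable_int h1 /measurable_int h2]; split; exact/mEFinP.
Qed.

Lemma cmeas_normc f : cmeas D f -> measurable_fun D (fun x => normc (f x)).
move=> [h1 h2]; rewrite [X in measurable_fun _ X](_ : _ =
 (fun t => Num.sqrt t) \o (fun x => cRe (f x) ^+ 2 + cIm (f x) ^+ 2)); last first.
 by apply/funext => x /=; rewrite normcE2.
apply: mcomp; first by apply: continuous_measurable_fun; exact: sqrt_continuous.
by apply: measurable_funD; exact: mfunX.
Qed.

Lemma cmeasM f g : cmeas D f -> cmeas D g ->
 cmeas D (fun x => f x * g x).
move=> [f1 f2] [g1 g2]; split.
 by under eq_fun do rewrite ReM; apply: mfunB; exact: mfunM.
by under eq_fun do rewrite ImM; apply: measurable_funD; exact: mfunM.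
Qed.

Lemma cmeasJ f : cmeas D f -> cmeas D (fun x => (f x)^*).
move=> [f1 f2]; split; first by under eq_fun do rewrite ReJ.
by under eq_fun do rewrite ImJ; exact: mcomp.
Qed.

Lemma cmeas_cst a : cmeas D (fun=> a).
by split; exact: mcst. Qed.
Lemma cmeasR (h : T -> R) : measurable_fun D h -> cmeas D (fun x => (h x)%:C).
by move=> mh; split => //=; exact: mcst. Qed.

Lemma le_cintegrable f (h : T -> R) : cmeas D f ->
 mu.-integrable D (EFin \o h) -> {in D, forall x, normc (f x) <= h x} -> cintg D f.
move=> [f1 f2] hi fh; split.
 apply: (le_integrable mD) hi => [|x Dx]; first exact/mEFinP.
 rewrite /= lee_fin (le_trans (normRe _))// (le_trans (fh _ _)) ?inE//. exact: ler_norm.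
apply: (le_integrable mD) hi => [|x Dx]; first exact/mEFinP.
rewrite /= lee_fin (le_trans (normIm _))// (le_trans (fh _ _)) ?inE//.
exact: ler_norm.
Qed.

Lemma cintg_normc f : cintg D f ->
 mu.-integrable D (fun x => (normc (f x))%:E).
move=> fi; have [f1 f2] := fi.
have := integrableD mD (integrable_abse f1) (integrable_abse f2).
apply: le_integrable => // [|x Dx].
 by apply/mEFinP; exact: cmeas_normc (cintg_measurable fi).
rewrite /= lee_fin ger0_norm ?nc_ge0// (le_trans (normc_le_ReIm _))//.
exact: ler_norm.
Qed.

Lemma cintgZ a f : cintg D f -> cintg D (fun x => a * f x).
move=> [f1 f2]; split.
 under eq_fun do rewrite ReM EFinB; apply: integrableB => //.
  by under eq_fun do rewrite EFinM; exact: integrableZl.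
 by under eq_fun do rewrite EFinM; exact: integrableZl.
under eq_fun do rewrite ImM EFinD; apply: integrableD => //.
 by under eq_fun do rewrite EFinM; exact: integrableZl.
by under eq_fun do rewrite EFinM; exact: integrableZl.
Qed.

Lemma cintgN f : cintg D f -> cintg D (fun x => - f x).
move/(cintgZ (-1)); apply: eq_cintegrable => // x _.
by rewrite mulN1r.
Qed.

Lemma cintD f g : cintg D f -> cintg D g ->
 cint D (fun x => f x + g x) = cint D f + cint D g.
move=> [f1 f2] [g1 g2]; apply: eqc; rewrite /cint ?ReD ?ImD/=.
 by under eq_Rintegral do rewrite ReD; rewrite RintegralD.
by under eq_Rintegral do rewrite ImD; rewrite RintegralD.
Qed.

Lemma cintZ a f : cintg D f ->
 cint D (fun x => a * f x) = a * cint D f.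
move=> [f1 f2]; have zl (h : T -> R) (x : R) : mu.-integrable D (EFin \o h) ->
  mu.-integrable D (EFin \o (fun t => x * h t)). by move=> hi; apply: (integrableZl mD x hi).
apply: eqc; rewrite /cint ?ReM ?ImM/=.
 under eq_Rintegral do rewrite ReM. by rewrite RintegralB// ?RintegralZl//; exact: zl.
under eq_Rintegral do rewrite ImM.
by rewrite RintegralD// ?RintegralZl//; exact: zl.
Qed.

Lemma cintN f : cintg D f -> cint D (fun x => - f x) = - cint D f.
move=> fi; rewrite -mulN1r -cintZ//.
by apply: eq_cint => x _; rewrite mulN1r.
Qed.

Lemma cintB f g : cintg D f -> cintg D g ->
 cint D (fun x => f x - g x) = cint D f - cint D g.
by move=> fi gi; rewrite cintD ?cintN//; exact: cintgN.
Qed.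

Lemma cintJ f : cintg D f -> cint D (fun x => (f x)^*) = (cint D f)^*.
move=> [f1 f2]; apply: eqc; rewrite /cint ?ReJ ?ImJ/=.
 by under eq_Rintegral do rewrite ReJ.
rewrite -mulN1r -RintegralZl//; apply: eq_Rintegral => x _.
by rewrite ImJ mulN1r.
Qed.

(** Multiplying by the unimodular [u] that turns the integral into its modulus leaves only a real
    part to be estimated. *)
Lemma le_normc_cint f : cintg D f ->
 normc (cint D f) <= \int[mu]_(x in D) normc (f x).
move=> fi; have [->|I0] := eqVneq (cint D f) 0.
 by rewrite normc0; apply: Rintegral_ge0 => x _; exact: nc_ge0.
set I := cint D f in I0 *.
have nI : 0 < normc I by rewrite normc_gt0.
pose u : C := I^* / (normc I)%:C.
have nu : normc u = 1 by rewrite normcM normcJ normcV normcR gtr0_norm// divff// gt_eqF.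
have uI : u * I = (normc I)%:C.
 rewrite /u mulrAC [_ * I]mulrC mulcJ expr2 RCM mulfK//. by rewrite RC_eq0 gt_eqF.
have -> : normc I = cRe (cint D (fun x => u * f x)) by rewrite cintZ// uI.
apply: le_Rintegral => //=.
- exact: (cintgZ u fi).1.
- exact: cintg_normc.
- by move=> x _; rewrite (le_trans (Re_le_normc _))// normcM nu mul1r.
Qed.

Lemma cintR (h : T -> R) :
 cint D (fun x => (h x)%:C) = (\int[mu]_(x in D) h x)%:C.
apply: eqc => //=; rewrite /Rintegral.
by rewrite integral0.
Qed.

End measurable_domain.
End ComplexIntegral.

(** * Continuous complex functions and their integrals over segments *)

Section ContinuousComplexFunctions.
Variable R : realType.
Notation C := R[i].
Notation leb := (@lebesgue_measure R).

Definition rccont (g : R -> C) x := forall e : R, 0 < e -> exists2 d : R, 0 < d &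
 forall y, `|y - x| < d -> normc (g y - g x) < e.

Definition ccont (g : C -> C) z := forall e : R, 0 < e -> exists2 d : R, 0 < d &
 forall w, normc (w - z) < d -> normc (g w - g z) < e.

Lemma Rintegral_segment_cst (a b c : R) : a <= b -> \int[leb]_(_ in `[a, b]) c = c * (b - a).
move=> ab; rewrite Rintegral_cst//; congr (_ * _).
transitivity (fine (lebesgue_measure (`[a, b]%classic : set R))) => //.
rewrite lebesgue_measure_itv/= lte_fin; case: ltP => [//|ba].
by rewrite (@le_anti _ _ a b) ?ab// subrr.
Qed.

Lemma rccont_within (g : R -> C) (a b : R) : (forall x, a <= x <= b -> rccont g x) ->
 {within `[a, b], continuous (fun x => cRe (g x))} /\ {within `[a, b], continuous (fun x => cIm (g x))}.
move=> gc; split; apply: continuous_in_subspaceT => x; rewrite inE/= in_itv/= => /gc gx;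
 apply/cvgrPdist_lt => e e0; have [d d0 dP] := gx e e0; near=> y.
 rewrite -ReN -ReD (le_lt_trans (normRe _))// normcB; apply: dP. rewrite distrC; near: y; exact: cvgr_dist_lt.
rewrite -ImN -ImD (le_lt_trans (normIm _))// normcB; apply: dP.
rewrite distrC; near: y; exact: cvgr_dist_lt.
Unshelve. all: by end_near. Qed.

Lemma rccont_integrable (g : R -> C) (a b : R) : (forall x, a <= x <= b -> rccont g x) ->
 cintg leb `[a, b] g.
move=> /rccont_within[h1 h2]; split.
 by apply: continuous_compact_integrable => //; exact: segment_compact.
by apply: continuous_compact_integrable => //; exact: segment_compact.
Qed.

Lemma le_normc_cint_itv (g : R -> C) (a b M : R) : a <= b ->
 (forall x, a <= x <= b -> rccont g x) -> (forall x, a <= x <= b -> normc (g x) <= M) ->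
 normc (cint leb `[a, b] g) <= M * (b - a).
move=> ab gc gM; have gi := rccont_integrable gc.
rewrite (le_trans (le_normc_cint _ gi))//.
rewrite -Rintegral_segment_cst//.
apply: le_Rintegral => //.
- exact: cintg_normc.
- apply: continuous_compact_integrable; first exact: segment_compact.
 by apply: continuous_subspaceT => x; exact: cvg_cst.
Qed.

Lemma cint_itv_cst (a b : R) (c : C) : a <= b ->
 cint leb `[a, b] (fun=> c) = (b - a)%:C * c.
by move=> ab; apply: eqc; rewrite ?ReZ ?ImZ/= Rintegral_segment_cst// mulrC.
Qed.

Lemma cint_itv_split (g : R -> C) (a m b : R) : a <= m <= b ->
 cintg leb `[a, b] g -> cint leb `[a, b] g = cint leb `[a, m] g + cint leb `[m, b] g.
move=> /andP[am mb] [g1 g2].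
have sp (h : R -> R) : leb.-integrable `[a, b] (EFin \o h) ->
  \int[leb]_(x in `[a, b]) h x = \int[leb]_(x in `[a, m]) h x + \int[leb]_(x in `[m, b]) h x.
 move=> hi; apply/eqP; rewrite addrC -subr_eq Rintegral_itvB//; apply/eqP.
 apply: Rintegral_itv_obnd_cbnd; apply: integrableS hi => //. by apply: subset_itvr; rewrite bnd_simp.
by rewrite /cint sp// sp//.
Qed.

Lemma rccontD (f g : R -> C) x : rccont f x -> rccont g x -> rccont (fun t => f t + g t) x.
move=> fx gx e e0; have e2 := half_gt0 e0.
have [d d0 dP] := fx _ e2; have [d' d'0 dP'] := gx _ e2.
exists (Num.min d d') => [|y]; first by rewrite lt_min d0.
rewrite lt_min => /andP[/dP h1 /dP' h2].
rewrite opprD addrACA (le_lt_trans (normcD _ _))//; lra.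
Qed.

(** The proof asks nothing of [dist], so one statement serves real and complex variables. *)
Lemma continuousM_at (S : Type) (dist : S -> S -> R) (cont := fun (f : S -> C) x =>
  forall e : R, 0 < e -> exists2 d : R, 0 < d & forall y, dist y x < d -> normc (f y - f x) < e) f g x :
 cont f x -> cont g x -> cont (fun y => f y * g y) x.
move=> fx gx e e0.
set A := normc (f x) + 1; set B := normc (g x) + 1.
have A0 : 0 < A by rewrite ltr_wpDl// nc_ge0.
have B0 : 0 < B by rewrite ltr_wpDl// nc_ge0.
have [d d0 dP] := fx (e / 2 / B) (divr_gt0 (divr_gt0 e0 (ltr0n _ 2)) B0).
have [d1 d10 dP1] := fx 1 ltr01.
have [d' d'0 dP'] := gx (e / 2 / A) (divr_gt0 (divr_gt0 e0 (ltr0n _ 2)) A0).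
exists (Num.min d (Num.min d' d1)) => [|y]; first by rewrite !lt_min d0 d'0.
rewrite !lt_min => /andP[/dP h1 /andP[/dP' h2 /dP1 h3]].
have -> : f y * g y - f x * g x = f y * (g y - g x) + (f y - f x) * g x by ring.
rewrite (le_lt_trans (normcD _ _))// !normcM.
have fy : normc (f y) <= A.
 rewrite -(subrK (f x) (f y)) (le_trans (normcD _ _))// addrC lerD2l ltW//.
have gB : normc (g x) <= B by rewrite lerDl.
have h1' : normc (f y) * normc (g y - g x) < e / 2.
 apply: le_lt_trans (ler_wpM2r (nc_ge0 _) fy) _. by rewrite mulrC -ltr_pdivlMr.
have h2' : normc (f y - f x) * normc (g x) <= e / 2.
 apply: le_trans (ler_wpM2l (nc_ge0 _) gB) _. by rewrite -ler_pdivlMr// ltW.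
lra.
Qed.

Lemma rccontM (f g : R -> C) x : rccont f x -> rccont g x -> rccont (fun t => f t * g t) x.
exact: (@continuousM_at _ (fun y x => `|y - x|)). Qed.
Lemma ccontM (f g : C -> C) z : ccont f z -> ccont g z -> ccont (fun w => f w * g w) z.
exact: (@continuousM_at _ (fun w z => normc (w - z))). Qed.
Lemma rccont_cst c x : rccont (fun=> c) x.
by move=> e e0; exists 1 => // y _; rewrite subrr normc0. Qed.

Lemma rccont_comp (f : C -> C) (g : R -> C) x :
 ccont f (g x) -> rccont g x -> rccont (f \o g) x.
move=> fx gx e e0; have [d d0 dP] := fx e e0; have [d' d'0 dP'] := gx d d0.
by exists d' => // y /dP'/dP.
Qed.

Lemma cdiff_ccont f (a : C) z : cdiff f a z -> ccont f z.
exact: cdiff_cont. Qed.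

Implicit Types (f g : R -> C) (a b : R).

Definition icint g a b : C := cint (@lebesgue_measure R) `[a, b] g.

Definition seg_cont g a b := forall x, a <= x <= b -> rccont g x.

Lemma eq_icint f g a b : (forall x, a <= x <= b -> f x = g x) -> icint f a b = icint g a b.
by move=> fg; apply: eq_cint => x; rewrite inE/= in_itv/=; exact: fg. Qed.

Lemma icintB f g a b : seg_cont f a b -> seg_cont g a b ->
 icint (fun x => f x - g x) a b = icint f a b - icint g a b.
by move=> hf hg; apply: cintB => //; exact: rccont_integrable. Qed.

Lemma icintZ k f a b : seg_cont f a b -> icint (fun x => k * f x) a b = k * icint f a b.
by move=> hf; apply: cintZ => //; exact: rccont_integrable. Qed.
Lemma icintJ f a b : seg_cont f a b -> icint (fun x => (f x)^*) a b = (icint f a b)^*.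
by move=> hf; apply: cintJ => //; exact: rccont_integrable. Qed.
Lemma icint_cst (k : C) a b : a <= b -> icint (fun=> k) a b = (b - a)%:C * k.
exact: cint_itv_cst. Qed.

Lemma icint_split f a m b : a <= m -> m <= b -> seg_cont f a b ->
 icint f a b = icint f a m + icint f m b.
by move=> am mb hf; apply: cint_itv_split; rewrite ?am//; exact: rccont_integrable. Qed.

Lemma le_normc_icint f a b M : a <= b -> seg_cont f a b ->
 (forall x, a <= x <= b -> normc (f x) <= M) -> normc (icint f a b) <= M * (b - a).
exact: le_normc_cint_itv. Qed.

Lemma rccontB f g x : rccont f x -> rccont g x -> rccont (fun t => f t - g t) x.
move=> fx gx; apply: rccontD => //.
by move=> e /gx[d d0 dP]; exists d => // y /dP; rewrite -opprD normcN.
Qed.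

Lemma seg_contB f g a b : seg_cont f a b -> seg_cont g a b -> seg_cont (fun t => f t - g t) a b.
by move=> hf hg x xab; apply: rccontB; [exact: hf|exact: hg]. Qed.

End ContinuousComplexFunctions.

(** * Goursat's theorem on rectangles *)

Section Goursat.
Variable R : realType.
Notation C := R[i].
Implicit Types (F : C -> C) (a b c d x y : R).

(* The integral of F along the boundary of [a, b] x [c, d], opposite sides
  being grouped. *)
Definition rect_int F a b c d : C :=
 icint (fun x => F (x +i* c) - F (x +i* d)) a b + (0 +i* 1) * icint (fun y => F (b +i* y) - F (a +i* y)) c d.

Definition rect_cont F a b c d :=
 forall x y, a <= x <= b -> c <= y <= d -> ccont F (x +i* y).

Lemma rccont_hline F x y : ccont F (x +i* y) -> rccont (fun t => F (t +i* y)) x.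
move=> h e e0; have [d d0 dP] := h e e0; exists d => // t td; apply: dP.
by rewrite (_ : _ - _ = (t - x)%:C) ?normcR//; apply: eqc; rewrite /= ?subrr.
Qed.

Lemma rccont_vline F x y : ccont F (x +i* y) -> rccont (fun t => F (x +i* t)) y.
move=> h e e0; have [d d0 dP] := h e e0; exists d => // t td; apply: dP.
by rewrite (_ : _ - _ = 0 +i* (t - y)) ?normc_i//; apply: eqc; rewrite /= ?subrr.
Qed.

Lemma rect_sub F a b c d a' b' c' d' : rect_cont F a b c d ->
 a <= a' -> b' <= b -> c <= c' -> d' <= d -> rect_cont F a' b' c' d'.
move=> h h1 h2 h3 h4 x y /andP[x1 x2] /andP[y1 y2]; apply: h; apply/andP; split.
- exact: le_trans x1.
- exact: le_trans h2.
- exact: le_trans y1.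
- exact: le_trans h4.
Qed.

Lemma rect_hi F a b c d y : rect_cont F a b c d -> c <= y <= d ->
 seg_cont (fun t => F (t +i* y)) a b.
by move=> h cy x ax; apply: rccont_hline; exact: h. Qed.

Lemma rect_vi F a b c d x : rect_cont F a b c d -> a <= x <= b ->
 seg_cont (fun t => F (x +i* t)) c d.
by move=> h cy y ax; apply: rccont_vline; exact: h. Qed.

Lemma rect_h2 F a b c d : c <= d -> rect_cont F a b c d ->
 seg_cont (fun x => F (x +i* c) - F (x +i* d)) a b.
by move=> cd h; apply: seg_contB; apply: rect_hi h _; rewrite lexx cd. Qed.

Lemma rect_v2 F a b c d : a <= b -> rect_cont F a b c d ->
 seg_cont (fun y => F (b +i* y) - F (a +i* y)) c d.
by move=> cd h; apply: seg_contB; apply: rect_vi h _; rewrite lexx cd. Qed.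

Lemma rect_int_splitx F a m b c d : a <= m <= b -> c <= d -> rect_cont F a b c d ->
 rect_int F a b c d = rect_int F a m c d + rect_int F m b c d.
move=> /andP[am mb] cd h; have ab := le_trans am mb.
rewrite /rect_int (icint_split am mb (rect_h2 cd h)).
have v x : a <= x <= b -> seg_cont (fun y => F (x +i* y)) c d by exact: rect_vi.
have va := v a; have vm := v m; have vb := v b.
rewrite !lexx ab am mb/= in va vm vb.
by rewrite !(@icintB _ _ _ c d); do ?[exact: va|exact: vm|exact: vb]; ring.
Qed.

Lemma rect_int_splity F a b c m d : a <= b -> c <= m <= d -> rect_cont F a b c d ->
 rect_int F a b c d = rect_int F a b c m + rect_int F a b m d.
move=> ab /andP[cm md] h; have cd := le_trans cm md.
rewrite /rect_int (icint_split cm md (rect_v2 ab h)).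
have v x : c <= x <= d -> seg_cont (fun y => F (y +i* x)) a b by exact: rect_hi.
have vc := v c; have vm := v m; have vd := v d.
rewrite !lexx cd cm md/= in vc vm vd.
by rewrite !(@icintB _ _ _ a b); do ?[exact: vc|exact: vm|exact: vd]; ring.
Qed.

Lemma rect_int_affine (p q : C) a b c d : a <= b -> c <= d ->
 rect_int (fun z => p + q * z) a b c d = 0.
move=> ab cd; rewrite /rect_int.
rewrite (@eq_icint _ _ (fun=> q * (0 +i* (c - d)))); last first.
 by move=> x _; apply: eqc; rewrite !(ReD, ImD, ReN, ImN, ReM, ImM)/=; ring.
rewrite (@eq_icint _ _ (fun=> q * (b - a)%:C) c d); last first.
 by move=> x _; apply: eqc; rewrite !(ReD, ImD, ReN, ImN, ReM, ImM)/=; ring.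
rewrite !icint_cst//; apply: eqc; rewrite !(ReD, ImD, ReN, ImN, ReM, ImM)/=; ring.
Qed.

Lemma le_rect_int F a b c d M : a <= b -> c <= d -> rect_cont F a b c d ->
 (forall x y, a <= x <= b -> c <= y <= d -> normc (F (x +i* y)) <= M) ->
 normc (rect_int F a b c d) <= 2 * M * ((b - a) + (d - c)).
move=> ab cd h FM; rewrite (le_trans (normcD _ _))// normcM normc_i normr1 mul1r mulrDr.
have lea : a <= a <= b by rewrite lexx. have leb' : a <= b <= b by rewrite lexx andbT.
have lec : c <= c <= d by rewrite lexx. have led : c <= d <= d by rewrite lexx andbT.
apply: lerD; apply: le_normc_icint => //.
- exact: rect_h2.
- by move=> x xab; rewrite (le_trans (normcBD _ _))// mulr2n mulrDl mul1r; apply: lerD; exact: FM.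
- exact: rect_v2.
- by move=> x xab; rewrite (le_trans (normcBD _ _))// mulr2n mulrDl mul1r; apply: lerD; exact: FM.
Qed.

Lemma rect_intB F G a b c d : a <= b -> c <= d -> rect_cont F a b c d ->
 rect_cont G a b c d -> rect_int (fun z => F z - G z) a b c d = rect_int F a b c d - rect_int G a b c d.
move=> ab cd hF hG; rewrite /rect_int.
rewrite (@eq_icint _ _ (fun x => (F (x +i* c) - F (x +i* d)) - (G (x +i* c) - G (x +i* d))) a b); last first.
 by move=> x _; ring.
rewrite (@eq_icint _ _ (fun x => (F (b +i* x) - F (a +i* x)) - (G (b +i* x) - G (a +i* x))) c d); last first.
 by move=> x _; ring.
rewrite (icintB (rect_h2 cd hF) (rect_h2 cd hG)) (icintB (rect_v2 ab hF) (rect_v2 ab hG)); ring.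
Qed.

Lemma nested_itv (A B : nat -> R) : (forall k, A k <= B k) -> (forall k, A k <= A k.+1 /\ B k.+1 <= B k) ->
 exists x, (forall j k, (j <= k)%N -> A j <= A k /\ B k <= B j) /\ forall k, A k <= x <= B k.
move=> AB mono.
have Am j k : (j <= k)%N -> A j <= A k /\ B k <= B j.
 elim: k => [|k IH]; first by rewrite leqn0 => /eqP ->.
 rewrite leq_eqVlt => /orP[/eqP ->//|/IH[h1 h2]]; have [h3 h4] := mono k.
 by split; [exact: le_trans h1 h3|exact: le_trans h4 h2].
have AjB j k : A j <= B k.
 have [h1 _] := Am _ _ (leq_maxl j k); have [_ h2] := Am _ _ (leq_maxr j k).
 exact: le_trans (le_trans h1 (AB _)) h2.
exists (sup (range A)); split => // k; apply/andP; split.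
 by apply: ub_le_sup; [exists (B 0%N) => _ [j _ <-]; exact: AjB|exists k].
by apply: ge_sup; [exists (A 0%N), 0%N|move=> _ [j _ <-]; exact: AjB].
Qed.

(** The rectangles are iterated as elements of a sigma type, so the recursion carries the proof that
    [P] still holds; [t] is a power of 1/2, and the point is common to the two nested sequences of
    intervals. *)
Lemma bisection_rect (P : R -> R -> R -> R -> Prop) a b c d : a < b -> c < d ->
 (forall a b c d, a < b -> c < d -> P a b c d ->
   [\/ P a ((a + b) / 2) c ((c + d) / 2), P ((a + b) / 2) b c ((c + d) / 2),
     P a ((a + b) / 2) ((c + d) / 2) d | P ((a + b) / 2) b ((c + d) / 2) d]) -> P a b c d ->
 exists x y, [/\ a <= x <= b, c <= y <= d & forall e, 0 < e -> exists t a' b' c' d',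
  [/\ 0 < t < e, (b' - a' = t * (b - a)) /\ (d' - c' = t * (d - c)), a' <= x <= b' /\ c' <= y <= d',
    (a <= a' /\ b' <= b) /\ (c <= c' /\ d' <= d) & P a' b' c' d']].
move=> ab cd step P0.
pose rect := (R * R * R * R)%type.
pose ok (q : rect) := let: (a, b, c, d) := q in [/\ a < b, c < d & P a b c d].
pose rel (q q' : rect) := let: (a, b, c, d) := q in let: (a', b', c', d') := q' in
 [/\ a <= a' /\ b' <= b, c <= c' /\ d' <= d & b' - a' = (b - a) / 2 /\ d' - c' = (d - c) / 2].
have next (q : {q | ok q}) : {q' : {q | ok q} | rel (sval q) (sval q')}.
 apply: cid; case: q => [[[[a0 b0] c0] d0]] [ab0 cd0 P00].
 have mk (q' : rect) (okq : ok q') : rel (a0, b0, c0, d0) q' -> exists q : {q | ok q}, rel (a0, b0, c0, d0) (sval q).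
  by exists (exist _ _ okq). case: (step _ _ _ _ ab0 cd0 P00) => Pq;
  [apply: (mk (a0, (a0 + b0) / 2, c0, (c0 + d0) / 2))|apply: (mk ((a0 + b0) / 2, b0, c0, (c0 + d0) / 2))
  |apply: (mk (a0, (a0 + b0) / 2, (c0 + d0) / 2, d0))|apply: (mk ((a0 + b0) / 2, b0, (c0 + d0) / 2, d0))];
  by split => //; try split; lra.
have ok0 : ok (a, b, c, d) by [].
pose q_ k := iter k (fun q => sval (next q)) (exist _ _ ok0 : {q | ok q}).
pose A k := (sval (q_ k)).1.1.1; pose B k := (sval (q_ k)).1.1.2.
pose C0 k := (sval (q_ k)).1.2; pose D k := (sval (q_ k)).2.
have okP k : [/\ A k < B k, C0 k < D k & P (A k) (B k) (C0 k) (D k)].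
 by rewrite /A /B /C0 /D; case: (q_ k) => [[[[? ?] ?] ?]] [].
have relk k : [/\ A k <= A k.+1 /\ B k.+1 <= B k, C0 k <= C0 k.+1 /\ D k.+1 <= D k &
  B k.+1 - A k.+1 = (B k - A k) / 2 /\ D k.+1 - C0 k.+1 = (D k - C0 k) / 2].
 rewrite /A /B /C0 /D /q_ iterS -/(q_ k); case: (next (q_ k)) => q' /=.
 by case: (q_ k) => [[[[? ?] ?] ?] ?]; case: q' => [[[[? ?] ?] ?] ?].
have wk k : B k - A k = 2^-1 ^+ k * (b - a) /\ D k - C0 k = 2^-1 ^+ k * (d - c).
 elim: k => [|k [IH1 IH2]]; first by rewrite expr0 !mul1r.
 by have [_ _ [-> ->]] := relk k; rewrite IH1 IH2 exprS; split; field.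
have [||x [Am xk]] := @nested_itv A B; [by move=> k; have [/ltW] := okP k|by move=> k; have [] := relk k|].
have [||y [Cm yk]] := @nested_itv C0 D; [by move=> k; have [_ /ltW] := okP k|by move=> k; have [] := relk k|].
exists x, y; split; [exact: (xk 0%N)|exact: (yk 0%N)|move=> e e0].
have [k ke] : exists k, 2^-1 ^+ k < e.
 have : (fun k => 2^-1 ^+ k : R) @ \oo --> (0 : R) by apply: cvg_expr; rewrite ger0_norm//; lra.
 move=> /cvgrPdist_lt/(_ _ e0)[k _ /(_ k (leqnn k))]; rewrite sub0r normrN => h.
 by exists k; exact: le_lt_trans (ler_norm _) h.
exists (2^-1 ^+ k), (A k), (B k), (C0 k), (D k); split.
- by rewrite ke exprn_gt0.
- exact: wk.
- by split; [exact: xk|exact: yk].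
- by split; [exact: (Am 0%N k)|exact: (Cm 0%N k)].
- by have [] := okP k.
Qed.

(** The bisected property is that the contour integral is at least [k] times the area. One of four
    quarters inherits it, since the four integrals add up. At the limit point the affine part of [F]
    integrates to 0 and the remainder is too small. *)
Lemma goursat F a b c d : a < b -> c < d ->
 (forall x y, a <= x <= b -> c <= y <= d -> exists l, cdiff F l (x +i* y)) -> rect_int F a b c d = 0.
move=> ab cd FD; apply/eqP; apply: contraT; rewrite -normc_gt0 => E0.
have Fc : rect_cont F a b c d.
 by move=> x y ax cy; have [l] := FD x y ax cy; exact: cdiff_ccont.
have w0 : 0 < b - a by rewrite subr_gt0.
have h0 : 0 < d - c by rewrite subr_gt0.
pose k := normc (rect_int F a b c d) / ((b - a) * (d - c)).
have k0 : 0 < k by rewrite divr_gt0// mulr_gt0.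
pose P a' b' c' d' := [/\ a <= a', b' <= b, c <= c', d' <= d &
 k * ((b' - a') * (d' - c')) <= normc (rect_int F a' b' c' d')].
have [||x [y [xab ycd H]]] := @bisection_rect P a b c d ab cd.
- move=> a1 b1 c1 d1 ab1 cd1 [h1 h2 h3 h4 h5].
 have m1 : a1 <= (a1 + b1) / 2 <= b1 by apply/andP; split; lra.
 have m2 : c1 <= (c1 + d1) / 2 <= d1 by apply/andP; split; lra.
 set m := (a1 + b1) / 2 in m1 *; set n := (c1 + d1) / 2 in m2 *. have hc := rect_sub Fc h1 h2 h3 h4.
 have [m1' m1''] := andP m1; have [m2' m2''] := andP m2.
 have hc1 := rect_sub hc (lexx a1) m1'' (lexx c1) (lexx d1).
 have hc2 := rect_sub hc m1' (lexx b1) (lexx c1) (lexx d1).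
 rewrite (rect_int_splitx m1 (ltW cd1) hc) (rect_int_splity m1' m2 hc1) (rect_int_splity m1'' m2 hc2) in h5.
 set q := k * ((b1 - a1) * (d1 - c1)) in h5.
 have E : [/\ k * ((m - a1) * (n - c1)) = q / 4, k * ((b1 - m) * (n - c1)) = q / 4,
  k * ((m - a1) * (d1 - n)) = q / 4 & k * ((b1 - m) * (d1 - n)) = q / 4]. by rewrite /q /m /n; split; field.
 case: E => E1 E2 E3 E4. have [g1|g1] := leP (q / 4) (normc (rect_int F a1 m c1 n)).
  by apply: Or41; split; rewrite ?E1// ?(le_trans m1'')// (le_trans m2'').
 have [g2|g2] := leP (q / 4) (normc (rect_int F m b1 c1 n)).
  by apply: Or42; split; rewrite ?E2// ?(le_trans h1)// (le_trans m2'').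
 have [g3|g3] := leP (q / 4) (normc (rect_int F a1 m n d1)).
  by apply: Or43; split; rewrite ?E3// ?(le_trans m1'')// (le_trans h3).
 have [g4|g4] := leP (q / 4) (normc (rect_int F m b1 n d1)).
  by apply: Or44; split; rewrite ?E4// ?(le_trans h1)// (le_trans h3).
 clearbody q; exfalso; move: h5; apply/negP; rewrite -ltNge.
 rewrite (le_lt_trans (normcD _ _))// (le_lt_trans (lerD (normcD _ _) (normcD _ _)))//.
 clear -g1 g2 g3 g4; lra.
- by split => //; rewrite /k divfK// gt_eqF// mulr_gt0.
have [l Fl] := FD x y xab ycd.
set w := b - a in w0 k k0 P H; set h := d - c in h0 k k0 P H.
(* With this [e] the estimate of [le_rect_int] gives exactly half of [k] times the area of the small
   rectangle. *)
pose e := k * (w * h) / (4 * (w + h) ^+ 2).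
have wh0 : 0 < w + h by rewrite addr_gt0.
have e0 : 0 < e := divr_gt0 (mulr_gt0 k0 (mulr_gt0 w0 h0)) (mulr_gt0 (ltr0n _ 4) (exprn_gt0 2 wh0)).
have [r r0 rP] := Fl e e0.
have [t [a1 [b1 [c1 [d1 [/andP[t0 tr] [E1 E2] [xab1 ycd1] [[g1 g2] [g3 g4]] [_ _ _ _ HP]]]]]]] :=
 H (r / (w + h)) (divr_gt0 r0 wh0).
rewrite E1 E2 in HP.
have ab1 : a1 <= b1 by rewrite -subr_ge0 E1 ltW// mulr_gt0.
have cd1 : c1 <= d1 by rewrite -subr_ge0 E2 ltW// mulr_gt0.
have hc := rect_sub Fc g1 g2 g3 g4.
pose p := x +i* y; pose G z := (F p - l * p) + l * z.
have Gc : rect_cont G a1 b1 c1 d1.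
 move=> x' y' _ _; have : cdiff G l (x' +i* y').
  move=> e' e'0; exists 1 => // z _; rewrite (_ : _ - _ = 0) ?normc0 ?mulr_ge0 ?nc_ge0// ?ltW//.
  by rewrite /G; ring. exact: cdiff_ccont.
have := rect_intB ab1 cd1 hc Gc; rewrite rect_int_affine// subr0 => EE.
have : normc (rect_int (fun z => F z - G z) a1 b1 c1 d1) <=
  2 * (e * (t * (w + h))) * (b1 - a1 + (d1 - c1)). apply: le_rect_int => //. move=> x' y' hx hy e' e'0.
  have e2 : 0 < e' / 2 by rewrite divr_gt0.
  have [r1 r10 H1] := hc _ _ hx hy _ e2; have [r2 r20 H2] := Gc _ _ hx hy _ e2.
  exists (Num.min r1 r2) => [|z]; first by rewrite lt_min r10. rewrite lt_min => /andP[/H1 u1 /H2 u2].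
  rewrite (_ : _ - _ = (F z - F (x' +i* y')) - (G z - G (x' +i* y'))); last by ring.
  rewrite (le_lt_trans (normcBD _ _))//; clear -u1 u2; lra. move=> x' y' /andP[x1 x2] /andP[y1 y2].
 have D : normc (x' +i* y' - p) <= t * (w + h). rewrite (le_trans (normc_le_ReIm _))//= mulrDr -E1 -E2.
  move: xab1 ycd1 => /andP[u1 u2] /andP[u3 u4].
  by apply: lerD; rewrite ler_norml; apply/andP; split; clear -u1 u2 u3 u4 x1 x2 y1 y2; lra.
 have := rP (x' +i* y'); rewrite -/p => /(_ _); have Dr : normc (x' +i* y' - p) < r.
  by rewrite (le_lt_trans D)// -ltr_pdivlMr. move=> /(_ Dr) hh.
 rewrite (_ : F _ - G _ = F (x' +i* y') - F p - l * (x' +i* y' - p)); last by rewrite /G; ring.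
 by rewrite (le_trans hh)// ler_pM2l.
rewrite EE E1 E2; move=> /(le_trans HP).
have -> : 2 * (e * (t * (w + h))) * (t * w + t * h) = k * (t * w * (t * h)) / 2.
 by rewrite /e; field; rewrite gt_eqF.
have := mulr_gt0 k0 (mulr_gt0 (mulr_gt0 t0 w0) (mulr_gt0 t0 h0)).
move=> q0 q1; exfalso; move: q0 q1; set q := k * _; clear; lra.
Qed.

(** Cutting along the sides of the inner rectangle leaves four outer pieces on which [goursat]
    applies. *)
Lemma rect_int_shrink F a u1 u2 b c v1 v2 d :
 a < u1 -> u1 < u2 -> u2 < b -> c < v1 -> v1 < v2 -> v2 < d -> rect_cont F a b c d ->
 (forall x y, a <= x <= b -> c <= y <= d ->
  [|| x <= u1, u2 <= x, y <= v1 | v2 <= y] -> exists l, cdiff F l (x +i* y)) ->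
 rect_int F a b c d = rect_int F u1 u2 v1 v2.
move=> au u12 ub cv v12 vd Fc FD.
have u1b := lt_trans u12 ub; have v1d := lt_trans v12 vd.
have au2 := lt_trans au u12; have cv2 := lt_trans cv v12.
have cd := lt_trans cv v1d.
have Fc1 : rect_cont F u1 b c d by apply: rect_sub Fc _ _ _ _ => //; exact: ltW.
have Fc2 : rect_cont F u1 u2 c d by apply: rect_sub Fc1 _ _ _ _ => //; exact: ltW.
have Fc3 : rect_cont F u1 u2 v1 d by apply: rect_sub Fc2 _ _ _ _ => //; exact: ltW.
rewrite (@rect_int_splitx F a u1) ?(ltW au) ?ltW// (@rect_int_splitx F u1 u2) ?(ltW u12) ?ltW//.
rewrite (@rect_int_splity F u1 u2 c v1) ?(ltW cv) ?ltW// (@rect_int_splity F u1 u2 v1 v2) ?(ltW v12) ?ltW//.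
rewrite [rect_int F a u1 c d]goursat//; last first.
 move=> x y /andP[x1 x2] cy; apply: FD => //; last by rewrite x2. by rewrite x1 (le_trans x2)// ltW.
rewrite [rect_int F u2 b c d]goursat//; last first.
 move=> x y /andP[x1 x2] cy; apply: FD => //; last by rewrite x1 orbT. by rewrite x2 (le_trans _ x1)// ltW.
rewrite [rect_int F u1 u2 c v1]goursat//; last first.
 move=> x y /andP[x1 x2] /andP[y1 y2]; apply: FD; last by rewrite y2 !orbT.
  by rewrite (le_trans (ltW au) x1) (le_trans x2 (ltW ub)). by rewrite y1 (le_trans y2)// ltW.
rewrite [rect_int F u1 u2 v2 d]goursat//; last first.
 move=> x y /andP[x1 x2] /andP[y1 y2]; apply: FD; last by rewrite y1 !orbT.
  by rewrite (le_trans (ltW au) x1) (le_trans x2 (ltW ub)). by rewrite y2 (le_trans _ y1)// ltW.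
by rewrite add0r !addr0 add0r.
Qed.

(** Continuity at the exceptional point is enough: the integral equals that over a small square
    around it, which is bounded there by a multiple of its side. *)
Lemma goursat_point F a b c d (p1 p2 : R) : a < p1 < b -> c < p2 < d ->
 rect_cont F a b c d -> (forall x y, a <= x <= b -> c <= y <= d -> (x, y) != (p1, p2) ->
  exists l, cdiff F l (x +i* y)) -> rect_int F a b c d = 0.
move=> /andP[ap pb] /andP[cp pd] Fc FD.
apply: normc_small => e e0.
have [||r r0 rP] := Fc p1 p2 _ _ 1 ltr01; [by rewrite !ltW|by rewrite !ltW|].
set M := normc (F (p1 +i* p2)) + 1.
have M0 : 0 < M by rewrite ltr_wpDl ?nc_ge0.
(* The integral over a square of half-side [t] is at most [2 M * 4 t]. *)
have q0 : 0 < e / (8 * M) by rewrite divr_gt0// mulr_gt0.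
have [t [t0 t1 t2] [t3 t4 t5 t6]] : exists2 t, [/\ 0 < t, t < p1 - a & t < b - p1] &
  [/\ t < p2 - c, t < d - p2, t + t < r & t < e / (8 * M)].
 pose m := Num.min (Num.min (Num.min (p1 - a) (b - p1)) (Num.min (p2 - c) (d - p2)))
  (Num.min (r / 2) (e / (8 * M))). have m0 : 0 < m by rewrite /m !lt_min !subr_gt0 ap pb cp pd q0 divr_gt0.
 have mm : m / 2 < m by rewrite ltr_pdivrMr// ltr_pMr// ltr1n.
 have : m <= m by []; rewrite {2}/m !le_min => /andP[/andP[/andP[? ?] /andP[? ?]] /andP[mr ?]].
 exists (m / 2). by split; [rewrite divr_gt0|exact: lt_le_trans mm _|exact: lt_le_trans mm _].
 split; [exact: lt_le_trans mm _|exact: lt_le_trans mm _| |exact: lt_le_trans mm _].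
 by rewrite -splitr (le_lt_trans mr)// ltr_pdivrMr// ltr_pMr// ltr1n.
have t' : - t < t by rewrite gtrN.
have h1 : a < p1 - t by rewrite ltrBrDr -ltrBrDl.
have h2 : p1 - t < p1 + t by rewrite ltrD2l.
have h3 : p1 + t < b by rewrite -ltrBrDl.
have h4 : c < p2 - t by rewrite ltrBrDr -ltrBrDl.
have h5 : p2 - t < p2 + t by rewrite ltrD2l.
have h6 : p2 + t < d by rewrite -ltrBrDl.
rewrite (rect_int_shrink h1 h2 h3 h4 h5 h6)//; last first.
 move=> x y hx hy out; apply: FD => //; apply/eqP => -[ex ey]; move: out.
 by rewrite ex ey !lerBrDr !gerDl leNgt t0.
have tp1 : p1 - t <= p1 + t by rewrite lerD2l ltW.
have tp2 : p2 - t <= p2 + t by rewrite lerD2l ltW.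
have Fc' : rect_cont F (p1 - t) (p1 + t) (p2 - t) (p2 + t).
 apply: rect_sub Fc _ _ _ _.
 - by rewrite lerBrDr -lerBrDl ltW.
 - by rewrite -lerBrDl ltW.
 - by rewrite lerBrDr -lerBrDl ltW.
 - by rewrite -lerBrDl ltW.
have := @le_rect_int F (p1 - t) (p1 + t) (p2 - t) (p2 + t) M tp1 tp2 Fc'.
have -> : p1 + t - (p1 - t) + (p2 + t - (p2 - t)) = t * 4 by ring.
move=> H; apply: le_trans (H _) _.
 move=> x y hx hy.
 rewrite -(subrK (F (p1 +i* p2)) (F (x +i* y))) (le_trans (normcD _ _))// addrC lerD2l ltW//.
 apply: rP; rewrite (le_lt_trans (normc_le_ReIm _))//= (le_lt_trans _ t5)// lerD//. by rewrite ler_distl.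
 by rewrite ler_distl.
move: t6; rewrite ltr_pdivlMr ?mulr_gt0// => /ltW; apply: le_trans.
by apply: eqle; ring.
Qed.

End Goursat.

(** * Closure properties of complex differentiability *)

Section Holomorphic.
Variable R : realType.
Notation C := R[i].
Implicit Types (f g : C -> C) (z w : C).

Definition holo f z := exists l, cdiff f l z.

Lemma holoP f z : holo f z <-> differentiable (f : cplx R -> cplx R) (z : cplx R).
by split=> [[l]|]; [exact: cdiff_differentiable|exact: differentiable_cdiff]. Qed.
Lemma holo_ccont f z : holo f z -> ccont f z.
by case=> l; exact: cdiff_ccont. Qed.
Lemma holo_cst c z : holo (fun=> c) z.
exact/holoP/differentiable_cst. Qed.
Lemma holo_id z : holo id z.
by exists 1 => e e0; exists 1 => // w _; rewrite mul1r subrr normc0 mulr_ge0 ?nc_ge0// ltW. Qed.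
Lemma holoD f g z : holo f z -> holo g z -> holo (fun w => f w + g w) z.
move=> /holoP hf /holoP hg; exact/holoP/(differentiableD hf hg). Qed.
Lemma holoM f g z : holo f z -> holo g z -> holo (fun w => f w * g w) z.
move=> /holoP hf /holoP hg; exact/holoP/(differentiableM hf hg). Qed.
Lemma holoN f z : holo f z -> holo (fun w => - f w) z.
move=> /holoP hf; exact/holoP/(differentiableN hf). Qed.
Lemma holoB f g z : holo f z -> holo g z -> holo (fun w => f w - g w) z.
by move=> hf /holoN; exact: holoD. Qed.
Lemma holoV f z : holo f z -> f z != 0 -> holo (fun w => (f w)^-1) z.
move=> /holoP hf f0; exact/holoP/(differentiableV hf f0). Qed.
Lemma holo_comp f g z : holo g z -> holo f (g z) -> holo (fun w => f (g w)) z.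
move=> /holoP hg /holoP hf; exact/holoP/(differentiable_comp hg hf). Qed.

Lemma holo_near f g z (d : R) : 0 < d -> (forall w, normc (w - z) < d -> f w = g w) ->
 holo f z -> holo g z.
by move=> d0 fg [l fl]; exists l; exact: cdiff_near fg fl. Qed.

Lemma holo_cexp z : holo (@cexp R) z. exists (cexp z); exact: cdiff_cexp. Qed.

End Holomorphic.

(** * Means over circles: Cauchy's formula and a second-order Taylor bound *)

Section CircleMean.
Variable R : realType.
Notation C := R[i].
Implicit Types (f g F G : C -> C) (r p q : R).

Definition eit (t : R) : C := cexp (0 +i* t).

Lemma normc_eit t : normc (eit t) = 1.
by rewrite normc_cexp expR0. Qed.
Lemma normc_reit (p t : R) : 0 <= p -> normc (p%:C * eit t) = p.
by move=> p0; rewrite normcM normc_eit mulr1 normcR ger0_norm. Qed.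
Lemma eitN t : eit (- t) = (eit t)^*.
by rewrite /eit -cexpJ; congr cexp; apply: eqc => //=; rewrite oppr0. Qed.

Lemma eit_neq0 t : eit t != 0. exact: cexp_neq0. Qed.

Lemma eitNV t : eit (- t) = (eit t)^-1.
by rewrite /eit -cexpN; congr cexp; apply: eqc => //=; rewrite oppr0. Qed.
Lemma cexp_polar (x y : R) : cexp (x +i* y) = (expR x)%:C * eit y.
by rewrite /eit -cexpR -cexpD; congr cexp; apply: eqc; rewrite /= ?addr0 ?add0r. Qed.

Lemma rccont_eit t : rccont eit t.
have := cdiff_ccont (cdiff_cexp (0 +i* t)).
exact: rccont_vline.
Qed.

Lemma rccont_circle G p t : ccont G (p%:C * eit t) -> rccont (fun t => G (p%:C * eit t)) t.
move=> h; apply: (@rccont_comp _ G (fun t => p%:C * eit t)) => //.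
by apply: rccontM; [exact: rccont_cst|exact: rccont_eit].
Qed.

Definition cmean (g : R -> C) : C := ((2 * pi)^-1)%:C * icint g (- pi) pi.

Lemma pi2_gt0 : 0 < 2 * pi :> R. by rewrite mulr_gt0// pi_gt0. Qed.

Lemma Npi_le_pi : - pi <= pi :> R. by have := pi_ge0 R; lra. Qed.

Lemma eq_cmean (f g : R -> C) : (forall t, f t = g t) -> cmean f = cmean g.
by move=> fg; rewrite /cmean; congr (_ * _); apply: eq_icint. Qed.

Lemma cmeanB (f g : R -> C) : (forall t, rccont f t) -> (forall t, rccont g t) ->
 cmean (fun t => f t - g t) = cmean f - cmean g.
by move=> hf hg; rewrite /cmean -mulrBr icintB. Qed.

Lemma cmeanZ k (f : R -> C) : (forall t, rccont f t) -> cmean (fun t => k * f t) = k * cmean f.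
by move=> hf; rewrite /cmean icintZ// mulrCA. Qed.
Lemma cmeanJ (f : R -> C) : (forall t, rccont f t) -> cmean (fun t => (f t)^*) = (cmean f)^*.
by move=> hf; rewrite /cmean icintJ// conjcM conjcR. Qed.

Lemma cmean_cst k : cmean (fun=> k) = k.
rewrite /cmean icint_cst ?Npi_le_pi// opprK mulrA -RCM (_ : _ * (pi + pi) = 1) ?mul1r//.
by rewrite -mulr2n -[pi *+ 2]mulr_natl mulVf// gt_eqF// pi2_gt0.
Qed.

Lemma le_normc_cmean (f : R -> C) M : (forall t, rccont f t) ->
 (forall t, normc (f t) <= M) -> normc (cmean f) <= M.
move=> hf fM; have p0 := pi2_gt0.
rewrite /cmean normcM normcR gtr0_norm ?invr_gt0// mulrC ler_pdivrMr//.
by rewrite (le_trans (le_normc_icint (M := M) _ _ _)) ?Npi_le_pi// opprK [2 * _]mulr_natl mulr2n.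
Qed.

(** The exponential wraps the rectangle [[ln p, ln q] x [-pi, pi]] onto the annulus. The two
    horizontal sides cancel by periodicity, and the vertical ones carry the two circle means. *)
Lemma circle_mean_rect G p q : 0 < p -> p <= q ->
 (forall z, p <= normc z <= q -> ccont G z) -> rect_int (fun z => G (cexp z)) (ln p) (ln q) (- pi) pi = 0 ->
 cmean (fun t => G (p%:C * eit t)) = cmean (fun t => G (q%:C * eit t)).
move=> p0 pq Gc; have q0 := lt_le_trans p0 pq.
rewrite /rect_int (@eq_icint _ _ (fun=> 0)); last first.
 move=> x _; apply/eqP; rewrite subr_eq0; apply/eqP; congr G.
 by rewrite !cexp_polar; congr (_ * _); rewrite /eit /cexp/= cosN sinN sinpi oppr0.
rewrite icint_cst; last by rewrite ler_ln.
rewrite mulr0 add0r => /eqP; rewrite mulf_eq0 => /orP[|/eqP].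
 by rewrite eq_complex/= oner_eq0 andbF.
rewrite (@eq_icint _ _ (fun t => G (q%:C * eit t) - G (p%:C * eit t))); last first.
 by move=> t _; rewrite !cexp_polar !lnK.
rewrite icintB; first by move=> /eqP; rewrite subr_eq0 /cmean => /eqP ->.
 by move=> t _; apply: rccont_circle; apply: Gc; rewrite normc_reit ?pq ?lexx// ltW.
by move=> t _; apply: rccont_circle; apply: Gc; rewrite normc_reit ?pq ?lexx// ltW.
Qed.

Lemma normc_cexp_itv p q x y : 0 < p -> 0 < q -> ln p <= x <= ln q -> p <= normc (cexp (x +i* y)) <= q.
by move=> p0 q0 /andP[px xq]; rewrite normc_cexp/= -{1}(lnK p0) -(lnK q0) !ler_expR px. Qed.

Lemma circle_mean_eq G p q : 0 < p -> p <= q ->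
 (forall z, p <= normc z <= q -> holo G z) ->
 cmean (fun t => G (p%:C * eit t)) = cmean (fun t => G (q%:C * eit t)).
move=> p0; rewrite le_eqVlt => /orP[/eqP ->//|pq] GD; have q0 := lt_trans p0 pq.
apply: circle_mean_rect => //; first exact: ltW.
 by move=> z /GD/holo_ccont.
apply: goursat; first by rewrite ltr_ln.
 by have := pi_gt0 R; lra.
move=> x y xpq _; apply: (@holo_comp _ G); first exact: holo_cexp.
exact/GD/normc_cexp_itv.
Qed.

(** In logarithmic coordinates the exceptional point of the positive axis is the single interior
    point [(ln r, 0)], which [goursat_point] tolerates. *)
Lemma circle_mean_eq_point G p r q : 0 < p -> p < r -> r < q ->
 (forall z, p <= normc z <= q -> ccont G z) -> (forall z, p <= normc z <= q -> z != r%:C -> holo G z) ->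
 cmean (fun t => G (p%:C * eit t)) = cmean (fun t => G (q%:C * eit t)).
move=> p0 pr rq GC GD; have pq := lt_trans pr rq; have q0 := lt_trans p0 pq.
have r0 := lt_trans p0 pr; have pi0 := pi_gt0 R.
apply: circle_mean_rect => //; first exact: ltW.
apply: (@goursat_point _ _ _ _ _ _ (ln r) 0).
- by rewrite !ltr_ln ?posrE// pr.
- by apply/andP; split; lra.
- move=> x y xpq _ e e0; have [d d0 dP] := GC _ (normc_cexp_itv y p0 q0 xpq) e e0.
 have [d' d'0 dP'] := cdiff_ccont (cdiff_cexp (x +i* y)) d0. by exists d' => // w /dP'/dP.
- move=> x y xpq /andP[y1 y2] xy; apply: (@holo_comp _ G); first exact: holo_cexp.
 apply: GD; first exact: normc_cexp_itv. apply: contra xy => /eqP E; have := congr1 (@normc R) E.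
 rewrite normc_cexp normcR/= gtr0_norm// => xr. have -> : x = ln r by rewrite -xr expRK.
 rewrite xpair_eqE eqxx/=; move: E; rewrite cexp_polar xr => /(canRL (mulKf _)).
 rewrite RC_eq0 (gt_eqF r0) => /(_ isT); rewrite mulVf ?RC_eq0 ?(gt_eqF r0)//.
 move=> E; have := congr1 (@complex.Re R) E; rewrite /eit ReZ/= expR0 mul1r => cy.
 (* [cos y = 1] means [sin (y / 2) = 0], which is impossible for [y != 0] in [[-pi, pi]]. *)
 apply: contraT => y0; suff : sin (y / 2) != 0. move=> s0; have h := cos2Dsin2 (y / 2).
  have cE : cos y = cos (y / 2) ^+ 2 - sin (y / 2) ^+ 2 by rewrite {1}[y]splitr cosD !expr2.
  have s2 : 0 < sin (y / 2) ^+ 2 by rewrite exprn_even_gt0. by clear -h cE s2 cy; lra.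
 move: y0; rewrite neq_lt => /orP[yn|yp]. rewrite -[y]opprK mulNr sinN oppr_eq0 gt_eqF//; apply: sin_gt0_pi.
  by apply/andP; split; clear -yn y1 pi0; lra.
 by rewrite gt_eqF//; apply: sin_gt0_pi; apply/andP; split; clear -yp y2 pi0; lra.
Qed.

(** By continuity the mean over a small circle is close to [G 0], so it suffices that small circles
    have the same mean as the large one. *)
Lemma ccont_cmean0 G q : 0 < q -> (forall z, normc z <= q -> ccont G z) ->
 (exists2 d, 0 < d & forall p, 0 < p < d -> p <= q ->
  cmean (fun t => G (p%:C * eit t)) = cmean (fun t => G (q%:C * eit t))) ->
 cmean (fun t => G (q%:C * eit t)) = G 0.
move=> q0 Gc [d1 d10 h]; apply: normc_small_eq => e e0.
have [|d d0 dP] := Gc 0 _ e e0; first by rewrite normc0 ltW.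
pose p := Num.min (Num.min (d / 2) (d1 / 2)) q.
have p0 : 0 < p by rewrite !lt_min q0 !divr_gt0.
have pq : p <= q by rewrite ge_min lexx orbT.
have pd : p < d by rewrite !gt_min; apply/orP; left; apply/orP; left; clear -d0; lra.
have pd1 : p < d1 by rewrite !gt_min; apply/orP; left; apply/orP; right; clear -d10; lra.
clearbody p.
have rc t : rccont (fun t => G (p%:C * eit t)) t.
 by apply: rccont_circle; apply: Gc; rewrite normc_reit// ltW.
rewrite -(h p) ?p0// -[X in _ - X](cmean_cst (G 0)) -cmeanB//; last by move=> t; exact: rccont_cst.
apply: le_normc_cmean => t; last by apply/ltW/dP; rewrite subr0 normc_reit// ltW.
by apply: rccontB => //; exact: rccont_cst.
Qed.

Lemma mean_value G q : 0 <= q -> (forall z, normc z <= q -> holo G z) ->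
 cmean (fun t => G (q%:C * eit t)) = G 0.
rewrite le_eqVlt => /orP[/eqP <- _|q0 Gh].
 by rewrite (@eq_cmean _ (fun=> G 0)) ?cmean_cst// => t; rewrite mul0r.
apply: ccont_cmean0 => // [z /Gh/holo_ccont//|]; exists 1 => // p /andP[p0 _] pq.
by apply: circle_mean_eq => // z /andP[_ /Gh].
Qed.

(** The function of [eit (- t)] is antiholomorphic; conjugation turns it into [1 / (1 - x z)] on the
    unit circle, whose mean is its value at 0. *)
Lemma cmean_geom (x : R) : 0 <= x < 1 -> cmean (fun t => (1 - x%:C * eit (- t))^-1) = 1.
move=> /andP[x0 x1].
have nz z : normc z <= 1 -> 1 - x%:C * z != 0.
 move=> z1; rewrite subr_eq0; apply/eqP => E; have := congr1 (@normc R) E.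
 rewrite normc1 normcM normcR ger0_norm// => e; have := ler_wpM2l x0 z1. by rewrite -e mulr1 leNgt x1.
have H := @mean_value (fun z => (1 - x%:C * z)^-1) 1 ler01.
rewrite (@eq_cmean _ (fun t => ((1 - x%:C * eit t)^-1)^*)); last first.
 by move=> t; rewrite conjcV conjcB conjcM conjcR eitN conjc_one.
rewrite cmeanJ.
 rewrite (@eq_cmean _ (fun t => (1 - x%:C * (1%:C * eit t))^-1)); last first. by move=> t; rewrite mul1r.
 rewrite H ?mulr0 ?subr0 ?invr1 ?conjc_one// => z z1.
 by apply: holoV; [apply: holoB; [exact: holo_cst|apply: holoM; [exact: holo_cst|exact: holo_id]]|exact: nz].
move=> t; have := @rccont_circle (fun z => (1 - x%:C * z)^-1) 1 t; rewrite !mul1r => h.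
have : rccont (fun t => (1 - x%:C * (1%:C * eit t))^-1) t.
 apply: h; apply: holo_ccont; apply: holoV; last by apply: nz; rewrite normc_eit.
 by apply: holoB; [exact: holo_cst|apply: holoM; [exact: holo_cst|exact: holo_id]].
by under [X in rccont X _ -> _]eq_fun do rewrite mul1r.
Qed.

(** On the circle [z = q eit t] the kernel is [z / (z - r)]. The difference quotient [Q], completed
    by [l] at [r], is continuous and holomorphic elsewhere, so [Q z * z] has mean 0; [cmean_geom]
    evaluates the part carrying the constant [f r]. *)
Lemma cauchy_formula f (r q q1 : R) : 0 <= r -> r < q -> q < q1 ->
 (forall z, normc z < q1 -> holo f z) ->
 cmean (fun t => f (q%:C * eit t) / (1 - (r / q)%:C * eit (- t))) = f r%:C.
move=> r0 rq qq fh; have q0 := le_lt_trans r0 rq.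
have [l fl] : holo f r%:C by apply: fh; rewrite normcR ger0_norm// (lt_trans rq).
pose Q z := if z == r%:C then l else (f z - f r%:C) / (z - r%:C).
have Qh z : normc z < q1 -> z != r%:C -> holo Q z.
 move=> zq zr; have d0 : 0 < normc (z - r%:C) by rewrite normc_gt0 subr_eq0.
 apply: (@holo_near _ (fun z => (f z - f r%:C) / (z - r%:C)) _ _ _ d0).
  move=> w wz; rewrite /Q ifF//; apply/negbTE/eqP => wr. by move: wz; rewrite wr normcB ltxx.
 apply: holoM; first by apply: holoB; [exact: fh|exact: holo_cst].
 by apply: holoV; [apply: holoB; [exact: holo_id|exact: holo_cst]|rewrite subr_eq0].
have Qc z : normc z < q1 -> ccont Q z.
 move=> zq; have [->|zr] := eqVneq z r%:C; last exact/holo_ccont/Qh.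
 move=> e e0; have [d d0 dP] := fl _ (divr_gt0 e0 (ltr0n _ 2)).
 exists d => // w /dP; rewrite /Q eqxx; case: eqP => [_ _|/eqP wr h]. by rewrite subrr normc0.
 have n0 : 0 < normc (w - r%:C) by rewrite normc_gt0 subr_eq0. apply: (@le_lt_trans _ _ (e / 2)); last by lra.
 rewrite -(ler_pM2r n0) -normcM (le_trans _ h)// mulrBl divfK// subr_eq0//.
pose G z := Q z * z.
have Gc z : normc z < q1 -> ccont G z.
 by move=> zq; apply: ccontM; [exact: Qc|exact/holo_ccont/holo_id].
have Gh z : normc z < q1 -> z != r%:C -> holo G z.
 by move=> zq zr; apply: holoM; [exact: Qh|exact: holo_id].
have G0 : cmean (fun t => G (q%:C * eit t)) = 0.
 transitivity (G 0); last by rewrite /G mulr0.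
 apply: ccont_cmean0 => //; first by move=> z zq; apply: Gc; exact: le_lt_trans qq.
 have [r00|r00] := eqVneq r 0. exists 1 => // p /andP[p0 _] pq; apply: circle_mean_eq => // z /andP[z1 z2].
  apply: Gh; first exact: le_lt_trans z2 qq. by apply/eqP => zr; move: z1; rewrite zr r00 normc0 leNgt p0.
 have r0' : 0 < r by rewrite lt_def r00.
 exists r => // p /andP[p0 pr] pq; apply: (@circle_mean_eq_point _ p r q) => //.
  by move=> z /andP[_ zq]; apply: Gc; exact: le_lt_trans zq qq.
 by move=> z /andP[_ zq]; apply: Gh; exact: le_lt_trans zq qq.
have xq : 0 <= r / q < 1 by rewrite divr_ge0 ?(ltW q0)//= ltr_pdivrMr// mul1r.
have nz t : 1 - (r / q)%:C * eit (- t) != 0.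
 rewrite subr_eq0; apply/eqP => E; have := congr1 (@normc R) E. move/andP : xq => [x0 x1].
 by rewrite normc1 normc_reit// => e; rewrite -e ltxx in x1.
have rc t : rccont (fun t => (1 - (r / q)%:C * eit (- t))^-1) t.
 have -> : (fun t => (1 - (r / q)%:C * eit (- t))^-1) =
   (fun t => (fun z => z / (z - (r / q)%:C)) (1%:C * eit t)).
  apply/funext => u; have := nz u; rewrite eitNV mul1r => h. have e0 := eit_neq0 u.
  by rewrite (_ : 1 - _ = (eit u - (r / q)%:C) / eit u) ?invf_div// mulrBl divff.
 apply: (@rccont_circle (fun z => z / (z - (r / q)%:C)) 1 t); apply: holo_ccont.
 apply: holoM; first exact: holo_id. apply: holoV; first by apply: holoB; [exact: holo_id|exact: holo_cst].
 rewrite subr_eq0; apply/eqP => E; have := congr1 (@normc R) E. move/andP : xq => [x0 x1].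
 by rewrite normc_reit// normcR ger0_norm// => e; rewrite -e ltxx in x1.
have rf t : rccont (fun t => f (q%:C * eit t)) t.
 apply: rccont_circle; apply: holo_ccont; apply: fh. by rewrite normc_reit// ltW.
have E : cmean (fun t => f (q%:C * eit t) / (1 - (r / q)%:C * eit (- t)) -
  f r%:C * (1 - (r / q)%:C * eit (- t))^-1) = 0.
 rewrite -G0; apply: eq_cmean => t; rewrite /G /Q ifF; last first.
  apply/negbTE/eqP => E; have := congr1 (@normc R) E. rewrite normc_reit ?(ltW q0)// normcR ger0_norm// => e.
  by move: rq; rewrite e ltxx. have q0' : q%:C != 0 by rewrite RC_eq0 gt_eqF.
 have e0 := eit_neq0 t; have h := nz t; rewrite eitNV RCM RCV in h *. have h' : q%:C * eit t - r%:C != 0.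
  apply: contra h => /eqP/subr0_eq h; rewrite -h subr_eq0 eq_sym; apply/eqP; field. by rewrite e0.
 have qe0 : q%:C * eit t != 0 by rewrite mulf_neq0.
 rewrite -mulrBl (_ : 1 - _ = (q%:C * eit t - r%:C) / (q%:C * eit t)).
  by rewrite invf_div -[RHS]mulrA; congr (_ * _); exact: mulrC.
 rewrite [RHS]mulrBl (divff qe0) [in RHS]invfM [in RHS]mulrA. by [].
rewrite cmeanB ?cmeanZ// in E; last first.
- by move=> t; apply: rccontM => //; exact: rccont_cst.
- by move=> t; apply: rccontM => //.
move/eqP : E; rewrite subr_eq0 => /eqP ->.
by rewrite cmean_geom// mulr1.
Qed.

(** The expansion [1 / (1 - w) = 1 + w + w^2 / (1 - w)] is inserted into Cauchy's formula on the
    circle of radius 1/2, with [|w| = 2 r <= 1/2]; the last term is at most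
    [M (2 r)^2 / (1/2) = 8 M r^2]. *)
Lemma taylor2_real f M l r : 0 <= M -> (forall z, normc z < 1 -> holo f z) ->
 (forall z, normc z < 1 -> normc (f z) <= M) -> cdiff f l 0 -> 0 <= r <= 1 / 4 ->
 normc (f r%:C - f 0 - l * r%:C) <= 8 * M * r ^+ 2.
move=> M0 fh fM fl.
have half0 : 0 < 1 / 2 :> R by rewrite divr_gt0.
have q1 : 1 / 2 < 1 :> R by rewrite ltr_pdivrMr// mul1r ltr1n.
have fq t : normc (f ((1 / 2)%:C * eit t)) <= M.
 by apply: fM; rewrite normc_reit// ltW.
have rf t : rccont (fun t => f ((1 / 2)%:C * eit t)) t.
 by apply/rccont_circle/holo_ccont/fh; rewrite normc_reit// ltW.
have rN t : rccont (fun t => eit (- t)) t.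
 move=> e e0; have [d d0 dP] := rccont_eit (- t) e0; exists d => // s sd; apply: dP. by rewrite -opprD normrN.
(* [2 A] is the first Taylor coefficient; [lA] identifies it with the derivative [l] by comparing
   both expansions at small [s]. *)
pose A := cmean (fun t => f ((1 / 2)%:C * eit t) * eit (- t)).
have main s : 0 <= s <= 1 / 4 ->
  normc (f s%:C - f 0 - (2 * s)%:C * A) <= 8 * M * s ^+ 2. move=> /andP[s0 s4]. have x12 : 2 * s <= 1 / 2.
  by rewrite -ler_pdivlMl//; apply: (le_trans s4); rewrite ler_pdivrMr//; lra. have s12 : s < 1 / 2.
  apply: le_lt_trans s4 _; rewrite ltr_pdivrMr//; lra.
 have := @cauchy_formula f s (1 / 2) 1 s0 s12 q1 fh; rewrite (_ : s / (1 / 2) = 2 * s); last by field.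
 set x := 2 * s in x12 * => fE. have x0 : 0 <= x by rewrite mulr_ge0.
 have low t : 1 / 2 <= normc (1 - x%:C * eit (- t)).
  have := normc_dist 1 (x%:C * eit (- t)); rewrite normc1 normc_reit//.
  by move=> /(le_trans (ler_norm _)); clear -x12; lra. have nz t : 1 - x%:C * eit (- t) != 0.
  by rewrite -normc_gt0 (lt_le_trans half0). have ri t : rccont (fun t => (1 - x%:C * eit (- t))^-1) t.
  have h : ccont (fun z => (1 - x%:C * z)^-1) (eit (- t)). apply: holo_ccont; apply: holoV => //.
   by apply: holoB; [exact: holo_cst|apply: holoM; [exact: holo_cst|exact: holo_id]].
  exact: (@rccont_comp _ _ (fun t => eit (- t)) t h (rN t)).
 have r1 t : rccont (fun t => f ((1 / 2)%:C * eit t) / (1 - x%:C * eit (- t))) t by exact: rccontM.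
 have r2 t : rccont (fun t => f ((1 / 2)%:C * eit t) * eit (- t)) t by exact: rccontM.
 have -> : f s%:C - f 0 - x%:C * A = cmean (fun t => f ((1 / 2)%:C * eit t) / (1 - x%:C * eit (- t))
    - f ((1 / 2)%:C * eit t) - x%:C * (f ((1 / 2)%:C * eit t) * eit (- t))). rewrite cmeanB.
  - rewrite cmeanB// fE cmeanZ// mean_value ?(ltW half0)// => z zq. by apply: fh; exact: le_lt_trans q1.
  - by move=> t; exact: rccontB.
  - by move=> t; apply: rccontM => //; exact: rccont_cst. apply: le_normc_cmean => t.
  by apply: rccontB; [exact: rccontB|apply: rccontM => //; exact: rccont_cst].
 have -> : f ((1 / 2)%:C * eit t) / (1 - x%:C * eit (- t)) - f ((1 / 2)%:C * eit t) -
   x%:C * (f ((1 / 2)%:C * eit t) * eit (- t)) =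
   f ((1 / 2)%:C * eit t) * (x%:C * eit (- t)) ^+ 2 / (1 - x%:C * eit (- t)).
  by have := nz t; move: (f _) (eit (- t)) => u v h; field.
 rewrite normcM normcV normcM normcX normc_reit// ler_pdivrMr; last exact: lt_le_trans (low t).
 apply: (@le_trans _ _ (M * x ^+ 2)); first by rewrite ler_wpM2r// exprn_ge0.
 have -> : M * x ^+ 2 = 8 * M * s ^+ 2 * (1 / 2) by rewrite /x; field.
 by rewrite ler_wpM2l// mulr_ge0 ?exprn_ge0// mulr_ge0.
have lA : 2%:C * A = l.
 apply: normc_small_eq => e e0. have e2 := half_gt0 e0. have [d d0 dP] := fl _ e2.
 have M1 : 0 < 16 * (M + 1) by rewrite mulr_gt0// ltr_wpDl.
 pose s := Num.min (d / 2) (Num.min (1 / 4) (e / (16 * (M + 1)))).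
 have s0 : 0 < s by rewrite !lt_min !divr_gt0.
 have sd : s < d by rewrite gt_min; apply/orP; left; rewrite ltr_pdivrMr// ltr_pMr// ltr1n.
 have s4 : s <= 1 / 4 by rewrite !ge_min lexx orbT.
 have se : s <= e / (16 * (M + 1)) by rewrite !ge_min lexx !orbT. clearbody s.
 have m := main s; rewrite s4 ltW// in m; have {}m := m isT.
 have := dP s%:C; rewrite subr0 normcR gtr0_norm// => /(_ sd) h.
 rewrite -(ler_pM2r s0) -{1}[s]gtr0_norm// -(@normcR R) -normcM.
 have -> : (2%:C * A - l) * s%:C = (f s%:C - f 0 - l * s%:C) - (f s%:C - f 0 - (2 * s)%:C * A).
  by rewrite RCM; ring. rewrite (le_trans (normcBD _ _))// (le_trans (lerD h m))//.
 rewrite -lerBrDl -mulrBl expr2 mulrA ler_wpM2r ?(ltW s0)//. move: se; rewrite ler_pdivlMr// => se.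
 have := mulr_ge0 M0 (ltW s0); clear -se s0; lra.
by move=> h; have := main _ h; rewrite RCM mulrAC lA.
Qed.

Lemma taylor2 f M l z : 0 <= M -> (forall z, normc z < 1 -> holo f z) ->
 (forall z, normc z < 1 -> normc (f z) <= M) -> cdiff f l 0 -> normc z <= 1 / 4 ->
 normc (f z - f 0 - l * z) <= 8 * M * normc z ^+ 2.
move=> M0 fh fM fl z4; have [->|z0] := eqVneq z 0.
 by rewrite subrr mulr0 subr0 normc0 expr0n mulr0.
set r := normc z; have r0 : 0 < r by rewrite normc_gt0.
have rC : r%:C != 0 by rewrite RC_eq0 gt_eqF.
pose u := z / r%:C.
have nu : normc u = 1 by rewrite normcM normcV normcR gtr0_norm// divff// gt_eqF.
have zE : z = u * r%:C by rewrite divfK.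
have nuw w : normc (u * w) = normc w by rewrite normcM nu mul1r.
have := @taylor2_real (fun w => f (u * w)) M (l * u) r M0.
rewrite mulr0 -zE -mulrA -zE; apply.
- move=> w w1; apply: (@holo_comp _ f); last by apply: fh; rewrite nuw.
 by apply: holoM; [exact: holo_cst|exact: holo_id].
- by move=> w w1; apply: fM; rewrite nuw.
- move=> e e0; have [d d0 dP] := fl e e0; exists d => // w; rewrite !subr0 => wd.
 by have := dP (u * w); rewrite !subr0 nuw mulr0 -mulrA => /(_ wd).
- by rewrite z4 ltW.
Qed.

End CircleMean.

(** * The completed measure and Borel versions of sets and functions *)

Section Completion.
Context d (T : measurableType d) (R : realType).
Variable mu : {sigma_finite_measure set T -> \bar R}.
Notation CT := (caratheodory_type (mu^*)%mu).
Notation cm := (@completed_measure_extension _ T R mu).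
Local Open Scope ereal_scope.

Lemma meas_completion (A : set T) : measurable A -> measurable (A : set CT).
exact: caratheodory_measurable_mu_ext. Qed.
Lemma completionE (A : set T) : measurable A -> cm A = mu A.
exact: measurable_mu_extE. Qed.

Lemma meas_fun_completion d' (U : measurableType d') (D : set T) (f : T -> U) :
 measurable D -> measurable_fun D f -> measurable_fun (D : set CT) f.
by move=> mD mf _ B mB; apply: meas_completion; exact: mf. Qed.

Lemma meas_id_completion : measurable_fun [set: CT] (idfun : CT -> T).
by move=> _ B mB; rewrite setTI preimage_id; exact: meas_completion.
Qed.

Lemma ge0_integral_completion (D : set T) (f : T -> \bar R) : measurable D ->
 measurable_fun D f -> {in D, forall x, 0 <= f x} -> \int[cm]_(x in (D : set CT)) f x = \int[mu]_(x in D) f x.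
move=> mD mf f0.
rewrite -(ge0_integral_pushforward meas_id_completion cm mD mf f0).
apply: eq_measure_integral; first exact: meas_id_completion.
by move=> mid A mA _; exact: (completionE mA).
Qed.

Lemma integral_completion (D : set T) (f : T -> \bar R) : measurable D ->
 measurable_fun D f -> \int[cm]_(x in (D : set CT)) f x = \int[mu]_(x in D) f x.
move=> mD mf; rewrite [LHS]integralE [RHS]integralE; congr (_ - _).
 by apply: ge0_integral_completion => //; exact: measurable_funepos.
by apply: ge0_integral_completion => //; exact: measurable_funeneg.
Qed.

Lemma integrable_completion (D : set T) (f : T -> \bar R) : measurable D ->
 measurable_fun D f -> (cm.-integrable (D : set CT) f <-> mu.-integrable D f).
move=> mD mf; have E : \int[cm]_(x in (D : set CT)) `|f x| = \int[mu]_(x in D) `|f x|.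
 by apply: ge0_integral_completion => //; exact: mcomp.
split=> /integrableP[_ h]; apply/integrableP; split=> //.
- by rewrite -E.
- exact: meas_fun_completion.
- by rewrite E.
Qed.

Lemma completion_cover (A : set T) (e : R) : (0 < e)%R -> cm A \is a fin_num ->
 exists B : set T, [/\ measurable B, A `<=` B & mu B <= cm A + e%:E].
move=> e0 Afin; have [x [F [mF AF] <-] /ltW h] := lb_ereal_inf_adherent e0 Afin.
exists (\bigcup_k F k); split => //; first exact: bigcup_measurable.
apply: le_trans h; apply: measure_sigma_subadditive => //.
exact: bigcup_measurable.
Qed.

(** Measurable covers within [1 / (k + 1)] of the outer measure, intersected over [k]. *)
Lemma completion_hull (A : set T) : cm A \is a fin_num ->
 exists B : set T, [/\ measurable B, A `<=` B & mu B = cm A].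
move=> Afin.
have /choice[F FP] : forall k : nat, exists B : set T, [/\ measurable B, A `<=` B &
  mu B <= cm A + (k.+1%:R^-1)%:E]. by move=> k; apply: completion_cover.
exists (\bigcap_k F k); split.
- by apply: bigcapT_measurable => k; have [] := FP k.
- by move=> x Ax k _; have [_ h _] := FP k; exact: h.
have mI : measurable (\bigcap_k F k) by apply: bigcapT_measurable => k; have [] := FP k.
apply/eqP; rewrite eq_le; apply/andP; split.
 apply/lee_addgt0Pr => e e0. have [k ke] : exists k : nat, (k.+1%:R^-1 < e)%R.
  by have [k _ /(_ k (leqnn k))] := near_infty_natSinv_lt (PosNum e0); exists k.
 have [mF _ h] := FP k; apply: (@le_trans _ _ (mu (F k))).
  by apply: le_measure; rewrite ?inE//; exact: bigcap_inf.
 by apply: (le_trans h); rewrite leeD2l// lee_fin ltW.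
rewrite -(completionE mI); apply: le_outer_measure.
by move=> x Ax k _; have [_ h _] := FP k; exact: h.
Qed.

Lemma completion_borel_finite (A : set CT) : measurable A -> cm A \is a fin_num ->
 exists B : set T, measurable B /\ cm.-negligible ((B `\` A) `|` (A `\` B)).
move=> mA Afin; have [B [mB AB BE]] := completion_hull Afin.
exists B; split => //; exists (B `\` A); split.
- by apply: measurableD => //; exact: meas_completion.
- have BA : cm B = cm A by rewrite completionE.
 have cB : cm B < +oo by rewrite BA ltey_eq Afin. have -> : cm (B `\` A) = cm B - cm (B `&` A).
  exact: (@measureD _ _ _ cm B A (meas_completion mB) mA cB). rewrite BA (_ : _ `&` _ = A) ?subee//.
 by apply/seteqP; split => [x []|x Ax]//; split => //; exact: AB.
- by move=> x [//|[Ax nBx]]; have := AB _ Ax.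
Qed.

Lemma completion_borel (A : set CT) : measurable A ->
 exists B : set T, measurable B /\ cm.-negligible ((B `\` A) `|` (A `\` B)).
move=> mA; have [F UF Ffin] := sigma_finiteT mu.
have /choice[G GP] : forall k, exists B : set T, measurable B /\
  cm.-negligible ((B `\` (A `&` F k)) `|` ((A `&` F k) `\` B)).
 move=> k; have [mF Fk] := Ffin k; apply: completion_borel_finite.
  by apply: measurableI => //; exact: meas_completion. rewrite ge0_fin_numE; last exact: mu_ext_ge0.
 apply: le_lt_trans Fk; apply: (@le_trans _ _ (cm (F k))); last by rewrite completionE.
 by apply: le_outer_measure; exact: subIsetr.
exists (\bigcup_k G k); split; first by apply: bigcup_measurable => k _; have [] := GP k.
apply: (@negligibleS _ _ _ cm (\bigcup_k ((G k `\` (A `&` F k)) `|` ((A `&` F k) `\` G k)))).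
 move=> x [[[k _ Gkx] nA]|[Ax nG]]; first by exists k => //; left; split => // -[].
 have : (\bigcup_k F k) x by rewrite -UF.
 move=> [k _ Fkx]; exists k => //; right; split => // Gk; apply: nG; by exists k.
by apply: negligible_bigcup => k; have [] := GP k.
Qed.

(** Each set where [f] exceeds a rational [q k] is replaced by a Borel set [G k], and [g x] is the
    supremum of the rationals whose set contains [x]. The countably many exceptional sets have a
    negligible union. *)
Lemma completion_borel_fun (D : set T) (f : T -> R) : measurable D ->
 measurable_fun (D : set CT) f -> exists2 g : T -> R, mfun g & {ae cm, forall x, D x -> f x = g x}.
move=> mD mf; have mDC := meas_completion mD.
pose q (k : nat) : R := ratr (odflt 0%R (unpickle k : option rat)).
pose E k : set CT := D `&` f @^-1` `]q k, +oo[%classic.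
have mE k : measurable (E k) by exact: mf.
have /choice[G GP] : forall k, exists B : set T, measurable B /\
  cm.-negligible ((B `\` E k) `|` (E k `\` B)) by move=> k; exact: completion_borel.
(* The value [-oo] lets a rational whose set misses [x] drop out of the supremum; off [D] and on the
   null set [fine] makes [g] real whatever the supremum is. *)
pose h k x : \bar R := if x \in G k then (q k)%:E else -oo.
pose g x := fine (esups (h^~ x) 0%N).
exists g.
 apply: mcomp; first exact: fine_measurable.
 apply: measurable_fun_esups => k; apply: measurable_fun_ifT => //.
 by apply: measurable_fun_bool; rewrite setTI; have [mG _] := GP k;
  rewrite (_ : _ @^-1` _ = G k)//; apply/seteqP; split => x /=; [move/set_mem|move/mem_set].
have [N [mN N0 NP]] : cm.-negligible (\bigcup_k ((G k `\` E k) `|` (E k `\` G k))).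
 by apply: negligible_bigcup => k; have [] := GP k.
exists N; split => // x /= nx; apply: NP; apply: contrapT => nN; apply: nx => Dx.
have EG k : G k x <-> (q k < f x)%R.
 split=> [Gx|qf]. apply: contrapT => nf; apply: nN; exists k => //; left; split => // -[_ /=].
  by rewrite in_itv/= andbT.
 apply: contrapT => nG; apply: nN; exists k => //; right; split => //; split => //=.
 by rewrite in_itv/= andbT.
rewrite /g /esups/= (_ : ereal_sup _ = (f x)%:E)//.
apply/eqP; rewrite eq_le; apply/andP; split.
 apply: ge_ereal_sup => _ [k _ <-]; rewrite /h; case: ifPn => [|_]; last by rewrite leNye.
 by rewrite inE => /EG/ltW; rewrite lee_fin.
apply/lee_subgt0Pr => e e0; rewrite -EFinB.
have fe : (f x - e < f x)%R by rewrite ltrBlDr ltrDl.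
have [r] := rat_in_itvoo fe.
rewrite in_itv/= => /andP[r1 r2].
apply: (@le_trans _ _ (ratr r)%:E); first by rewrite lee_fin ltW.
apply: ereal_sup_ubound; exists (pickle r) => //; rewrite /h /q pickleK/= ifT//.
by rewrite inE; apply/EG; rewrite /q pickleK.
Qed.

End Completion.

Notation pfm m mf :=
 (measure_function_pushforward__canonical__measure_function_Measure m mf).

Lemma meas_indic_comp {R : realType} d d' (T : measurableType d) (T' : measurableType d')
  (A : set T') (f : T -> T') : measurable A -> mfun f -> mfun (fun t => (\1_A (f t))%:E : \bar R).
move=> mA mf; apply/mEFinP.
rewrite (_ : (fun t => _) = \1_(f @^-1` A)); last by apply/funext => t; rewrite !indicE.
by apply: measurable_indic; rewrite -[X in measurable X]setTI; exact: mf.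
Qed.

(** * Invariance of the volume under translations, rotations and isometries; Gaussian integrals *)

Section LebesgueInvariance.
Context {R : realType}.
Local Open Scope ereal_scope.
Notation RR := (RxR R).
Notation leb := (@lebesgue_measure R).

Definition mpres d (T : measurableType d) (m : {measure set T -> \bar R}) (f : T -> T) :=
 mfun f /\ forall A, measurable A -> m (f @^-1` A) = m A.

Lemma mpres_preimage d (T : measurableType d) (m : {measure set T -> \bar R}) f A :
 mpres m f -> measurable A -> measurable (f @^-1` A).
by move=> [mf _] mA; rewrite -[X in measurable X]setTI; exact: mf. Qed.

Lemma ge0_integral_mpres d (T : measurableType d) (m : {measure set T -> \bar R}) f
  (h : T -> \bar R) : mpres m f -> mfun h -> (forall x, 0 <= h x) -> \int[m]_x h (f x) = \int[m]_x h x.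
move=> [mf mfE] mh h0.
have E : \int[pushforward m f]_x h x = \int[m]_x (h \o f) x.
 by rewrite ge0_integral_pushforward// preimage_setT.
rewrite -[LHS]E; apply: eq_measure_integral => A mA _; exact: mfE.
Qed.

Lemma integral_mpres d (T : measurableType d) (m : {measure set T -> \bar R}) f
  (h : T -> \bar R) : mpres m f -> mfun h -> \int[m]_x h (f x) = \int[m]_x h x.
move=> mf mh; rewrite [LHS]integralE [RHS]integralE; congr (_ - _).
 rewrite -(ge0_integral_mpres mf (measurable_funepos mh)). by apply: eq_integral => x _; rewrite !funeposE.
 by move=> x; exact: funepos_ge0.
rewrite -(ge0_integral_mpres mf (measurable_funeneg mh)).
 by apply: eq_integral => x _; rewrite !funenegE.
by move=> x; exact: funeneg_ge0.
Qed.

Lemma integrable_mpres d (T : measurableType d) (m : {measure set T -> \bar R}) f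
  (h : T -> \bar R) : mpres m f -> mfun h -> m.-integrable setT h -> m.-integrable setT (h \o f).
move=> mf mh /integrableP[_ hi]; apply/integrableP; split.
 by apply: mcomp => //; case: mf.
rewrite (_ : \int[m]_x _ = \int[m]_x `|h x|)//.
by apply: (ge0_integral_mpres (h := fun x => `|h x|)) => //; exact: mcomp.
Qed.

Lemma mpres_prod d1 d2 (T1 : measurableType d1) (T2 : measurableType d2)
  (m1 : {sigma_finite_measure set T1 -> \bar R}) (m2 : {sigma_finite_measure set T2 -> \bar R}) f g :
 mpres m1 f -> mpres m2 g -> mpres (m1 \x m2) (fun p => (f p.1, g p.2)).
move=> mf mg; have mfg : mfun (fun p : T1 * T2 => (f p.1, g p.2)).
 apply/measurable_fun_pairP; split. by apply: (mcomp mf.1); exact: measurable_fst.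
 by apply: (mcomp mg.1); exact: measurable_snd.
split => // A mA.
rewrite [RHS](@product_measure_unique _ _ _ _ R m1 m2 (pfm (m1 \x m2) mfg))//.
move=> B C mB mC; rewrite /= /pushforward.
rewrite (_ : _ @^-1` _ = (f @^-1` B) `*` (g @^-1` C)); last first.
 by apply/seteqP; split => -[x y].
rewrite product_measure1E; [|exact: mpres_preimage mf mB|exact: mpres_preimage mg mC].
by rewrite mf.2// mg.2.
Qed.

Lemma meas_shift (a : R) : mfun (fun x : mR R => x + a : mR R)%R.
by apply: measurable_funD => //; exact: mcst. Qed.

Lemma mpres_shift (a : R) : mpres leb (fun x : mR R => x + a : mR R)%R.
split=> [|A mA]; first exact: meas_shift.
rewrite [RHS](@lebesgue_measure_unique _ (pfm leb (meas_shift a)))// => _ [[x y] xy <-].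
transitivity (leb (`](x - a)%R, (y - a)%R]%classic : set R)); last first.
 by congr (leb _); apply/seteqP; split => z /=; rewrite !in_itv/= ltrBlDr lerBrDr.
rewrite !lebesgue_measure_itv/= !lte_fin ltrD2r; case: ifPn => // _.
by rewrite -!EFinD; congr EFin; ring.
Qed.

Lemma mpres_opp : mpres leb (fun x : mR R => - x : mR R)%R.
have mo : mfun (fun x : mR R => - x : mR R)%R.
 exact: oppr_measurable.
split=> // A mA.
rewrite [RHS](@lebesgue_measure_unique _ (pfm leb mo))// => _ [[x y] xy <-].
transitivity (leb (`[(- y)%R, (- x)%R[%classic : set R)); last first.
 by congr (leb _); apply/seteqP; split => z /=; rewrite !in_itv/= ltrNr lerNl andbC.
rewrite !lebesgue_measure_itv/= !lte_fin ltrN2; case: ifPn => // _.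
by rewrite -!EFinD; congr EFin; ring.
Qed.

Lemma mpres_lebesgue2 f g : mpres leb f -> mpres leb g ->
 mpres (@lebesgue2 R) (fun p => (f p.1, g p.2)).
exact: mpres_prod. Qed.

Definition tmap n (phi : nat -> RR -> RR) (x : n.-tuple RR) : n.-tuple RR :=
 [tuple phi i (tnth x i) | i < n].

Lemma meas_tmap n phi : (forall i, mfun (phi i)) ->
 mfun (@tmap n phi).
move=> mphi; apply/measurable_fun_tnthP => i.
rewrite (_ : _ \o _ = (phi i) \o (fun x => tnth x i)).
 by apply: mcomp; [exact: mphi|exact: measurable_tnth].
by apply/funext => x /=; rewrite tnth_mktuple.
Qed.

Lemma tmap_cons n phi p : @tmap n.+1 phi (consT p) =
 consT (phi 0%N p.1, tmap (fun i => phi i.+1) p.2).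
apply: eq_from_tnth => i; rewrite tnth_mktuple; case: (unliftP ord0 i) => [j|] ->.
 by rewrite !tnthS tnth_mktuple.
by rewrite !tnth0.
Qed.

Lemma mpres_tmap n phi : (forall i, mpres (@lebesgue2 R) (phi i)) -> mpres (vol R n) (tmap phi).
elim: n phi => [|n IH] phi hphi; split=> [|A mA]; try by apply: meas_tmap => i; case: (hphi i).
 by congr (_ _ _); apply/seteqP; split => x /=; rewrite (tuple0 x) (tuple0 (tmap _ _)).
have mc (B : set (n.+1.-tuple RR)) : measurable B -> measurable (@consT R n @^-1` B).
 by move=> mB; rewrite -[X in measurable X]setTI; exact: measurable_consT.
rewrite /= /vol_step /pushforward -[RHS](mpres_prod (hphi 0%N) (IH _ (fun i => hphi i.+1))).2.
 by congr (_ _ _); apply/seteqP; split => p /=; rewrite tmap_cons.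
exact: mc.
Qed.

Definition tadd n (x y : n.-tuple RR) : n.-tuple RR :=
 [tuple ((tnth x i).1 + (tnth y i).1, (tnth x i).2 + (tnth y i).2)%R | i < n].

Definition topp n (x : n.-tuple RR) : n.-tuple RR :=
 [tuple (- (tnth x i).1, - (tnth x i).2)%R | i < n].

Lemma mpres_taddr n (y : n.-tuple RR) : mpres (vol R n) (fun x => tadd x y).
pose phi i (p : RR) : RR := (p.1 + (nth (0, 0) y i).1, p.2 + (nth (0, 0) y i).2)%R.
have -> : (fun x => tadd x y) = tmap phi.
 apply/funext => x; apply: eq_from_tnth => i; rewrite !tnth_mktuple /phi. by rewrite -!(tnth_nth (0, 0)%R).
apply: mpres_tmap => i; exact: mpres_lebesgue2 (mpres_shift _) (mpres_shift _).
Qed.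

Lemma mpres_topp n : mpres (vol R n) (@topp n).
have -> : @topp n = tmap (fun _ p => (- p.1, - p.2)%R).
 by apply/funext => x; apply: eq_from_tnth => i; rewrite !tnth_mktuple.
apply: mpres_tmap => i; exact: mpres_lebesgue2 mpres_opp mpres_opp.
Qed.

Lemma meas_tadd n d (T : measurableType d) (f g : T -> n.-tuple RR) :
 mfun f -> mfun g -> mfun (fun t => tadd (f t) (g t)).
move=> mf mg; apply/measurable_fun_tnthP => i.
rewrite (_ : _ \o _ = fun t => ((tnth (f t) i).1 + (tnth (g t) i).1,
 (tnth (f t) i).2 + (tnth (g t) i).2)%R); last first. by apply/funext => x /=; rewrite tnth_mktuple.
have mfi : mfun (fun t => tnth (f t) i) by exact: (mcomp (measurable_tnth i)).
have mgi : mfun (fun t => tnth (g t) i) by exact: (mcomp (measurable_tnth i)).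
by apply/measurable_fun_pairP; split; rewrite /comp/=; apply: measurable_funD;
 do ?[exact: (mcomp measurable_fst)|exact: (mcomp measurable_snd)].
Qed.

Definition tsq n (x : n.-tuple RR) : R :=
 \sum_(i < n) ((tnth x i).1 ^+ 2 + (tnth x i).2 ^+ 2)%R.

Lemma meas_tsq n : mfun (@tsq n).
apply: measurable_sum => i; apply: measurable_funD; apply: mfunX.
- by apply: (mcomp measurable_fst); exact: measurable_tnth.
- by apply: (mcomp measurable_snd); exact: measurable_tnth.
Qed.

Lemma tsq_cons n p : tsq (@consT R n p) = ((p.1.1 ^+ 2 + p.1.2 ^+ 2) + tsq p.2)%R.
by rewrite /tsq big_ord_recl; congr (_ + _)%R; apply: eq_bigr => i _; rewrite tnthS.
Qed.

Lemma ge0_integral_vol_cons n (h : n.+1.-tuple RR -> \bar R) :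
 mfun h -> (forall x, 0 <= h x) ->
 \int[vol R n.+1]_x h x = \int[@lebesgue2 R]_p \int[vol R n]_y h (consT (p, y)).
move=> mh h0; rewrite /= ge0_integral_pushforward//.
 rewrite preimage_setT fubini_tonelli1//; last by move=> p; exact: h0.
 by apply: mcomp => //; exact: measurable_consT.
exact: measurable_consT.
Qed.

Lemma ge0_integral_lebesgue2 (h : RR -> \bar R) :
 mfun h -> (forall x, 0 <= h x) -> \int[@lebesgue2 R]_p h p = \int[leb]_x \int[leb]_y h (x, y).
by move=> mh h0; rewrite /= fubini_tonelli1. Qed.

Lemma meas_gauss2 : mfun
 (fun p : RR => (expR (- (p.1 ^+ 2 + p.2 ^+ 2)))%:E : \bar R).
apply/mEFinP; apply: (mcomp (@measurable_expR R)).
apply: measurable_funN; apply: measurable_funD; apply: mfunX.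
 exact: measurable_fst.
exact: measurable_snd.
Qed.

Lemma meas_gauss_vol n : mfun
 (fun x : n.-tuple RR => (expR (- tsq x))%:E : \bar R).
apply/mEFinP; apply: (mcomp (@measurable_expR R)).
by apply: measurable_funN; exact: meas_tsq.
Qed.

Lemma integral_gauss2 :
 \int[@lebesgue2 R]_p (expR (- (p.1 ^+ 2 + p.2 ^+ 2)))%:E = pi%:E.
have mg : mfun (fun x : R => (gauss_fun x)%:E).
 by apply/mEFinP; exact: measurable_gauss_fun.
rewrite ge0_integral_lebesgue2; last 2 first.
- exact: meas_gauss2.
- by move=> p; rewrite lee_fin expR_ge0.
under eq_integral => x _.
 under eq_integral => y _ do rewrite /= opprD expRD EFinM -/(gauss_fun x) -/(gauss_fun y).
 rewrite ge0_integralZl//; last 2 first.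
 - by move=> y _; rewrite lee_fin gauss_fun_ge0.
 - by rewrite lee_fin gauss_fun_ge0. rewrite integralT_gauss muleC; over.
rewrite ge0_integralZl//; last by move=> y _; rewrite lee_fin gauss_fun_ge0.
by rewrite integralT_gauss -EFinM -expr2 sqr_sqrtr// pi_ge0.
Qed.

Lemma integral_gauss_vol n : \int[vol R n]_x (expR (- tsq x))%:E = (pi ^+ n)%:E.
elim: n => [|n IH].
 rewrite /= integral_dirac//; last exact: meas_gauss_vol.
 by rewrite diracT mul1e /tsq big_ord0 oppr0 expR0 expr0.
rewrite ge0_integral_vol_cons; last 2 first.
- exact: meas_gauss_vol.
- by move=> p; rewrite lee_fin expR_ge0.
under eq_integral => p _.
 under eq_integral => y _ do rewrite tsq_cons/= opprD expRD EFinM.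
 rewrite ge0_integralZl//; do ?[exact: meas_gauss_vol|
  by move=> y _; rewrite lee_fin expR_ge0|by rewrite lee_fin expR_ge0]. rewrite IH muleC; over.
rewrite ge0_integralZl//; do ?[exact: meas_gauss2|
 by move=> y _; rewrite lee_fin expR_ge0|by rewrite lee_fin exprn_ge0// pi_ge0].
by rewrite integral_gauss2 -EFinM exprSr.
Qed.

(* Both orders of integration of 1_A(x) exp(-|x + U y|^2) over the product,
  as in the proof of uniqueness of Haar measure. *)
Lemma mpres_isometry n (U : n.-tuple RR -> n.-tuple RR) : mfun U ->
 (forall x y, U (tadd x y) = tadd (U x) (U y)) -> (forall y, exists x, U x = y) ->
 (forall x, tsq (U x) = tsq x) -> mpres (vol R n) U.
move=> mU Uadd Usurj Uiso; split => // A mA.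
have mUA : measurable (U @^-1` A) by rewrite -[X in measurable X]setTI; exact: mU.
pose g (x : n.-tuple RR) := (expR (- tsq x))%:E.
have mg : mfun g.
 exact: meas_gauss_vol.
have g0 x : 0 <= g x by rewrite lee_fin expR_ge0.
have gI : \int[vol R n]_x g x = (pi ^+ n)%:E by exact: integral_gauss_vol.
have taddC (x y : n.-tuple RR) : tadd x y = tadd y x.
 by apply: eq_from_tnth => i; rewrite !tnth_mktuple !(addrC (tnth x i).1) !(addrC (tnth x i).2).
have taddKN (x y : n.-tuple RR) : tadd (tadd x y) (topp y) = x.
 by apply: eq_from_tnth => i; rewrite !tnth_mktuple/= !addrK; case: (tnth x i).
have tN (y : n.-tuple RR) : tadd y (topp y) = [tuple (0, 0)%R | i < n].
 by apply: eq_from_tnth => i; rewrite !tnth_mktuple/= !subrr.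
have t0 (y : n.-tuple RR) : tadd [tuple (0, 0)%R | i < n] y = y.
 by apply: eq_from_tnth => i; rewrite !tnth_mktuple/= !add0r; case: (tnth y i).
have U0 : U [tuple (0, 0)%R | i < n] = [tuple (0, 0)%R | i < n].
 move: tN t0; set z := [tuple _ | _ < _] => tN t0.
 by have E := Uadd z z; rewrite t0 in E; rewrite -[LHS](taddKN _ (U z)) -E tN.
have Uopp x : U (topp x) = topp (U x).
 by rewrite -[LHS](taddKN _ (U x)) -Uadd taddC [tadd (topp x) x]taddC tN U0 taddC t0.
pose F (p : n.-tuple RR * n.-tuple RR) := (\1_A p.1)%:E * g (tadd p.1 (U p.2)).
have mF : mfun F.
 apply: emeasurable_funM. by apply: meas_indic_comp => //; exact: measurable_fst.
 apply: (mcomp mg); apply: meas_tadd; first exact: measurable_fst.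
 by apply: (mcomp mU); exact: measurable_snd.
have F0 p : 0 <= F p by rewrite mule_ge0// lee_fin.
(* Every [x] is some [U x'], so the inner integral is that of the Gaussian at [U (x' + y)], which
   does not depend on [x]. *)
have I1 : \int[vol R n]_x \int[vol R n]_y ((\1_A x)%:E * g (tadd x (U y))) = vol R n A * (pi ^+ n)%:E.
 under eq_integral => x _. have [x' Ux'] := Usurj x. have mgx : mfun (fun y => g (tadd x (U y))).
   by apply: (mcomp mg); apply: meas_tadd; [exact: mcst|exact: mU]. rewrite ge0_integralZl//.
  have E : \int[vol R n]_y g (tadd x (U y)) = (pi ^+ n)%:E.
   rewrite -gI -(ge0_integral_mpres (mpres_taddr x') mg g0).
   by apply: eq_integral => y _; rewrite -Ux' -Uadd /g Uiso taddC. rewrite E muleC; over.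
 have mi : mfun (fun y => (\1_A y)%:E : \bar R). by apply/mEFinP; exact: measurable_indic.
 rewrite ge0_integralZl//; last by rewrite lee_fin exprn_ge0// pi_ge0.
 by rewrite integral_indic// setIT muleC.
(* Translating [x] by [U y] moves [U y] from the Gaussian into the indicator. *)
have I2 : \int[vol R n]_y \int[vol R n]_x ((\1_A x)%:E * g (tadd x (U y))) =
  \int[vol R n]_y \int[vol R n]_x ((\1_A (tadd x (topp (U y))))%:E * g x). clear I1.
 apply: eq_integral => y _. rewrite -[RHS](ge0_integral_mpres (mpres_taddr (U y))).
 - by apply: eq_integral => x _; rewrite taddKN.
 - apply: emeasurable_funM => //; apply: meas_indic_comp => //. by have [] := mpres_taddr (topp (U y)).
 - by move=> x; rewrite mule_ge0// lee_fin.
(* With [x = U x'] the indicator is taken at [U (x' - y)]; translation and reflection in [y] turn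
   the inner integral into the volume of the preimage. *)
have I3 : \int[vol R n]_x \int[vol R n]_y ((\1_A (tadd x (topp (U y))))%:E * g x) =
  vol R n (U @^-1` A) * (pi ^+ n)%:E. clear I1 I2. under eq_integral => x _. have [x' Ux'] := Usurj x.
  under eq_integral => y _ do rewrite muleC. have mAU : mfun (fun y => (\1_A (U y))%:E : \bar R).
   exact: meas_indic_comp. have mix : mfun (fun y => (\1_A (tadd x (topp (U y))))%:E : \bar R).
   apply: meas_indic_comp => //; apply: meas_tadd; first exact: mcst. exact: (mcomp (mpres_topp n).1).
  rewrite ge0_integralZl//. have E : \int[vol R n]_y (\1_A (tadd x (topp (U y))))%:E = vol R n (U @^-1` A).
   transitivity (\int[vol R n]_y (\1_A (U y))%:E); last first. by rewrite [LHS]integral_indic ?setIT.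
   rewrite -(ge0_integral_mpres (mpres_taddr x') mAU)//. rewrite -(ge0_integral_mpres (mpres_topp n)).
   - by apply: eq_integral => y _; rewrite Uadd Uopp Ux' taddC.
   - apply: meas_indic_comp => //; by apply: (mcomp mU); have [] := mpres_taddr x'.
   - by move=> y; rewrite lee_fin. rewrite E muleC; over. rewrite ge0_integralZl//. by rewrite gI.
have fub : \int[vol R n]_x \int[vol R n]_y ((\1_A x)%:E * g (tadd x (U y))) =
  \int[vol R n]_y \int[vol R n]_x ((\1_A x)%:E * g (tadd x (U y))). clear I1 I2 I3.
 exact: (@fubini_tonelli _ _ _ _ R (vol R n) (vol R n) F mF F0).
have fub2 : \int[vol R n]_y \int[vol R n]_x ((\1_A (tadd x (topp (U y))))%:E * g x) =
  \int[vol R n]_x \int[vol R n]_y ((\1_A (tadd x (topp (U y))))%:E * g x). clear I1 I2 I3 fub.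
 apply: (@fubini_tonelli _ _ _ _ R (vol R n) (vol R n) (fun p => (\1_A (tadd p.2 (topp (U p.1))))%:E * g p.2)); last first.
  by move=> p; rewrite mule_ge0// lee_fin.
 apply: emeasurable_funM; last by apply: (mcomp mg); exact: measurable_snd.
 apply: meas_indic_comp => //; apply: meas_tadd; first exact: measurable_snd.
 apply: (mcomp (mpres_topp n).1); apply: (mcomp mU). exact: measurable_fst.
have E : vol R n (U @^-1` A) * (pi ^+ n)%:E = vol R n A * (pi ^+ n)%:E.
 exact: (etrans (esym I3) (etrans (esym fub2) (etrans (esym I2) (etrans (esym fub) I1)))).
clear -E.
have pn0 : (0 < pi ^+ n :> R)%R by rewrite exprn_gt0// pi_gt0.
have := congr1 (fun x => x * ((pi ^+ n)^-1)%:E) E.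
by rewrite -!muleA -EFinM divff ?gt_eqF// !mule1.
Qed.

End LebesgueInvariance.

(** * One-variable integrals of powers and of the sliced kernel *)

Section RealIntegrals.
Variable R : realType.
Notation leb := (@lebesgue_measure R).
Notation C := R[i].

Lemma ftc (F f : R -> R) (a b : R) : a < b ->
 (forall x, a <= x <= b -> is_derive x 1 F (f x)) -> (forall x, a <= x <= b -> {for x, continuous f}) ->
 (\int[leb]_(x in `[a, b]) (f x)%:E = (F b - F a)%:E)%E.
move=> ab dF cf.
have cF x : a <= x <= b -> {for x, continuous F}.
 move=> /dF[Fx _]; apply: differentiable_continuous; exact/derivable1_diffP.
rewrite (continuous_FTC2 (F := F) ab)//.
- apply: continuous_in_subspaceT => x; rewrite inE/= in_itv/=; exact: cf.
- split.
 + by move=> x; rewrite in_itv/= => /andP[ax xb]; have [] := dF x (introT andP (conj (ltW ax) (ltW xb))).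
 + by apply: cvg_at_right_filter; apply: cF; rewrite lexx ltW.
 + by apply: cvg_at_left_filter; apply: cF; rewrite lexx ltW.
- move=> x; rewrite in_itv/= => /andP[ax xb].
 have [? <-] := dF x (introT andP (conj (ltW ax) (ltW xb))). by rewrite derive1E.
Qed.

Lemma is_derive_powRB (u g x : R) : x < u ->
 is_derive x 1 (fun t => (u - t) `^ g) (- (g * (u - x) `^ (g - 1))).
move=> xu; have H : is_derive (u - x) 1 (@powR R ^~ g) (g * (u - x) `^ (g - 1)).
 by apply: is_derive1_powR; rewrite subr_gt0.
have K : is_derive x 1 (fun t : R => u - t) (-1).
 by have := is_deriveB (is_derive_cst u x 1) (is_derive_id x (1 : R)); rewrite sub0r.
by have := @is_derive1_comp _ _ (fun t => u - t) _ _ _ H K; rewrite mulrN1.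
Qed.

Lemma continuous_powRB (u g x : R) : x < u -> {for x, continuous (fun t => (u - t) `^ g)}.
move=> /(is_derive_powRB g)[h _]; apply: differentiable_continuous.
exact/derivable1_diffP.
Qed.

Lemma powRB_bound (u g y : R) : -1 < g -> 0 < u -> 0 <= y < u ->
 (\int[leb]_(t in `[0%R, y]) ((u - t) `^ g)%:E = ((u `^ (g + 1) - (u - y) `^ (g + 1)) / (g + 1))%:E)%E.
move=> g1 u0 /andP[]; rewrite le_eqVlt => /predU1P[<- _|y0 yu].
 by rewrite set_itv1 integral_set1 subr0 subrr mul0r.
have g10 : 0 < g + 1 by rewrite -ltrBlDr add0r.
have dF x : 0 <= x <= y -> is_derive x 1 (fun t => (- (g + 1)^-1) * (u - t) `^ (g + 1)) ((u - x) `^ g).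
 move=> /andP[x0 xy]; have xu : x < u by exact: le_lt_trans yu.
 have := is_derive_powRB (g + 1) xu => H; apply: is_derive_eq.
 by rewrite /GRing.scale/= addrK mulrNN mulrA mulVf ?mul1r// gt_eqF.
rewrite (ftc y0 dF).
 by congr EFin; rewrite subr0 !mulNr opprK addrC -mulrBr mulrC.
by move=> x /andP[x0 xy]; apply: continuous_powRB; exact: le_lt_trans yu.
Qed.

Lemma itv_co_exhaust (u : R) : 0 < u ->
 `[0, u[%classic = \bigcup_k `[0, u - u / k.+1%:R]%classic.
move=> u0; apply/seteqP; split => t /=; rewrite ?in_itv/=.
 move=> /andP[t0 tu]. have tu0 : 0 < u - t by rewrite subr_gt0.
 exists (Num.truncn (u / (u - t))) => //=; rewrite in_itv/= t0/= lerBrDr addrC -lerBrDr.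
 rewrite ler_pdivrMr ?ltr0n// mulrC -ler_pdivrMr//. by apply: ltW; apply: truncnS_gt.
move=> [k _ /=]; rewrite in_itv/= => /andP[-> /= h]; rewrite (le_lt_trans h)//.
by rewrite ltrBlDr ltrDl divr_gt0.
Qed.

Lemma meas_powRB (D : set R) (u g : R) : measurable_fun D (fun t => ((u - t) `^ g)%:E).
apply/mEFinP; apply: measurable_funTS.
apply: (mcomp (measurable_powR _)).
by apply: mfunB => //; exact: mcst.
Qed.

(** For [g < 0] the integrand is unbounded at [u], so the value is obtained as the limit over
    [[0, u - u / (k + 1)]]. *)
Lemma integral_powRB (u g : R) : -1 < g -> 0 < u ->
 (\int[leb]_(t in `[0%R, u[) ((u - t) `^ g)%:E = (u `^ (g + 1) / (g + 1))%:E)%E.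
move=> g1 u0; have g10 : 0 < g + 1 by rewrite -ltrBlDr add0r.
rewrite itv_co_exhaust//.
have mono : {homo (fun k => `[0, u - u / k.+1%:R]%classic) : n m / (n <= m)%N >-> (n <= m)%O}.
 move=> n m nm; apply/subsetPset => t /=; rewrite !in_itv/= => /andP[-> /= h].
 by rewrite (le_trans h)// lerD2l lerN2 ler_pM2l// lef_pV2 ?posrE ?ltr0n// ler_nat.
have := @ge0_nondecreasing_set_cvg_integral _ _ R _ (fun t : mR R => ((u - t) `^ g)%:E) leb mono.
move=> /(_ _ _ _)/cvg_lim <-//; last first.
- by move=> i t _; rewrite lee_fin powR_ge0.
- by move=> i; exact: meas_powRB.
apply/cvg_lim => //.
have E k : (\int[leb]_(t in `[0%R, (u - u / k.+1%:R)%R]) ((u - t) `^ g)%:E =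
  ((u `^ (g + 1) - (u / k.+1%:R) `^ (g + 1)) / (g + 1))%:E)%E. rewrite powRB_bound//; first by rewrite subKr.
 rewrite subr_ge0 ler_pdivrMr ?ltr0n// ler_peMr ?ler1n ?ltW//=. by rewrite ltrBlDr ltrDl divr_gt0.
under eq_fun do rewrite E; apply: cvg_EFin; first exact: nearW.
rewrite -[X in _ --> X]subr0 -[X in _ - X](mul0r (g + 1)^-1) -mulrBl.
apply: cvgMl; apply: cvgB; first exact: cvg_cst.
have -> : (fun k : nat => (u / k.+1%:R) `^ (g + 1)) = (fun k => u `^ (g + 1) * k.+1%:R^-1 `^ (g + 1)).
 by apply/funext => k; rewrite powRM ?invr_ge0 ?ltW.
rewrite -(mulr0 (u `^ (g + 1))); apply: cvgMr.
apply/cvgrPdist_lt => e e0; near=> k.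
rewrite sub0r normrN ger0_norm ?powR_ge0// [ltRHS](_ : e = (e `^ (g + 1)^-1) `^ (g + 1)); last first.
 by rewrite -powRrM mulVf ?powRr1 ?ltW// gt_eqF.
rewrite gt0_ltr_powR ?nnegrE ?invr_ge0 ?powR_ge0//.
near: k; have : (harmonic : R^nat) @ \oo --> (0 : R) by exact: cvg_harmonic.
move=> /cvgrPdist_lt/(_ (e `^ (g + 1)^-1)); rewrite powR_gt0// => /(_ isT); apply: filterS => k.
by rewrite sub0r normrN ger0_norm ?harmonic_ge0.
Unshelve. all: by end_near. Qed.

Lemma integrable_powRB (u g : R) : -1 < g -> 0 < u ->
 leb.-integrable `[0%R, u[ (fun t => ((u - t) `^ g)%:E).
move=> g1 u0; apply/integrableP; split; first exact: meas_powRB.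
under eq_integral do rewrite gee0_abs ?lee_fin ?powR_ge0//.
by rewrite integral_powRB// ltry.
Qed.

Lemma is_derive_Re (H : C -> C) l (x : R) : cdiff H l x%:C ->
 is_derive x 1 (fun t => cRe (H t%:C)) (cRe l) /\ is_derive x 1 (fun t => cIm (H t%:C)) (cIm l).
move=> Hl.
suff K (q : C -> R) : (forall z w, q (z - w) = q z - q w) -> (forall (a : R) z, q (a%:C * z) = a * q z) ->
  (forall z, `|q z| <= normc z) -> is_derive x 1 (fun t => q (H t%:C)) (q l). split; apply: K => //.
 - by move=> z w; rewrite ReD ReN.
 - by move=> a z; rewrite ReZ.
 - exact: normRe.
 - by move=> z w; rewrite ImD ImN.
 - by move=> a z; rewrite ImZ.
 - exact: normIm.
move=> qB qZ qn.
have h : (fun h : R => h^-1 *: (q (H (h *: (1 : R) + x)%:C) - q (H x%:C))) @ 0^' --> (q l : R).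
 apply/cvgrPdist_le => e e0; have [d d0 dP] := Hl e e0. exists d => //= t; rewrite /= sub0r normrN => td t0.
 rewrite /GRing.scale/= mulr1 distrC -(ler_pM2l (x := `|t|)) ?normr_gt0// -normrM mulrBr mulVKf//.
 rewrite -qB -qZ -qB (le_trans (qn _))//.
 have -> : t%:C * l = l * ((t + x)%:C - x%:C) by rewrite -RCB addrK mulrC.
 have -> : `|t| * e = e * normc ((t + x)%:C - x%:C) by rewrite -RCB addrK normcR mulrC.
 by apply: dP; rewrite -RCB addrK normcR.
split; first by apply/cvg_ex; exists (q l).
exact: cvg_lim h.
Qed.

Lemma cdiff_chain (f g : C -> C) a b z : cdiff g b z -> cdiff f a (g z) ->
 cdiff (fun w => f (g w)) (a * b) z.
move=> gb fa e e0.
have [e2 e20 e2P] : exists2 e2, 0 < e2 & normc a * e2 <= e / 2.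
 have a0 : 0 < normc a + 1 by rewrite ltr_wpDl// nc_ge0.
 exists (e / 2 / (normc a + 1)); first by rewrite !divr_gt0.
 by rewrite mulrA ler_pdivrMr// mulrC ler_pM2l ?divr_gt0// lerDl.
have b0 : 0 < normc b + e2 by rewrite ltr_wpDl// nc_ge0.
have e10 : 0 < e / 2 / (normc b + e2) by rewrite !divr_gt0.
have [d1 d10 d1P] := fa _ e10; have [d2 d20 d2P] := cdiff_cont gb d10.
have [d3 d30 d3P] := gb _ e20.
exists (Num.min d2 d3) => [|w]; first by rewrite lt_min d20.
rewrite lt_min => /andP[/d2P/d1P h1 /d3P h3].
have -> : f (g w) - f (g z) - a * b * (w - z) =
 (f (g w) - f (g z) - a * (g w - g z)) + a * (g w - g z - b * (w - z)) by ring.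
rewrite (le_trans (normcD _ _))// [leRHS](_ : _ = e / 2 * normc (w - z) + e / 2 * normc (w - z)); last by rewrite -mulrDl -splitr.
apply: lerD.
 rewrite (le_trans h1)// [X in _ <= X * _](_ : _ = e / 2 / (normc b + e2) * (normc b + e2)).
  rewrite -[leRHS]mulrA; apply: ler_wpM2l; first exact: ltW.
  have := normcD (g w - g z - b * (w - z)) (b * (w - z)); rewrite subrK => /le_trans; apply.
  by rewrite mulrDl addrC lerD// normcM. by rewrite divfK// gt_eqF.
by rewrite normcM (le_trans (ler_wpM2l (nc_ge0 _) h3))// mulrA ler_wpM2r ?nc_ge0.
Qed.

Lemma cdiff_moebius (x z : C) : 1 - z * x != 0 ->
 cdiff (fun w => (1 - w) / (1 - w * x)) (- (1 - x) / (1 - z * x) ^+ 2) z.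
move=> zx0; have hi : holo (fun w => (1 - w * x)^-1) z.
 apply: holoV => //; apply: holoB; first exact: holo_cst. by apply: holoM; [exact: holo_id|exact: holo_cst].
have hh : holo (fun w => 1 - w * x) z.
 apply: holoB; first exact: holo_cst. by apply: holoM; [exact: holo_id|exact: holo_cst].
pose k := normc (1 - x) / normc (1 - z * x) + 1.
have k0 : 0 < k by rewrite ltr_wpDl// divr_ge0// nc_ge0.
move=> e e0; have [d1 d10 d1P] := holo_ccont hi (divr_gt0 e0 k0).
have zx1 : 0 < normc (1 - z * x) by rewrite normc_gt0.
have [d2 d20 d2P] := holo_ccont hh zx1.
exists (Num.min d1 d2) => [|w]; first by rewrite lt_min d10.
rewrite lt_min => /andP[/d1P h1 /d2P h2].
have wx0 : 1 - w * x != 0.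
 by apply: contraTneq h2 => ->; rewrite sub0r normcN ltxx.
have -> : (1 - w) / (1 - w * x) - (1 - z) / (1 - z * x) - - (1 - x) / (1 - z * x) ^+ 2 * (w - z) =
  (- (1 - x) / (1 - z * x)) * ((1 - w * x)^-1 - (1 - z * x)^-1) * (w - z) by field; rewrite zx0.
rewrite normcM ler_wpM2r ?nc_ge0// normcM.
rewrite (le_trans (ler_wpM2l (nc_ge0 _) (ltW h1)))//.
rewrite normcM normcN normcV mulrCA -[leRHS]mulr1 ler_pM2l// ler_pdivrMr// mul1r /k lerDl//.
Qed.

Lemma Re_1BZ_gt0 (x : C) (t : R) : normc x < 1 -> 0 <= t <= 1 -> 0 < cRe (1 - t%:C * x).
move=> x1 /andP[t0 t1]; rewrite ReD ReN ReZ/= subr_gt0.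
rewrite (le_lt_trans (ler_norm _))// normrM ger0_norm//.
rewrite (le_lt_trans (ler_wpM2l t0 (normRe _)))// (le_lt_trans _ x1)//.
by rewrite ler_piMl ?nc_ge0.
Qed.

(** Up to the constant [- (b + 1) (1 - x)] this is the derivative of
    [((1 - t) / (1 - t x)) ^ (b + 1)], which explains the exponent [b + 2]. It arises when all
    coordinates but the first are integrated out, see [slice_ker1]. *)
Definition ker1 (b : R) (x : C) (t : R) : C := ((1 - t) `^ b)%:C * cpow (1 - t%:C * x) (- (b + 2)).

Lemma cdiff_ker1 (b : R) (x : C) (t : R) : normc x < 1 -> 0 <= t < 1 ->
 cdiff (fun w => cpow ((1 - w) / (1 - w * x)) (b + 1)) (- (b + 1)%:C * (1 - x) * ker1 b x t) t%:C.
move=> x1 /andP[t0 t1]; have re0 : 0 < cRe (1 - t%:C * x) by rewrite Re_1BZ_gt0// t0 ltW.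
have n0 := Re_gt0_neq0 re0.
have t10 : 0 < 1 - t by rewrite subr_gt0.
have reV : 0 < cRe (1 - t%:C * x)^-1.
 rewrite -(@pmulr_rgt0 _ (normc (1 - t%:C * x) ^+ 2)) ?exprn_gt0 ?normc_gt0//.
 by rewrite -ReZ -mulcJ mulrAC divff// mul1r ReJ.
have tE : (1 - t%:C : C) = (1 - t)%:C by rewrite RCB.
have re1 : 0 < cRe ((1 - t%:C) / (1 - t%:C * x)).
 by rewrite tE ReZ mulr_gt0.
have K := cdiff_chain (cdiff_moebius n0) (cdiff_cpowE (b + 1) re1).
suff -> : - (b + 1)%:C * (1 - x) * ker1 b x t = cpow ((1 - t%:C) / (1 - t%:C * x)) (b + 1) *
 ((b + 1)%:C / ((1 - t%:C) / (1 - t%:C * x))) * (- (1 - x) / (1 - t%:C * x) ^+ 2) by [].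
have cV : cpow (1 - t%:C * x)^-1 (b + 1) = cpow (1 - t%:C * x) (- (b + 2)) * (1 - t%:C * x).
 have -> : - (b + 2) = - (b + 1) - 1 by ring.
 rewrite (cpowD (- (b + 1)) (- 1) re0) (cpowN 1 re0) cpow_1r// divfK// (cpowN (b + 1) re0).
 apply: (mulfI (cpow_neq0 (b + 1) re0)); rewrite -cpowM ?divff ?cpow1 ?cpow_neq0//=.
rewrite tE cpowM//; last by rewrite -tE.
rewrite cpowR// cV /ker1 powRD; last by rewrite (gt_eqF t10) implybT.
rewrite powRr1 ?ltW// RCM.
have t1C : ((1 - t)%:C : C) != 0 by rewrite RC_eq0 gt_eqF.
by rewrite -tE in t1C *; field; rewrite ?t1C ?n0.
Qed.

Lemma ker1_bound (b : R) (x : C) (t : R) : -1 < b -> normc x < 1 -> 0 <= t <= 1 ->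
 normc (ker1 b x t) <= (1 - normc x) `^ (- (b + 2)) * (1 - t) `^ b.
move=> b1 x1 t01; have re0 := Re_1BZ_gt0 x1 t01; move/andP: t01 => [t0 t1].
rewrite /ker1 normcM normcR ger0_norm ?powR_ge0// mulrC ler_wpM2r ?powR_ge0//.
rewrite normc_cpow// !powRN lef_pV2 ?posrE ?powR_gt0 ?subr_gt0 ?normc_gt0 ?Re_gt0_neq0//.
apply: ge0_ler_powR; rewrite ?nnegrE ?subr_ge0 ?nc_ge0 ?(ltW x1)//.
 by clear -b1; lra.
rewrite (le_trans _ (Re_le_normc _))// ReD ReN ReZ/= lerD2l lerN2.
rewrite (le_trans (ler_norm _))// normrM ger0_norm//.
rewrite (le_trans (ler_wpM2l t0 (normRe _)))// ler_piMl ?nc_ge0//.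
Qed.

Lemma rccont_real (h : R -> R) (t : R) : {for t, continuous h} -> rccont (fun t => (h t)%:C) t.
move=> hc e e0; have /cvgrPdist_lt/(_ e e0)/nbhs_ballP[d d0 dP] := hc.
exists d; first by [].
move=> y yt; rewrite -RCB normcR distrC; apply: dP.
by rewrite /ball/= distrC.
Qed.

Lemma rccont_for (g : R -> C) (t : R) : rccont g t ->
 {for t, continuous (fun t => cRe (g t))} /\ {for t, continuous (fun t => cIm (g t))}.
move=> gc; split; apply/cvgrPdist_lt => e e0; have [d d0 dP] := gc e e0; apply/nbhs_ballP;
 exists d => //= y; rewrite /ball/= distrC => /dP h. by rewrite distrC -ReN -ReD (le_lt_trans (normRe _)).
by rewrite distrC -ImN -ImD (le_lt_trans (normIm _)).
Qed.

Lemma rccont_ker1 (b : R) (x : C) (t : R) : normc x < 1 -> 0 <= t < 1 -> rccont (ker1 b x) t.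
move=> x1 /andP[t0 t1]; apply: rccontM; first exact/rccont_real/continuous_powRB.
apply: (@rccont_comp _ (fun w => cpow w (- (b + 2))) (fun t => 1 - t%:C * x)).
 by apply: cdiff_ccont; apply: cdiff_cpowE; rewrite Re_1BZ_gt0// t0 ltW.
apply: rccontB; first exact: rccont_cst.
apply: rccontM; last exact: rccont_cst.
apply: (@rccont_real id); exact: cvg_id.
Qed.

Lemma meas_ker1 (b : R) (x : C) : normc x < 1 -> @cmeas _ (mR R) R `[0, 1[ (ker1 b x).
move=> x1.
by split; apply: subspace_continuous_measurable_fun => //; apply: continuous_in_subspaceT => t;
 rewrite inE/= in_itv/= => t01; have [] := rccont_for (rccont_ker1 b x1 t01).
Qed.

Lemma cintg_ker1 (b : R) (x : C) : -1 < b -> normc x < 1 ->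
 cintg leb `[0, 1[ (ker1 b x).
move=> b1 x1; pose h t : R := (1 - normc x) `^ (- (b + 2)) * (1 - t) `^ b.
have hi : leb.-integrable `[0%R, 1[ (EFin \o h) by exact: (integrableZl _ _ (integrable_powRB b1 (@ltr01 R))).
apply: (le_cintegrable _ (meas_ker1 b x1) hi) => //.
move=> t; rewrite inE/= in_itv/= => /andP[t0 t1].
 by apply: ker1_bound => //; rewrite t0 ltW.
Qed.

Lemma icint_ker1 (b : R) (x : C) (y : R) : -1 < b -> normc x < 1 -> 0 <= y < 1 ->
 icint (ker1 b x) 0 y = (1 - cpow ((1 - y%:C) / (1 - y%:C * x)) (b + 1)) / ((b + 1)%:C * (1 - x)).
move=> b1 x1 /andP[]; have b10 : b + 1 != 0 by rewrite gt_eqF//; clear -b1; lra.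
have x0 : 1 - x != 0.
 by apply: Re_gt0_neq0; have := @Re_1BZ_gt0 x 1 x1; rewrite mul1r; apply; rewrite ler01 lexx.
have c0 : (b + 1)%:C * (1 - x) != 0 by rewrite mulf_neq0// RC_eq0.
rewrite le_eqVlt => /predU1P[<- _|y0 y1].
 by rewrite /icint /cint set_itv1 !Rintegral_set1 mul0r !subr0 divr1 cpow1 subrr mul0r.
pose U (w : C) := cpow ((1 - w) / (1 - w * x)) (b + 1).
pose k := - ((b + 1)%:C * (1 - x)).
have d t : 0 <= t <= y -> cdiff (fun w => k^-1 * U w) (ker1 b x t) t%:C.
 move=> /andP[t0 ty]; have := cdiff_mul k^-1 (cdiff_ker1 b x1 (introT andP (conj t0 (le_lt_trans ty y1)))).
 by rewrite mulNr -/k mulKf// oppr_eq0.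
have c t : 0 <= t <= y -> rccont (ker1 b x) t.
 by move=> /andP[t0 ty]; apply: rccont_ker1 => //; rewrite t0 (le_lt_trans ty).
have -> : (1 - U y%:C) / ((b + 1)%:C * (1 - x)) = k^-1 * U y%:C - k^-1 * U 0.
 by rewrite /U mul0r !subr0 divr1 cpow1 mulr1 /k invrN !mulNr opprK mulrBl mul1r addrC [U _ * _]mulrC.
apply: eqc; rewrite /icint /cint /Rintegral/=.
 rewrite (ftc y0 (fun t h => (is_derive_Re (d t h)).1)) ?ReD ?ReN//.
 by move=> t h; have [] := rccont_for (c t h).
rewrite (ftc y0 (fun t h => (is_derive_Re (d t h)).2)) ?ImD ?ImN//.
by move=> t h; have [] := rccont_for (c t h).
Qed.

(** The primitive is available on [[0, y]] with [y < 1] only. Both the missing tail and the boundary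
    term at [y] are of order [(1 - y) ^ (b + 1)], which tends to 0 because [b + 1 > 0]. *)
Lemma cint_ker1 (b : R) (x : C) : -1 < b -> normc x < 1 ->
 cint leb `[0, 1[ (ker1 b x) = ((b + 1)%:C * (1 - x))^-1.
move=> b1 x1; set I := cint _ _ _; set L := _^-1.
have b10 : 0 < b + 1 by clear -b1; lra.
have nx : 0 < 1 - normc x by rewrite subr_gt0.
pose M := (1 - normc x) `^ (- (b + 2)).
(* The first summand bounds the tail, the second the boundary term, and 1 makes [K] positive. *)
pose K := M / (b + 1) + ((1 - normc x)^-1) `^ (b + 1) * normc L + 1.
have M0 : 0 <= M by exact: powR_ge0.
have K0 : 0 < K.
 by rewrite ltr_wpDl// addr_ge0// mulr_ge0 ?invr_ge0 ?powR_ge0 ?nc_ge0// ltW.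
have ki := cintg_ker1 b1 x1.
have bnd y : 0 <= y < 1 -> normc (I - L) <= K * (1 - y) `^ (b + 1).
 move=> /andP[y0 y1]; have y10 : 0 < 1 - y by rewrite subr_gt0.
 have re := @Re_1BZ_gt0 x y x1; rewrite y0 ltW// in re; have {}re := re isT.
 have IE : I = icint (ker1 b x) 0 y + cint leb `]y, 1[ (ker1 b x).
  have reE := @Rintegral_itvB _ _ (BLeft 0) (BLeft 1) y ki.1.
  have imE := @Rintegral_itvB _ _ (BLeft 0) (BLeft 1) y ki.2.
  rewrite !bnd_simp in reE imE; have {}reE := reE y0 y1; have {}imE := imE y0 y1.
  apply: eqc; rewrite ?ReD ?ImD; apply/eqP; rewrite addrC -subr_eq; apply/eqP. exact: reE. exact: imE.
 have ki' : cintg leb `]y, 1[ (ker1 b x).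
  by case: ki => k1 k2; split; [apply: integrableS k1|apply: integrableS k2] => //;
   move=> t /=; rewrite !in_itv/= => /andP[h ->]; rewrite (le_trans y0 (ltW h)).
 have pw : leb.-integrable `[0%R, 1[ (EFin \o (fun t => (1 - t) `^ b)) by exact: integrable_powRB.
 have h2 : normc (cint leb `]y, 1[ (ker1 b x)) <= M * ((1 - y) `^ (b + 1) / (b + 1)).
  rewrite (le_trans (le_normc_cint _ ki'))//.
  have pw' : leb.-integrable `]y, 1[ (EFin \o (fun t => (1 - t) `^ b)).
   apply: integrableS pw => // t /=; rewrite !in_itv/= => /andP[h ->]. by rewrite (le_trans y0 (ltW h)).
  have -> : (1 - y) `^ (b + 1) / (b + 1) = \int[leb]_(t in `]y, 1[) (1 - t) `^ b.
   rewrite -(Rintegral_itvB pw)// /Rintegral integral_powRB// powRB_bound ?y0 ?y1//=.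
   by rewrite powR1 -mulrBl subKr. rewrite -RintegralZl//; apply: le_Rintegral => //.
  - exact: (cintg_normc _ ki').
  - exact: (integrableZl _ M pw').
  - move=> t; rewrite /= in_itv/= => /andP[t0 t1]; apply: ker1_bound => //.
   by rewrite (le_trans y0 (ltW t0)) ltW.
 have -> : I - L = cint leb `]y, 1[ (ker1 b x) - cpow ((1 - y%:C) / (1 - y%:C * x)) (b + 1) * L.
  rewrite IE icint_ker1 ?y0 ?y1// -/L mulrBl mul1r; ring. rewrite (le_trans (normcBD _ _))//.
 have -> : K * (1 - y) `^ (b + 1) = M * ((1 - y) `^ (b + 1) / (b + 1)) +
   ((1 - normc x)^-1 `^ (b + 1) * (1 - y) `^ (b + 1) * normc L + (1 - y) `^ (b + 1)). by rewrite /K; ring.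
 rewrite lerD// -[leLHS]addr0 lerD ?powR_ge0// normcM ler_wpM2r ?nc_ge0//.
 have reV : 0 < cRe (1 - y%:C * x)^-1.
  rewrite -(@pmulr_rgt0 _ (normc (1 - y%:C * x) ^+ 2)) ?exprn_gt0 ?normc_gt0 ?Re_gt0_neq0//.
  by rewrite -ReZ -mulcJ mulrAC divff ?Re_gt0_neq0// mul1r ReJ.
 have yE : (1 - y%:C : C) = (1 - y)%:C by rewrite RCB. rewrite normc_cpow; last by rewrite yE ReZ mulr_gt0.
 rewrite yE normcM normcR (gtr0_norm y10) normcV -powRM ?invr_ge0 ?(ltW nx) ?(ltW y10)//.
 rewrite mulrC; apply: ge0_ler_powR; rewrite ?nnegrE ?mulr_ge0 ?invr_ge0 ?nc_ge0 ?(ltW nx) ?(ltW y10) ?(ltW b10)//.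
 rewrite ler_wpM2r ?(ltW y10)// lef_pV2 ?posrE// ?normc_gt0 ?Re_gt0_neq0//.
 rewrite (le_trans _ (Re_le_normc _))// ReD ReN ReZ/= lerD2l lerN2.
 rewrite (le_trans (ler_norm _))// normrM ger0_norm//.
 by rewrite (le_trans (ler_wpM2l y0 (normRe _)))// ler_piMl ?nc_ge0// ltW.
apply: normc_small_eq => e e0.
(* At [y = 1 - u] the error is at most [K u ^ (b + 1)], and this [u] makes it at most [e]. *)
pose u := Num.min 1 ((e / K) `^ (b + 1)^-1).
have u0 : 0 < u by rewrite lt_min ltr01 powR_gt0// divr_gt0.
have u1 : u <= 1 by rewrite ge_min lexx.
have := bnd (1 - u); rewrite subr_ge0 u1 ltrBlDr ltrDl u0 => /(_ isT) /le_trans; apply.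
rewrite subKr mulrC -ler_pdivlMr// (le_trans (_ : _ <= ((e / K) `^ (b + 1)^-1) `^ (b + 1)))//.
 apply: ge0_ler_powR; rewrite ?nnegrE ?powR_ge0 ?(ltW u0) ?(ltW b10)//. by rewrite ge_min lexx orbT.
by rewrite -powRrM mulVf ?gt_eqF// powRr1// divr_ge0// ltW.
Qed.

End RealIntegrals.

(** * Polar coordinates without angles, ball integrals and the Gamma function *)

Section RadialIntegrals.
Variable R : realType.
Local Open Scope ereal_scope.
Notation RR := (RxR R).
Notation leb := (@lebesgue_measure R).
Notation pfm m mf :=
 (measure_function_pushforward__canonical__measure_function_Measure m mf).
Notation scm r m := (measure_function_mscale__canonical__measure_function_Measure r m).

Lemma lebesgue_measure_scale (c : R) (A : set (mR R)) : (0 < c)%R -> measurable A ->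
 leb A = c%:E * leb ((fun x : mR R => c * x : mR R)%R @^-1` A).
move=> c0 mA.
have mc : mfun (fun x : mR R => c * x : mR R)%R.
 by apply: mfunM => //; exact: mcst.
have c0' : (0 <= c)%R by exact: ltW.
rewrite (@lebesgue_measure_unique _ (scm (NngNum c0') (pfm leb mc)))// => _ [[x y] xy <-].
rewrite /= /mscale/= /pushforward/=.
have -> : leb ((fun t : mR R => c * t : mR R)%R @^-1` [set` `]x, y]%R]) =
  leb (`](x / c)%R, (y / c)%R]%classic : set R).
 by congr (leb _); apply/seteqP; split => z /=; rewrite !in_itv/= ltr_pdivrMr// ler_pdivlMr// mulrC.
rewrite !lebesgue_measure_itv/= !lte_fin ltr_pM2r ?invr_gt0//; case: ifPn => // _; last by rewrite mule0.
by rewrite -!EFinD -EFinM -mulrBl mulrC divfK// gt_eqF.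
Qed.

Lemma lebesgue2_scale (c : R) (A : set RR) : (0 < c)%R -> measurable A ->
 lebesgue2 A = (c ^+ 2)%:E * lebesgue2 ((fun p : RR => (c * p.1, c * p.2)%R : RR) @^-1` A).
move=> c0 mA.
have mc : mfun (fun p : RR => (c * p.1, c * p.2)%R : RR).
 by apply/measurable_fun_pairP; split; rewrite /comp/=; apply: mfunM => //.
have c0' : (0 <= c ^+ 2)%R by exact: sqr_ge0.
rewrite [LHS](@product_measure_unique _ _ _ _ R leb leb (scm (NngNum c0') (pfm (@lebesgue2 R) mc)))//.
move=> B C mB mC; rewrite /= /mscale/= /pushforward/=.
rewrite (lebesgue_measure_scale c0 mB) (lebesgue_measure_scale c0 mC).
have mp (D : set (mR R)) : measurable D ->
  measurable ((fun x : mR R => c * x : mR R)%R @^-1` D). move=> mD; rewrite -[X in measurable X]setTI.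
 have : mfun (fun x : mR R => c * x : mR R)%R. by apply: mfunM => //; exact: mcst. exact.
rewrite (_ : _ @^-1` _ = ((fun x : mR R => c * x : mR R)%R @^-1` B) `*`
  ((fun x : mR R => c * x : mR R)%R @^-1` C)); last first. by apply/seteqP; split => -[x y].
rewrite /lebesgue2 product_measure1E; [|exact: mp|exact: mp].
by rewrite expr2 EFinM muleACA.
Qed.

Definition sq2 (p : RR) : R := (p.1 ^+ 2 + p.2 ^+ 2)%R.

Lemma meas_sq2 : mfun (sq2 : RR -> mR R).
by apply: measurable_funD; apply: mfunX; [exact: measurable_fst|exact: measurable_snd].
Qed.

Lemma meas_disc (t : R) : measurable [set p : RR | (sq2 p <= t)%R].
rewrite (_ : [set p | _] = sq2 @^-1` `]-oo, t]).
 by rewrite -[X in measurable X]setTI; apply: meas_sq2.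
by apply/seteqP; split => p /=; rewrite in_itv.
Qed.

(** Scaling makes the area proportional to the squared radius [t]; comparison with squares shows
    that the factor is finite and positive. Its value is found in [radial]. *)
Lemma disc_measure : exists2 a : R, (0 < a)%R &
 forall t : R, (0 <= t)%R -> lebesgue2 [set p : RR | (sq2 p <= t)%R] = (a * t)%:E.
pose D t := [set p : RR | (sq2 p <= t)%R].
have mD t : measurable (D t) by exact: meas_disc.
have sc t : (0 < t)%R -> lebesgue2 (D t) = t%:E * lebesgue2 (D 1%R).
 move=> t0; have s0 : (0 < Num.sqrt t)%R by rewrite sqrtr_gt0.
 rewrite [LHS](lebesgue2_scale s0 (mD t)) sqr_sqrtr ?ltW//; congr (_ * lebesgue2 _).
 apply/seteqP; split => p; rewrite /D /sq2/= !exprMn sqr_sqrtr ?(ltW t0)// -mulrDr.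
  by rewrite -{2}[t]mulr1 ler_pM2l. by rewrite -{2}[t]mulr1 ler_pM2l.
have box (a b : R) : (a <= b)%R -> lebesgue2 ((`[a, b]%classic : set R) `*` (`[a, b]%classic : set R)) = ((b - a) ^+ 2)%:E.
 move=> ab; rewrite /lebesgue2 product_measure1E//. have lE : leb (`[a, b]%classic : set R) = (b - a)%:E.
  rewrite lebesgue_measure_itv/= lte_fin; case: ltP => // ba. by rewrite (@le_anti _ _ a b) ?ab// subrr.
 by rewrite expr2 EFinM; congr (_ * _); exact: lE.
have fin : lebesgue2 (D 1%R) \is a fin_num.
 rewrite ge0_fin_numE//; apply: (@le_lt_trans _ _ (((1 - (-1)) ^+ 2)%R)%:E); last by rewrite ltry.
 rewrite -box; last by clear; lra. apply: le_measure; rewrite ?inE//; first exact: measurableX.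
 move=> [x y]; rewrite /D /sq2/= => h; rewrite !in_itv/= -!ler_norml; split;
  rewrite -(@expr_le1 _ 2)// -normrX ger0_norm ?sqr_ge0// (le_trans _ h)//. by rewrite lerDl sqr_ge0.
 by rewrite lerDr sqr_ge0.
have pos : (0 < fine (lebesgue2 (D 1%R)))%R.
 rewrite -lte_fin fineK//; apply: (@lt_le_trans _ _ (((1 / 2 - 0) ^+ 2)%R)%:E).
  by rewrite lte_fin subr0 exprn_gt0.
 rewrite -box//; apply: le_measure; rewrite ?inE//; first exact: measurableX.
 move=> [x y]; rewrite /D /sq2/= !in_itv/= => -[/andP[x0 x1] /andP[y0 y1]]. have : (x ^+ 2 <= 1 / 4)%R.
  by rewrite expr2 (le_trans (ler_pM x0 x0 x1 x1))//; clear; lra. have : (y ^+ 2 <= 1 / 4)%R.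
  by rewrite expr2 (le_trans (ler_pM y0 y0 y1 y1))//; clear; lra. by clear; lra.
exists (fine (lebesgue2 (D 1%R))) => // t; rewrite le_eqVlt => /predU1P[<-|t0].
 rewrite mulr0; apply/eqP; rewrite eq_le measure_ge0 andbT.
 have z0 : lebesgue2 ([set 0%R : mR R] `*` [set 0%R : mR R]) = 0%:E. rewrite /lebesgue2 product_measure1E//.
  rewrite (_ : 0%:E = 0%:E * 0%:E); last by rewrite mule0.
  by congr (_ * _); exact: (@lebesgue_measure_set1 R 0%R).
 have mz : measurable ([set 0%R : mR R] `*` [set 0%R : mR R]). by apply: measurableX; exact: measurable_set1.
 rewrite -z0; apply: le_measure; rewrite ?inE//; first exact: mD. move=> [x y]; rewrite /D /sq2/= => h.
 have : (x ^+ 2 + y ^+ 2 == 0)%R by rewrite eq_le h addr_ge0 ?sqr_ge0.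
 by rewrite paddr_eq0 ?sqr_ge0// !sqrf_eq0 => /andP[/eqP -> /eqP ->].
by rewrite [LHS]sc// EFinM fineK// muleC.
Qed.

Lemma integral_expRN : \int[leb]_(t in `[0%R, +oo[) (expR (- t))%:E = 1.
rewrite (@ge0_continuous_FTC2y _ (fun t => expR (- t)) (fun t => - expR (- t))%R 0%R 0%R).
- by rewrite oppr0 expR0 EFinN oppeK add0e.
- by move=> x _; exact: expR_ge0.
- apply: continuous_subspaceT => x.
 by apply: (@continuous_comp _ _ _ (fun t : R => - t)%R expR); [exact: opp_continuous|exact: continuous_expR].
- rewrite -oppr0; apply: cvgN; have := @cvgr_expR R; exact.
- by move=> x _; exact: ex_derive.
- apply: cvg_at_right_filter.
 apply: cvgN; apply: (@continuous_comp _ _ _ (fun t : R => - t)%R expR); [exact: opp_continuous|exact: continuous_expR].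
- move=> x _; rewrite derive1E; apply: derive_val.
 have H1 := is_deriveN (is_derive_id x (1%R : R)).
 have H2 := @is_derive1_comp _ (@expR R) (fun t => - t)%R x _ _ (is_derive_expR _) H1.
 by have := is_deriveN H2; rewrite mulrN1 opprK.
Qed.

(** The image of plane measure under [sq2] is [a] times Lebesgue measure on the half-line, by
    uniqueness of the measure that gives intervals their length. *)
Lemma radial_unscaled (a : R) (h : R -> \bar R) : (0 < a)%R ->
 (forall t : R, (0 <= t)%R -> lebesgue2 [set p : RR | (sq2 p <= t)%R] = (a * t)%:E) ->
 mfun (h : mR R -> \bar R) -> (forall t, 0 <= h t) ->
 \int[@lebesgue2 R]_p h (sq2 p) = a%:E * \int[leb]_(t in `[0%R, +oo[) h t.
move=> a0 aE mh h0.
have a0' : (0 <= a^-1)%R by rewrite invr_ge0 ltW.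
have a0'' : (0 <= a)%R by rewrite ltW.
pose nu := pfm (@lebesgue2 R) meas_sq2.
have mneg : measurable (`]-oo, 0%R[%classic : set (mR R)) by exact: measurable_itv.
(* Uniqueness concerns measures on the whole line, so the missing negative half-line is filled in
   with Lebesgue measure itself. *)
pose m1 := [the measure (mR R) R of measure_add (scm (NngNum a0') nu)
 (measure_function_mrestr__canonical__measure_function_Measure leb mneg)].
have nuE (x y : R) : (x <= y)%R -> nu `]x, y]%classic = (a * (Num.max y 0 - Num.max x 0))%:E.
 move=> xy; rewrite /nu/= /pushforward.
 have F t : lebesgue2 [set p : RR | (sq2 p <= t)%R] = (a * Num.max t 0)%:E.
  have [t0|t0] := leP t 0%R; last by rewrite aE// ltW.
  move: t0; rewrite le_eqVlt => /predU1P[->|t0]; first by rewrite aE.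
  rewrite mulr0 (_ : [set p | _] = set0) ?measure0//. apply/seteqP; split => p //=; rewrite /sq2 => pt.
  have : (0 <= p.1 ^+ 2 + p.2 ^+ 2 :> R)%R by rewrite addr_ge0 ?sqr_ge0.
  by move=> /(lt_le_trans t0); rewrite ltNge pt.
 rewrite (_ : _ @^-1` _ = [set p : RR | (sq2 p <= y)%R] `\` [set p : RR | (sq2 p <= x)%R]); last first.
  apply/seteqP; split => p /=; rewrite in_itv/=.
   by move=> /andP[xp ->]; split => //; apply/negP; rewrite -ltNge.
  by move=> [-> /negP]; rewrite -ltNge => ->.
 rewrite measureD; try exact: meas_disc; last by rewrite [X in X < _]F ltry.
 rewrite (_ : _ `&` _ = [set p : RR | (sq2 p <= x)%R]); last first.
  by apply/seteqP; split => p /=; [case|move=> px; split => //; exact: le_trans px xy].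
 by rewrite [X in X - _]F [X in _ - X]F -EFinB mulrBr.
have m1E (A : set (mR R)) : m1 A = (a^-1)%:E * nu A + leb (A `&` `]-oo, 0%R[%classic).
 exact: measure_addE.
have key (A : set (mR R)) : measurable A -> leb A = m1 A.
 apply: lebesgue_measure_unique => _ [[x y] /= _ <-].
 have [xy|yx] := leP x y; last by rewrite set_itv_ge ?measure0// bnd_simp -leNgt ltW. rewrite m1E nuE//.
 have -> : leb ([set` `]x, y]%R] `&` `]-oo, 0%R[%classic) = (Num.min y 0 - Num.min x 0)%:E.
  have [y0|y0] := ltP y 0%R. rewrite (_ : Num.min x 0 = x)%R; last by rewrite minEle (le_trans xy (ltW y0)).
   rewrite (_ : _ `&` _ = (`]x, y]%classic : set R)); last first.
    apply/seteqP; split => z /=; rewrite !in_itv/=; first by case.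
    by move=> /andP[-> zy]; split; rewrite ?zy// (le_lt_trans zy).
   rewrite lebesgue_measure_itv/= lte_fin; case: ltP => //.
   by move=> yx; rewrite (@le_anti _ _ x y) ?xy// subrr.
  rewrite (_ : _ `&` _ = (`]x, 0%R[%classic : set R)); last first.
   apply/seteqP; split => z /=; rewrite !in_itv/=; first by move=> [/andP[-> _] ->].
   by move=> /andP[-> z0]; split; rewrite ?z0// (le_trans (ltW z0)).
  rewrite lebesgue_measure_itv/= lte_fin; case: ltP => x0. by rewrite -EFinB. by rewrite subrr.
 rewrite -EFinM -EFinD mulKf ?gt_eqF//.
 have -> : (Num.max y 0 - Num.max x 0 + (Num.min y 0 - Num.min x 0) = y - x)%R.
  have := addr_max_min y 0%R; have := addr_max_min x 0%R; clear; lra.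
 rewrite lebesgue_measure_itv/= lte_fin; case: ltP => //.
 by move=> yx; rewrite (@le_anti _ _ x y) ?xy// subrr.
have pre : sq2 @^-1` `[0%R, +oo[ = [set: RR].
 by apply/seteqP; split => p //= _; rewrite in_itv/= andbT addr_ge0 ?sqr_ge0.
transitivity (\int[nu]_(t in `[0%R, +oo[) h t).
 rewrite /nu (ge0_integral_pushforward meas_sq2)//; first by rewrite pre. exact: measurable_funTS.
rewrite -(ge0_integral_mscale leb _ (NngNum a0''))//; last exact: measurable_funTS.
apply: eq_measure_integral => A mA A0.
rewrite /= /mscale/= [X in _ * X](key A mA).
rewrite m1E.
rewrite (_ : A `&` _ = set0) ?measure0 ?adde0; last first.
 by apply/seteqP; split => z //= -[/A0 /=]; rewrite !in_itv/= andbT leNgt => /negP.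
by rewrite muleA -EFinM divff ?mul1e// gt_eqF.
Qed.

(** The unknown area constant is read off from the function [exp (- t)], whose plane integral is the
    Gaussian one. *)
Lemma radial (h : R -> \bar R) :
 mfun (h : mR R -> \bar R) -> (forall t, 0 <= h t) ->
 \int[@lebesgue2 R]_p h (sq2 p) = pi%:E * \int[leb]_(t in `[0%R, +oo[) h t.
move=> mh h0; have [a a0 aE] := disc_measure.
suff -> : pi = a by exact: radial_unscaled.
have mE : mfun (fun t : mR R => (expR (- t))%:E : \bar R).
 apply/mEFinP; apply: (mcomp (@measurable_expR R)). exact: measurable_funN.
have := radial_unscaled a0 aE mE (fun t => expR_ge0 _).
by rewrite integral_expRN mule1 integral_gauss2 => -[].
Qed.

(** The Bergman weight as a function of the squared norm. The cut-off belongs to the weight, so that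
    ball integrals become integrals over the whole space. *)
Definition pw (u g t : R) : R := if (t < u)%R then ((u - t) `^ g)%R else 0%R.

Lemma pw_ge0 u g t : (0 <= pw u g t)%R.
by rewrite /pw; case: ifP => // _; exact: powR_ge0. Qed.

Lemma meas_pw u g : mfun (pw u g : mR R -> mR R).
apply: measurable_fun_ifT.
- by apply: measurable_fun_ltr => //; exact: mcst.
- apply: (mcomp (measurable_powR _)).
 by apply: mfunB => //; exact: mcst.
- exact: mcst.
Qed.

Lemma integral_pw u g : (-1 < g)%R -> (0 < u)%R ->
 \int[leb]_(t in `[0%R, +oo[) (pw u g t)%:E = (u `^ (g + 1) / (g + 1))%:E.
move=> g1 u0; rewrite -integral_powRB// [LHS]integral_mkcond [RHS]integral_mkcond.
apply: eq_integral => t _; rewrite !patchE /pw !mem_setE !in_itv/= andbT.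
by case: (0 <= t)%R => //=; case: ltP.
Qed.

Lemma meas_pw_tsq n u g : mfun (fun x : n.-tuple RR => (pw u g (tsq x))%:E).
apply/mEFinP; apply: (mcomp (meas_pw u g)).
exact: meas_tsq.
Qed.

Lemma tsq_ge0 n (x : n.-tuple RR) : (0 <= tsq x)%R.
by apply: sumr_ge0 => i _; rewrite addr_ge0 ?sqr_ge0. Qed.

(** The Pochhammer symbol [(g + 1) ... (g + n)], which is [Gamma (g + n + 1) / Gamma (g + 1)]. *)
Definition rising (g : R) n : R := (\prod_(j < n) (g + j.+1%:R))%R.

Lemma rising_gt0 (g : R) n : (-1 < g)%R -> (0 < rising g n)%R.
by move=> g1; apply: prodr_gt0 => i _; rewrite -natr1; have := ler0n R i; clear -g1; lra. Qed.

(** For a fixed first coordinate [p] the inner integral is the same one with [u - |p|^2] in place of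
    [u]; the remaining radial integral raises the exponent by 1 and contributes one factor
    [pi / (g + n + 1)]. *)
Lemma integral_vol_pw n (u g : R) : (-1 < g)%R -> (0 < u)%R ->
 \int[vol R n]_x (pw u g (tsq x))%:E = (pi ^+ n * u `^ (g + n%:R) / rising g n)%:E.
move=> g1; elim: n u => [|n IH] u u0.
 rewrite /= integral_dirac//; last exact: meas_pw_tsq.
 by rewrite diracT mul1e /tsq /rising !big_ord0 /pw u0 expr0 !subr0 addr0 mul1r divr1.
rewrite ge0_integral_vol_cons; [|exact: meas_pw_tsq|by move=> x; rewrite lee_fin pw_ge0].
have r0 := rising_gt0 n g1.
have gn1 : (-1 < g + n%:R)%R by rewrite ltr_wpDr.
transitivity (\int[@lebesgue2 R]_p ((pi ^+ n / rising g n)%:E * (pw u (g + n%:R) (sq2 p))%:E)).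
 apply: eq_integral => p _. under eq_integral => y _ do rewrite tsq_cons/= -/(sq2 p).
 have [pu|pu] := ltP (sq2 p) u. have pu' : (0 < u - sq2 p)%R by rewrite subr_gt0.
  rewrite (_ : _ * _ = (pi ^+ n * (u - sq2 p) `^ (g + n%:R) / rising g n)%:E); last first.
   by rewrite /pw pu -EFinM mulrAC. rewrite -(IH _ pu').
  by apply: eq_integral => y _; rewrite /pw ltrBrDl opprD addrA.
 rewrite (_ : pw u (g + n%:R) (sq2 p) = 0%R); last by rewrite /pw ltNge pu.
 rewrite mule0 integral0_eq// => y _. by rewrite /pw ltNge (le_trans pu)//= lerDl tsq_ge0.
rewrite ge0_integralZl//; last 2 first.
- by move=> p _; rewrite lee_fin pw_ge0.
- by rewrite lee_fin divr_ge0 ?exprn_ge0 ?pi_ge0 ?(ltW r0).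
- rewrite (radial (h := fun t => (pw u (g + n%:R) t)%:E)); last 2 first.
 + by apply/mEFinP; exact: meas_pw. + by move=> t; rewrite lee_fin pw_ge0.
 rewrite integral_pw// -!EFinM; congr EFin.
 rewrite /rising big_ord_recr/= -/(rising g n) -natr1 !addrA exprSr.
 have gn0 : (g + n%:R + 1 != 0)%R by rewrite gt_eqF// -ltrBlDr sub0r. by field; rewrite gn0 gt_eqF.
- apply/mEFinP; apply: (mcomp (meas_pw _ _)).
 exact: meas_sq2.
Qed.

Definition egamma (x : R) : \bar R := \int[leb]_(t in `]0%R, +oo[) (t `^ (x - 1) * expR (- t))%:E.

Definition gfun (x t : R) : R := if (0 < t)%R then (t `^ (x - 1) * expR (- t))%R else 0%R.

Lemma gfun_ge0 x t : (0 <= gfun x t)%R.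
by rewrite /gfun; case: ifP => // _; rewrite mulr_ge0 ?powR_ge0 ?expR_ge0. Qed.

Lemma meas_gfun x : mfun (gfun x : mR R -> mR R).
apply: measurable_fun_ifT; last exact: mcst.
 by apply: measurable_fun_ltr => //; exact: mcst.
apply: mfunM; first exact: measurable_powR.
by apply: (mcomp (@measurable_expR R)); exact: measurable_funN.
Qed.

Lemma egammaE x : egamma x = \int[leb]_t (gfun x t)%:E.
rewrite /egamma integral_mkcond; apply: eq_integral => t _; rewrite patchE /gfun mem_setE in_itv/= andbT.
by case: ltP.
Qed.

Lemma Gamma_fine x : Gamma x = fine (egamma x). by []. Qed.

Lemma egamma_ge0 x : 0 <= egamma x.
by rewrite egammaE; apply: integral_ge0 => t _; rewrite lee_fin gfun_ge0. Qed.

Lemma egamma1 : egamma 1%R = 1.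
rewrite -integral_expRN -integral_itv_obnd_cbnd; last first.
 apply/mEFinP; apply: (mcomp (@measurable_expR R)). exact: measurable_funN.
apply: eq_integral => t _; rewrite subrr powRr0 mul1r//.
Qed.

(* [t ^ x = x * \int_0^t (t - s)^(x - 1) ds] and Tonelli. *)
Lemma egammaS x : (0 < x)%R -> egamma (x + 1)%R = x%:E * egamma x.
move=> x0; pose F (p : RR) : \bar R :=
 (if (0 < p.2)%R then gfun x (p.1 - p.2) * expR (- p.2) else 0)%:E.
have mF : mfun F.
 apply/mEFinP; apply: measurable_fun_ifT; last exact: mcst. by apply: measurable_fun_ltr => //. apply: mfunM.
  by apply: (mcomp (meas_gfun x)); apply: mfunB; [exact: measurable_fst|exact: measurable_snd].
 by apply: (mcomp (@measurable_expR R)); apply: measurable_funN; exact: measurable_snd.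
have F0 p : 0 <= F p.
 by rewrite lee_fin; case: ifP => // _; rewrite mulr_ge0 ?gfun_ge0 ?expR_ge0.
have fub : \int[leb]_t \int[leb]_s F (t, s) = \int[leb]_s \int[leb]_t F (t, s).
 exact: (@fubini_tonelli _ _ _ _ R leb leb F mF F0).
have I1 : \int[leb]_s \int[leb]_t F (t, s) = egamma x.
 clear fub. transitivity (\int[leb]_s (egamma x * (if (0 < s)%R then expR (- s) else 0%R)%:E)).
  apply: eq_integral => s _; rewrite /F/=; case: ifP => s0; last by rewrite mule0 integral0_eq.
  under eq_integral => t _ do rewrite mulrC EFinM. rewrite ge0_integralZl//.
  - rewrite muleC; congr (_ * _). have ms := @mpres_shift R (GRing.opp (s : R)).
   rewrite egammaE -(ge0_integral_mpres ms (h := fun t : mR R => (gfun x t)%:E))//.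
   + by apply/mEFinP; exact: meas_gfun. + by move=> t; rewrite lee_fin gfun_ge0.
  - by apply/mEFinP; apply: (mcomp (meas_gfun x)); exact: mfunB.
  - by move=> t _; rewrite lee_fin gfun_ge0. rewrite ge0_integralZl//.
 - rewrite (_ : \int[leb]_s _ = 1) ?mule1// -egamma1 egammaE; apply: eq_integral => s _.
  by rewrite /gfun subrr powRr0 mul1r.
 - apply/mEFinP; apply: measurable_fun_ifT; last exact: mcst. by apply: measurable_fun_ltr => //; exact: mcst.
  by apply: (mcomp (@measurable_expR R)); exact: measurable_funN.
 - by move=> s _; rewrite lee_fin; case: ifP => // _; exact: expR_ge0.
 - exact: egamma_ge0.
have I2 : \int[leb]_t \int[leb]_s F (t, s) = (x^-1)%:E * egamma (x + 1)%R.
 clear fub I1. transitivity (\int[leb]_t ((x^-1)%:E * (gfun (x + 1) t)%:E)).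
  apply: eq_integral => t _; rewrite /gfun addrK; case: (ltP 0%R t) => t0; last first.
   rewrite mule0 integral0_eq// => s _; rewrite /F/= /gfun subr_gt0.
   case: ifP => // s0; case: ltP => [st|_]; last by rewrite mul0r.
   by have := lt_trans s0 st; rewrite ltNge t0. rewrite -EFinM mulrA [(x^-1 * _)%R]mulrC EFinM.
  have := @integral_powRB R t (x - 1)%R; rewrite subrK => <-//; last by clear -x0; lra.
  transitivity (\int[leb]_s ((expR (- t))%:E * ((EFin \o (fun s => (t - s) `^ (x - 1))%R) \_ `]0%R, t[) s)).
   apply: eq_integral => s _; rewrite /F/= /gfun subr_gt0 patchE mem_setE in_itv/=.
   case: ifP => s0/=; last by rewrite mule0. case: ifP => st; last by rewrite mul0r mule0.
   by rewrite -EFinM -mulrA -expRD opprB addrAC subrr add0r mulrC. rewrite ge0_integralZl//.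
  - by rewrite muleC -integral_mkcond integral_itv_obnd_cbnd//; exact: meas_powRB.
  - apply/(measurable_restrictT _ _).1 => //; exact: meas_powRB.
  - by move=> s _; rewrite patchE; case: ifP => // _; rewrite lee_fin powR_ge0. rewrite ge0_integralZl//.
 - by rewrite -egammaE.
 - by apply/mEFinP; exact: meas_gfun.
 - by move=> s _; rewrite lee_fin gfun_ge0.
 - by rewrite lee_fin invr_ge0 ltW.
have -> : egamma x = (x^-1)%:E * egamma (x + 1)%R by exact: (etrans (esym I1) (etrans (esym fub) I2)).
clear fub I1 I2 F F0 mF.
by rewrite muleA -EFinM divff ?mul1e// gt_eqF.
Qed.

(** On [[1, 2]] the integrand is below the sum of those for 1 and 2; the functional equation carries
    finiteness up and down from there. *)
Lemma egamma_fin x : (0 < x)%R -> egamma x < +oo.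
have down y : (0 < y)%R -> egamma (y + 1)%R < +oo -> egamma y < +oo.
 move=> y0; rewrite egammaS//; have := egamma_ge0 y; case: (egamma y) => [r _ _||] //=; first by rewrite ltry.
 by rewrite gt0_muley ?lte_fin.
have up y : (0 < y)%R -> egamma y < +oo -> egamma (y + 1)%R < +oo.
 by move=> y0 h; rewrite egammaS// lte_mul_pinfty// lee_fin ltW.
have mid y : (1 <= y <= 2)%R -> egamma y < +oo.
 move=> /andP[y1 y2]; apply: (@le_lt_trans _ _ (egamma 1%R + egamma 2%R)); last first.
  have -> : (2 = 1 + 1 :> R)%R by clear; lra. by rewrite egammaS// egamma1 mul1e -EFinD ltry.
 rewrite !egammaE -ge0_integralD//; do ?[by apply/mEFinP; exact: meas_gfun|
  by move=> t _; rewrite lee_fin gfun_ge0].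
 apply: ge0_le_integral => //; do ?[by apply/mEFinP; exact: meas_gfun|
  by move=> t _; rewrite lee_fin gfun_ge0].
 - by apply: emeasurable_funD; apply/mEFinP; exact: meas_gfun.
 - move=> t _; rewrite -EFinD lee_fin /gfun; case: ifP => t0; last by rewrite addr0.
  rewrite -mulrDl ler_wpM2r ?expR_ge0// subrr powRr0. have [t1|t1] := leP t 1%R.
   have e1 : (1 `^ (y - 1) = 1 :> R)%R by rewrite powR1. rewrite -[leLHS]addr0 lerD ?powR_ge0// -[leRHS]e1.
   by apply: ge0_ler_powR; rewrite ?nnegrE ?(ltW t0)//; clear -y1; lra.
  rewrite -[leLHS]add0r lerD// ler_powR ?(ltW t1)//; clear -y2; lra.
move=> x0; have [N] : exists N : nat, (x <= N%:R + 1)%R.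
 by exists (Num.truncn x).+1; rewrite (le_trans (ltW (truncnS_gt x)))// lerDl.
elim: N x x0 => [|N IH] x x0 xN.
 by apply: down => //; apply: mid; move: xN x0; rewrite add0r; clear; lra.
have [x1|x1] := leP x 1%R; first by apply: down => //; apply: mid; clear -x0 x1; lra.
rewrite -(subrK 1%R x); apply: up; first by rewrite subr_gt0.
by apply: IH; rewrite ?subr_gt0// lerBlDr natr1.
Qed.

Lemma egamma_gt0 x : (0 < x)%R -> 0 < egamma x.
have up y : (1 <= y)%R -> 0 < egamma y.
 move=> y1; apply: (@lt_le_trans _ _ (\int[leb]_(t in `[1%R, 2%R]) (expR (- 2))%:E)).
  rewrite integral_cst// [X in _ * X](_ : _ = 1%:E); first by rewrite mule1 lte_fin expR_gt0.
  transitivity (leb (`[1%R, 2%R]%classic : set R)) => //.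
  by rewrite lebesgue_measure_itv/= lte_fin ltr1n -EFinB; congr EFin; clear; lra.
 apply: (@le_trans _ _ (\int[leb]_(t in `[1%R, 2%R]) (gfun y t)%:E)). apply: ge0_le_integral => //.
  - by apply/mEFinP; apply: measurable_funTS; exact: meas_gfun.
  - move=> t /=; rewrite in_itv/= => /andP[t1 t2]; rewrite lee_fin /gfun (lt_le_trans ltr01 t1).
   rewrite -[leLHS]mul1r ler_pM ?expR_ge0//; last by rewrite ler_expR lerN2.
   have e1 : (1 `^ (y - 1) = 1 :> R)%R by rewrite powR1.
   by rewrite -[leLHS]e1; apply: ge0_ler_powR; rewrite ?nnegrE ?subr_ge0 ?(le_trans ler01 t1).
 rewrite egammaE; apply: ge0_subset_integral => //. by apply/mEFinP; exact: meas_gfun.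
 by move=> t _; rewrite lee_fin gfun_ge0.
move=> x0; have [x1|x1] := leP 1%R x; first exact: up.
rewrite lt_neqAle egamma_ge0 andbT; apply/eqP => h.
have : 0 < egamma (x + 1)%R by apply: up; rewrite lerDr ltW.
by rewrite egammaS// -h mule0 ltxx.
Qed.

Lemma Gamma_gt0 (x : R) : (0 < x)%R -> (0 < Gamma x)%R.
by move=> x0; rewrite Gamma_fine fine_gt0// egamma_gt0//= egamma_fin. Qed.
Lemma GammaS (x : R) : (0 < x)%R -> (Gamma (x + 1) = x * Gamma x)%R.
by move=> x0; rewrite !Gamma_fine egammaS// fineM// ge0_fin_numE ?egamma_ge0 ?egamma_fin. Qed.

Lemma Gamma_rising (g : R) n : (-1 < g)%R -> (Gamma (n%:R + g + 1) = rising g n * Gamma (g + 1))%R.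
move=> g1; elim: n => [|n IH]; first by rewrite /rising big_ord0 mul1r add0r.
have -> : (n.+1%:R + g + 1 = (n%:R + g + 1) + 1 :> R)%R by rewrite -natr1; ring.
rewrite (@GammaS (n%:R + g + 1)); last by rewrite -addrA ltr_wpDl// -ltrBlDr sub0r.
by rewrite IH /rising big_ord_recr/= -natr1; ring.
Qed.

Lemma cst_alphaE n (g : R) : (-1 < g)%R -> cst_alpha n g = (rising g n / pi ^+ n)%R.
move=> g1; rewrite /cst_alpha Gamma_rising//.
have G0 : (Gamma (g + 1) != 0)%R by rewrite gt_eqF// Gamma_gt0//; clear -g1; lra.
have p0 : (pi ^+ n != 0 :> R)%R by rewrite expf_eq0 gt_eqF ?andbF// pi_gt0.
by field; rewrite G0 p0.
Qed.

Lemma cst_alpha_gt0 n (g : R) : (-1 < g)%R -> (0 < cst_alpha n g)%R.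
by move=> g1; rewrite cst_alphaE// divr_gt0 ?rising_gt0 ?exprn_gt0 ?pi_gt0. Qed.

End RadialIntegrals.

(** * Fubini's theorem for complex functions *)

Section ComplexFubini.
Context d1 d2 (T1 : measurableType d1) (T2 : measurableType d2) (R : realType).
Context (m1 : {sigma_finite_measure set T1 -> \bar R}) (m2 : {sigma_finite_measure set T2 -> \bar R}).
Notation C := R[i].

Lemma Rfubini (f : T1 * T2 -> R) : mfun f ->
 (\int[m1]_x \int[m2]_y `|(f (x, y))%:E| < +oo)%E ->
 (forall x, m2.-integrable setT (fun y => (f (x, y))%:E)) ->
 (forall y, m1.-integrable setT (fun x => (f (x, y))%:E)) ->
 \int[m1]_x \int[m2]_y f (x, y) = \int[m2]_y \int[m1]_x f (x, y) /\
 m1.-integrable setT (fun x => (\int[m2]_y f (x, y))%:E).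
move=> mf fi h1 h2.
have mf' : mfun (fun p => (f p)%:E) by exact/mEFinP.
have fI := (integrable12ltyP m1 m2 mf').2 fi.
have e1 x : (\int[m2]_y (f (x, y))%:E)%E = (\int[m2]_y f (x, y))%:E.
 by rewrite fineK//; apply: integrable_fin_num.
have e2 y : (\int[m1]_x (f (x, y))%:E)%E = (\int[m1]_x f (x, y))%:E.
 by rewrite fineK//; apply: integrable_fin_num.
split.
- have := Fubini fI; rewrite /= (eq_integral _ _ (fun x _ => e1 x)) (eq_integral _ _ (fun x _ => e2 x)).
 by move=> E; rewrite /Rintegral E.
- by have := integrable_fubini_F fI; apply: eq_integrable => // x _; rewrite /fubini_F e1.
Qed.

Lemma cfubini (F : T1 * T2 -> C) : cmeas setT F ->
 (\int[m1]_x \int[m2]_y (normc (F (x, y)))%:E < +oo)%E -> (forall x, cintg m2 setT (fun y => F (x, y))) ->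
 (forall y, cintg m1 setT (fun x => F (x, y))) -> cint m1 setT (fun x => cint m2 setT (fun y => F (x, y))) =
  cint m2 setT (fun y => cint m1 setT (fun x => F (x, y))) /\
 cintg m1 setT (fun x => cint m2 setT (fun y => F (x, y))).
move=> mF Fi h1 h2.
have mn : mfun (fun p => (normc (F p))%:E).
 by apply/mEFinP; exact: cmeas_normc.
have bnd (q : C -> R) : (forall z, `|q z| <= normc z) -> mfun (fun p => q (F p)) ->
  (\int[m1]_x \int[m2]_y `|(q (F (x, y)))%:E| < +oo)%E. move=> qn mq; apply: le_lt_trans Fi.
 have mq' : mfun (fun p => `|(q (F p))%:E|%E). by apply: mcomp => //; exact/mEFinP.
 apply: ge0_le_integral => //.
 - by move=> x _; exact: integral_ge0.
 - have := @measurable_fun_fubini_tonelli_F _ _ T1 T2 R m2 (fun p => `|(q (F p))%:E|%E) mq' (fun p => abse_ge0 _).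
  exact.
 - have := @measurable_fun_fubini_tonelli_F _ _ T1 T2 R m2 (fun p => (normc (F p))%:E) mn (fun p => nc_ge0 _).
  exact.
 - move=> x _; apply: ge0_le_integral => //. + by apply: mcomp mq' _; exact: measurable_pair1.
  + by apply: mcomp mn _; exact: measurable_pair1. + by move=> y _; rewrite abse_EFin lee_fin.
have [r1 r2] := Rfubini mF.1 (bnd (@complex.Re R) (@normRe R) mF.1) (fun x => (h1 x).1) (fun y => (h2 y).1).
have [i1 i2] := Rfubini mF.2 (bnd (@complex.Im R) (@normIm R) mF.2) (fun x => (h1 x).2) (fun y => (h2 y).2).
split.
- by apply: eqc; [exact: r1|exact: i1].
- by split; [exact: r2|exact: i2].
Qed.

End ComplexFubini.

(** * Rotation of circle means and the shift of contour *)

Section CircleRotation.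
Variable R : realType.
Notation C := R[i].
Notation leb := (@lebesgue_measure R).

Lemma icint_shift (h : R -> C) (a p q : R) : (forall t, rccont h t) ->
 icint (fun t => h (t + a)) p q = icint h (p + a) (q + a).
move=> hc.
have hm : @cmeas _ (mR R) R setT h.
 by split; apply: continuous_measurable_fun => t; have [] := rccont_for (hc t).
have E (k : R -> R) : @measurable_fun _ _ (mR R) R setT k ->
  \int[leb]_(t in `[p, q]) k (t + a) = \int[leb]_(t in `[p + a, q + a]) k t.
 move=> mk; rewrite /Rintegral integral_mkcond [in RHS]integral_mkcond; congr fine.
 have mk' : mfun ((fun t : mR R => (k t)%:E) \_ `[p + a, q + a]).
  apply/(measurable_restrictT _ _).1 => //; apply/mEFinP; exact: measurable_funTS.
 rewrite -(integral_mpres (@mpres_shift R a) mk'); apply: eq_integral => t _.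
 by rewrite !patchE !mem_setE !in_itv/= !lerD2r.
by apply: eqc; [exact: E hm.1|exact: E hm.2].
Qed.

Lemma cmean_shift (h : R -> C) (a : R) : 0 <= a <= 2 * pi -> (forall t, rccont h t) ->
 (forall t, h (t + 2 * pi) = h t) -> cmean (fun t => h (t + a)) = cmean h.
move=> /andP[a0 a2] hc hp; have p0 := pi_gt0 R.
rewrite /cmean; congr (_ * _); rewrite icint_shift//.
have sc x y : seg_cont h x y by move=> t _; exact: hc.
have hk : - pi <= - pi + a by rewrite lerDl.
have hl : - pi + a <= pi by clear -a2; lra.
have hm : pi <= pi + a by rewrite lerDl.
rewrite (icint_split (m := pi))// [RHS](icint_split (m := - pi + a))// addrC; congr (_ + _).
have e1 : - pi + 2 * pi = pi :> R by ring.
have e2 : - pi + a + 2 * pi = pi + a by ring.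
have := icint_shift (2 * pi) (- pi) (- pi + a) hc; rewrite e1 e2 => <-; apply: eq_icint => t _; exact: hp.
Qed.

Lemma unit_eit (z : C) : normc z = 1 -> exists2 a : R, 0 <= a <= 2 * pi & z = eit a.
move=> z1; have n1 : cRe z ^+ 2 + cIm z ^+ 2 = 1 by rewrite -sqr_normcE z1 expr1n.
have x1 : -1 <= cRe z <= 1.
 by rewrite -ler_norml -(@expr_le1 _ 2)// -normrX ger0_norm ?sqr_ge0// -n1 lerDl sqr_ge0.
have xI : cRe z \in `[-1, 1] by rewrite in_itv.
have s : sin (acos (cRe z)) = `|cIm z|.
 by rewrite sin_acos ?x1// -n1 addrAC subrr add0r sqrtr_sqr.
have [a0 a1] : 0 <= acos (cRe z) /\ acos (cRe z) <= pi.
 by split; [exact: acos_ge0|exact: acos_lepi].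
have p0 := pi_gt0 R.
have [y0|y0] := leP 0 (cIm z).
 exists (acos (cRe z)); first by rewrite a0; clear -a1 p0; lra.
 by apply: eqc; rewrite /eit /cexp/= expR0 !mul0r ?subr0 ?addr0 mul1r ?acosK// s ger0_norm.
exists (2 * pi - acos (cRe z)); first by apply/andP; split; clear -a0 a1 p0; lra.
have c2 : cos (2 * pi - acos (cRe z)) = cRe z.
 by rewrite addrC mulr_natl cosD2pi cosN acosK.
have s2 : sin (2 * pi - acos (cRe z)) = cIm z.
 by rewrite addrC mulr_natl sinD2pi sinN s ltr0_norm ?opprK.
by apply: eqc; rewrite /eit /cexp/= expR0 !mul0r ?subr0 ?addr0 mul1r.
Qed.

Lemma eit2pi (t : R) : eit (t + 2 * pi) = eit t.
by rewrite /eit /cexp/= mulr_natl cosD2pi sinD2pi. Qed.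
Lemma eitD (s t : R) : eit (s + t) = eit s * eit t.
by rewrite /eit -cexpD; congr cexp; apply: eqc; rewrite /= ?addr0. Qed.

(** On the circle [|u| = |z|] the conjugate of [u] is [|z|^2 / u], so the integrand is the
    restriction of a function holomorphic for [r |z|^2 < |u| < 1]. Moving to the circle [|u| = q]
    frees the argument of [f] from [z], which then enters through [|z|^2] only. *)
Lemma contour_shift (f : C -> C) (r q s : R) (z : C) :
 (forall w, normc w < 1 -> holo f w) -> 0 <= r -> r < q -> q < 1 -> normc z < 1 ->
 cmean (fun t => f (eit t * z) * cpow (1 - r%:C * (eit t * z)^*) s) =
 cmean (fun t => f (q%:C * eit t) * cpow (1 - (normc z ^+ 2)%:C * ((r / q)%:C * eit (- t))) s).
move=> hf r0 rq q1 z1; have q0 : 0 < q := le_lt_trans r0 rq.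
have [->|zn] := eqVneq z 0.
 rewrite [LHS](@eq_cmean _ _ (fun=> f 0)); last first.
  by move=> t; rewrite mulr0 rmorph0 mulr0 subr0 cpow1 mulr1.
 rewrite cmean_cst [RHS](@eq_cmean _ _ (fun t => f (q%:C * eit t))); last first.
  by move=> t; rewrite normc0 expr0n mul0r subr0 cpow1 mulr1. rewrite mean_value//; first exact: ltW.
 by move=> w wq; apply: hf; exact: le_lt_trans q1.
set p := normc z; have p0 : 0 < p by rewrite normc_gt0.
have pC : (p%:C != 0 :> C) by rewrite RC_eq0 gt_eqF.
have [|a a2 za] := @unit_eit (z / p%:C).
 by rewrite normcM normcV normcR gtr0_norm// divff// gt_eqF.
have zE : z = p%:C * eit a by rewrite -za mulrC divfK.
pose G (u : C) := f u * cpow (1 - (r * p ^+ 2)%:C / u) s.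
(* [z] is [p eit a], so the left side is the mean of [G] over [|u| = p] with the angle shifted by
   [a]. *)
have GL t : f (eit t * z) * cpow (1 - r%:C * (eit t * z)^*) s = G (p%:C * eit (t + a)).
 have -> : eit t * z = p%:C * eit (t + a) by rewrite zE eitD; ring. rewrite /G; congr (_ * cpow (1 - _) _).
 rewrite conjcM conjcR -eitN eitNV RCM expr2 RCM. by have e0 := eit_neq0 (t + a); field; rewrite pC e0.
have GR t : f (q%:C * eit t) * cpow (1 - (p ^+ 2)%:C * ((r / q)%:C * eit (- t))) s = G (q%:C * eit t).
 rewrite /G; congr (_ * cpow (1 - _) _).
 rewrite eitNV !RCM RCV; have e0 := eit_neq0 t; have qC : (q%:C != 0 :> C) by rewrite RC_eq0 gt_eqF.
 by field; rewrite qC e0.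
rewrite (eq_cmean GL) (eq_cmean GR).
have rp2 : r * p ^+ 2 < Num.min p q.
 rewrite lt_min; apply/andP; split. rewrite expr2 mulrA gtr_pMl// (@le_lt_trans _ _ r) ?(lt_trans rq)//.
  by rewrite ler_piMr// ltW. by rewrite (le_lt_trans _ rq)// ler_piMr// expr_le1 ?ltW.
have m0 : 0 < Num.min p q by rewrite lt_min p0.
have hG u : Num.min p q <= normc u -> normc u < 1 -> holo G u.
 move=> u0 u1; have un : 0 < normc u by exact: lt_le_trans u0. apply: holoM; first exact: hf.
 have uC : u != 0 by rewrite -normc_gt0. apply: (@holo_comp _ (fun w => cpow w s)).
  apply: holoB; first exact: holo_cst. apply: holoM; first exact: holo_cst.
  by apply: holoV => //; exact: holo_id.
 exists (cpow (1 - (r * p ^+ 2)%:C / u) s * (s%:C / (1 - (r * p ^+ 2)%:C / u))).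
 apply: cdiff_cpowE; rewrite ReD ReN/= subr_gt0.
 rewrite (le_lt_trans (Re_le_normc _))// normcM normcR normcV ger0_norm ?mulr_ge0 ?exprn_ge0 ?(ltW p0)//.
 by rewrite ltr_pdivrMr// mul1r (lt_le_trans rp2).
have rc k t : Num.min p q <= k -> k < 1 -> rccont (fun t => G (k%:C * eit t)) t.
 move=> k1 k2; have k0 : 0 <= k by rewrite ltW// (lt_le_trans m0).
 by apply: rccont_circle; apply: holo_ccont; apply: hG; rewrite normc_reit.
transitivity (cmean (fun t => G (p%:C * eit t))).
 apply: (@cmean_shift (fun t => G (p%:C * eit t)) a a2). by move=> t; apply: rc; rewrite ?ge_min ?lexx.
 by move=> t; rewrite eit2pi.
clear GL GR.
have [pq|qp] := leP p q.
 apply: circle_mean_eq => // u /andP[pu uq]; apply: hG; last exact: le_lt_trans q1. by rewrite ge_min pu.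
symmetry; apply: circle_mean_eq => //; first exact: ltW.
move=> u /andP[qu up]; apply: hG; last exact: le_lt_trans z1.
by rewrite ge_min qu orbT.
Qed.

End CircleRotation.

(** * Hermitian geometry in coordinates; measurability of continuous functions *)

Section Coordinates.
Variable R : realType.
Notation C := R[i].
Notation RR := (RxR R).
Implicit Types n : nat.

Definition ofCn n (z : Cn R n) : n.-tuple RR :=
 [tuple (cRe (z ord0 i), cIm (z ord0 i)) | i < n].

Lemma toCnE n (x : n.-tuple RR) i : toCn x ord0 i = (tnth x i).1 +i* (tnth x i).2.
by rewrite mxE. Qed.

Lemma ofCnK n : cancel (@ofCn n) (@toCn R n).
move=> z; apply/matrixP => i j; rewrite (ord1 i) toCnE tnth_mktuple/=.
by apply: eqc.
Qed.

Lemma toCnK n : cancel (@toCn R n) (@ofCn n).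
by move=> x; apply: eq_from_tnth => i; rewrite tnth_mktuple toCnE/=; case: (tnth x i).
Qed.

Lemma sqnormE n (z : Cn R n) : sqnorm z = \sum_(i < n) normc (z ord0 i) ^+ 2.
rewrite /sqnorm /dotCn Re_sum; apply: eq_bigr => i _.
by rewrite mulcJ.
Qed.

Lemma sqnorm_toCn n (x : n.-tuple RR) : sqnorm (toCn x) = tsq x.
by rewrite sqnormE; apply: eq_bigr => i _; rewrite toCnE sqr_normcE. Qed.
Lemma sqnorm_ge0 n (z : Cn R n) : 0 <= sqnorm z.
by rewrite sqnormE; apply: sumr_ge0 => i _; rewrite sqr_ge0. Qed.

Lemma dotCnn n (z : Cn R n) : dotCn z z = (sqnorm z)%:C.
apply: eqc => //=; rewrite /dotCn Im_sum; apply: big1 => i _.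
by rewrite mulcJ.
Qed.

Lemma dotCnDl n (x y z : Cn R n) : dotCn (x + y) z = dotCn x z + dotCn y z.
by rewrite /dotCn -big_split/=; apply: eq_bigr => i _; rewrite mxE mulrDl. Qed.
Lemma dotCnZl n (a : C) (x z : Cn R n) : dotCn (a *: x) z = a * dotCn x z.
by rewrite /dotCn mulr_sumr; apply: eq_bigr => i _; rewrite mxE -mulrA. Qed.

Lemma dotCnJ n (x y : Cn R n) : dotCn y x = (dotCn x y)^*.
rewrite /dotCn rmorph_sum/=; apply: eq_bigr => i _.
by rewrite conjcM conjCK mulrC.
Qed.

Lemma dotCnDr n (x y z : Cn R n) : dotCn x (y + z) = dotCn x y + dotCn x z.
by rewrite dotCnJ dotCnDl conjcD -!dotCnJ. Qed.
Lemma dotCnZr n (a : C) (x z : Cn R n) : dotCn x (a *: z) = a^* * dotCn x z.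
by rewrite dotCnJ dotCnZl conjcM -dotCnJ. Qed.
Lemma dotCn0l n (x : Cn R n) : dotCn 0 x = 0.
by rewrite -[0](scale0r (0 : Cn R n)) dotCnZl mul0r. Qed.
Lemma dotCn0r n (x : Cn R n) : dotCn x 0 = 0.
by rewrite dotCnJ dotCn0l rmorph0. Qed.

Lemma sqnormD n (x y : Cn R n) : sqnorm (x + y) = sqnorm x + 2 * cRe (dotCn x y) + sqnorm y.
rewrite /sqnorm dotCnDl !dotCnDr !ReD [dotCn y x]dotCnJ ReJ; ring.
Qed.

Lemma sqnormZ n (a : C) (x : Cn R n) : sqnorm (a *: x) = normc a ^+ 2 * sqnorm x.
by rewrite /sqnorm dotCnZl dotCnZr mulrA mulcJ ReZ. Qed.
Lemma sqnorm0 n : sqnorm (0 : Cn R n) = 0.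
by rewrite /sqnorm dotCn0l. Qed.

Lemma sqnorm_eq0 n (x : Cn R n) : sqnorm x = 0 -> x = 0.
rewrite sqnormE => /eqP; rewrite psumr_eq0 => [/allP h|i _]; last exact: sqr_ge0.
apply/matrixP => i j; rewrite (ord1 i) mxE; apply/eqP; rewrite -normc_eq0.
by have := h j (mem_index_enum _); rewrite /= sqrf_eq0.
Qed.

Lemma cauchy_schwarzCn n (x y : Cn R n) : normc (dotCn x y) ^+ 2 <= sqnorm x * sqnorm y.
have [y0|y0] := eqVneq (sqnorm y) 0.
 by rewrite (sqnorm_eq0 y0) dotCn0r normc0 expr0n sqnorm0 mulr0.
have yp : 0 < sqnorm y by rewrite lt_neqAle eq_sym y0 sqnorm_ge0.
pose a : C := - (dotCn x y / (sqnorm y)%:C).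
have := sqnorm_ge0 (x + a *: y).
rewrite sqnormD sqnormZ dotCnZr /a conjcN conjcM conjcV conjcR.
have -> : - ((dotCn x y)^* / (sqnorm y)%:C) * dotCn x y = (- (normc (dotCn x y) ^+ 2 / sqnorm y))%:C.
 by rewrite mulNr mulrAC [_^* * _]mulrC mulcJ -RCV -RCM -RCN.
rewrite normcN normcM normcV normcR gtr0_norm//= exprMn exprVn.
set N := normc _ ^+ 2 => h.
have : 0 <= (sqnorm x * sqnorm y - N) / sqnorm y.
 by apply: le_trans h _; apply: eqle; field.
by rewrite pmulr_lge0 ?invr_gt0// subr_ge0.
Qed.

(** The squared distance: no root is taken, here or in [tcont] and [tccont]. *)
Definition tdist n (x y : n.-tuple RR) : R := sqnorm (toCn x - toCn y).

Definition tcont n (F : n.-tuple RR -> R) x := forall e : R, 0 < e -> exists2 d : R, 0 < d &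
 forall y, tdist y x < d -> `|F y - F x| < e.

Definition rnd (k : nat) (a : R) : int := Num.floor (a * k.+1%:R).

Lemma rndP k a : `|(rnd k a)%:~R / k.+1%:R - a| <= k.+1%:R^-1.
have k0 : 0 < k.+1%:R :> R by rewrite ltr0n.
have := floor_eq (a * k.+1%:R) (rnd k a); rewrite eqxx => /esym/andP[h1 h2].
rewrite -(ler_pM2r k0) mulVf ?gt_eqF// -[X in _ * X](gtr0_norm k0) -normrM mulrBl divfK ?gt_eqF//.
move: h2; rewrite intrD => h2; rewrite ler_norml; apply/andP; split; clear -h1 h2; lra.
Qed.

(** Rounding to the grid of mesh [1 / (k + 1)]. The result is a tuple of integers, a countable type,
    so the fibres are countably many measurable cells. *)
Definition trnd n k (x : n.-tuple RR) : n.-tuple (int * int) :=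
 [tuple (rnd k (tnth x i).1, rnd k (tnth x i).2) | i < n].

Definition unrnd n k (v : n.-tuple (int * int)) : n.-tuple RR :=
 [tuple ((tnth v i).1%:~R / k.+1%:R, (tnth v i).2%:~R / k.+1%:R) | i < n].

Lemma meas_trnd n k (v : n.-tuple (int * int)) : measurable [set x : n.-tuple RR | trnd k x = v].
have mr (z : int) : measurable [set a : mR R | rnd k a = z].
 rewrite (_ : [set a | _] = (fun a : mR R => a * k.+1%:R : mR R) @^-1` `[z%:~R, (z + 1)%:~R[); last first.
  apply/seteqP; split => a /=; rewrite in_itv/= -floor_eq. by move=> <-. by move=> /eqP.
 rewrite -[X in measurable X]setTI. have : mfun (fun a : mR R => a * k.+1%:R : mR R).
  by apply: mfunM => //; exact: mcst. exact.
rewrite (_ : [set x | _] = \bigcap_(i in [set: 'I_n])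
  ((fun x : n.-tuple RR => tnth x i) @^-1` ([set a | rnd k a = (tnth v i).1] `*` [set a | rnd k a = (tnth v i).2]))).
 apply: fin_bigcap_measurable => [|i _]; first exact: finite_finset.
 rewrite -[X in measurable X]setTI; apply: measurable_tnth => //. exact: measurableX.
apply/seteqP; split => x /=.
 by move=> <- i _ /=; rewrite tnth_mktuple.
move=> h; apply: eq_from_tnth => i; rewrite tnth_mktuple.
by have [/= -> ->] := h i I; case: (tnth v i).
Qed.

Lemma tdist_unrnd n k (x : n.-tuple RR) : tdist (unrnd k (trnd k x)) x <= n%:R * 2 / k.+1%:R.
rewrite /tdist sqnormE (_ : n%:R * 2 / k.+1%:R = \sum_(i < n) (2 / k.+1%:R)); last first.
 by rewrite sumr_const card_ord -mulrA mulr_natl.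
apply: ler_sum => i _; rewrite !mxE sqr_normcE !tnth_mktuple/=.
have k0 : 0 < k.+1%:R :> R by rewrite ltr0n.
have h a : ((rnd k a)%:~R / k.+1%:R - a) ^+ 2 <= k.+1%:R^-1.
 have := rndP k a; set b := _ - a => hb. rewrite -[b ^+ 2]ger0_norm ?sqr_ge0// normrX expr2.
 rewrite (le_trans (ler_pM _ _ hb hb))// ler_piMr ?invr_ge0 ?(ltW k0)// invf_le1//. by rewrite ler1n.
by rewrite mulrDl mul1r lerD// h.
Qed.

(** The sigma-algebra of tuples is the product one; continuity enters by writing [F] as the limit of
    functions constant on grid cells. The grid point may fall outside [D], but only continuity of
    [F] at points of [D] is used. *)
Lemma meas_tcont n (D : set (n.-tuple RR)) (F : n.-tuple RR -> R) :
 (forall x, D x -> tcont F x) -> measurable_fun D F.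
move=> hF; apply: (measurable_fun_cvg (h := fun k x => F (unrnd k (trnd k x)))).
 move=> k; apply: measurable_funTS => _ Y mY; rewrite setTI.
 rewrite (_ : _ @^-1` Y = \bigcup_j (if unpickle j is Some v then
   if F (unrnd k v) \in Y then [set x | trnd k x = v] else set0 else set0)).
  apply: bigcupT_measurable => j; case: unpickle => // v.
  by case: ifP => _; [exact: meas_trnd|exact: measurable0]. apply/seteqP; split => x /=.
  by move=> Yx; exists (pickle (trnd k x)) => //=; rewrite pickleK mem_set.
 by move=> [j _]; case: unpickle => //= v; case: ifPn => //= /set_mem Yv xv; rewrite xv.
move=> x Dx; apply/cvgrPdist_lt => e e0; have [d d0 dP] := hF x Dx e e0.
have : (harmonic : R^nat) @ \oo --> (0 : R) by exact: cvg_harmonic.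
move=> /cvgrPdist_lt/(_ (d / (n%:R * 2 + 1))).
have n0 : 0 < n%:R * 2 + 1 :> R by rewrite ltr_wpDl// mulr_ge0.
rewrite divr_gt0// => /(_ isT) H.
near=> k; rewrite distrC; apply: dP; apply: le_lt_trans (tdist_unrnd k x) _.
have : `|0 - harmonic k| < d / (n%:R * 2 + 1) by near: k.
rewrite sub0r normrN ger0_norm ?harmonic_ge0// /harmonic/= ltr_pdivlMr// mulrC => h.
by rewrite (le_lt_trans _ h)// ler_wpM2r ?invr_ge0// lerDl.
Unshelve. all: by end_near. Qed.

Definition tccont n (F : n.-tuple RR -> C) x := forall e : R, 0 < e -> exists2 d : R, 0 < d &
 forall y, tdist y x < d -> normc (F y - F x) < e.

Lemma cmeas_tccont n (D : set (n.-tuple RR)) (F : n.-tuple RR -> C) :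
 (forall x, D x -> tccont F x) -> cmeas D F.
move=> h; split; apply: meas_tcont => x Dx e e0; have [d d0 dP] := h x Dx e e0;
 exists d => // y /dP hy. by rewrite -ReN -ReD (le_lt_trans (normRe _)).
by rewrite -ImN -ImD (le_lt_trans (normIm _)).
Qed.

Lemma differentiable_tccont n (f : Cn R n -> cplx R) (x : n.-tuple RR) :
 differentiable f (toCn x) -> tccont (fun y => f (toCn y)) x.
move=> /differentiable_continuous fc e e0.
have H := (cvg_normcP _ _).1 fc e e0; have [d /= d0 dP] := (nbhs_ballP _ _).1 (H _).
have dr : d = (cRe d)%:C by case: d d0 {dP} => a b; rewrite ltcE/= => /andP[/eqP -> _].
have d1 : 0 < cRe d by move: d0; rewrite {1}dr ltcR.
exists (cRe d ^+ 2); first by rewrite exprn_gt0.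
move=> y yx; apply: dP; rewrite /ball/= /mx_ball; split => // i j; rewrite (ord1 i) /ball/=.
rewrite normr_normc dr ltcR normcB -(ltr_pXn2r (n := 2)) ?nnegrE ?nc_ge0 ?ltW//.
apply: le_lt_trans yx; rewrite /tdist sqnormE (bigD1 j)//= !mxE lerDl.
by apply: sumr_ge0 => k _; rewrite sqr_ge0.
Qed.

End Coordinates.

Section CpowMeasurable.
Context d (T : measurableType d) (R : realType) (D : set T).
Hypothesis mD : measurable D.
Notation C := R[i].

Lemma meas_invR : measurable_fun [set: mR R] (fun x : mR R => x^-1 : mR R).
rewrite (_ : (fun x => _) = fun x : mR R => if 0 <= (x : R) then (x : R) `^ (-1) else - ((- (x : R)) `^ (-1))).
 apply: measurable_fun_ifT.
 - by apply: measurable_fun_ler => //; exact: mcst.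
 - exact: measurable_powR.
 - apply: measurable_funN; apply: (mcomp (measurable_powR _)). exact: measurable_funN.
apply/funext => x; case: ifPn => [x0|]; first by rewrite powR_inv1.
by rewrite -ltNge => x0; rewrite powR_inv1 ?oppr_ge0 ?ltW// invrN opprK.
Qed.

Lemma cmeas_cpow (h : T -> C) s : cmeas D h -> cmeas D (fun x => cpow (h x) s).
move=> mh; have [h1 h2] := mh.
have mt : measurable_fun D (fun x => s * atan (cIm (h x) / cRe (h x))).
 apply: mfunM; first exact: mcst. apply: (mcomp (f := @atan R)).
  by apply: continuous_measurable_fun; exact: continuous_atan.
 by apply: mfunM => //; exact: (mcomp meas_invR).
apply: cmeasM => //.
 apply: cmeasR; apply: (mcomp (measurable_powR s)). exact: cmeas_normc.
split => /=.
 apply: (mcomp (f := @cos R)) => //. by apply: continuous_measurable_fun; exact: continuous_cos.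
apply: (mcomp (f := @sin R)) => //.
by apply: continuous_measurable_fun; exact: continuous_sin.
Qed.

End CpowMeasurable.

(** * Averages over rotations and the reproducing formula on an axis *)

Section RotationAverage.
Variable R : realType.
Notation C := R[i].
Notation RR := (RxR R).
Notation leb := (@lebesgue_measure R).
Implicit Types n : nat.

(** Only the coordinates selected by [b] turn, since the first coordinate and the others are
    averaged separately. *)
Definition trot n (b : pred nat) (t : R) (x : n.-tuple RR) : n.-tuple RR :=
 [tuple (if b i then (cos t * (tnth x i).1 - sin t * (tnth x i).2, sin t * (tnth x i).1 + cos t * (tnth x i).2)
  else tnth x i) | i < n].

Lemma trotE n b t (x : n.-tuple RR) i :
 toCn (trot b t x) ord0 i = (if b i then eit t else 1) * toCn x ord0 i.
rewrite !toCnE tnth_mktuple; case: ifP => _; last by rewrite mul1r.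
by apply: eqc; rewrite /eit /cexp/= expR0 !mul0r ?subr0 ?addr0 !mul1r// addrC.
Qed.

Lemma tsq_trot n b t (x : n.-tuple RR) : tsq (trot b t x) = tsq x.
rewrite -!sqnorm_toCn !sqnormE; apply: eq_bigr => i _; rewrite trotE normcM.
by case: ifP => _; rewrite ?normc_eit ?normc1 mul1r.
Qed.

Lemma trotK n b t : cancel (@trot n b t) (@trot n b (- t)).
move=> x; apply: (can_inj (@toCnK R n)); apply/matrixP => i j; rewrite (ord1 i) !trotE.
by case: ifP => _; rewrite ?mul1r// mulrA eitNV mulVf ?mul1r// eit_neq0.
Qed.

Lemma meas_trot2 n b d (T : measurableType d) (g : T -> R) (f : T -> n.-tuple RR) :
 mfun g -> mfun f -> mfun (fun p => trot b (g p) (f p)).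
move=> mg mf; apply/measurable_fun_tnthP => i.
have mfi : mfun (fun p => tnth (f p) i) by exact: (mcomp (measurable_tnth i)).
have -> : (fun t => tnth t i) \o (fun p => trot b (g p) (f p)) = fun p =>
  if b i then (cos (g p) * (tnth (f p) i).1 - sin (g p) * (tnth (f p) i).2,
   sin (g p) * (tnth (f p) i).1 + cos (g p) * (tnth (f p) i).2) else tnth (f p) i.
 by apply/funext => p /=; rewrite tnth_mktuple.
case: (b i) => //.
have mc : mfun (fun p => cos (g p)).
 by apply: (mcomp (f := @cos R)) => //; apply: continuous_measurable_fun; exact: continuous_cos.
have ms : mfun (fun p => sin (g p)).
 by apply: (mcomp (f := @sin R)) => //; apply: continuous_measurable_fun; exact: continuous_sin.
have m1 := mcomp measurable_fst mfi; have m2 := mcomp measurable_snd mfi.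
apply/measurable_fun_pairP; split; rewrite /comp/=.
 by apply: mfunB; apply: mfunM.
by apply: measurable_funD; apply: mfunM.
Qed.

Lemma mpres_trot n b t : mpres (vol R n) (trot b t).
apply: mpres_isometry.
- by apply: meas_trot2 => //; exact: mcst.
- move=> x y; apply: eq_from_tnth => i; rewrite !tnth_mktuple; case: ifP => //= _.
 by congr pair; ring.
- by move=> y; exists (trot b (- t) y); have := @trotK n b (- t) y; rewrite opprK.
- by move=> x; rewrite tsq_trot.
Qed.

(** Integrating out the [m] other coordinates raises the exponent of the weight by [m]; what is left
    depends on the squared modulus of the first coordinate, to which [radial] applies. *)
Lemma ge0_slice_radial m (a : R) (h : R -> R) : -1 < a ->
 mfun (h : mR R -> mR R) -> (forall t, 0 <= h t) ->
 (\int[vol R m.+1]_x (h (sq2 (tnth x ord0)) * pw 1 a (tsq x))%:E =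
  (pi ^+ m.+1 / rising a m)%:E * \int[leb]_(t in `[0%R, 1%R[) (h t * (1 - t) `^ (a + m%:R))%:E)%E.
move=> a1 mh h0; have r0 := rising_gt0 m a1.
have mhs : mfun (fun x : m.+1.-tuple RR => h (sq2 (tnth x ord0))).
 apply: (mcomp mh); apply: (mcomp (@meas_sq2 R)). exact: measurable_tnth.
rewrite ge0_integral_vol_cons; last 2 first.
- by apply/mEFinP; apply: mfunM => //; have /mEFinP := @meas_pw_tsq R m.+1 1 a.
- by move=> x; rewrite lee_fin mulr_ge0 ?pw_ge0.
transitivity (\int[@lebesgue2 R]_p ((pi ^+ m / rising a m)%:E * (h (sq2 p) * pw 1 (a + m%:R) (sq2 p))%:E))%E.
 apply: eq_integral => p _. under eq_integral => y _ do rewrite tnth0 tsq_cons/= -/(sq2 p) EFinM.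
 rewrite ge0_integralZl//; last 3 first.
 - have -> : (fun y : m.-tuple RR => (pw 1 a (sq2 p + tsq y))%:E) = (fun y => (pw (1 - sq2 p) a (tsq y))%:E).
   by apply/funext => y; rewrite /pw ltrBrDl opprD addrA. exact: meas_pw_tsq.
 - by move=> y _; rewrite lee_fin pw_ge0.
 - by rewrite lee_fin. rewrite -EFinM mulrCA EFinM; congr (_ * _)%E. have [pu|pu] := ltP (sq2 p) 1.
  have pu' : 0 < 1 - sq2 p by rewrite subr_gt0.
  rewrite (_ : _ / _ * _ = pi ^+ m * (1 - sq2 p) `^ (a + m%:R) / rising a m); last first.
   by rewrite /pw pu mulrAC. rewrite -(integral_vol_pw _ a1 pu').
  by apply: eq_integral => y _; rewrite /pw ltrBrDl opprD addrA.
 rewrite (_ : pw 1 (a + m%:R) (sq2 p) = 0); last by rewrite /pw ltNge pu. rewrite mulr0 integral0_eq// => y _.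
 by rewrite /pw ltNge (le_trans pu)//= lerDl tsq_ge0.
have mhp : mfun (fun t : mR R => (h t * pw 1 (a + m%:R) t)%:E).
 by apply/mEFinP; apply: mfunM => //; exact: meas_pw.
rewrite ge0_integralZl//; last 3 first.
- exact: (mcomp mhp (@meas_sq2 R)).
- by move=> p _; rewrite lee_fin mulr_ge0 ?pw_ge0.
- by rewrite lee_fin divr_ge0 ?exprn_ge0 ?pi_ge0 ?(ltW r0).
rewrite (radial mhp); last by move=> t; rewrite lee_fin mulr_ge0 ?pw_ge0.
rewrite muleA -EFinM mulrAC -exprSr; congr (_ * _)%E.
rewrite [LHS]integral_mkcond [RHS]integral_mkcond.
apply: eq_integral => t _; rewrite !patchE /pw !mem_setE !in_itv/= andbT.
by case: (0 <= t) => //=; case: ltP => // _; rewrite mulr0.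
Qed.

Lemma slice_radial m (a : R) (h : R -> R) : -1 < a ->
 mfun (h : mR R -> mR R) -> leb.-integrable `[0%R, 1%R[ (fun t : mR R => (h t * (1 - t) `^ (a + m%:R))%:E) ->
 \int[vol R m.+1]_x (h (sq2 (tnth x ord0)) * pw 1 a (tsq x)) =
  (pi ^+ m.+1 / rising a m) * \int[leb]_(t in `[0%R, 1%R[) (h t * (1 - t) `^ (a + m%:R)) /\
 (vol R m.+1).-integrable setT (fun x => (h (sq2 (tnth x ord0)) * pw 1 a (tsq x))%:E).
move=> a1 mh hi; have k0 : 0 <= pi ^+ m.+1 / rising a m.
 by rewrite divr_ge0 ?exprn_ge0 ?pi_ge0 ?(ltW (rising_gt0 m a1)).
have mk (k : R -> R) : mfun (k : mR R -> mR R) ->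
  mfun (fun x : m.+1.-tuple RR => (k (sq2 (tnth x ord0)) * pw 1 a (tsq x))%:E).
 move=> mk; apply/mEFinP; apply: mfunM. apply: (mcomp mk); apply: (mcomp (@meas_sq2 R)).
  exact: measurable_tnth. by have /mEFinP := @meas_pw_tsq R m.+1 1 a.
have mk2 (k : R -> R) : mfun (k : mR R -> mR R) ->
  measurable_fun (`[0%R, 1%R[%classic : set (mR R)) (fun t : mR R => (k t * (1 - t) `^ (a + m%:R))%:E).
 move=> mk2; apply/mEFinP; apply: mfunM; first exact: measurable_funTS.
 by have /mEFinP := @meas_powRB R `[0%R, 1%R[ 1 (a + m%:R).
have pos (k : R -> R) : mfun (k : mR R -> mR R) ->
  (forall t, 0 <= k t) -> (forall t, k t <= `|h t|) ->
  [/\ \int[vol R m.+1]_x (k (sq2 (tnth x ord0)) * pw 1 a (tsq x)) =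
   (pi ^+ m.+1 / rising a m) * \int[leb]_(t in `[0%R, 1%R[) (k t * (1 - t) `^ (a + m%:R)),
   (vol R m.+1).-integrable setT (fun x => (k (sq2 (tnth x ord0)) * pw 1 a (tsq x))%:E) &
   leb.-integrable `[0%R, 1%R[ (fun t : mR R => (k t * (1 - t) `^ (a + m%:R))%:E)]. move=> mK k0' kh.
 have ki : leb.-integrable `[0%R, 1%R[ (fun t : mR R => (k t * (1 - t) `^ (a + m%:R))%:E).
  apply: le_integrable hi => //; first exact: mk2.
  move=> t _; rewrite /= lee_fin !normrM ler_wpM2r// ger0_norm//. have E := ge0_slice_radial m a1 mK k0'.
 have fin : (\int[leb]_(t in `[0%R, 1%R[) (k t * (1 - t) `^ (a + m%:R))%:E < +oo)%E.
  have /integrableP[_] := ki. by under eq_integral do rewrite gee0_abs ?lee_fin ?mulr_ge0 ?powR_ge0//.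
 split => //. rewrite /Rintegral E fineM// ge0_fin_numE//; apply: integral_ge0 => t _.
  by rewrite lee_fin mulr_ge0 ?powR_ge0. apply/integrableP; split; first exact: mk.
 under eq_integral do rewrite gee0_abs ?lee_fin ?mulr_ge0 ?pw_ge0//. by rewrite E lte_mul_pinfty// lee_fin.
have mp : mfun ((fun t => Num.max (h t) 0) : mR R -> mR R).
 by apply: measurable_maxr => //; exact: mcst.
have mn : mfun ((fun t => Num.max (- h t) 0) : mR R -> mR R).
 by apply: measurable_maxr; [exact: measurable_funN|exact: mcst].
have [|t|p1 p2 p3] := pos _ mp.
- by move=> t; rewrite le_max lexx orbT.
- by rewrite ge_max ler_norm normr_ge0.
have [|t|n1 n2 n3] := pos _ mn.
- by move=> t; rewrite le_max lexx orbT.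
- by rewrite ge_max -normrN ler_norm normr_ge0.
have hE t : h t = Num.max (h t) 0 - Num.max (- h t) 0.
 have [h0|h0] := leP 0 (h t). by rewrite (max_idPr _) ?subr0// oppr_le0.
 by rewrite (max_idPl _) ?sub0r ?opprK// oppr_ge0 ltW.
have IE : (fun x : m.+1.-tuple RR => (h (sq2 (tnth x ord0)) * pw 1 a (tsq x))%:E) =
  ((fun x => (Num.max (h (sq2 (tnth x ord0))) 0 * pw 1 a (tsq x))%:E) \-
   (fun x => (Num.max (- h (sq2 (tnth x ord0))) 0 * pw 1 a (tsq x))%:E))%E.
 by apply/funext => x /=; rewrite {1}hE mulrBl.
split; last by rewrite IE; exact: integrableB.
transitivity (\int[vol R m.+1]_x ((Num.max (h (sq2 (tnth x ord0))) 0 * pw 1 a (tsq x)) -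
  (Num.max (- h (sq2 (tnth x ord0))) 0 * pw 1 a (tsq x)))).
 by apply: eq_Rintegral => x _; rewrite -mulrBl -hE.
rewrite RintegralB// p1 n1 -mulrBr -RintegralB//; congr (_ * _).
by apply: eq_Rintegral => t _; rewrite -mulrBl -hE.
Qed.

Lemma rccont_bounded (h : R -> C) (a b : R) : a <= b -> (forall t, rccont h t) ->
 exists2 K, 0 <= K & forall t, a <= t <= b -> normc (h t) <= K.
move=> ab hc; have nc : {within `[a, b], continuous (fun t => normc (h t))}.
 apply: continuous_subspaceT => t; apply/cvgrPdist_lt => e e0; have [d d0 dP] := hc t e e0.
 apply/nbhs_ballP; exists d => // y; rewrite /ball/= distrC => /dP hy.
 by rewrite (le_lt_trans (normc_dist _ _))// normcB.
have [c _ cP] := EVT_max ab nc.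
by exists (normc (h c)) => [|t tab]; [exact: nc_ge0|apply: cP; rewrite in_itv].
Qed.

Lemma cmeas_rccont (h : R -> C) : (forall t, rccont h t) ->
 @cmeas _ (mR R) R setT h.
by move=> hc; split; apply: continuous_measurable_fun => t; have [] := rccont_for (hc t). Qed.

Lemma cmeas_comp d1 d2 (T1 : measurableType d1) (T2 : measurableType d2) (h : T2 -> C) (g : T1 -> T2) :
 cmeas setT h -> mfun g -> cmeas setT (fun x => h (g x)).
by move=> [h1 h2] mg; split; [exact: (mcomp h1)|exact: (mcomp h2)]. Qed.

Lemma cmeasB d (T : measurableType d) (D : set T) (h k : T -> C) : measurable D ->
 cmeas D h -> cmeas D k -> cmeas D (fun x => h x - k x).
move=> mD [h1 h2] [k1 k2]; split.
 by under eq_fun do rewrite ReD ReN; exact: mfunB.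
by under eq_fun do rewrite ImD ImN; exact: mfunB.
Qed.

Lemma cint_indic_itv (h : R -> C) (a b : R) :
 cint leb setT (fun t => (\1_(`[a, b]%classic : set (mR R)) t)%:C * h t) = icint h a b.
apply: eqc; rewrite /icint /cint/= /Rintegral [in RHS]integral_mkcond; congr fine;
 apply: eq_integral => t _; rewrite patchE indicE ?ReZ ?ImZ; case: ifP => _; by rewrite ?mul1r ?mul0r.
Qed.

Lemma cint_mpres d (T : measurableType d) (m : {measure set T -> \bar R}) f (h : T -> C) :
 mpres m f -> cmeas setT h -> cint m setT (fun x => h (f x)) = cint m setT h.
move=> mf [h1 h2]; apply: eqc; rewrite /cint/= /Rintegral; congr fine.
 by apply: (integral_mpres mf (h := fun x => (cRe (h x))%:E)); exact/mEFinP.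
by apply: (integral_mpres mf (h := fun x => (cIm (h x))%:E)); exact/mEFinP.
Qed.

Lemma cintg_mpres d (T : measurableType d) (m : {measure set T -> \bar R}) f (h : T -> C) :
 mpres m f -> cintg m setT h -> cintg m setT (fun x => h (f x)).
move=> mf hi; have [m1 m2] := cintg_measurable hi; have [i1 i2] := hi; split.
 by apply: (integrable_mpres mf (h := fun x => (cRe (h x))%:E)) => //; exact/mEFinP.
by apply: (integrable_mpres mf (h := fun x => (cIm (h x))%:E)) => //; exact/mEFinP.
Qed.

Lemma cmean_swap d (T : measurableType d) (mu : {sigma_finite_measure set T -> \bar R})
  (H : T -> R -> C) (V : R) : cmeas setT (fun p : T * mR R => H p.1 p.2) -> (forall x t, rccont (H x) t) ->
 (forall t, - pi <= t <= pi -> cintg mu setT (H ^~ t)) ->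
 (forall t, - pi <= t <= pi -> (\int[mu]_x (normc (H x t))%:E <= V%:E)%E) ->
 cint mu setT (fun x => cmean (H x)) = cmean (fun t => cint mu setT (H ^~ t)) /\
 cintg mu setT (fun x => cmean (H x)).
move=> mH Hc Hi HV; have p0 := pi_gt0 R.
pose D := `[- pi, pi]%classic : set (mR R).
have mD : measurable D by exact: measurable_itv.
have DP t : (t \in D) = (- pi <= t <= pi) 
 by apply/idP/idP => [/set_mem|h]; [|apply/mem_set]; rewrite /D/= in_itv.
have lD : leb D = (2 * pi)%:E.
 rewrite /D; transitivity (leb (`[- pi, pi]%classic : set R)) => //.
 rewrite lebesgue_measure_itv/= lte_fin ifT; last by clear -p0; lra. by rewrite -EFinB; congr EFin; ring.
have miD : mfun (fun t : mR R => (\1_D t)%:E : \bar R).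
 by apply/mEFinP; exact: measurable_indic.
(* The interval of angles becomes an indicator, so that Fubini is applied on the whole line. *)
pose G (p : T * mR R) : C := (\1_D p.2)%:C * H p.1 p.2.
have mG : cmeas setT G.
 apply: cmeasM => //; apply: cmeasR; apply/mEFinP. exact: meas_indic_comp.
have h1 x : cintg leb setT (fun t => G (x, t)).
 have [i1 i2] := rccont_integrable (fun t (_ : - pi <= t <= pi) => Hc x t).
 have mk (h : R -> R) : leb.-integrable D (fun t => (h t)%:E) -> leb.-integrable setT (fun t => (\1_D t * h t)%:E).
  move=> hi; have := (integrable_mkcond (fun t : mR R => (h t)%:E) mD).1 hi.
  apply: eq_integrable => // t _; rewrite patchE indicE; case: ifP => _; by rewrite ?mul1r ?mul0r.
 have [k1 k2] := (mk _ i1, mk _ i2).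
 by split; [move: k1|move: k2]; apply: eq_integrable => // t _; rewrite /G ?ReZ ?ImZ.
have h2 t : cintg mu setT (fun x => G (x, t)).
 rewrite /G/= indicE; case: (boolP (t \in D)) => [|_]; last first.
  by split; (rewrite (_ : (fun x => _) = cst 0%E); [exact: integrable0|]; apply/funext => x; rewrite ?ReZ ?ImZ mul0r).
 by rewrite DP => tD; exact: (cintgZ measurableT 1 (Hi t tD)).
have mn : mfun (fun p => (normc (G p))%:E).
 by apply/mEFinP; exact: cmeas_normc.
have fin : (\int[mu]_x \int[leb]_t (normc (G (x, t)))%:E < +oo)%E.
 rewrite (@fubini_tonelli _ _ _ _ R mu leb (fun p => (normc (G p))%:E) mn (fun p => nc_ge0 _)).
 apply: (@le_lt_trans _ _ (\int[leb]_t ((\1_D t)%:E * `|V|%:E))%E). apply: ge0_le_integral => //.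
  - by move=> t _; apply: integral_ge0 => x _; rewrite lee_fin nc_ge0.
  - exact: (@measurable_fun_fubini_tonelli_G _ _ T (mR R) R mu (fun p => (normc (G p))%:E) mn (fun p => nc_ge0 _)).
  - by apply: emeasurable_funM. move=> t _; rewrite /G/= indicE; case: (boolP (t \in D)) => [|_].
   rewrite DP => /HV h; under eq_integral do rewrite mul1r. by rewrite mul1e (le_trans h)// lee_fin ler_norm.
  by rewrite mul0e integral0_eq// => x _; rewrite mul0r normc0.
 by rewrite ge0_integralZr// integral_indic// setIT [X in (X * _)%E]lD -EFinM ltry.
have [E I] := cfubini mG fin h1 h2; clear fin.
have cm x : cmean (H x) = ((2 * pi)^-1)%:C * cint leb setT (fun t => G (x, t)).
 by rewrite /G cint_indic_itv.
rewrite (_ : (fun x => cmean (H x)) = fun x => ((2 * pi)^-1)%:C * cint leb setT (fun t => G (x, t))); last first.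
 by apply/funext => x; exact: cm.
split; last exact: (cintgZ measurableT _ I).
rewrite cintZ// E /cmean -cint_indic_itv; congr (_ * _).
apply: eq_cint => t _; rewrite /G/= indicE; case: (t \in D).
 by rewrite !mul1r; apply: eq_cint => x _; rewrite mul1r.
rewrite mul0r; apply: eqc; rewrite /cint/= /Rintegral integral0_eq// => x _;
 by rewrite ?ReZ ?ImZ mul0r.
Qed.

(** Each rotation preserves the volume, so averaging over the angle does not change the integral;
    [cmean_swap] exchanges the two. *)
Lemma cint_average n b (F : n.-tuple RR -> C) : cmeas setT F ->
 cintg (vol R n) setT F -> (forall x t, rccont (fun t => F (trot b t x)) t) ->
 cint (vol R n) setT F = cint (vol R n) setT (fun x => cmean (fun t => F (trot b t x))) /\
 cintg (vol R n) setT (fun x => cmean (fun t => F (trot b t x))).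
move=> mF iF cF.
have mt : mfun (fun p : n.-tuple RR * mR R => trot b p.2 p.1).
 by apply: meas_trot2; [exact: measurable_snd|exact: measurable_fst].
have nF : (\int[vol R n]_x (normc (F x))%:E)%E = (\int[vol R n]_x normc (F x))%:E.
 by rewrite fineK//; exact: (integrable_fin_num _ (cintg_normc measurableT iF)).
have mnF : mfun (fun x => (normc (F x))%:E).
 by apply/mEFinP; exact: cmeas_normc.
have [||E I] := cmean_swap (mu := vol R n) (V := \int[vol R n]_x normc (F x)) (cmeas_comp mF mt) cF.
- by move=> t _; exact: cintg_mpres (mpres_trot n b t) iF.
- by move=> t _; rewrite (ge0_integral_mpres (mpres_trot n b t) mnF (fun x => nc_ge0 _)) nF.
split=> //; rewrite E (@eq_cmean _ _ (fun=> cint (vol R n) setT F)) ?cmean_cst// => t.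
exact: (cint_mpres (mpres_trot n b t) mF).
Qed.

Lemma rccontJ (h : R -> C) t : rccont h t -> rccont (fun t => (h t)^*) t.
by move=> hc e e0; have [d d0 dP] := hc e e0; exists d => // y /dP; rewrite -conjcB normcJ. Qed.

Lemma normc_cpow_bound (v : C) (r s : R) : 0 <= s -> normc v <= r -> r < 1 ->
 normc (cpow (1 - v) (- s)) <= (1 - r) `^ (- s) /\ 0 < cRe (1 - v).
move=> s0 vr r1.
have re : 1 - r <= cRe (1 - v).
 by rewrite ReD ReN/= lerD2l lerN2 (le_trans (Re_le_normc _)).
have re0 : 0 < cRe (1 - v) by apply: lt_le_trans re; rewrite subr_gt0.
split => //; rewrite normc_cpow// !powRN lef_pV2 ?posrE ?powR_gt0 ?subr_gt0 ?normc_gt0 ?Re_gt0_neq0//.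
apply: ge0_ler_powR => //; rewrite ?nnegrE ?subr_ge0 ?nc_ge0 ?(ltW r1)//.
by rewrite (le_trans re)// Re_le_normc.
Qed.

(** Holomorphy along complex lines. It is stable under the affine substitutions used below and is
    all the reproducing formula requires. *)
Definition ghol n (f : Cn R n -> C) := forall (a b : Cn R n) (u : C),
 unit_ball (a + u *: b) -> holo (fun u => f (a + u *: b)) u.

(** After slicing, the exponent [a + m + 2] is exactly the one for which [ker1] has an elementary
    primitive; the kernel of the ball collapses to the Cauchy kernel [1 / (1 - x)]. *)
Lemma slice_ker1 m (a : R) (x : C) : -1 < a -> normc x < 1 ->
 cint (vol R m.+1) setT (fun y => cpow (1 - (sq2 (tnth y ord0))%:C * x) (- (a + m%:R + 2)) * (pw 1 a (tsq y))%:C) =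
 (pi ^+ m.+1 / rising a m.+1)%:C / (1 - x).
move=> a1 x1; set b := a + m%:R; have b1 : -1 < b by rewrite ltr_wpDr.
pose k (t : R) := cpow (1 - t%:C * x) (- (b + 2)).
have mk : @cmeas _ (mR R) R setT k.
 apply: cmeas_cpow; apply: cmeasB => //. by apply: cmeasM => //; exact: cmeasR.
have [k1 k2] := cintg_ker1 b1 x1.
have i1 : leb.-integrable `[0%R, 1%R[ (fun t : mR R => (cRe (k t) * (1 - t) `^ b)%:E).
 by apply: eq_integrable k1 => // t _; rewrite /ker1 ReZ mulrC.
have i2 : leb.-integrable `[0%R, 1%R[ (fun t : mR R => (cIm (k t) * (1 - t) `^ b)%:E).
 by apply: eq_integrable k2 => // t _; rewrite /ker1 ImZ mulrC.
have [e1 _] := slice_radial a1 mk.1 i1; have [e2 _] := slice_radial a1 mk.2 i2.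
transitivity ((pi ^+ m.+1 / rising a m)%:C * cint leb `[0, 1[ (ker1 b x)).
 apply: eqc; rewrite ?ReZ ?ImZ.
  transitivity (\int[vol R m.+1]_y (cRe (k (sq2 (tnth y ord0))) * pw 1 a (tsq y))).
   by apply: eq_Rintegral => y _; rewrite mulrC ReZ mulrC.
  rewrite e1; congr (_ * _); apply: eq_Rintegral => t _; by rewrite /ker1 [in RHS]ReZ mulrC.
 transitivity (\int[vol R m.+1]_y (cIm (k (sq2 (tnth y ord0))) * pw 1 a (tsq y))).
  by apply: eq_Rintegral => y _; rewrite mulrC ImZ mulrC.
 rewrite e2; congr (_ * _); apply: eq_Rintegral => t _; by rewrite /ker1 [in RHS]ImZ mulrC.
rewrite cint_ker1//.
have rE : rising a m.+1 = rising a m * (b + 1).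
 by rewrite /rising big_ord_recr/= -natr1 /b !addrA.
rewrite rE; have r0 := rising_gt0 m a1.
have b10 : 0 < b + 1 by clear -b1; lra.
have x0 : 1 - x != 0.
 by have [_ /Re_gt0_neq0] := @normc_cpow_bound x (normc x) 0 (lexx _) (lexx _) x1.
have rC : (rising a m)%:C != 0 :> C by rewrite RC_eq0 gt_eqF.
have bC : (b + 1)%:C != 0 :> C by rewrite RC_eq0 gt_eqF.
clear e1 e2 i1 i2 k1 k2.
rewrite RCM RCV [in RHS]RCM RCV RCM.
by move: (pi ^+ m.+1)%:C (rising a m)%:C rC (b + 1)%:C bC => P r1 rC bb bC; field; rewrite x0 rC bC.
Qed.

Definition axis m (u : C) : Cn R m.+1 := \row_i (if i == ord0 then u else 0).

Lemma axisZ m (c u : C) : axis m (c * u) = c *: axis m u.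
by apply/matrixP => i j; rewrite !mxE; case: ifP => _; rewrite ?mulr0. Qed.

Lemma sqnorm_axis m u : sqnorm (axis m u) = normc u ^+ 2.
rewrite sqnormE (bigD1 ord0)//= mxE eqxx big1 ?addr0// => i i0.
by rewrite mxE (negPf i0) normc0 expr0n.
Qed.

Lemma dot_axis m u (z : Cn R m.+1) : dotCn (axis m u) z = u * (z ord0 ord0)^*.
rewrite /dotCn (bigD1 ord0)//= mxE eqxx big1 ?addr0// => i i0.
by rewrite mxE (negPf i0) mul0r.
Qed.

Lemma normc_coord_lt1 m (x : m.+1.-tuple RR) : tsq x < 1 -> normc (toCn x ord0 ord0) < 1.
rewrite -sqnorm_toCn sqnormE => h; rewrite -(@expr_lt1 _ 2)// ?nc_ge0//.
by apply: le_lt_trans h; rewrite (bigD1 ord0)//= lerDl sumr_ge0// => i _; rewrite sqr_ge0.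
Qed.

Notation z0 x := (toCn x ord0 ord0).

Lemma rccont_cpow (h : R -> C) (s r t : R) : 0 <= s -> r < 1 -> normc (h t) <= r -> rccont h t ->
 rccont (fun t => cpow (1 - h t) (- s)) t.
move=> s0 r1 hr hc; apply: (@rccont_comp _ (fun w => cpow (1 - w) (- s)) h) => //.
apply: holo_ccont; apply: (@holo_comp _ (fun w => cpow w (- s)) (fun w => 1 - w)).
 by apply: holoB; [exact: holo_cst|exact: holo_id].
exists (cpow (1 - h t) (- s) * ((- s)%:C / (1 - h t))); apply: cdiff_cpowE.
exact: (normc_cpow_bound s0 hr r1).2.
Qed.

(* Averaging over rotations of the coordinates other than the first reduces the
  integral to the slice through the axis; averaging over rotations of the first
  coordinate and shifting the contour then separates [f] from the kernel. *)
Lemma repro_axis m (a r : R) (f : Cn R m.+1 -> C) : -1 < a -> 0 <= r < 1 -> ghol f ->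
 cmeas setT (fun x => f (toCn x)) -> cintg (vol R m.+1) setT (fun x => f (toCn x) * (pw 1 a (tsq x))%:C) ->
 f (axis m r%:C) = (cst_alpha m.+1 a)%:C * cint (vol R m.+1) setT
  (fun x => f (toCn x) * cpow (1 - r%:C * (z0 x)^*) (- (m.+1%:R + 1 + a)) * (pw 1 a (tsq x))%:C).
move=> a1 /andP[r0 r1] hf mf fi; set s := m.+1%:R + 1 + a; set mu := vol R m.+1.
have s0 : 0 <= s by rewrite /s -addrA addr_ge0//; clear -a1; lra.
pose g (z : C) := cpow (1 - r%:C * z^*) (- s).
pose W (x : m.+1.-tuple RR) : C := (pw 1 a (tsq x))%:C.
pose F x := f (toCn x) * g (z0 x) * W x.
have rz z : normc z < 1 -> normc (r%:C * z^*) <= r.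
 by move=> z1; rewrite normcM normcJ normcR ger0_norm// ler_piMr// ltW.
have W0 x : 1 <= tsq x -> W x = 0 by move=> x1; rewrite /W /pw ltNge x1.
have mz : cmeas setT (fun x : m.+1.-tuple RR => z0 x).
 split; under eq_fun do rewrite toCnE/=. by apply: (mcomp measurable_fst); exact: measurable_tnth.
 by apply: (mcomp measurable_snd); exact: measurable_tnth.
have cst1 d (T : measurableType d) (c : C) : cmeas [set: T] (fun=> c) by exact: cmeas_cst.
have mW : cmeas setT W.
 by apply: cmeasR; have /mEFinP := @meas_pw_tsq R m.+1 1 a.
have mF : cmeas setT F.
 apply: cmeasM => //; apply: cmeasM => //; apply: cmeas_cpow; apply: cmeasB => //.
 by apply: cmeasM => //; exact: cmeasJ.
have iF : cintg mu setT F.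
 have hi : mu.-integrable setT (EFin \o (fun x => (1 - r) `^ (- s) * normc (f (toCn x) * W x))).
  exact: (integrableZl measurableT ((1 - r) `^ (- s)) (cintg_normc measurableT fi)).
 apply: (le_cintegrable _ mF hi) => // x _.
 have [x1|x1] := ltP (tsq x) 1; last by rewrite /F W0// !mulr0 normc0 mulr0.
 have -> : F x = f (toCn x) * W x * g (z0 x) by rewrite /F mulrAC.
 rewrite [normc (_ * g _)]normcM mulrC ler_wpM2r ?nc_ge0//.
 exact: (normc_cpow_bound s0 (rz _ (normc_coord_lt1 x1)) r1).1.
have gc (h : R -> C) t : normc (h t) < 1 -> rccont h t -> rccont (fun t => g (h t)) t.
 move=> z1 hc; apply: (rccont_cpow s0 r1 (rz _ z1)). by apply: rccontM; [exact: rccont_cst|exact: rccontJ].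
pose b1 : pred nat := fun i => i != 0%N.
pose b0 : pred nat := fun i => i == 0%N.
have rot1 t x : toCn (trot b1 t x) = axis m (z0 x) + eit t *: (toCn x - axis m (z0 x)).
 apply/matrixP => i j; rewrite (ord1 i) trotE !mxE /b1.
 case: (eqVneq j ord0) => [->|j0]; first by rewrite /= mul1r subrr mulr0 addr0.
 by rewrite ifT ?subr0 ?add0r//; apply: contra_neq j0 => j0; exact/val_inj.
have rot0 t x : z0 (trot b0 t x) = eit t * z0 x by rewrite trotE.
have rot10 t x : z0 (trot b1 t x) = z0 x by rewrite trotE mul1r.
have WT b t x : W (trot b t x) = W x by rewrite /W tsq_trot.
have rcW (h : R -> C) x t : (tsq x < 1 -> rccont h t) -> rccont (fun t => h t * W x) t.
 have [x1 hc|x1 _] := ltP (tsq x) 1; first by apply: rccontM; [exact: hc|exact: rccont_cst].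
 by under eq_fun do rewrite W0// mulr0; exact: rccont_cst.
have cF b x t : rccont (fun t => F (trot b t x)) t.
 rewrite /F; under eq_fun do rewrite WT; apply: rcW => x1; apply: rccontM.
  pose A : Cn R m.+1 := \row_i (if b i then 0 else toCn x ord0 i).
  pose B : Cn R m.+1 := \row_i (if b i then toCn x ord0 i else 0).
  have E u : toCn (trot b u x) = A + eit u *: B.
   apply/matrixP => i j; rewrite (ord1 i) trotE !mxE; case: ifP => _; first by rewrite add0r.
   by rewrite mulr0 addr0 mul1r.
  under eq_fun do rewrite E; apply: (@rccont_comp _ (fun u => f (A + u *: B)) (@eit R)).
   by apply/holo_ccont/hf; rewrite /unit_ball/= -E sqnorm_toCn tsq_trot. exact: rccont_eit.
 apply: gc; first by apply: normc_coord_lt1; rewrite tsq_trot.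
 under eq_fun do rewrite trotE; case: ifP => _; last exact: rccont_cst.
 by apply: rccontM; [exact: rccont_eit|exact: rccont_cst].
have [E1 I1] := cint_average (b := b1) mF iF (cF b1).
pose F1 x := f (axis m (z0 x)) * g (z0 x) * W x.
(* Turning the other coordinates by [u] is holomorphic for [|u| <= 1], and [u = 0] sets them to 0:
   the mean is the value on the axis. The kernel and the weight are unaffected. *)
have mean1 : (fun x => cmean (fun t => F (trot b1 t x))) = F1.
 apply/funext => x; have [x1|x1] := ltP (tsq x) 1; last first.
  rewrite (@eq_cmean _ _ (fun=> 0)); last by move=> u; rewrite /F WT W0// mulr0.
  by rewrite cmean_cst /F1 W0// mulr0.
 pose G u := f (axis m (z0 x) + u *: (toCn x - axis m (z0 x))) * (g (z0 x) * W x).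
 rewrite (@eq_cmean _ _ (fun t => G (1%:C * eit t))); last first.
  move=> t; have e1 : 1%:C * eit t = eit t :> C by exact: mul1r. by rewrite /F rot10 WT rot1 e1 /G [RHS]mulrA.
 rewrite mean_value//; first by rewrite /G scale0r addr0 /F1 mulrA.
 move=> u u1; apply: holoM; last exact: holo_cst. apply: hf; rewrite /unit_ball/=; apply: le_lt_trans x1.
 rewrite -sqnorm_toCn !sqnormE; apply: ler_sum => i _; rewrite !mxE.
 case: (eqVneq i ord0) => [->|i0]; first by rewrite /= subrr mulr0 addr0.
 by rewrite subr0 add0r normcM exprMn ler_piMl ?sqr_ge0// expr_le1 ?nc_ge0.
rewrite mean1 in E1 I1.
have fax u : normc u < 1 -> holo (fun u => f (axis m u)) u.
 move=> u1; have E v : axis m v = 0 + v *: axis m 1 by rewrite -axisZ mulr1 add0r.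
 rewrite (_ : (fun u => _) = fun u => f (0 + u *: axis m 1)); last by apply/funext => v; rewrite E.
 by apply: hf; rewrite /unit_ball/= -E sqnorm_axis expr_lt1 ?nc_ge0.
have rx t (x : m.+1.-tuple RR) : F1 (trot b0 t x) = f (axis m (eit t * z0 x)) * g (eit t * z0 x) * W x.
 by rewrite /F1 rot0 WT.
have c0 x t : tsq x < 1 -> rccont (fun t => f (axis m (eit t * z0 x)) * g (eit t * z0 x)) t.
 move=> x1; have n2 : normc (eit t * z0 x) < 1 by rewrite normcM normc_eit mul1r normc_coord_lt1.
 have ec : rccont (fun t => eit t * z0 x) t by apply: rccontM; [exact: rccont_eit|exact: rccont_cst].
 apply: rccontM; last exact: gc.
 by apply: (@rccont_comp _ (fun u => f (axis m u)) (fun t => eit t * z0 x)) => //; exact/holo_ccont/fax.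
have c1 x t : rccont (fun t => F1 (trot b0 t x)) t.
 by under eq_fun do rewrite rx; apply: rcW => x1; exact: c0.
have [E2 _] := cint_average (b := b0) (cintg_measurable I1) I1 c1.
(* The contour must lie outside the point [r] and inside the unit disc. *)
have [q [rq q1]] : exists q : R, r < q /\ q < 1 by exists ((1 + r) / 2); split; clear -r1; lra.
have q0 : 0 < q by exact: le_lt_trans rq.
pose om t : C := (r / q)%:C * eit (- t).
have om1 t : normc (om t) = r / q.
 by rewrite /om normcM normc_eit mulr1 normcR ger0_norm// divr_ge0// ltW.
have omc t : rccont om t.
 by apply: rccontM; [exact: rccont_cst|under eq_fun do rewrite eitN; apply: rccontJ; exact: rccont_eit].
have rq1 : r / q < 1 by rewrite ltr_pdivrMr// mul1r.
pose u x t : C := (sq2 (tnth x (ord0 : 'I_m.+1)))%:C * om t.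
have nu x t : tsq x < 1 -> normc (u x t) <= r / q.
 move=> /normc_coord_lt1 x1; rewrite normcM om1 normcR ger0_norm ?addr_ge0 ?sqr_ge0//.
 rewrite ler_piMl ?divr_ge0 ?(ltW q0)//.
 by move: x1; rewrite toCnE -(@expr_lt1 _ 2)// ?nc_ge0// sqr_normcE => /ltW.
pose P x t := cpow (1 - u x t) (- s) * W x.
pose H x t := f (axis m (q%:C * eit t)) * P x t.
have uc x t : tsq x < 1 -> rccont (fun t => cpow (1 - u x t) (- s)) t.
 move=> x1; apply: (rccont_cpow s0 rq1 (nu x t x1)). by apply: rccontM => //; exact: rccont_cst.
have fqc t : rccont (fun t => f (axis m (q%:C * eit t))) t.
 apply: (@rccont_comp _ (fun u => f (axis m u)) (fun t => q%:C * eit t)).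
  by apply: holo_ccont; apply: fax; rewrite normc_reit// ltW.
 by apply: rccontM; [exact: rccont_cst|exact: rccont_eit].
have Hc x t : rccont (H x) t.
 by apply: rccontM => //; apply: rcW => x1; exact: uc.
(* From here [f] is evaluated on the fixed circle of radius [q], and [x] is confined to the kernel,
   so the integral over [x] can be computed. *)
have mean2 : (fun x => cmean (fun t => F1 (trot b0 t x))) = fun x => cmean (H x).
 apply/funext => x; have [x1|x1] := ltP (tsq x) 1; last first.
  by apply: eq_cmean => t; rewrite /H /P /F1 WT W0// !mulr0.
 have := @contour_shift R (fun u => f (axis m u)) r q (- s) _ fax r0 rq q1 (normc_coord_lt1 x1).
 have -> : normc (z0 x) ^+ 2 = sq2 (tnth x ord0) by rewrite toCnE sqr_normcE.
 move=> E; transitivity (W x * cmean (fun t => f (axis m (eit t * z0 x)) * cpow (1 - r%:C * (eit t * z0 x)^*) (- s))).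
  rewrite -cmeanZ; last by move=> t; exact: c0. by apply: eq_cmean => t; rewrite rx mulrC.
 rewrite E -cmeanZ; last by move=> t; apply: rccontM => //; exact: uc.
 by apply: eq_cmean => t; rewrite /H /P /u /om [LHS]mulrC -[LHS]mulrA.
rewrite mean2 in E2.
have [K K0 KP] := rccont_bounded (Npi_le_pi R) fqc.
have iW (c : R) : mu.-integrable setT (EFin \o (fun x => c * pw 1 a (tsq x))).
 have iw : mu.-integrable setT (fun x => (pw 1 a (tsq x))%:E).
  apply/integrableP; split; first exact: meas_pw_tsq.
  under eq_integral do rewrite gee0_abs ?lee_fin ?pw_ge0//. by rewrite integral_vol_pw// ltry.
 exact: (integrableZl measurableT _ iw).
have Pb x t : normc (P x t) <= (1 - r / q) `^ (- s) * pw 1 a (tsq x).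
 have [x1|x1] := ltP (tsq x) 1; last by rewrite /P W0// mulr0 normc0 mulr_ge0 ?pw_ge0 ?powR_ge0.
 rewrite normcM /W normcR (ger0_norm (pw_ge0 _ _ _)) ler_wpM2r ?pw_ge0//.
 exact: (normc_cpow_bound s0 (nu x t x1) rq1).1.
have mu1 d (T : measurableType d) (h : T -> m.+1.-tuple RR) (k : T -> C) : mfun h -> cmeas setT k ->
  cmeas setT (fun p => cpow (1 - (sq2 (tnth (h p) ord0))%:C * k p) (- s) * W (h p)).
 move=> mh mk; apply: cmeasM => //; last exact: (cmeas_comp mW).
 apply: cmeas_cpow; apply: cmeasB => //; apply: cmeasM => //; apply: cmeasR.
 by apply: (mcomp (@meas_sq2 R)); exact: (mcomp (measurable_tnth ord0)).
have iP t : cintg mu setT (P ^~ t).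
 apply: (le_cintegrable _ _ (iW ((1 - r / q) `^ (- s)))) => //. exact: (mu1 _ _ id (fun=> om t)).
have Hb x t : - pi <= t <= pi -> normc (H x t) <= K * (1 - r / q) `^ (- s) * pw 1 a (tsq x).
 by move=> tp; rewrite normcM -mulrA ler_pM ?nc_ge0// KP.
have mom : @cmeas _ (mR R) R setT om by exact: cmeas_rccont.
have [|t tp|t tp|E3 _] := cmean_swap (mu := mu) (H := H) (V := \int[mu]_x (K * (1 - r / q) `^ (- s) * pw 1 a (tsq x))) _ Hc.
- apply: cmeasM => //; last by apply: (mu1 _ _ fst (fun p => om p.2)); [exact: measurable_fst|exact: (cmeas_comp mom measurable_snd)].
 by apply: (cmeas_comp (cmeas_rccont fqc)); exact: measurable_snd.
- exact: (cintgZ measurableT _ (iP t)).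
- rewrite fineK; last exact: (integrable_fin_num measurableT (iW _)).
 apply: ge0_le_integral => //; try by move=> x _; rewrite lee_fin ?nc_ge0 ?Hb// mulr_ge0 ?pw_ge0// mulr_ge0 ?powR_ge0.
  apply/mEFinP; apply: cmeas_normc => //.
  exact: (cintg_measurable (cintgZ measurableT (f (axis m (q%:C * eit t))) (iP t))).
 by have /measurable_int := iW (K * (1 - r / q) `^ (- s)).
pose k0 : C := (pi ^+ m.+1 / rising a m.+1)%:C.
(* The integral over [x] turns the kernel into [1 / (1 - om t)], and the mean over [t] is then
   Cauchy's formula at [r]. *)
have E4 t : cint mu setT (H ^~ t) = k0 * (f (axis m (q%:C * eit t)) / (1 - om t)).
 rewrite /H cintZ//; have om11 : normc (om t) < 1 by rewrite om1.
 have sE : - s = - (a + m%:R + 2) by rewrite /s -natr1; ring.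
 by rewrite /P /u /W sE (slice_ker1 m a1 om11) -/k0 mulrCA; congr (_ * _); rewrite mulrC.
have E5 := @cauchy_formula R (fun u => f (axis m u)) r q 1 r0 rq q1 fax.
rewrite -/F [cint _ _ _]E1 E2 E3 (eq_cmean E4) cmeanZ; last first.
 move=> t; apply: rccontM => //. apply: (@rccont_comp _ (fun w => (1 - w)^-1) om) => //.
 apply: holo_ccont; apply: holoV; first by apply: holoB; [exact: holo_cst|exact: holo_id].
 by apply: Re_gt0_neq0; apply: (@normc_cpow_bound _ (r / q) s s0 _ rq1).2; rewrite om1.
rewrite E5 mulrA /k0 -RCM cst_alphaE// mulrC.
have -> : rising a m.+1 / pi ^+ m.+1 * (pi ^+ m.+1 / rising a m.+1) = 1 :> R.
 by rewrite mulrA divfK ?divff// gt_eqF ?rising_gt0// exprn_gt0// pi_gt0.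
by rewrite mulr1.
Qed.

End RotationAverage.

(** * Differentiability in several complex variables *)

Section SeveralVariables.
Variable R : realType.
Notation C := R[i].
Implicit Types n : nat.

Lemma normr_coord n (z : Cn R n) i : `|z ord0 i| <= `|z|.
rewrite [leRHS]/Num.Def.normr/= mx_normE.
by have := le_bigmax 0%:nng (fun i : 'I_1 * 'I_n => `|z i.1 i.2|%:nng) (ord0, i) => /(_ _ _); apply.
Qed.

Lemma normC_real (a : C) : 0 <= a -> a = (cRe a)%:C /\ 0 <= cRe a.
by case: a => x y; rewrite lecE/= => /andP[/eqP -> x0]. Qed.

Lemma sqnorm_le_normr n (z : Cn R n) : sqnorm z <= n%:R * cRe `|z| ^+ 2.
have [zE z0] := normC_real (normr_ge0 z).
have h i : normc (z ord0 i) <= cRe `|z|.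
 by have := normr_coord z i; rewrite normr_normc zE lecR.
rewrite sqnormE (_ : n%:R * _ = \sum_(i < n) cRe `|z| ^+ 2); last first.
 by rewrite sumr_const card_ord mulr_natl.
by apply: ler_sum => i _; rewrite ler_pXn2r ?nnegrE ?nc_ge0.
Qed.

(** An increment bounded by a multiple of [|h|^2] is negligible against [h], so the zero map is the
    differential; uniqueness of the differential delivers it. *)
Lemma differentiable_quadratic n (r : Cn R n -> cplx R) (w : Cn R n) (K d : R) : 0 <= K -> 0 < d ->
 (forall h, sqnorm h < d -> normc (r (w + h) - r w) <= K * sqnorm h) -> differentiable r w.
move=> K0 d0 H.
have DU := @diff_unique _ _ _ r (\0 : {linear (Cn R n) -> (cplx R)}) w (fun x => @cst_continuous _ _ (0 : cplx R) x).
(* The little-o condition is taken verbatim from the premise of [DU]. *)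
lazymatch type of DU with ?Q -> _ => have o0 : Q end.
 apply/eqaddoP => e e0. have [eE e0'] : e = (cRe e)%:C /\ 0 < cRe e.
  by have [E _] := normC_real (ltW e0); split => //; move: e0; rewrite {1}E ltcR.
 set N : R := n%:R + 1; have N0 : 0 < N by rewrite ltr_wpDl.
 pose dl : R := Num.min (Num.min 1 (d / N)) (cRe e / (K * N + 1)).
 have KN : 0 < K * N + 1 by rewrite ltr_wpDl// mulr_ge0// ltW.
 have dl0 : 0 < dl by rewrite !lt_min ltr01 !divr_gt0.
 apply/nbhs_ballP; exists (dl%:C); first by rewrite /= ltcR.
 move=> h; rewrite mx_norm_ball /ball_/= sub0r normrN => hd.
 have [hE h0] := normC_real (normr_ge0 h); set t := cRe `|h| in hE h0.
 have {}hd : t < dl by move: hd; rewrite hE ltcR. move: hd; rewrite !lt_min => /andP[/andP[t1 td] te].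
 have sh : sqnorm h <= N * t ^+ 2. by rewrite (le_trans (sqnorm_le_normr h))// ler_wpM2r ?sqr_ge0// lerDl.
 have t2 : t ^+ 2 <= t by rewrite expr2 ler_piMl// ltW. have hd : sqnorm h < d.
  rewrite (le_lt_trans sh)// (le_lt_trans (ler_wpM2l (ltW N0) t2))//. by rewrite mulrC -ltr_pdivlMr.
 have := H h hd; rewrite [w + h]addrC => hh. rewrite (_ : _ h = r (h + w) - r w); last first.
  by rewrite !fctE /= addr0. rewrite normr_normc eE hE -RCM lecR (le_trans hh)//.
 rewrite (le_trans (ler_wpM2l K0 sh))// expr2 !mulrA ler_wpM2r//.
 have := ltW te; rewrite ler_pdivlMr// => h3; apply: le_trans h3. by rewrite [leRHS]mulrC ler_wpM2r// lerDl.
have dE := DU o0.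
apply/diff_locallyP; rewrite dE; split => //; exact: (fun x => @cst_continuous _ _ (0 : cplx R) x).
Qed.

Definition linform n (d : 'I_n -> C) (h : Cn R n) : C := \sum_(i < n) h ord0 i * d i.

Lemma differentiable_taylor n (f : Cn R n -> cplx R) (w : Cn R n) (c : 'I_n -> C) (K d : R) :
 0 <= K -> 0 < d ->
 (forall h, sqnorm h < d -> normc (f (w + h) - f w - linform c h) <= K * sqnorm h) -> differentiable f w.
move=> K0 d0 H; pose P (z : Cn R n) : cplx R := \sum_(i < n) (z ord0 i * c i).
have dP : differentiable P w.
 rewrite (_ : P = \sum_(i < n) (fun z : Cn R n => z ord0 i * c i : cplx R)); last first.
  by apply/funext => z; rewrite fct_sumE. apply: differentiable_sum => i.
 apply: (@differentiableM _ _ (fun z : Cn R n => z ord0 i : cplx R) (fun=> c i)). exact: differentiable_coord.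
 exact: differentiable_cst.
have dr : differentiable (fun z => f z - P z : cplx R) w.
 apply: (differentiable_quadratic K0 d0) => h hd.
 rewrite (_ : _ - _ = f (w + h) - f w - linform c h); first exact: H. have -> : P (w + h) = P w + linform c h.
  by rewrite /P /linform -big_split/=; apply: eq_bigr => i _; rewrite mxE mulrDl. ring.
rewrite (_ : f = (fun z => f z - P z) + P); first exact: differentiableD.
by apply/funext => z /=; rewrite /GRing.add/= subrK.
Qed.

Lemma differentiable_direction n (f : Cn R n -> cplx R) (w : Cn R n) : differentiable f w ->
 exists c : 'I_n -> C, forall h, cdiff (fun u => f (w + u *: h)) (linform c h) 0.
move=> fw; have /diff_locallyP[_ /eqaddoP fo] := fw.
exists (fun i => 'd f w (delta_mx ord0 i)) => h e e0.
have -> : linform (fun i => 'd f w (delta_mx ord0 i)) h = 'd f w h.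
 by rewrite {2}[h]row_sum_delta linear_sum; apply: eq_bigr => i _; rewrite linearZ.
have [hE h0] := normC_real (normr_ge0 h); set t := cRe `|h| in hE h0.
have t0 : 0 < t + 1 by rewrite ltr_wpDl.
have e1 : 0 < ((e / (t + 1))%:C : C) by rewrite ltcR divr_gt0.
have [d /= d0 dP] := (nbhs_ballP _ _).1 (fo _ e1).
have [dE d1] : d = (cRe d)%:C /\ 0 < cRe d.
 by have [E _] := normC_real (ltW d0); split => //; move: d0; rewrite {1}E ltcR.
exists (cRe d / (t + 1)); first by rewrite divr_gt0.
move=> u; rewrite subr0 ltr_pdivlMr// => ud.
have uh : normc u * t <= normc u * (t + 1) by rewrite ler_wpM2l ?nc_ge0// lerDl.
have := dP (u *: h); rewrite mx_norm_ball /ball_/= sub0r normrN normrZ normr_normc hE -RCM dE ltcR.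
move=> /(_ (le_lt_trans uh ud)); rewrite scale0r addr0.
have -> : (f \o shift w - (cst (f w) + 'd f w)) (u *: h) = f (w + u *: h) - f w - 'd f w h * u.
 by rewrite !fctE /= [u *: h + w]addrC opprD addrA linearZ/= [in RHS]mulrC.
rewrite normr_normc -RCM lecR => /le_trans; apply.
rewrite [leRHS]mulrC mulrCA ler_wpM2l ?nc_ge0// mulrAC ler_pdivrMr//.
by rewrite ler_wpM2l ?(ltW e0)// lerDl.
Qed.

Lemma differentiable_line n (f : Cn R n -> cplx R) (a b : Cn R n) (u : C) :
 differentiable f (a + u *: b) -> holo (fun u => f (a + u *: b)) u.
move=> /differentiable_direction[c /(_ b) cb]; exists (linform c b) => e e0.
have [d d0 dP] := cb e e0; exists d => // w wu.
have := dP (w - u); rewrite subr0 => /(_ wu); rewrite scale0r addr0.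
have -> : a + u *: b + (w - u) *: b = a + w *: b by rewrite -addrA -scalerDl subrKC.
exact.
Qed.

End SeveralVariables.

(** * Phases and reflections as measure-preserving unitary maps *)

Section Unitary.
Variable R : realType.
Notation C := R[i].
Notation RR := (RxR R).
Variables (n : nat) (g : C) (v : Cn R n).
Hypothesis g1 : normc g = 1.

(** For [v = 0] the quotient is 0, and the reflection below is the identity. *)
Let k : C := (2 / sqnorm v)%:C.

Definition householder (z : Cn R n) : Cn R n := z - (k * dotCn z v) *: v.

Lemma dot_householder z y : dotCn (householder z) (householder y) = dotCn z y.
have kv : k ^+ 2 * dotCn v v = 2 * k.
 have [v0|v0] := eqVneq (sqnorm v) 0. by rewrite /k v0 invr0 mulr0 expr0n mul0r mulr0.
 have -> : 2 = (2 : R)%:C :> C by rewrite rmorph_nat. by rewrite dotCnn /k expr2 -!RCM; congr (_%:C); field.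
have kJ : k^* = k by rewrite conjcR.
have hE x : householder x = x + (- (k * dotCn x v)) *: v by rewrite scaleNr.
rewrite !hE !(dotCnDl, dotCnDr, dotCnZl, dotCnZr).
rewrite conjcN conjcM kJ -[(dotCn y v)^*]dotCnJ.
move: kv; move: (dotCn z v) (dotCn v y) (dotCn v v) (dotCn z y) => a b vv zy kv.
have : k ^+ 2 * vv * (a * b) = 2 * k * (a * b) by rewrite kv.
move=> E; apply/eqP; rewrite -subr_eq0; apply/eqP.
rewrite (_ : _ - zy = k ^+ 2 * vv * (a * b) - 2 * k * (a * b)); last by ring.
by rewrite E subrr.
Qed.

Lemma householderK : involutive householder.
move=> z; have [v0|v0] := eqVneq (sqnorm v) 0.
 by rewrite /householder (sqnorm_eq0 v0) !scaler0 !subr0.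
have E : dotCn (householder z) v = - dotCn z v.
 rewrite /householder -scaleNr dotCnDl dotCnZl dotCnn mulNr mulrAC /k -RCM divfK//.
 by rewrite (rmorph_nat (real_complex R)); ring.
by rewrite {1}/householder E mulrN scaleNr opprK /householder subrK.
Qed.

(** A phase followed by one reflection already carries the first axis to any given direction, see
    [unitary_to_axis]. *)
Definition unitary (z : Cn R n) : Cn R n := householder (g *: z).

Lemma gg1 : g * g^* = 1. by rewrite mulcJ g1 expr1n. Qed.

Lemma dot_unitary z y : dotCn (unitary z) (unitary y) = dotCn z y.
by rewrite dot_householder dotCnZl dotCnZr mulrA gg1 mul1r. Qed.
Lemma sqnorm_unitary z : sqnorm (unitary z) = sqnorm z.
by rewrite /sqnorm dot_unitary. Qed.

Lemma unitary_affine (a b : Cn R n) (u : C) : unitary (a + u *: b) = unitary a + u *: unitary b.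
rewrite /unitary /householder scalerDr !dotCnDl !dotCnZl mulrDr scalerDl scalerBr !scalerA opprD.
rewrite addrACA; congr (_ + (_ *: _ - _ *: _)); ring.
Qed.

Lemma unitary_surj y : exists z, unitary z = y.
exists (g^* *: householder y); rewrite /unitary scalerA gg1 scale1r householderK//.
Qed.

Definition tunitary (x : n.-tuple RR) : n.-tuple RR := ofCn (unitary (toCn x)).

Lemma cmeas_coord i : cmeas setT (fun x : n.-tuple RR => toCn x ord0 i).
split; under eq_fun do rewrite toCnE/=.
 by apply: (mcomp measurable_fst); exact: measurable_tnth.
by apply: (mcomp measurable_snd); exact: measurable_tnth.
Qed.

Lemma cmeas_sum d (T : measurableType d) (D : set T) m (F : 'I_m -> T -> C) : measurable D ->
 (forall i, cmeas D (F i)) -> cmeas D (fun x => \sum_(i < m) F i x).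
move=> mD mF; split.
 under eq_fun do rewrite Re_sum; apply: measurable_sum => i; exact: (mF i).1.
under eq_fun do rewrite Im_sum; apply: measurable_sum => i; exact: (mF i).2.
Qed.

Lemma cmeas_dotr (w : Cn R n) : cmeas setT (fun x : n.-tuple RR => dotCn (toCn x) w).
by apply: cmeas_sum => // i; apply: cmeasM => //; exact: cmeas_coord.
Qed.

Lemma meas_tunitary : mfun tunitary.
apply/measurable_fun_tnthP => i.
have mi : cmeas setT (fun x => unitary (toCn x) ord0 i).
 have -> : (fun x => unitary (toCn x) ord0 i) = fun x => g * toCn x ord0 i - k * (g * dotCn (toCn x) v) * v ord0 i.
  by apply/funext => x; rewrite /unitary /householder dotCnZl !mxE. apply: cmeasB => //.
  by apply: cmeasM => //; exact: cmeas_coord. apply: cmeasM => //; apply: cmeasM => //.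
 by apply: cmeasM => //; exact: cmeas_dotr.
have -> : (fun x => tnth x i) \o tunitary =
  fun x => (cRe (unitary (toCn x) ord0 i), cIm (unitary (toCn x) ord0 i)).
 by apply/funext => x /=; rewrite tnth_mktuple.
by apply/measurable_fun_pairP; split; [exact: mi.1|exact: mi.2].
Qed.

Lemma toCn_tadd (x y : n.-tuple RR) : toCn (tadd x y) = toCn x + toCn y.
by apply/matrixP => i j; rewrite (ord1 i) !mxE !tnth_mktuple. Qed.

Lemma mpres_tunitary : mpres (vol R n) tunitary.
apply: mpres_isometry.
- exact: meas_tunitary.
- move=> x y; apply: (can_inj (@toCnK R n)).
 have E : unitary (toCn x + toCn y) = unitary (toCn x) + unitary (toCn y).
  by have := unitary_affine (toCn x) (toCn y) 1; rewrite !scale1r.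
 rewrite (ofCnK (unitary (toCn (tadd x y)))) (toCn_tadd (tunitary x)) (toCn_tadd x).
 by transitivity (unitary (toCn x) + unitary (toCn y)); [exact: E|congr (_ + _); exact/esym/ofCnK].
- move=> y; have [z zy] := unitary_surj (toCn y); exists (ofCn z).
 by rewrite /tunitary ofCnK zy toCnK.
- by move=> x; rewrite -!sqnorm_toCn ofCnK sqnorm_unitary.
Qed.

End Unitary.

(** * The reproducing formula at an arbitrary point of the ball *)

Section ReproducingFormula.
Variable R : realType.
Notation C := R[i].
Notation RR := (RxR R).

(** A complex reflection exchanges two vectors of the same length only when their inner product is
    real. The phase [g] makes it real; [v] is then the difference of the two vectors. *)
Lemma unitary_to_axis m (w : Cn R m.+1) : exists g v, normc g = 1 /\
 unitary g v (axis m (Num.sqrt (sqnorm w))%:C) = w.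
set r := Num.sqrt (sqnorm w).
have r2 : r ^+ 2 = sqnorm w by rewrite sqr_sqrtr// sqnorm_ge0.
have [g [g1 gw]] : exists g : C, normc g = 1 /\ exists2 c : R, dotCn (axis m (g * r%:C)) w = c%:C & True.
 have [w0|w0] := eqVneq (w ord0 ord0) 0. exists 1; rewrite normc1; split => //; exists 0 => //.
  by rewrite dot_axis w0 rmorph0 mulr0. have nw : normc (w ord0 ord0) != 0 by rewrite normc_eq0.
 exists (w ord0 ord0 / (normc (w ord0 ord0))%:C); split.
  by rewrite normcM normcV normcR ger0_norm ?nc_ge0// divff. exists (normc (w ord0 ord0) * r) => //.
 rewrite dot_axis RCM; have := mulcJ (w ord0 ord0); rewrite rmorphXn/=.
 have : (normc (w ord0 ord0))%:C != 0 :> C by rewrite RC_eq0.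
 move: (normc _)%:C (r%:C : C) => nc rc nc0; move: (_^*) => wj E.
 rewrite (_ : _ * wj = w ord0 ord0 * wj * (rc / nc)); last by field. by rewrite E expr2; field.
have [c cE _] := gw; exists g, (w - axis m (g * r%:C)); split => //.
set v := w - _; rewrite /unitary -axisZ; set A := axis m (g * r%:C) in cE v *.
have AA : sqnorm A = r ^+ 2.
 by rewrite sqnorm_axis normcM g1 mul1r normcR ger0_norm// sqrtr_ge0.
have Av : dotCn A v = (c - r ^+ 2)%:C.
 by rewrite /v -scaleN1r dotCnDr dotCnZr cE dotCnn AA conjcN conjc_one mulN1r -RCB.
have vv : sqnorm v = 2 * (r ^+ 2 - c).
 have : (sqnorm v)%:C = (2 * (r ^+ 2 - c))%:C :> C.
  rewrite -dotCnn {1}/v -scaleN1r dotCnDl dotCnZl Av /v -scaleN1r dotCnDr dotCnZr [dotCn w A]dotCnJ cE dotCnn -r2.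
  rewrite conjcR conjcN conjc_one !mulN1r -!RCN -!RCD; congr (_%:C); ring. by case.
rewrite /householder Av -RCM vv.
have [rc|rc] := eqVneq (r ^+ 2 - c) 0.
 have v0 : v = 0 by apply: sqnorm_eq0; rewrite vv rc mulr0.
 by rewrite v0 scaler0 subr0; move/eqP: v0; rewrite /v subr_eq0 => /eqP ->.
rewrite (_ : 2 / _ * _ = -1); last by field.
by rewrite RCN scaleN1r opprK /v addrC subrK.
Qed.

(** Volume, weight and kernel are invariant under unitary maps, so [w] may be moved to the first
    axis. *)
Lemma repro m (a : R) (f : Cn R m.+1 -> C) (w : Cn R m.+1) : -1 < a -> ghol f -> unit_ball w ->
 cmeas setT (fun x => f (toCn x)) -> cintg (vol R m.+1) setT (fun x => f (toCn x) * (pw 1 a (tsq x))%:C) ->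
 f w = (cst_alpha m.+1 a)%:C * cint (vol R m.+1) setT
  (fun x => f (toCn x) * cpow (1 - dotCn w (toCn x)) (- (m.+1%:R + 1 + a)) * (pw 1 a (tsq x))%:C).
move=> a1 hf wb mf fi; have [g [v [g1 gv]]] := unitary_to_axis w.
set r := Num.sqrt _ in gv.
have r01 : 0 <= r < 1 by rewrite sqrtr_ge0/= -sqrtr1 ltr_sqrt.
have mU := mpres_tunitary v g1.
have UE x : toCn (tunitary g v x) = unitary g v (toCn x) by rewrite ofCnK.
have UT x : tsq (tunitary g v x) = tsq x by rewrite -!sqnorm_toCn UE sqnorm_unitary.
have := @repro_axis R m a r (fun z => f (unitary g v z)) a1 r01.
rewrite gv => -> //.
- congr (_ * _); pose G x := f (toCn x) * cpow (1 - dotCn w (toCn x)) (- (m.+1%:R + 1 + a)) * (pw 1 a (tsq x))%:C.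
 rewrite -(cint_mpres mU (h := G)). apply: eq_cint => x _; rewrite /G UT UE; congr (_ * cpow (1 - _) _ * _).
  by rewrite -{1}gv dot_unitary// dot_axis. apply: cmeasM => //.
  apply: cmeasM => //; apply: cmeas_cpow => //; apply: cmeasB => //.
  have -> : (fun x => dotCn w (toCn x)) = fun x => (dotCn (toCn x) w)^*.
   by apply/funext => x; rewrite -dotCnJ. by apply: cmeasJ; exact: cmeas_dotr.
 by apply: cmeasR; have /mEFinP := @meas_pw_tsq R m.+1 1 a.
- move=> p q u pq; under eq_fun do rewrite unitary_affine.
 by apply: hf; rewrite /unit_ball/= -unitary_affine sqnorm_unitary.
- have -> : (fun x => f (unitary g v (toCn x))) = (fun x => f (toCn (tunitary g v x))).
  by apply/funext => x; rewrite UE. by apply: (cmeas_comp mf); case: mU.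
- have := cintg_mpres mU fi; apply: eq_cintegrable => // x _.
 by rewrite UE UT.
Qed.

End ReproducingFormula.

(** * Abstract Hilbert spaces: Riesz representation and orthonormal expansions *)

Section HilbertSpace.
Variable R : realType.
Notation C := R[i].
Variables (W : lmodType C) (ip : W -> W -> C).
Notation N := (hnorm ip).

(** The carrier is a whole type, whereas [bergman] is a set of functions; [subspace_type] mediates
    between the two. *)
Record hilbert : Prop := Hilbert {
 ip_linear : forall h a f g, ip (a *: f + g) h = a * ip f h + ip g h;
 ip_conj : forall f g, ip g f = (ip f g)^*; ip_ge0 : forall f, 0 <= cRe (ip f f);
 ip_inj : forall f, cRe (ip f f) = 0 -> f = 0; ip_complete : forall u : nat -> W,
  (forall e, 0 < e -> exists n, forall i j, (n <= i)%N -> (n <= j)%N -> N (u i - u j) <= e) ->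
  exists l, forall e, 0 < e -> exists n, forall j, (n <= j)%N -> N (u j - l) <= e }.

Hypothesis hW : hilbert.
Implicit Types f g h : W.

Lemma ipDl f g h : ip (f + g) h = ip f h + ip g h.
by have := ip_linear hW h 1 f g; rewrite scale1r mul1r. Qed.
Lemma ip0l h : ip 0 h = 0.
by apply: (@addrI _ (ip 0 h)); rewrite -ipDl !addr0. Qed.
Lemma ipZl a f h : ip (a *: f) h = a * ip f h.
by have := ip_linear hW h a f 0; rewrite !addr0 ip0l addr0. Qed.
Lemma ipNl f h : ip (- f) h = - ip f h.
by rewrite -scaleN1r ipZl mulN1r. Qed.
Lemma ipBl f g h : ip (f - g) h = ip f h - ip g h.
by rewrite ipDl ipNl. Qed.
Lemma ipDr f g h : ip h (f + g) = ip h f + ip h g.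
by rewrite (ip_conj hW) ipDl conjcD -!(ip_conj hW). Qed.
Lemma ipZr a f h : ip h (a *: f) = a^* * ip h f.
by rewrite (ip_conj hW) ipZl conjcM -(ip_conj hW). Qed.
Lemma ip0r h : ip h 0 = 0.
by rewrite (ip_conj hW) ip0l rmorph0. Qed.
Lemma ipNr f h : ip h (- f) = - ip h f.
by rewrite (ip_conj hW) ipNl conjcN -(ip_conj hW). Qed.
Lemma ipBr f g h : ip h (f - g) = ip h f - ip h g.
by rewrite ipDr ipNr. Qed.

Lemma ip_suml I (r : seq I) (P : pred I) (F : I -> W) h :
 ip (\sum_(i <- r | P i) F i) h = \sum_(i <- r | P i) ip (F i) h.
by apply: (big_morph (fun f => ip f h) (fun f g => ipDl f g h) (ip0l h)). Qed.

Lemma ip_sumr I (r : seq I) (P : pred I) (F : I -> W) h :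
 ip h (\sum_(i <- r | P i) F i) = \sum_(i <- r | P i) ip h (F i).
by apply: (big_morph (fun f => ip h f) (fun f g => ipDr f g h) (ip0r h)). Qed.

Lemma hnorm_ge0 f : 0 <= N f. exact: sqrtr_ge0. Qed.

Lemma hnorm_sqr f : N f ^+ 2 = cRe (ip f f).
by rewrite /hnorm sqr_sqrtr// (ip_ge0 hW). Qed.

Lemma ipff f : ip f f = (N f ^+ 2)%:C.
rewrite hnorm_sqr; apply: eqc => //=.
have := congr1 (@complex.Im R) (ip_conj hW f f); rewrite ImJ => E; lra.
Qed.

Lemma hnorm_inj f : N f = 0 -> f = 0.
by move=> E; apply: (ip_inj hW); rewrite -hnorm_sqr E expr0n. Qed.
Lemma hnorm0 : N 0 = 0.
by apply/eqP; rewrite -sqrf_eq0 hnorm_sqr ip0l. Qed.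

Lemma hnormZ a f : N (a *: f) = normc a * N f.
apply/eqP; rewrite -(@eqrXn2 _ 2)// ?mulr_ge0 ?nc_ge0 ?hnorm_ge0//.
by rewrite exprMn !hnorm_sqr ipZl ipZr mulrA mulcJ ReZ.
Qed.

Lemma hnormN f : N (- f) = N f.
by rewrite -scaleN1r hnormZ normcN normc1 mul1r. Qed.
Lemma hnormBC f g : N (f - g) = N (g - f).
by rewrite -hnormN opprB. Qed.
Lemma hnorm_sqrD f g : N (f + g) ^+ 2 = N f ^+ 2 + 2 * cRe (ip f g) + N g ^+ 2.
rewrite !hnorm_sqr ipDl !ipDr !ReD (ip_conj hW f g) ReJ; ring. Qed.
Lemma hnorm_sqrB f g : N (f - g) ^+ 2 = N f ^+ 2 - 2 * cRe (ip f g) + N g ^+ 2.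
rewrite hnorm_sqrD hnormN ipNr ReN; ring. Qed.

Lemma cauchy_schwarz f g : normc (ip f g) <= N f * N g.
have [g0|g0] := eqVneq (N g) 0.
 by rewrite (hnorm_inj g0) ip0r normc0 mulr_ge0 ?hnorm_ge0.
rewrite -(@ler_pXn2r _ 2)// ?nnegrE ?mulr_ge0 ?nc_ge0 ?hnorm_ge0// exprMn.
have := sqr_ge0 (N (((N g ^+ 2)%:C) *: f - ip f g *: g)).
rewrite hnorm_sqrB !hnormZ ipZl ipZr !exprMn normcR ger0_norm ?sqr_ge0// ReZ.
rewrite (_ : cRe _ = normc (ip f g) ^+ 2); last by rewrite mulrC mulcJ.
move=> E; have g2 : 0 < N g ^+ 2 by rewrite exprn_even_gt0.
rewrite -(@ler_pM2l _ (N g ^+ 2))//; move: E.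
by move: (N g ^+ 2) (N f ^+ 2) (normc _ ^+ 2) => x y z; nra.
Qed.

Lemma hnormD f g : N (f + g) <= N f + N g.
rewrite -(@ler_pXn2r _ 2)// ?nnegrE ?addr_ge0 ?hnorm_ge0// hnorm_sqrD.
have := le_trans (Re_le_normc _) (cauchy_schwarz f g); nra.
Qed.

Lemma hnormBD f g h : N (f - h) <= N (f - g) + N (g - h).
by rewrite -[X in N X <= _](subrKA g) addrC [leRHS]addrC hnormD// addrC. Qed.

Lemma hnorm_le0 f : (forall e, 0 < e -> N f <= e) -> f = 0.
move=> H; apply: hnorm_inj; apply/eqP; rewrite eq_le hnorm_ge0 andbT.
by apply/ler_addgt0Pr => e e0; rewrite add0r H.
Qed.

Lemma ip_ext f g : (forall h, ip f h = ip g h) -> f = g.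
move=> H; apply/eqP; rewrite -subr_eq0; apply/eqP/hnorm_inj/eqP.
by rewrite -sqrf_eq0 hnorm_sqr ipBl H subrr.
Qed.

Definition orthonormal (u : nat -> W) := forall j k, ip (u j) (u k) = (j == k)%:R.

Definition total (u : nat -> W) := forall f, (forall j, ip f (u j) = 0) -> f = 0.

Definition psum (u : nat -> W) (c : nat -> C) m n : W := \sum_(m <= k < n) c k *: u k.

Lemma tail_le (a : nat -> R) B : (forall k, 0 <= a k) -> (forall n, \sum_(0 <= k < n) a k <= B) ->
 forall e, 0 < e -> exists n0, forall m n, (n0 <= m)%N -> \sum_(m <= k < n) a k <= e.
move=> a0 aB e e0; pose S := range (fun n => \sum_(0 <= k < n) a k).
have hS : has_sup S.
 by split; [exists (\sum_(0 <= k < 0) a k), 0%N|exists B => _ [n _ <-]].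
have [_ [n0 _ <-] h] := sup_adherent e0 hS.
exists n0 => m n n0m; have [nm|mn] := leqP n m; first by rewrite big_geq// ltW.
have := ub_le_sup hS.2 (imageT (fun n => \sum_(0 <= k < n) a k) n).
rewrite (big_cat_nat (n := m))//=; last exact: ltnW.
rewrite (big_cat_nat (n := n0) (p := m))//= => h2.
have : 0 <= \sum_(n0 <= k < m) a k by apply: sumr_ge0.
by move: h h2; lra.
Qed.

Section Orthonormal.
Variable u : nat -> W.
Hypothesis ou : orthonormal u.

Lemma ip_psum c m n j : ip (psum u c m n) (u j) = if (m <= j < n)%N then c j else 0.
rewrite /psum ip_suml.
case: ifPn => mjn.
 rewrite (bigD1_seq j)//= ?mem_index_iota// ?iota_uniq// ipZl ou eqxx mulr1.
 rewrite big1 ?addr0// => k kj; rewrite ipZl ou (negbTE kj) mulr0//.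
rewrite big_nat big1// => k mkn; rewrite ipZl ou.
by case: eqP => [kj|]; [move: mjn; rewrite -kj mkn|rewrite mulr0].
Qed.

Lemma hnorm_psum c m n : N (psum u c m n) ^+ 2 = \sum_(m <= k < n) normc (c k) ^+ 2.
rewrite hnorm_sqr {2}/psum ip_sumr Re_sum big_nat [in RHS]big_nat.
by apply: eq_bigr => k mkn; rewrite ipZr ip_psum mkn mulrC mulcJ.
Qed.

Lemma hnorm_sub_psum f n : N (f - psum u (fun k => ip f (u k)) 0 n) ^+ 2 =
 N f ^+ 2 - \sum_(0 <= k < n) normc (ip f (u k)) ^+ 2.
rewrite hnorm_sqrB hnorm_psum (_ : cRe _ = \sum_(0 <= k < n) normc (ip f (u k)) ^+ 2); first by ring.
by rewrite /psum ip_sumr Re_sum; apply: eq_bigr => k _; rewrite ipZr mulrC mulcJ.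
Qed.

Lemma bessel f n : \sum_(0 <= k < n) normc (ip f (u k)) ^+ 2 <= N f ^+ 2.
by rewrite -subr_ge0 -hnorm_sub_psum sqr_ge0. Qed.

Lemma riesz_fischer c B : (forall n, \sum_(0 <= k < n) normc (c k) ^+ 2 <= B) ->
 exists f, (forall k, ip f (u k) = c k) /\
  forall e, 0 < e -> exists n0, forall n, (n0 <= n)%N -> N (psum u c 0 n - f) <= e.
move=> cB; have [|f fP] := ip_complete hW (u := fun n => psum u c 0 n).
 move=> e e0. have [n0 n0P] := tail_le (fun k => sqr_ge0 (normc (c k))) cB (exprn_gt0 2 e0).
 have H m n : (n0 <= m)%N -> (m <= n)%N -> N (psum u c 0 n - psum u c 0 m) <= e.
  move=> n0m mn; rewrite {1}/psum (big_cat_nat (n := m))//= -/(psum u c 0 m) -/(psum u c m n).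
  rewrite addrAC subrr add0r -(@ler_pXn2r _ 2)// ?nnegrE ?hnorm_ge0 ?(ltW e0)// hnorm_psum. exact: n0P.
 exists n0 => i j n0i n0j; have [ij|/ltnW ji] := leqP i j; last exact: H. by rewrite hnormBC; exact: H.
exists f; split => // k; apply: normc_small_eq => e e0.
have [n0 n0P] := fP e e0; have := n0P (maxn n0 k.+1) (leq_maxl _ _).
apply: le_trans; rewrite hnormBC.
have := cauchy_schwarz (f - psum u c 0 (maxn n0 k.+1)) (u k).
rewrite ipBl ip_psum /= leq_max ltnSn orbT.
have -> : N (u k) = 1 by rewrite /hnorm ou eqxx sqrtr1.
by rewrite mulr1.
Qed.

Hypothesis tu : total u.

Lemma total_ext f g : (forall k, ip f (u k) = ip g (u k)) -> f = g.
by move=> H; apply/eqP; rewrite -subr_eq0; apply/eqP/tu => k; rewrite ipBl H subrr.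
Qed.

Lemma expansion f e : 0 < e -> exists n0, forall n, (n0 <= n)%N ->
 N (f - psum u (fun k => ip f (u k)) 0 n) <= e.
have [g [gk gP]] := riesz_fischer (bessel f).
have fg : f = g by apply: total_ext => k; rewrite gk.
by move=> /gP[n0 n0P]; exists n0 => n /n0P; rewrite hnormBC -fg.
Qed.

Lemma parseval_le f B : (forall n, \sum_(0 <= k < n) normc (ip f (u k)) ^+ 2 <= B) -> N f ^+ 2 <= B.
move=> fB; apply/ler_addgt0Pr => e e0.
have [|n0 /(_ _ (leqnn _)) n0P] := @expansion f (Num.sqrt e); first by rewrite sqrtr_gt0.
move: n0P; rewrite -(@ler_pXn2r _ 2)// ?nnegrE ?hnorm_ge0 ?sqrtr_ge0//.
rewrite [X in _ <= X]sqr_sqrtr ?(ltW e0)// hnorm_sub_psum lerBlDr => h.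
by rewrite (le_trans h)// addrC lerD2r.
Qed.

Lemma parseval f : ((N f ^+ 2)%:E = \sum_(0 <= k <oo) (normc (ip f (u k)) ^+ 2)%:E)%E.
have nd : {homo (fun n => \sum_(0 <= k < n) normc (ip f (u k)) ^+ 2) : n m / (n <= m)%N >-> n <= m}.
 by move=> n m nm; rewrite [leRHS](big_cat_nat (n := n))//= lerDl sumr_ge0// => *; rewrite sqr_ge0.
have cv : cvgn (fun n => \sum_(0 <= k < n) normc (ip f (u k)) ^+ 2).
 by apply: nondecreasing_is_cvgn => //; exists (N f ^+ 2) => _ [n _ <-]; exact: bessel.
apply/esym/cvg_lim => //.
rewrite (_ : (fun n => _) = EFin \o (fun n => \sum_(0 <= k < n) normc (ip f (u k)) ^+ 2)); last first.
 by apply/funext => n /=; rewrite sumEFin.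
suff lE : limn (fun n => \sum_(0 <= k < n) normc (ip f (u k)) ^+ 2) = N f ^+ 2.
 by apply: cvg_comp; [exact: cv|rewrite lE].
apply/eqP; rewrite eq_le; apply/andP; split.
 by apply: limr_le => //; apply: nearW => n; exact: bessel.
by apply: parseval_le => n; exact: nondecreasing_cvgn_le.
Qed.

(** Testing [L] on its own partial sums shows that the numbers [L (u k)] are square summable with
    bound [M ^ 2]; [riesz_fischer] then yields the vector. *)
Lemma riesz (L : W -> C) M : (forall a f g, L (a *: f + g) = a^* * L f + L g) ->
 (forall g, normc (L g) <= M * N g) -> exists f, (forall g, ip f g = L g) /\ N f <= M.
move=> Ll LM; have L0 : L 0 = 0.
 by apply: (@addrI _ (L 0)); have := Ll 1 0 0; rewrite scale1r conjc_one mul1r !addr0.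
have Lps c n : L (psum u c 0 n) = \sum_(0 <= k < n) (c k)^* * L (u k).
 rewrite /psum; elim: n => [|n IH]; first by rewrite !big_geq. by rewrite !big_nat_recr//= addrC Ll IH addrC.
have M0 : 0 <= M.
 have := LM (u 0%N); have -> : N (u 0%N) = 1 by rewrite /hnorm ou eqxx sqrtr1.
 by rewrite mulr1; apply: le_trans; exact: nc_ge0.
have cB n : \sum_(0 <= k < n) normc (L (u k)) ^+ 2 <= M ^+ 2.
 rewrite -hnorm_psum; set v := psum _ _ _ _. have : N v ^+ 2 <= M * N v.
  apply: le_trans (LM v); rewrite -[leLHS]ger0_norm ?sqr_ge0// -normcR hnorm_psum Lps.
  rewrite (rmorph_sum (real_complex R))/=; under eq_bigr do rewrite -mulcJ mulrC. exact: lexx.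
 have [->|v0] := eqVneq (N v) 0; first by rewrite expr0n sqr_ge0.
 have vp : 0 < N v by rewrite lt_neqAle eq_sym v0 hnorm_ge0.
 by move=> h; rewrite ler_pXn2r ?nnegrE ?hnorm_ge0// -(ler_pM2r vp) -expr2.
have [f [fk _]] := riesz_fischer cB.
have E g : ip f g = L g.
 apply: normc_small_eq => e e0. have K0 : 0 < N f + M + 1 by rewrite ltr_wpDl// addr_ge0 ?hnorm_ge0.
 have [n0 /(_ _ (leqnn _))] := @expansion g (e / (N f + M + 1)) (divr_gt0 e0 K0). set v := psum _ _ _ _ => hv.
 have -> : ip f g - L g = ip f (g - v) - L (g - v).
  have := Ll (-1) v g; rewrite scaleN1r addrC => ->; rewrite ipBr conjcN conjc_one mulN1r.
  have -> : ip f v = L v. by rewrite Lps /v /psum ip_sumr; apply: eq_bigr => k _; rewrite ipZr fk. by ring.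
 rewrite (le_trans (normcBD _ _))//. have h1 := cauchy_schwarz f (g - v); have h2 := LM (g - v).
 move: hv; rewrite ler_pdivlMr// => hv. have := hnorm_ge0 (g - v); have := hnorm_ge0 f; nra.
exists f; split => //; have := LM f; rewrite -E ipff normcR ger0_norm ?sqr_ge0//.
have [->|f0] := eqVneq (N f) 0; first by [].
by rewrite expr2 ler_pM2r// lt_neqAle eq_sym f0 hnorm_ge0.
Qed.

Lemma operator_of_form (B : W -> W -> C) M :
 (forall h a f g, B (a *: f + g) h = a * B f h + B g h) ->
 (forall h a f g, B h (a *: f + g) = a^* * B h f + B h g) -> (forall f g, normc (B f g) <= M * N f * N g) ->
 exists T, [/\ forall a f g, T (a *: f + g) = a *: T f + T g,
  forall f g, ip (T f) g = B f g & forall f, N (T f) <= M * N f].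
move=> Bl Br BM; have /choice[T TP] := fun f => riesz (Br f) (BM f).
exists T; split => [a f g|f|f]; last 2 first.
- exact: (TP f).1.
- exact: (TP f).2.
by apply: ip_ext => h; rewrite ipDl ipZl !(TP _).1.
Qed.

Lemma diagonal_operator (m : nat -> R) M : (forall k, `|m k| <= M) ->
 exists S, [/\ forall a f g, S (a *: f + g) = a *: S f + S g,
  forall f k, ip (S f) (u k) = (m k)%:C * ip f (u k) & forall f, N (S f) <= M * N f].
move=> mM; have M0 : 0 <= M by apply: le_trans (mM 0%N).
have cB f n : \sum_(0 <= k < n) normc ((m k)%:C * ip f (u k)) ^+ 2 <= (M * N f) ^+ 2.
 rewrite exprMn; apply: le_trans (ler_wpM2l (sqr_ge0 M) (bessel f n)).
 rewrite mulr_sumr; apply: ler_sum => k _; rewrite normcM exprMn ler_wpM2r ?sqr_ge0//.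
 by rewrite normcR ler_pXn2r ?nnegrE.
have /choice[S SP] := fun f => riesz_fischer (cB f).
exists S; split => [a f g|f k|f].
- by apply: total_ext => k; rewrite ipDl ipZl !(SP _).1 ipDl ipZl; ring.
- exact: (SP f).1.
- rewrite -(@ler_pXn2r _ 2)// ?nnegrE ?mulr_ge0 ?hnorm_ge0//; apply: parseval_le => n.
 by under eq_bigr do rewrite (SP f).1; exact: cB.
Qed.

(** * Self-adjoint Hilbert-Schmidt operators and their eigenvectors *)

Section HilbertSchmidt.
Variables (T : W -> W) (B : R).
Hypotheses (Tl : forall a f g, T (a *: f + g) = a *: T f + T g)
 (Ts : forall f g, ip (T f) g = ip f (T g)) (THS : forall n, \sum_(0 <= k < n) N (T (u k)) ^+ 2 <= B).

Lemma opD f g : T (f + g) = T f + T g.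
by have := Tl 1 f g; rewrite !scale1r. Qed.
Lemma op0 : T 0 = 0.
by apply: (@addrI _ (T 0)); rewrite -opD !addr0. Qed.
Lemma opZ a f : T (a *: f) = a *: T f.
by have := Tl a f 0; rewrite op0 !addr0. Qed.
Lemma opB f g : T (f - g) = T f - T g.
by rewrite -scaleN1r opD opZ scaleN1r. Qed.

(** Self-adjointness moves [T] to the basis: [|<T f, u k>| = |<f, T (u k)>|], to be summed by
    Parseval. *)
Lemma hs_bound f : N (T f) ^+ 2 <= B * N f ^+ 2.
apply: parseval_le => n; apply: le_trans (ler_wpM2r (sqr_ge0 (N f)) (THS n)).
rewrite mulr_suml; apply: ler_sum => k _; rewrite Ts mulrC -exprMn.
by rewrite ler_pXn2r ?nnegrE ?mulr_ge0 ?hnorm_ge0 ?nc_ge0// cauchy_schwarz.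
Qed.

(** The limit is the supremum of the levels that the sequence exceeds on a set of the
    ultrafilter. *)
Lemma ultra_bounded (U : set_system nat) (UU : UltraFilter U) (x : nat -> R) M :
 (forall j, `|x j| <= M) -> exists l, forall e, 0 < e -> U [set j | `|x j - l| <= e].
move=> xM; pose S := [set a | U [set j | a <= x j]].
have hS : has_sup S.
 split; first exists (- M). by apply: filterS filterT => j _ /=; have := xM j; rewrite ler_norml => /andP[].
 exists M => a /filter_ex[j /= /le_trans]; apply. by have := xM j; rewrite ler_norml => /andP[].
exists (sup S) => e e0; have [a Sa al] := sup_adherent e0 hS.
have U2 : U [set j | x j <= sup S + e].
 have [h|] := in_ultra_setVsetC [set j | sup S + e <= x j] UU.
  by have := ub_le_sup hS.2 h; rewrite gerDl leNgt e0.
 by apply: filterS => j /= /negP; rewrite -ltNge => /ltW.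
apply: filterS2 Sa U2 => j /= h1 h2; rewrite ler_norml; apply/andP; split; lra.
Qed.

Lemma ultra_bounded_complex (U : set_system nat) (UU : UltraFilter U) (x : nat -> C) M :
 (forall j, normc (x j) <= M) -> exists l, forall e : R, 0 < e -> U [set j | normc (x j - l) <= e].
move=> xB; have [l1 P1] := ultra_bounded UU (fun j => le_trans (normRe (x j)) (xB j)).
have [l2 P2] := ultra_bounded UU (fun j => le_trans (normIm (x j)) (xB j)).
exists (l1 +i* l2) => e e0; have e2 := half_gt0 e0.
apply: filterS2 (P1 _ e2) (P2 _ e2) => j /= h1 h2.
by rewrite (le_trans (normc_le_ReIm _))// ReD ImD ReN ImN /= (splitr e) lerD.
Qed.

(** Along an ultrafilter all inner products converge at once, with no extraction of subsequences;
    the limit is a bounded antilinear functional, hence a vector by [riesz]. *)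
Lemma weak_limit (U : set_system nat) (UU : UltraFilter U) (f : nat -> W) : (forall j, N (f j) <= 1) ->
 exists g, N g <= 1 /\ forall h e, 0 < e -> U [set j | normc (ip (f j - g) h) <= e].
move=> f1; have b h j : normc (ip (f j) h) <= N h.
 by rewrite (le_trans (cauchy_schwarz _ _))// ler_piMl ?hnorm_ge0.
have /choice[L LP] : forall h, exists l, forall e, 0 < e -> U [set j | normc (ip (f j) h - l) <= e].
 move=> h; exact: ultra_bounded_complex (b h).
have Luniq h l : (forall e, 0 < e -> U [set j | normc (ip (f j) h - l) <= e]) -> L h = l.
 move=> H; apply: normc_small_eq => e e0; have e2 := half_gt0 e0.
 have [j [/= h1 h2]] := filter_ex (filterI (LP h _ e2) (H _ e2)).
 rewrite (_ : L h - l = (ip (f j) h - l) - (ip (f j) h - L h)); last by ring.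
 by rewrite (le_trans (normcBD _ _))// (splitr e) lerD.
have Ll a g h : L (a *: g + h) = a^* * L g + L h.
 apply: Luniq => e e0; have a0 : 0 < normc a + 1 by rewrite ltr_wpDl ?nc_ge0.
 have e1 : 0 < e / (normc a + 1) by rewrite divr_gt0. apply: filterS2 (LP g _ e1) (LP h _ e1) => j /= h1 h2.
 rewrite ipDr ipZr (_ : _ - _ = a^* * (ip (f j) g - L g) + (ip (f j) h - L h)); last by ring.
 rewrite (le_trans (normcD _ _))// normcM normcJ.
 have : e = normc a * (e / (normc a + 1)) + e / (normc a + 1) by field; rewrite lt0r_neq0.
 by move=> ->; rewrite lerD// ler_wpM2l ?nc_ge0.
have LM h : normc (L h) <= 1 * N h.
 apply/ler_addgt0Pr => e e0; have /filter_ex[j /= hj] := LP h e e0.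
 rewrite mul1r (_ : L h = ip (f j) h - (ip (f j) h - L h)); last by ring.
 by rewrite (le_trans (normcBD _ _))// lerD.
have [g [gL g1]] := riesz Ll LM; exists g; split => // h e e0.
by apply: filterS (LP h e e0) => j /=; rewrite ipBl gL.
Qed.

(** Hilbert-Schmidt operators are compact: finitely many coordinates of the image converge, and the
    rest is uniformly small. *)
Lemma weak_to_strong (U : set_system nat) (UU : UltraFilter U) (f : nat -> W) g :
 (forall j, N (f j) <= 1) -> N g <= 1 -> (forall h e, 0 < e -> U [set j | normc (ip (f j - g) h) <= e]) ->
 forall e, 0 < e -> U [set j | N (T (f j - g)) <= e].
move=> f1 g1 H e e0.
have fin n e' : 0 < e' -> U [set j | \sum_(0 <= k < n) normc (ip (f j - g) (T (u k))) ^+ 2 <= e'].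
 elim: n e' => [|n IH] e' e'0. by apply: filterS filterT => j _ /=; rewrite big_geq// ltW.
 have e2 : 0 < e' / 2 by rewrite divr_gt0. have m0 : 0 < Num.min 1 (e' / 2) by rewrite lt_min ltr01.
 apply: filterS2 (IH _ e2) (H (T (u n)) _ m0) => j /= h1.
 rewrite le_min => /andP[h2 h3]; rewrite big_nat_recr//= (splitr e') lerD//.
 by apply: le_trans h3; rewrite expr2 ler_piMl ?nc_ge0.
(* The tail is multiplied by [||f_j - g||^2 <= 4], which leaves [e^2 / 2] for each of the two
   parts. *)
have e2 : 0 < e ^+ 2 / 8 by rewrite divr_gt0// exprn_gt0.
have [n0 n0P] := tail_le (fun k => sqr_ge0 (N (T (u k)))) THS e2.
have e3 : 0 < e ^+ 2 / 2 by rewrite divr_gt0// exprn_gt0.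
apply: filterS (fin n0 _ e3) => j /= hj.
rewrite -(@ler_pXn2r _ 2)// ?nnegrE ?hnorm_ge0 ?(ltW e0)//; apply: parseval_le => n.
under eq_bigr do rewrite Ts.
have fg : N (f j - g) ^+ 2 <= 4.
 have : N (f j - g) <= 2 by rewrite (le_trans (hnormD _ _))// hnormN; have := f1 j; lra.
 by have := hnorm_ge0 (f j - g); nra.
have tl : \sum_(n0 <= k < n) normc (ip (f j - g) (T (u k))) ^+ 2 <= e ^+ 2 / 2.
 apply: (@le_trans _ _ (4 * \sum_(n0 <= k < n) N (T (u k)) ^+ 2)); last by have := n0P n0 n (leqnn _); lra.
 rewrite mulr_sumr; apply: ler_sum => k _. apply: le_trans (ler_wpM2r (sqr_ge0 _) fg); rewrite -exprMn.
 by rewrite ler_pXn2r ?nnegrE ?mulr_ge0 ?hnorm_ge0 ?nc_ge0// cauchy_schwarz.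
have [nn|nn] := leqP n0 n.
 by rewrite (big_cat_nat (n := n0))//= (splitr (e ^+ 2)) lerD.
apply: (@le_trans _ _ (\sum_(0 <= k < n0) normc (ip (f j - g) (T (u k))) ^+ 2)).
 by rewrite [leRHS](big_cat_nat (n := n))//= ?(ltnW nn)// lerDl sumr_ge0// => *; rewrite sqr_ge0.
by move: hj e0; have := sqr_ge0 e; lra.
Qed.

Definition eigen (lam : R) w := T w = lam%:C *: w.

(** The orthogonal complement of eigenvectors is invariant. On its unit ball the supremum [M] of
    [||T f||] is attained at the weak limit [g] of a maximising sequence, since [T] turns weak into
    strong convergence. *)
Lemma eigenvector_exists (A : set W) : (forall a, A a -> exists lam, eigen lam a) ->
 (exists2 f, f != 0 & forall a, A a -> ip f a = 0) ->
 exists w, [/\ exists lam, eigen lam w, N w = 1 & forall a, A a -> ip w a = 0].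
move=> Aeig [f0 f00 f0A]; pose P f := forall a, A a -> ip f a = 0.
have PD f g : P f -> P g -> P (f + g) by move=> Pf Pg a Aa; rewrite ipDl Pf// Pg// addr0.
have PZ c f : P f -> P (c *: f) by move=> Pf a Aa; rewrite ipZl Pf// mulr0.
have PT f : P f -> P (T f).
 move=> Pf a Aa; rewrite Ts; have [lam ->] := Aeig a Aa; by rewrite ipZr Pf// mulr0.
have norm1 w lam : P w -> w != 0 -> eigen lam w ->
  exists w, [/\ exists lam, eigen lam w, N w = 1 & forall a, A a -> ip w a = 0].
 move=> Pw w0 Ew; have nw : N w != 0 by apply: contra_neq w0 => /hnorm_inj.
 exists ((N w)^-1%:C *: w); split; last exact: PZ. by exists lam; rewrite /eigen opZ Ew !scalerA mulrC.
 by rewrite hnormZ normcR ger0_norm ?invr_ge0 ?hnorm_ge0// mulVf.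
pose S := [set x | exists f, [/\ P f, N f <= 1 & x = N (T f)]].
have B0 : 0 <= B by have := THS 0; rewrite big_geq.
have hS : has_sup S.
 split; first by exists (N (T 0)), 0; split => //; [move=> a _; rewrite ip0l|rewrite hnorm0].
 exists (Num.sqrt B) => _ [f [_ f1 ->]].
 rewrite -(@ler_pXn2r _ 2)// ?nnegrE ?hnorm_ge0 ?sqrtr_ge0// [leRHS]sqr_sqrtr//.
 rewrite (le_trans (hs_bound f))// ler_piMr// expr_le1// hnorm_ge0//.
set M := sup S.
have M0 : 0 <= M.
 apply: le_trans (ub_le_sup hS.2 (_ : S (N (T 0)))); first exact: hnorm_ge0.
 by exists 0; split => //; [move=> a _; rewrite ip0l|rewrite hnorm0].
have MT f : P f -> N (T f) <= M * N f.
 move=> Pf; have [f0'|f0'] := eqVneq (N f) 0. by rewrite (hnorm_inj f0') op0 hnorm0 mulr0.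
 have fp : 0 < N f by rewrite lt_neqAle eq_sym f0' hnorm_ge0.
 rewrite -ler_pdivrMr// mulrC; apply: (ub_le_sup hS.2); exists ((N f)^-1%:C *: f); split.
 - exact: PZ.
 - by rewrite hnormZ normcR ger0_norm ?invr_ge0 ?hnorm_ge0// mulVf.
 - by rewrite opZ hnormZ normcR ger0_norm ?invr_ge0 ?hnorm_ge0.
(* If [M = 0], then [T] vanishes on the complement and [f0] is an eigenvector for 0. *)
have [M00|Mn0] := eqVneq M 0.
 apply: (norm1 f0 0) => //; rewrite /eigen scale0r; apply: hnorm_inj.
 by apply/eqP; rewrite eq_le hnorm_ge0 andbT; have := MT f0 f0A; rewrite M00 mul0r.
have /choice[f fP] : forall j : nat, exists f, [/\ P f, N f <= 1 & M - j.+1%:R^-1 < N (T f)].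
 move=> j; have j0 : 0 < j.+1%:R^-1 :> R by rewrite invr_gt0.
 by have [_ [f [Pf f1 ->]] h] := sup_adherent j0 hS; exists f.
have f1 j : N (f j) <= 1 by have [] := fP j.
have [U [UU Uoo]] := ultraFilterLemma (eventually_filter : ProperFilter (\oo : set_system nat)).
have [g [g1 gw]] := weak_limit UU f1.
have gs := weak_to_strong UU f1 g1 gw.
have Pg : P g.
 move=> a Aa; apply: normc_small => e e0; have /filter_ex[j /=] := gw a e e0.
 by have [Pf _ _] := fP j; rewrite ipBl Pf// sub0r normcN.
have MTg : M <= N (T g).
 apply/ler_addgt0Pr => e e0; have e2 := half_gt0 e0. have Uj : U [set j : nat | j.+1%:R^-1 < e / 2].
  by apply: Uoo; exact: near_infty_natSinv_lt (PosNum e2).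
 have [j [/= h1 h2]] := filter_ex (filterI Uj (gs _ e2)). have [_ _ h3] := fP j.
 have h4 : N (T (f j)) <= N (T g) + N (T (f j - g)).
  by rewrite opB -[X in N X <= _](subrK (T g)) addrC hnormD.
 rewrite ltrBlDr in h3; apply/ltW/(lt_le_trans h3); rewrite (splitr e) addrA lerD ?(ltW h1)//.
 by rewrite (le_trans h4)// lerD2l.
(* Expanding [||T T g - M^2 g||^2] with [||T g|| = M], [||T T g|| <= M^2] and [||g|| <= 1] gives at
   most 0. *)
have TTg : T (T g) = (M ^+ 2)%:C *: g.
 apply/eqP; rewrite -subr_eq0; apply/eqP/hnorm_inj/eqP.
 rewrite -sqrf_eq0 eq_le sqr_ge0 andbT hnorm_sqrB hnormZ normcR ger0_norm ?sqr_ge0//.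
 rewrite ipZr conjcR ReZ Ts -hnorm_sqr. have h1 := MT _ (PT _ Pg); have h2 := MT _ Pg. have eM : N (T g) = M.
  by apply/eqP; rewrite eq_le MTg andbT (le_trans h2)// ler_piMr.
 rewrite eM in h1 *; have := hnorm_ge0 (T (T g)); have := hnorm_ge0 g.
 move: (N (T (T g))) (N g) g1 h1 => x y y1 h1 y0 x0.
 have : x ^+ 2 <= (M * M) ^+ 2 by rewrite ler_pXn2r ?nnegrE// mulr_ge0.
 have : (M ^+ 2 * y) ^+ 2 <= (M ^+ 2) ^+ 2.
  by rewrite ler_pXn2r ?nnegrE ?mulr_ge0 ?sqr_ge0// ler_piMr ?sqr_ge0. by rewrite !expr2; lra.
(* [(T - M) (T + M) g = 0]: either [g] is an eigenvector for [- M], or [(T + M) g] is one for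
   [M]. *)
have [hE|h0] := eqVneq (T g + M%:C *: g) 0.
 apply: (norm1 g (- M)) => //.
  by apply: contra_neq Mn0 => g0; apply/eqP; rewrite eq_le M0 andbT (le_trans MTg)// g0 op0 hnorm0.
 by apply/eqP; rewrite /eigen RCN scaleNr -addr_eq0 hE.
apply: (norm1 (T g + M%:C *: g) M) => //; first by apply: PD; [exact: PT|exact: PZ].
by rewrite /eigen opD opZ TTg scalerDr scalerA -RCM -expr2 addrC.
Qed.

End HilbertSchmidt.
End Orthonormal.

(** * A total orthonormal sequence with a prescribed property *)

Section Greedy.
Variables (E : W -> Prop) (g : nat -> W).
Hypotheses (sep : total g)
 (infdim : forall s : seq W, exists2 f, f != 0 & forall a, a \in s -> ip f a = 0).
Hypothesis Eex : forall A : set W, (forall a, A a -> E a) ->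
 (exists2 f, f != 0 & forall a, A a -> ip f a = 0) ->
 exists w, [/\ E w, N w = 1 & forall a, A a -> ip w a = 0].

Let good (s : seq W) w := [/\ E w, N w = 1 & forall a, a \in s -> ip w a = 0].

(** The supremum of [|<w, g j>|] over the admissible [w] need not be attained, hence the factor 2.
    When [p.1] leaves [E] nothing is claimed, and 0 serves as a default. *)
Lemma greedy_step (p : seq W * nat) : exists w, (forall a, a \in p.1 -> E a) ->
 good p.1 w /\ forall w', good p.1 w' -> normc (ip w' (g p.2)) <= 2 * normc (ip w (g p.2)).
case: p => s j /=; have [sE|nE] := pselect (forall a, a \in s -> E a); last by exists 0.
have [w0 w0P] := @Eex [set a | a \in s] sE (infdim s).
pose S := [set x | exists w, good s w /\ x = normc (ip w (g j))].
have hS : has_sup S.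
 split; first by exists (normc (ip w0 (g j))), w0.
 by exists (N (g j)) => _ [w [[_ w1 _] ->]]; rewrite (le_trans (cauchy_schwarz _ _))// w1 mul1r.
have [S0|S0] := leP (sup S) 0.
 exists w0 => _; split => // w' gw'. have := ub_le_sup hS.2 (ex_intro _ w' (conj gw' erefl) : S _) => h.
 by rewrite (le_trans h)// (le_trans S0)// mulr_ge0// nc_ge0.
have S2 : 0 < sup S / 2 by rewrite divr_gt0.
have [_ [w [gw ->]] h] := sup_adherent S2 hS.
exists w => _; split => // w' gw'.
have := ub_le_sup hS.2 (ex_intro _ w' (conj gw' erefl) : S _).
by move: h; lra.
Qed.

(** If the sequence were not total, a unit vector [v] satisfying [E] would be orthogonal to all of
    it and thus compete at every step. Then [|<v, g j>| <= 2 |<w k, g j>|] for infinitely many [k],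
    and Bessel forces [v] to be orthogonal to the total family [g]. *)
Lemma greedy_basis : exists w, [/\ orthonormal w, total w & forall k, E (w k)].
have /choice[F FP] := greedy_step.
(* [L k] lists the first [k] vectors. Step [k] favours the vector of [g] indexed by the 2-adic
   valuation of [k], so every index recurs forever. *)
pose L := fix L k := if k is k'.+1 then rcons (L k') (F (L k', logn 2 k')) else [::].
pose w k := F (L k, logn 2 k).
have LE k : (forall a, a \in L k -> E a).
 elim: k => [//|k IH] a; rewrite /= mem_rcons inE => /orP[/eqP ->|]; last exact: IH.
 by have [[]] := FP (L k, logn 2 k) IH.
have wP k := FP (L k, logn 2 k) (LE k).
have wL j k : (j < k)%N -> w j \in L k.
 elim: k => [//|k IH]; rewrite ltnS leq_eqVlt /= mem_rcons inE => /orP[/eqP ->|/IH ->]. by rewrite eqxx.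
 by rewrite orbT.
have ow : orthonormal w.
 have lt j k : (j < k)%N -> ip (w k) (w j) = 0. by move=> jk; have [[_ _ h] _] := wP k; apply: h; exact: wL.
 move=> j k; have [jk|kj|->] := ltngtP j k.
 - by rewrite (ip_conj hW) lt// rmorph0.
 - by rewrite lt.
 - by have [[_ w1 _] _] := wP k; rewrite ipff -/(w k) w1 expr1n.
exists w; split => //; last by move=> k; have [[]] := wP k.
move=> f fw; apply: contrapT => /eqP f0.
have [||v [Ev v1 vw]] := @Eex (range w).
- by move=> _ [k _ <-]; have [[]] := wP k.
- by exists f => // _ [k _ <-].
have gv k : good (L k) v.
 split => // a; elim: k => [//|k IH]; rewrite /= mem_rcons inE => /orP[/eqP ->|//]. by apply: vw; exists k.
have v0 : v = 0.
 apply: sep => j; apply/eqP; rewrite -normc_eq0 -sqrf_eq0 eq_le sqr_ge0 andbT.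
 apply/ler_addgt0Pr => e e0; rewrite add0r; have e4 : 0 < e / 4 by rewrite divr_gt0.
 have [n0 n0P] := tail_le (fun k => sqr_ge0 (normc (ip (g j) (w k)))) (bessel ow (g j)) e4.
 (* An odd multiple of [2 ^ j] beyond [n0]. Bessel bounds the squared coefficient by [e / 4], and
    the factor 2 squared restores [e]. *)
 pose k := (2 ^ j * (2 * n0).+1)%N. have kj : logn 2 k = j.
  rewrite lognM ?expn_gt0// pfactorK// (_ : logn 2 _ = 0%N) ?addn0//.
  by apply/eqP; rewrite -leqn0 leqNgt logn_gt0 mem_primes/= dvdn2/= mul2n odd_double. have n0k : (n0 <= k)%N.
  by rewrite (@leq_trans (2 * n0).+1)// ?leq_pmull ?expn_gt0// ltnW// ltnS leq_pmull.
 have := n0P k k.+1 n0k; rewrite big_nat1 => hk. have [_ /(_ v (gv k))] := wP k; rewrite -/(w k) /= kj => h.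
 have hc : normc (ip (w k) (g j)) = normc (ip (g j) (w k)) by rewrite (ip_conj hW) normcJ.
 rewrite hc in h; have := nc_ge0 (ip v (g j)); have := nc_ge0 (ip (g j) (w k)).
 by move: h hk; rewrite !expr2; nra.
by have := v1; rewrite v0 hnorm0 => /esym/eqP; rewrite oner_eq0.
Qed.

End Greedy.

End HilbertSpace.

(** * Series of nonnegative reals *)

Section RealSeries.
Variable R : realType.

Lemma nneseries_cvg (a : nat -> R) A : (forall k, 0 <= a k) -> (forall n, \sum_(0 <= k < n) a k <= A) ->
 exists2 l : R, ((\sum_(0 <= k <oo) (a k)%:E)%E = l%:E) & (fun n => \sum_(0 <= k < n) a k) @ \oo --> l.
move=> a0 aA.
have nd : {homo (fun n => \sum_(0 <= k < n) a k) : n m / (n <= m)%N >-> n <= m}.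
 by move=> n m nm; rewrite [leRHS](big_cat_nat (n := n))//= lerDl sumr_ge0.
have cv : cvgn (fun n => \sum_(0 <= k < n) a k).
 by apply: nondecreasing_is_cvgn => //; exists A => _ [n _ <-]; exact: aA.
exists (limn (fun n => \sum_(0 <= k < n) a k)) => //; apply/cvg_lim => //.
rewrite (_ : (fun n => _) = EFin \o (fun n => \sum_(0 <= k < n) a k)); last first.
 by apply/funext => n /=; rewrite sumEFin.
by apply: cvg_comp; [exact: cv|].
Qed.

Lemma nneseries_partial_le (a : nat -> R) l : (forall k, 0 <= a k) ->
 ((\sum_(0 <= k <oo) (a k)%:E)%E = l%:E) -> forall n, \sum_(0 <= k < n) a k <= l.
move=> a0 al n; rewrite -lee_fin -al -sumEFin.
by apply: nneseries_lim_ge => k _ _; rewrite lee_fin.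
Qed.

End RealSeries.

(** * Spectrum, functional calculus and trace in an eigenbasis *)

Section Spectral.
Variable R : realType.
Notation C := R[i].
Variables (W : lmodType C) (ip : W -> W -> C).
Hypothesis hW : hilbert ip.
Notation N := (hnorm ip).
Variables (u : nat -> W) (lam : nat -> R) (T : W -> W).
Hypotheses (ou : orthonormal ip u) (tu : total ip u).
Hypotheses (Tl : forall a f g, T (a *: f + g) = a *: T f + T g)
 (Ts : forall f g, ip (T f) g = ip f (T g)) (Tu : forall k, T (u k) = (lam k)%:C *: u k).

Lemma hnorm_onb k : N (u k) = 1.
by rewrite /hnorm ou eqxx sqrtr1. Qed.
Lemma ip_op f k : ip (T f) (u k) = (lam k)%:C * ip f (u k).
by rewrite Ts Tu (ipZr hW) conjcR. Qed.

Lemma ip_poly_op p f k : ip (poly_op p T f) (u k) = (p.[lam k])%:C * ip f (u k).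
have it i g : ip (iter i T g) (u k) = (lam k ^+ i)%:C * ip g (u k).
 elim: i => [|i IH]; first by rewrite expr0 mul1r. by rewrite iterS ip_op IH exprS RCM mulrA.
rewrite /poly_op (ip_suml hW) horner_coef (rmorph_sum (real_complex R)) mulr_suml.
by apply: eq_bigr => i _; rewrite (ipZl hW) it mulrA -RCM.
Qed.

Lemma eigenvalue_spectrum k : spectrum setT ip T (lam k)%:C.
move=> [S [_ Sl _] /(_ (u k) I)[h _]]; move: h; rewrite Tu subrr.
have -> : S 0 = 0.
 by apply: (@addrI _ (S 0)); have := Sl 1 0 0 I I; rewrite !scale1r !addr0.
by move=> /esym uk; have := hnorm_onb k; rewrite uk (hnorm0 hW) => /esym/eqP; rewrite oner_eq0.
Qed.

(** For a real [x] off the interval the numbers [lam k - x] stay away from 0, and the diagonal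
    operator of their inverses is the resolvent. *)
Lemma spectrum_itv (a b : R) : (forall k, a <= lam k <= b) ->
 forall x : R, spectrum setT ip T x%:C -> a <= x <= b.
move=> ab x sx; apply: contrapT => xab; apply: sx.
have [d d0 dP] : exists2 d : R, 0 < d & forall k, d <= `|lam k - x|.
 have [ax|xa] := leP a x. have bx : b < x by rewrite ltNge; apply/negP => xb; apply: xab; rewrite ax.
  exists (x - b); first by rewrite subr_gt0.
  by move=> k; rewrite distrC; have /andP[_ h] := ab k; rewrite ger0_norm; lra.
 exists (a - x); first by rewrite subr_gt0. by move=> k; have /andP[h _] := ab k; rewrite ger0_norm; lra.
have lx k : lam k - x != 0 by rewrite -normr_gt0 (lt_le_trans d0).
have mM k : `|(lam k - x)^-1| <= d^-1 by rewrite normfV lef_pV2// posrE (lt_le_trans d0).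
have [S [Sl Sd Sb]] := diagonal_operator hW ou tu mM.
exists S; first by split => // [c f g _ _|]; [exact: Sl|exists d^-1 => f _; exact: Sb].
by move=> f _; split; apply: (total_ext hW tu) => k;
 rewrite ?Sd (ipBl hW) ip_op (ipZl hW) ?Sd -mulrBl -RCB mulrA -RCM ?mulVf ?mulfV ?mul1r.
Qed.

Lemma funcalc_exists (a b : R) (psi : R -> R) (p : nat -> {poly R}) M :
 (forall k, a <= lam k <= b) -> (forall x, a <= x <= b -> `|psi x| <= M) ->
 (forall e : R, 0 < e -> \forall k \near \oo, forall x : R, a <= x <= b -> `|(p k).[x] - psi x| <= e) ->
 exists S, is_funcalc setT ip psi T S.
move=> ab psiM' pP; have psiM k := psiM' _ (ab k).
have [S [Sl Sd Sb]] := diagonal_operator hW ou tu psiM.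
exists S; split; first by split => // [c f g _ _|]; [exact: Sl|exists M => f _; exact: Sb].
exists p; split => e e0; near=> n => x.
 by move=> /(spectrum_itv ab); move: x; near: n; exact: pP.
move=> _; rewrite -(@ler_pXn2r _ 2)// ?nnegrE ?mulr_ge0 ?hnorm_ge0 ?(ltW e0)//.
apply: (parseval_le hW ou tu) => m.
rewrite exprMn; apply: le_trans (ler_wpM2l (sqr_ge0 e) (bessel hW ou x m)).
rewrite mulr_sumr; apply: ler_sum => k _; rewrite (ipBl hW) ip_poly_op Sd -mulrBl -RCB normcM exprMn.
rewrite ler_wpM2r ?sqr_ge0// normcR ler_pXn2r ?nnegrE ?(ltW e0)//.
have : a <= lam k <= b by []; move: (lam k); near: n; exact: pP.
Unshelve. all: by end_near. Qed.

(** Eigenvalues belong to the spectrum, so the approximating polynomials converge to [psi] there,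
    while on [u k] they act by their value at [lam k]. *)
Lemma funcalc_eigen psi S k : is_funcalc setT ip psi T S -> S (u k) = (psi (lam k))%:C *: u k.
move=> [_ [p [p1 p2]]]; apply/esym/eqP; rewrite -subr_eq0; apply/eqP/(hnorm_le0 hW) => e e0.
have e2 := half_gt0 e0.
have [n [h1 h2]] := filter_ex (filterI (p1 _ e2) (p2 _ e2)).
have E : poly_op (p n) T (u k) = ((p n).[lam k])%:C *: u k.
 apply: (total_ext hW tu) => j; rewrite ip_poly_op (ipZl hW) ou. by case: eqP => [->|]//; rewrite !mulr0.
have {}h1 := h1 _ (@eigenvalue_spectrum k); have {}h2 := h2 (u k) I.
rewrite E hnorm_onb mulr1 in h2.
rewrite (le_trans (hnormBD hW _ (((p n).[lam k])%:C *: u k) _))// (splitr e) lerD//.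
by rewrite -scalerBl -RCB (hnormZ hW) normcR hnorm_onb mulr1 distrC.
Qed.

(** Linearity covers finite sums only; boundedness of [D] carries the formula from the partial sums
    to [f]. *)
Lemma diagonal_ip (D : W -> W) (tau : nat -> R) f k : bounded_op setT ip D ->
 (forall k, D (u k) = (tau k)%:C *: u k) -> ip (D f) (u k) = (tau k)%:C * ip f (u k).
move=> [_ Dl [M DM]] Du; pose v n := psum u (fun k => ip f (u k)) 0 n.
have D0 : D 0 = 0.
 by apply: (@addrI _ (D 0)); have := Dl 1 0 0 I I; rewrite !scale1r !addr0.
have Dv n : (k < n)%N -> ip (D (v n)) (u k) = (tau k)%:C * ip f (u k).
 have -> : D (v n) = psum u (fun k => (tau k)%:C * ip f (u k)) 0 n.
  rewrite /v /psum; elim: n => [|n IH]; first by rewrite !big_geq.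
  by rewrite !big_nat_recr//= addrC Dl// IH Du scalerA mulrC addrC. by move=> kn; rewrite (ip_psum hW ou) kn.
apply: normc_small_eq => e e0.
have M0 : 0 < `|M| + 1 by rewrite ltr_wpDl.
have [n0 n0P] := expansion hW ou tu f (divr_gt0 e0 M0).
have := n0P (maxn n0 k.+1) (leq_maxl _ _); set n := maxn _ _.
have kn : (k < n)%N by rewrite leq_max ltnSn orbT.
rewrite -(Dv n kn) ler_pdivlMr// -/(v n) => h.
have -> : ip (D f) (u k) - ip (D (v n)) (u k) = ip (D (f - v n)) (u k).
 have := Dl (-1) (v n) f I I; rewrite !scaleN1r [- v n + f]addrC => ->. by rewrite (ipDl hW) (ipNl hW) addrC.
rewrite (le_trans (cauchy_schwarz hW _ _))// hnorm_onb mulr1 (le_trans (DM _ I))//.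
rewrite (le_trans _ h)// mulrC ler_wpM2l ?hnorm_ge0//.
by rewrite (le_trans (ler_norm _))// lerDl.
Qed.

Lemma diagonal_form_cvg (D : W -> W) (tau : nat -> R) f : bounded_op setT ip D ->
 (forall k, D (u k) = (tau k)%:C *: u k) -> forall e : R, 0 < e -> exists n0, forall n, (n0 <= n)%N ->
 normc (ip (D f) f - (\sum_(0 <= k < n) tau k * normc (ip f (u k)) ^+ 2)%:C) <= e.
move=> Db Du e e0; have K0 : 0 < N (D f) + 1 by rewrite ltr_wpDl ?hnorm_ge0.
have [n0 n0P] := expansion hW ou tu f (divr_gt0 e0 K0).
exists n0 => n h1.
have := n0P n h1; set v := psum _ _ _ _; rewrite ler_pdivlMr// => h3.
have <- : ip (D f) v = (\sum_(0 <= k < n) tau k * normc (ip f (u k)) ^+ 2)%:C.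
 rewrite /v /psum (ip_sumr hW) (rmorph_sum (real_complex R)); apply: eq_bigr => k _.
 by rewrite (ipZr hW) (diagonal_ip f k Db Du) mulrCA [_^* * _]mulrC mulcJ -RCM.
rewrite -(ipBr hW) (le_trans (cauchy_schwarz hW _ _))// mulrC (le_trans _ h3)// ler_wpM2l ?hnorm_ge0//.
by rewrite lerDl.
Qed.

(** For nonnegative eigenvalues the diagonal sums in another basis are double series of nonnegative
    terms; interchanging them and applying Parseval to [u k] in the new basis gives the same
    total. *)
Lemma nonneg_trace (t : nat -> R) A : (forall k, 0 <= t k) -> (forall n, \sum_(0 <= k < n) t k <= A) ->
 exists (s : W -> R) (l : R), [/\ forall f, (fun n => \sum_(0 <= k < n) t k * normc (ip f (u k)) ^+ 2 : R) @ \oo --> s f,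
  (fun n => \sum_(0 <= k < n) t k) @ \oo --> l &
  forall e, orthonormal ip e -> total ip e -> (fun n => \sum_(0 <= j < n) s (e j) : R) @ \oo --> l].
move=> t0 tA.
have tk k : t k <= A.
 by apply: le_trans (tA k.+1); rewrite big_nat_recr//= lerDr sumr_ge0.
have A0 : 0 <= A by have := tA 0%N; rewrite big_geq.
have b0 f k : 0 <= t k * normc (ip f (u k)) ^+ 2 by rewrite mulr_ge0 ?sqr_ge0.
have bA f n : \sum_(0 <= k < n) t k * normc (ip f (u k)) ^+ 2 <= A * N f ^+ 2.
 apply: le_trans (ler_wpM2l A0 (bessel hW ou f n)).
 by rewrite mulr_sumr; apply: ler_sum => k _; rewrite ler_wpM2r ?sqr_ge0.
have /choice[s sP] : forall f, exists l, ((\sum_(0 <= k <oo) (t k * normc (ip f (u k)) ^+ 2)%:E)%E = l%:E) /\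
  (fun n => \sum_(0 <= k < n) t k * normc (ip f (u k)) ^+ 2) @ \oo --> l.
 by move=> f; have [l] := nneseries_cvg (b0 f) (bA f); exists l.
have [l lE lc] := nneseries_cvg t0 tA.
exists s, l; split => // [f|e oe te]; first exact: (sP f).2.
have s0 f : 0 <= s f by rewrite -lee_fin -(sP f).1; apply: nneseries_ge0 => k _ _; rewrite lee_fin.
have E : (\sum_(0 <= j <oo) (s (e j))%:E = l%:E)%E.
 under eq_eseriesr do rewrite -(sP _).1. rewrite nneseries_interchange; last by move=> i j; rewrite lee_fin.
 rewrite -lE; apply: eq_eseriesr => k _.
 rewrite (_ : (t k)%:E = (t k)%:E * (N (u k) ^+ 2)%:E)%E; last by rewrite hnorm_onb expr1n mule1.
 rewrite (parseval hW oe te) -nneseriesZl//; last by move=> i _; rewrite lee_fin sqr_ge0.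
 by apply: eq_eseriesr => j _; rewrite EFinM (ip_conj hW) normcJ.
have [l' l'E l'c] := nneseries_cvg (fun j => s0 (e j)) (nneseries_partial_le (fun j => s0 (e j)) E).
by move: l'E l'c; rewrite E => -[->].
Qed.

(** [has_trace] quantifies over all orthonormal bases; absolute summability reduces this to the
    nonnegative case for the positive and negative parts of [tau]. *)
Lemma has_trace_diagonal (D : W -> W) (tau : nat -> R) A : bounded_op setT ip D ->
 (forall k, D (u k) = (tau k)%:C *: u k) -> (forall n, \sum_(0 <= k < n) `|tau k| <= A) ->
 exists l : R, (fun n => \sum_(0 <= k < n) tau k) @ \oo --> l /\ has_trace setT ip D l%:C.
move=> Db Du tA.
pose tp k := Num.max (tau k) 0; pose tn k := Num.max (- tau k) 0.
have tE k : tau k = tp k - tn k.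
 rewrite /tp /tn; have [h|/ltW h] := leP 0 (tau k). by rewrite max_r ?oppr_le0// subr0.
 by rewrite max_l ?oppr_ge0// sub0r opprK.
have tp0 k : 0 <= tp k by rewrite le_max lexx orbT.
have tn0 k : 0 <= tn k by rewrite le_max lexx orbT.
have tpA n : \sum_(0 <= k < n) tp k <= A.
 apply: le_trans (tA n); apply: ler_sum => k _; rewrite ge_max normr_ge0 andbT; exact: ler_norm.
have tnA n : \sum_(0 <= k < n) tn k <= A.
 by apply: le_trans (tA n); apply: ler_sum => k _; rewrite ge_max normr_ge0 andbT -normrN ler_norm.
have [sp [lp [sp1 lpc sp2]]] := nonneg_trace tp0 tpA.
have [sn [ln [sn1 lnc sn2]]] := nonneg_trace tn0 tnA.
exists (lp - ln); split.
 under eq_fun do under eq_bigr do rewrite tE. by under eq_fun do rewrite sumrB; apply: cvgB.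
have DE f : ip (D f) f = (sp f - sn f)%:C.
 apply: normc_small_eq => e e0. have e2 := half_gt0 e0. have [n0 n0P] := diagonal_form_cvg f Db Du e2.
 have cd : (fun n => \sum_(0 <= k < n) tau k * normc (ip f (u k)) ^+ 2) @ \oo --> sp f - sn f.
  under eq_fun do under eq_bigr do rewrite tE mulrBl. by under eq_fun do rewrite sumrB; apply: cvgB.
 move/cvgrPdist_le : cd => /(_ _ e2) cd. have [n [h1 h2]] := filter_ex (filterI (nbhs_infty_ge n0) cd).
 have h3 := n0P n h1; move: h3 h2; set s := (\sum_(0 <= k < n) _); move=> h3 h2.
 rewrite (_ : _ - _ = (ip (D f) f - s%:C) - ((sp f - sn f) - s)%:C).
  by rewrite (le_trans (normcBD _ _))// (splitr e) lerD// normcR. by rewrite [in RHS]RCB; ring.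
move=> e [_ oe te]; have te' : total ip e by move=> f; exact: te.
apply/cvg_normcP => d d0.
have c : (fun n => \sum_(0 <= j < n) (sp (e j) - sn (e j))) @ \oo --> lp - ln.
 by under eq_fun do rewrite sumrB; apply: cvgB; [exact: sp2|exact: sn2].
move/cvgrPdist_lt : c => /(_ d d0) cc; apply: filterS cc => n /=.
rewrite /series/= distrC; under [X in normc (X - _)]eq_bigr do rewrite DE.
by rewrite -(rmorph_sum (real_complex R)) -RCB normcR.
Qed.

End Spectral.

(** * Subspaces as types, and transfer of the operator notions to them *)

Record subspace (K : fieldType) (V : lmodType K) (H : set V) : Prop := Subspace {
 subspace0 : H 0; subspaceP : forall a f g, H f -> H g -> H (a *: f + g) }.

Section SubspaceType.
Variables (K : fieldType) (V : lmodType K) (H : set V) (h : subspace H).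

(** Indexing the predicate by the proof of closedness lets the submodule structure be attached to
    it. *)
Definition in_subspace (_ : subspace H) : {pred V} := fun x => x \in H.

Lemma in_subspace_closed : submod_closed (in_subspace h).
split; first by rewrite unfold_in; apply/mem_set; exact: subspace0.
by move=> a u v; rewrite !unfold_in => /set_mem Hu /set_mem Hv; apply/mem_set; exact: subspaceP.
Qed.

HB.instance Definition _ := GRing.isSubmodClosed.Build K V (in_subspace h) in_subspace_closed.

Record subspace_type := Subsp { sub_val : V; sub_valP : sub_val \in in_subspace h }.
HB.instance Definition _ := [isSub for sub_val].
HB.instance Definition _ := [Choice of subspace_type by <:].
HB.instance Definition _ := [SubChoice_isSubLmodule of subspace_type by <:].

Lemma sub_valH (w : subspace_type) : H (sub_val w).
exact/set_mem/sub_valP. Qed.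

Definition to_sub f (Hf : H f) : subspace_type := Subsp (mem_set Hf).

Lemma sub_val_inj : injective sub_val. exact: val_inj. Qed.

Lemma sub_val_lin a f g : sub_val (a *: f + g) = a *: sub_val f + sub_val g.
by []. Qed.
Lemma sub_valB f g : sub_val (f - g) = sub_val f - sub_val g.
by []. Qed.
Lemma sub_val_sum n (F : 'I_n -> subspace_type) : sub_val (\sum_(i < n) F i) = \sum_(i < n) sub_val (F i).
exact: (big_morph sub_val). Qed.

End SubspaceType.

Section Transfer.
Variable R : realType.
Notation C := R[i].
Variables (V : lmodType C) (H : set V) (h : subspace H) (ip : V -> V -> C).
Notation W := (subspace_type h).
Notation sv := (@sub_val _ _ _ h).
Definition sub_ip (f g : W) : C := ip (sv f) (sv g).

Lemma hnorm_sub f : hnorm sub_ip f = hnorm ip (sv f). by []. Qed.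

Lemma bounded_op_restrict (T : V -> V) : bounded_op H ip T ->
 exists T' : W -> W, (forall w, sv (T' w) = T (sv w)) /\ bounded_op setT sub_ip T'.
move=> [TH Tl [M TM]]; exists (fun w => to_sub h (TH _ (sub_valH w))); split => //; split => //.
 by move=> a f g _ _; apply: sub_val_inj; rewrite /= Tl//; exact: sub_valH.
by exists M => f _; apply: TM; exact: sub_valH.
Qed.

(** The extension is 0 off [H]; [bounded_op] constrains an operator on [H] only, so any value would
    do. *)
Lemma bounded_op_extend (T' : W -> W) : bounded_op setT sub_ip T' ->
 exists T : V -> V, (forall w, sv (T' w) = T (sv w)) /\ bounded_op H ip T.
move=> [_ Tl [M TM]].
pose T f := if pselect (H f) is left Hf then sv (T' (to_sub h Hf)) else 0.
have TE w : sv (T' w) = T (sv w).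
 rewrite /T; case: pselect => [Hw|]; last by move/(_ (sub_valH w)). by congr (sv (T' _)); exact: sub_val_inj.
have TE' f (Hf : H f) : T f = sv (T' (to_sub h Hf)) by rewrite TE.
exists T; split => //; split.
- by move=> f Hf; rewrite TE'; exact: sub_valH.
- move=> a f g Hf Hg; rewrite (TE' _ (subspaceP h a Hf Hg)) (TE' _ Hf) (TE' _ Hg) -sub_val_lin -Tl//.
 by congr (sv (T' _)); exact: sub_val_inj.
- by exists M => f Hf; rewrite TE' -hnorm_sub; exact: TM.
Qed.

Lemma bounded_op_iff (T : V -> V) (T' : W -> W) : (forall w, sv (T' w) = T (sv w)) ->
 bounded_op H ip T <-> bounded_op setT sub_ip T'.
move=> TT; split=> [/bounded_op_restrict|/bounded_op_extend] [T2 [TT2 T2b]].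
 by have -> : T' = T2 by apply/funext => w; apply: sub_val_inj; rewrite TT TT2.
have E f : H f -> T f = T2 f by move=> Hf; rewrite -(TT (to_sub h Hf)) TT2.
have [b1 b2 [M b3]] := T2b; split.
- by move=> f Hf; rewrite E//; exact: b1.
- by move=> a f g Hf Hg; rewrite !E ?b2//; exact: subspaceP.
- by exists M => f Hf; rewrite E//; exact: b3.
Qed.

Lemma spectrum_restrict (T : V -> V) (T' : W -> W) : (forall w, sv (T' w) = T (sv w)) ->
 spectrum H ip T = spectrum setT sub_ip T'.
move=> TT; apply/funext => lam; apply/propext; split => sp [S Sb SP]; apply: sp.
 have [S2 [SS2 S2b]] := bounded_op_extend Sb; exists S2 => // f Hf. have [h1 h2] := SP (to_sub h Hf) I.
 move/(congr1 sv): h1; move/(congr1 sv): h2; rewrite !sub_valB/= TT !SS2/= => -> h1; split => //.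
 by rewrite TT in h1.
have [S2 [SS2 S2b]] := bounded_op_restrict Sb; exists S2 => // f _.
have [h1 h2] := SP _ (sub_valH f).
by split; apply: sub_val_inj; rewrite ?SS2 sub_valB/= TT ?SS2.
Qed.

Lemma poly_op_restrict (T : V -> V) (T' : W -> W) p w : (forall w, sv (T' w) = T (sv w)) ->
 sv (poly_op p T' w) = poly_op p T (sv w).
move=> TT; rewrite /poly_op sub_val_sum; apply: eq_bigr => i _ /=; congr (_ *: _).
by elim: (nat_of_ord i) => [//|k IH]; rewrite !iterS TT IH.
Qed.

Lemma is_funcalc_restrict psi (T S : V -> V) (T' S' : W -> W) :
 (forall w, sv (T' w) = T (sv w)) -> (forall w, sv (S' w) = S (sv w)) ->
 is_funcalc H ip psi T S <-> is_funcalc setT sub_ip psi T' S'.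
move=> TT SS; rewrite /is_funcalc (spectrum_restrict TT) (bounded_op_iff SS).
split => -[Sb [p [p1 p2]]]; split => //; exists p; split => // e e0; apply: filterS (p2 e e0) => k hk f Hf.
 by rewrite hnorm_sub sub_valB (poly_op_restrict _ _ TT) SS; apply: hk; exact: sub_valH.
have := hk (to_sub h Hf) I; by rewrite hnorm_sub sub_valB (poly_op_restrict _ _ TT) SS.
Qed.

Lemma onb_restrict (e : nat -> W) : onb H ip (sv \o e) <-> orthonormal sub_ip e /\ total sub_ip e.
split => [[eH eo et]|[eo et]]; split => //.
- move=> f ft; apply: sub_val_inj; apply: et => //; exact: sub_valH.
- by move=> j; exact: sub_valH.
- move=> f Hf ft; have := et (to_sub h Hf) ft; by move/(congr1 sv).
Qed.

Lemma has_trace_restrict (D : V -> V) (D' : W -> W) t : (forall w, sv (D' w) = D (sv w)) ->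
 has_trace H ip D t <-> has_trace setT sub_ip D' t.
move=> DD; split=> Dt e eo.
 rewrite (_ : (fun j => _) = (fun j => ip (D (sv (e j))) (sv (e j)) : cplx R)).
  have [_ e1 e2] := eo; by apply: (Dt (sv \o e)); apply/onb_restrict; split => // f; exact: e2.
 by apply/funext => j; rewrite /sub_ip DD.
have [eH _ _] := eo; pose e' j := to_sub h (eH j).
rewrite (_ : (fun j => _) = (fun j => sub_ip (D' (e' j)) (e' j) : cplx R)).
 by apply: (Dt e'); have /onb_restrict[e1 e2] : onb H ip (sv \o e') by []; split => // f _; exact: e2.
by apply/funext => j; rewrite /sub_ip DD.
Qed.

Lemma op_traceE (D : V -> V) t (e : nat -> V) : onb H ip e -> has_trace H ip D t -> op_trace H ip D = t.
move=> eo Dt; rewrite /op_trace; case: xgetP => [t' _ Dt'|/(_ t)//].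
apply: (@cvg_unique _ _ _ _ _ _ (Dt' e eo) (Dt e eo)); exact: norm_hausdorff.
Qed.

End Transfer.

(** * Integrals of real functions over the whole space *)

Section RealIntegral.
Context {R : realType} {d : measure_display} {X : measurableType d}.
Variable mu : {measure set X -> \bar R}.
Implicit Types f g : X -> R.

Definition rint f : R := \int[mu]_x f x.
Definition rintg f : Prop := mu.-integrable setT (EFin \o f).

Lemma rintg_le f g : mfun f -> (forall x, `|f x| <= g x) -> rintg g -> rintg f.
move=> mf fg hg; apply: (le_integrable measurableT _ _ hg); first exact/mEFinP.
by move=> x _ /=; rewrite lee_fin (le_trans (fg x))// ler_norm.
Qed.

Lemma rintgD f g : rintg f -> rintg g -> rintg (fun x => f x + g x).
exact: integrableD. Qed.
Lemma rintgZ (c : R) f : rintg f -> rintg (fun x => c * f x).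
exact: integrableZl. Qed.
Lemma rintgB f g : rintg f -> rintg g -> rintg (fun x => f x - g x).
exact: integrableB. Qed.
Lemma rintg_abs f : rintg f -> rintg (fun x => `|f x|).
exact: integrable_abse. Qed.
Lemma rintg0 : rintg (fun=> 0).
exact: integrable0. Qed.

Lemma rintg_sum (F : nat -> X -> R) n : (forall k, rintg (F k)) -> rintg (fun x => \sum_(0 <= k < n) F k x).
move=> Fi; elim: n => [|n IH]; first by under eq_fun do rewrite big_geq//; exact: rintg0.
by under eq_fun do rewrite big_nat_recr//=; exact: rintgD.
Qed.

Lemma eq_rint f g : f =1 g -> rint f = rint g.
by move=> /funext ->. Qed.
Lemma rintD f g : rintg f -> rintg g -> rint (fun x => f x + g x) = rint f + rint g.
exact: RintegralD. Qed.
Lemma rintZ (c : R) f : rintg f -> rint (fun x => c * f x) = c * rint f.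
exact: RintegralZl. Qed.
Lemma rintB f g : rintg f -> rintg g -> rint (fun x => f x - g x) = rint f - rint g.
exact: RintegralB. Qed.
Lemma rint0 : rint (fun=> 0) = 0.
by rewrite -[RHS](mul0r (rint (fun=> 0))) -rintZ; [apply: eq_rint => x; rewrite mul0r|exact: rintg0]. Qed.

Lemma rint_sum (F : nat -> X -> R) n : (forall k, rintg (F k)) ->
 rint (fun x => \sum_(0 <= k < n) F k x) = \sum_(0 <= k < n) rint (F k).
move=> Fi; elim: n => [|n IH].
 by rewrite big_geq// -[RHS]rint0; apply: eq_rint => x; rewrite big_geq.
rewrite big_nat_recr//= -IH -rintD//; last exact: rintg_sum.
by apply: eq_rint => x; rewrite big_nat_recr.
Qed.

Lemma rint_le f g : rintg f -> rintg g -> (forall x, f x <= g x) -> rint f <= rint g.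
by move=> fi gi fg; exact: le_Rintegral. Qed.
Lemma rint_ge0 f : (forall x, 0 <= f x) -> 0 <= rint f.
by move=> f0; exact: Rintegral_ge0. Qed.

Lemma rint_abs f : rintg f -> `|rint f| <= rint (fun x => `|f x|).
move=> fi; rewrite ler_norml -[- _]mulN1r -rintZ; last exact: rintg_abs.
apply/andP; split; apply: rint_le => //; try exact: rintg_abs.
- exact/rintgZ/rintg_abs.
- by move=> x; rewrite mulN1r lerNl -normrN ler_norm.
- by move=> x; rewrite ler_norm.
Qed.

Lemma rintE f : rintg f -> ((\int[mu]_x (f x)%:E)%E = (rint f)%:E).
by move=> fi; rewrite /rint /Rintegral fineK//; exact: integrable_fin_num. Qed.

Lemma rintg_ge0 f (v : R) : mfun f -> (forall x, 0 <= f x) ->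
 (\int[mu]_x (f x)%:E <= v%:E)%E -> rintg f.
move=> mf f0 fv; apply/integrableP; split; first exact/mEFinP.
under eq_integral => x _ do rewrite /= ger0_norm//.
by rewrite (le_lt_trans fv)// ltry.
Qed.

Lemma rint_cvg (f_ : nat -> X -> R) f g : (forall n, mfun (f_ n)) ->
 (forall x, f_ ^~ x @ \oo --> f x) -> (forall n x, `|f_ n x| <= g x) -> rintg g ->
 rintg f /\ (fun n => rint (f_ n)) @ \oo --> rint f.
move=> mf cf fg gi.
have mlim : mfun f by apply: (measurable_fun_cvg mf) => x _; exact: cf.
have fn n : rintg (f_ n) by apply: (rintg_le (mf n) (fg n) gi).
have [|||||h1 _ h3] := @dominated_convergence _ _ _ mu setT measurableT (fun n => EFin \o f_ n)
  (EFin \o f) (EFin \o g).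
- by move=> n; exact/mEFinP.
- exact/mEFinP.
- by apply: aeW => x _; apply: cvg_comp; [exact: cf|].
- exact: gi.
- by apply: aeW => x n _; rewrite /= lee_fin.
split => //; move: h3; rewrite rintE// => /fine_cvgP[_].
by [].
Qed.

End RealIntegral.

(** * Abstract reproducing kernel spaces inside an [L^2] space *)

Section RKHS.
Variable R : realType.
Notation C := R[i].
Variables (W : lmodType C) (ip : W -> W -> C).
Hypothesis hW : hilbert ip.
Notation N := (hnorm ip).
Context {d : measure_display} {X : measurableType d}.
Variables (mu : {sigma_finite_measure set X -> \bar R}) (kap : X -> W).

(** [kap x] is a kernel vector multiplied by the root of the density, so that [f |-> evl f] is
    isometric into [L^2 (mu)]. Accordingly [diag] and [ker2] are the kernel on the diagonal and the
    squared kernel, densities included. *)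
Definition evl f x : C := ip f (kap x).
Definition diag x : R := N (kap x) ^+ 2.
Definition ker2 x y : R := normc (ip (kap x) (kap y)) ^+ 2.
Definition ev2 f x : R := normc (evl f x) ^+ 2.

(** Space and measure are tied by [rkhs_norm]. Separability and infinite dimension ensure that
    orthonormal bases are sequences indexed by all of [nat], as [onb] requires. *)
Record rkhs : Prop := Rkhs {
 rkhs_meas : forall f, cmeas setT (evl f); rkhs_meas_diag : mfun diag;
 rkhs_meas_ker : mfun (fun p : X * X => ker2 p.1 p.2);
 rkhs_norm : forall f, ((N f ^+ 2)%:E = \int[mu]_x (ev2 f x)%:E)%E; rkhs_sep : exists g, total ip g;
 rkhs_infdim : forall s : seq W, exists2 f, f != 0 & forall a, a \in s -> ip f a = 0 }.
Hypothesis hX : rkhs.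

Lemma diag_ge0 x : 0 <= diag x. exact: sqr_ge0. Qed.
Lemma ev2_ge0 f x : 0 <= ev2 f x. exact: sqr_ge0. Qed.
Lemma meas_ev2 f : mfun (ev2 f).
by apply: mfunX; apply: cmeas_normc => //; exact: rkhs_meas. Qed.

Lemma ev2_le f x : ev2 f x <= N f ^+ 2 * diag x.
rewrite /ev2 /diag -exprMn ler_pXn2r ?nnegrE ?nc_ge0 ?mulr_ge0 ?hnorm_ge0//.
exact: cauchy_schwarz.
Qed.

Lemma rintg_ev2 f : rintg mu (ev2 f).
apply: (@rintg_ge0 _ _ _ _ _ (N f ^+ 2)); first exact: meas_ev2.
- exact: ev2_ge0.
- by rewrite -(rkhs_norm hX).
Qed.

Lemma rint_ev2 f : rint mu (ev2 f) = N f ^+ 2.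
by have := rkhs_norm hX f; rewrite rintE; [case|exact: rintg_ev2]. Qed.

Lemma ker2_ev2 x : ker2 x = ev2 (kap x). by []. Qed.

Lemma onb_exists : exists e, orthonormal ip e /\ total ip e.
have [g gt] := rkhs_sep hX.
have [|w [w1 w2 _]] := @greedy_basis _ _ _ hW (fun=> True) g gt (rkhs_infdim hX).
 move=> A _ [f f0 fA]; have nf : N f != 0 by apply: contra_neq f0 => /(hnorm_inj hW).
 exists ((N f)^-1%:C *: f); split => //. by rewrite (hnormZ hW) normcR ger0_norm ?invr_ge0 ?hnorm_ge0// mulVf.
 by move=> a Aa; rewrite (ipZl hW) fA// mulr0.
by exists w.
Qed.

Lemma sum_ev2_le u n x : orthonormal ip u -> \sum_(0 <= k < n) ev2 (u k) x <= diag x.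
move=> ou; apply: le_trans (bessel hW ou (kap x) n).
by apply: ler_sum => k _; rewrite /ev2 /evl (ip_conj hW) normcJ.
Qed.

Lemma sum_ev2_cvg u x : orthonormal ip u -> total ip u ->
 (fun n => \sum_(0 <= k < n) ev2 (u k) x) @ \oo --> diag x.
move=> ou tu.
have [l lE lc] := nneseries_cvg (fun k => ev2_ge0 (u k) x) (fun n => sum_ev2_le n x ou).
suff -> : diag x = l by [].
have := parseval hW ou tu (kap x); rewrite (_ : (\sum_(0 <= k <oo) _)%E = l%:E); first by case.
by rewrite -lE; apply: eq_eseriesr => k _; rewrite /ev2 /evl (ip_conj hW) normcJ.
Qed.

(** * Toeplitz operators on such a space are Hilbert-Schmidt *)

Section Toeplitz.
Variable sig : X -> R.
Hypotheses (msig : mfun sig)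
 (isig : rintg mu (fun x => `|sig x| * diag x)).
Notation M := (rint mu (fun x => `|sig x| * diag x)).

Definition form f g : C := cint mu setT (fun x => (sig x)%:C * evl f x * (evl g x)^*).

Lemma mass_ge0 : 0 <= M.
by apply: rint_ge0 => x; rewrite mulr_ge0// diag_ge0. Qed.

Lemma form_integrable f g : cintg mu setT (fun x => (sig x)%:C * evl f x * (evl g x)^*).
have h : rintg mu (fun x => (N f * N g) * (`|sig x| * diag x)) by exact: rintgZ.
apply: (le_cintegrable measurableT _ h).
 apply: cmeasM; last exact/cmeasJ/(rkhs_meas hX). by apply: cmeasM; [exact: cmeasR|exact: (rkhs_meas hX)].
move=> x _; rewrite !normcM normcJ normcR mulrCA -mulrA ler_wpM2l//.
apply: (le_trans (ler_pM (nc_ge0 _) (nc_ge0 _) (cauchy_schwarz hW f (kap x)) (cauchy_schwarz hW g (kap x)))).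
by rewrite /diag expr2 mulrACA.
Qed.

Lemma rintg_sig_ev2 f : rintg mu (fun x => `|sig x| * ev2 f x).
apply: (rintg_le _ _ (rintgZ (N f ^+ 2) isig)).
 apply: mfunM; last exact: meas_ev2. exact: mcomp.
move=> x; rewrite normrM normr_id (ger0_norm (ev2_ge0 _ _)) [leRHS]mulrCA ler_wpM2l//.
exact: ev2_le.
Qed.

Lemma mass_ev2 f : rint mu (fun x => `|sig x| * ev2 f x) <= M * N f ^+ 2.
rewrite mulrC -rintZ//; apply: rint_le; [exact: rintg_sig_ev2|exact: rintgZ|].
by move=> x; rewrite [leRHS]mulrCA ler_wpM2l// ev2_le.
Qed.

Lemma form_linearl h a f g : form (a *: f + g) h = a * form f h + form g h.
rewrite /form -cintZ//; last exact: form_integrable.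
rewrite -cintD//; [|exact/cintgZ/form_integrable|exact: form_integrable].
by apply: eq_cint => x _; rewrite /evl (ip_linear hW); ring.
Qed.

Lemma form_conj f g : form g f = (form f g)^*.
rewrite /form -cintJ//; last exact: form_integrable.
apply: eq_cint => x _; rewrite !conjcM conjcR conjCK; ring.
Qed.

Lemma form_linearr h a f g : form h (a *: f + g) = a^* * form h f + form h g.
by rewrite form_conj form_linearl conjcD conjcM -!form_conj. Qed.

(** The free parameter [t] keeps the two integrals apart, which the Cauchy-Schwarz bound
    [form_bound] does not. *)
Lemma form_amgm f g t : 0 < t -> 2 * normc (form f g) <=
 t * rint mu (fun x => `|sig x| * ev2 f x) + t^-1 * rint mu (fun x => `|sig x| * ev2 g x).
move=> t0; have i1 := rintg_sig_ev2 f; have i2 := rintg_sig_ev2 g.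
have h := le_normc_cint measurableT (form_integrable f g).
apply: (le_trans (ler_wpM2l (ler0n _ 2) h)).
have i3 : rintg mu (fun x => normc ((sig x)%:C * evl f x * (evl g x)^*)).
 exact: cintg_normc (form_integrable f g).
rewrite -(rintZ t i1) -(rintZ t^-1 i2) -(rintD (rintgZ t i1) (rintgZ t^-1 i2)) -[leLHS](rintZ 2 i3); apply: rint_le; [exact: rintgZ|by apply: rintgD; exact: rintgZ|].
move=> x; rewrite !normcM normcJ normcR /ev2 !mulrA.
have [a0 b0] := (nc_ge0 (evl f x), nc_ge0 (evl g x)).
move: (normc (evl f x)) (normc (evl g x)) a0 b0 => a b a0 b0.
rewrite -subr_ge0 (_ : _ - _ = `|sig x| * (t^-1 * (t * a - b) ^+ 2)).
 by rewrite mulr_ge0// mulr_ge0 ?sqr_ge0// invr_ge0 ltW.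
by field; rewrite lt0r_neq0.
Qed.

Lemma form_bound f g : normc (form f g) <= M * N f * N g.
have h := le_normc_cint measurableT (form_integrable f g).
apply: (le_trans h); rewrite -mulrA mulrC -rintZ//.
apply: rint_le; [exact: cintg_normc (form_integrable f g)|exact: rintgZ|].
move=> x; rewrite !normcM normcJ normcR mulrCA -mulrA ler_wpM2l//.
apply: (le_trans (ler_pM (nc_ge0 _) (nc_ge0 _) (cauchy_schwarz hW f (kap x)) (cauchy_schwarz hW g (kap x)))).
by rewrite /diag expr2 mulrACA.
Qed.

Lemma toeplitz_exists : exists T, [/\ forall a f g, T (a *: f + g) = a *: T f + T g,
  forall f g, ip (T f) g = form f g & forall f, N (T f) <= M * N f].
have [e [oe te]] := onb_exists.
exact: (operator_of_form hW oe te form_linearl form_linearr form_bound).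
Qed.

Section Operator.
Variable T : W -> W.
Hypotheses (Tl : forall a f g, T (a *: f + g) = a *: T f + T g)
 (TB : forall f g, ip (T f) g = form f g).

Lemma toeplitz_selfadjoint f g : ip (T f) g = ip f (T g).
by rewrite TB form_conj -TB -(ip_conj hW). Qed.

(** [form_amgm] with [g = T f] and [t = M]: the second term is at most [||T f||^2] and is absorbed.
    The bound keeps the integral of [|sig| |f|^2], whose sum over a basis is at most [M]; this makes
    [T] Hilbert-Schmidt. *)
Lemma toeplitz_norm f : N (T f) ^+ 2 <= M * rint mu (fun x => `|sig x| * ev2 f x).
have E : form f (T f) = (N (T f) ^+ 2)%:C by rewrite -TB (ipff hW).
have [M0|M0] := eqVneq M 0.
 have := form_bound f (T f); rewrite E normcR M0 !mul0r => h. by rewrite (le_trans (ler_norm _)).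
have Mp : 0 < M by rewrite lt_neqAle eq_sym M0 mass_ge0.
have := form_amgm f (T f) Mp; rewrite E normcR ger0_norm ?sqr_ge0//.
have : M^-1 * rint mu (fun x => `|sig x| * ev2 (T f) x) <= N (T f) ^+ 2.
 by rewrite mulrC ler_pdivrMr// mulrC mass_ev2.
lra.
Qed.

Lemma toeplitz_hs u n : orthonormal ip u -> \sum_(0 <= k < n) N (T (u k)) ^+ 2 <= M ^+ 2.
move=> ou; apply: (@le_trans _ _ (\sum_(0 <= k < n) M * rint mu (fun x => `|sig x| * ev2 (u k) x))).
 by apply: ler_sum => k _; exact: toeplitz_norm.
rewrite -mulr_sumr expr2 ler_wpM2l ?mass_ge0//.
rewrite -(rint_sum (F := fun k x => `|sig x| * ev2 (u k) x)); last by move=> k; exact: rintg_sig_ev2.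
apply: rint_le => //; first by apply: rintg_sum => k; exact: rintg_sig_ev2.
by move=> x; rewrite -mulr_sumr ler_wpM2l// sum_ev2_le.
Qed.

Lemma toeplitz_eigenbasis : exists u (lam : nat -> R),
 [/\ orthonormal ip u, total ip u & forall k, T (u k) = (lam k)%:C *: u k].
have [e [oe te]] := onb_exists; have [g gt] := rkhs_sep hX.
have Teig := eigenvector_exists hW oe te Tl toeplitz_selfadjoint (fun n => toeplitz_hs n oe).
have [w [w1 w2 /choice[lam wl]]] := greedy_basis hW gt (rkhs_infdim hX) Teig.
by exists w, lam.
Qed.

(** * Eigenvalues as means of the symbol, and the trace estimate *)

Section Eigenbasis.
Variables (u : nat -> W) (lam : nat -> R).
Hypotheses (ou : orthonormal ip u) (tu : total ip u).
Hypothesis Tu : forall k, T (u k) = (lam k)%:C *: u k.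
Notation p k := (ev2 (u k)).

Lemma rintg_sig_ev2' f : rintg mu (fun x => sig x * ev2 f x).
apply: (rintg_le _ _ (rintg_sig_ev2 f)); first exact: mfunM (meas_ev2 f).
by move=> x; rewrite normrM (ger0_norm (ev2_ge0 _ _)).
Qed.

Lemma form_diag f : form f f = (rint mu (fun x => sig x * ev2 f x))%:C.
rewrite /rint -cintR; apply: eq_cint => x _.
by rewrite -mulrA mulcJ -RCM.
Qed.

Lemma eigenvalueE k : lam k = rint mu (fun x => sig x * p k x).
have : form (u k) (u k) = (lam k)%:C by rewrite -TB Tu (ipZl hW) ou eqxx mulr1.
by rewrite form_diag => -[].
Qed.

Lemma rint_p k : rint mu (p k) = 1.
by rewrite rint_ev2 (hnorm_onb ou) expr1n. Qed.

Lemma eigenvalue_lower a : (forall x, a <= sig x) -> forall k, a <= lam k.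
move=> ab k; rewrite eigenvalueE -[a]mulr1 -(rint_p k) -rintZ; last exact: rintg_ev2.
apply: rint_le; [exact/rintgZ/rintg_ev2|exact: rintg_sig_ev2'|].
by move=> x; rewrite ler_wpM2r ?ev2_ge0.
Qed.

Lemma eigenvalue_upper b : (forall x, sig x <= b) -> forall k, lam k <= b.
move=> ab k; rewrite eigenvalueE -[b]mulr1 -(rint_p k) -rintZ; last exact: rintg_ev2.
apply: rint_le; [exact: rintg_sig_ev2'|exact/rintgZ/rintg_ev2|].
by move=> x; rewrite ler_wpM2r ?ev2_ge0.
Qed.

Lemma eigenvalue_sum n : \sum_(0 <= k < n) `|lam k| <= M.
apply: (@le_trans _ _ (\sum_(0 <= k < n) rint mu (fun x => `|sig x| * p k x))).
 apply: ler_sum => k _; rewrite eigenvalueE (le_trans (rint_abs (rintg_sig_ev2' _)))//.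
 by apply: eqle; apply: eq_rint => x; rewrite normrM (ger0_norm (ev2_ge0 _ _)).
rewrite -(rint_sum (F := fun k x => `|sig x| * p k x)); last by move=> k; exact: rintg_sig_ev2.
apply: rint_le => //; first by apply: rintg_sum => k; exact: rintg_sig_ev2.
by move=> x; rewrite -mulr_sumr ler_wpM2l// sum_ev2_le.
Qed.

Lemma eigenvalue_le k : `|lam k| <= M.
by apply: le_trans (eigenvalue_sum k.+1); rewrite big_nat_recr//= lerDr sumr_ge0.
Qed.

Notation G := (rint mu (fun x => sig x * rint mu (fun y => sig y * ker2 x y))).

(** Both sides are [<T (kap x), kap x>]: once expanded in the eigenbasis, once through the defining
    form. *)
Lemma eigenvalue_form_cvg x :
 (fun n => \sum_(0 <= k < n) lam k * p k x) @ \oo --> rint mu (fun y => sig y * ker2 x y).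
apply/cvgrPdist_le => e e0.
have Tb : bounded_op setT ip T.
 split => //; exists M => f _; by rewrite -(@ler_pXn2r _ 2)// ?nnegrE ?mulr_ge0 ?mass_ge0 ?hnorm_ge0// exprMn
  (le_trans (toeplitz_norm f))// expr2 -mulrA ler_wpM2l ?mass_ge0// mass_ev2.
have [n0 n0P] := diagonal_form_cvg hW ou tu (kap x) Tb Tu e0.
near=> n; have n0n : (n0 <= n)%N by near: n; exact: nbhs_infty_ge.
have := n0P n n0n; rewrite TB form_diag -RCB normcR; congr (`|_ - _| <= _).
by apply: eq_bigr => k _; rewrite /ev2 /evl (ip_conj hW) normcJ.
Unshelve. all: by end_near. Qed.

(** The expansion of [<T (kap x), kap x>] is integrated against [sig]; the integral of [sig * p k]
    returns one more factor [lam k]. The bound [|lam k| <= M] provides the dominating function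
    [M |sig| diag]. *)
Lemma eigenvalue_sqr_cvg : rintg mu (fun x => sig x * rint mu (fun y => sig y * ker2 x y)) /\
 (fun n => \sum_(0 <= k < n) lam k ^+ 2) @ \oo --> G.
have mS n : mfun (fun x => \sum_(0 <= k < n) lam k * p k x).
 by apply: measurable_sum => k; apply: mfunM => //; exact: meas_ev2.
have [] := @rint_cvg _ _ _ mu (fun n x => sig x * \sum_(0 <= k < n) lam k * p k x)
 (fun x => sig x * rint mu (fun y => sig y * ker2 x y)) (fun x => M * (`|sig x| * diag x)).
- by move=> n; exact: mfunM.
- by move=> x; apply: cvgMr; exact: eigenvalue_form_cvg.
- move=> n x; rewrite normrM mulrCA ler_wpM2l//.
 apply: le_trans (ler_wpM2l mass_ge0 (sum_ev2_le n x ou)).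
 rewrite (le_trans (ler_norm_sum _ _ _))// mulr_sumr; apply: ler_sum => k _.
 by rewrite normrM (ger0_norm (ev2_ge0 _ _)) ler_wpM2r ?ev2_ge0// eigenvalue_le.
- exact: rintgZ.
move=> h1 h2; split => //.
suff Ef : (fun n => rint mu (fun x => sig x * \sum_(0 <= k < n) lam k * p k x)) =
  fun n => \sum_(0 <= k < n) lam k ^+ 2 by rewrite -Ef.
apply/funext => n.
rewrite (_ : (fun x => _) = fun x => \sum_(0 <= k < n) lam k * (sig x * p k x)); last first.
 by apply/funext => x; rewrite mulr_sumr; apply: eq_bigr => k _; rewrite mulrCA.
rewrite (rint_sum (F := fun k x => lam k * (sig x * p k x))); last by move=> k; exact/rintgZ/rintg_sig_ev2'.
apply: eq_bigr => k _; rewrite rintZ; last exact: rintg_sig_ev2'.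
by rewrite -eigenvalueE expr2.
Qed.

Hypothesis isig2 : rintg mu (fun x => sig x ^+ 2 * diag x).
Notation I2 := (rint mu (fun x => sig x ^+ 2 * diag x)).

Lemma ker2C x y : ker2 x y = ker2 y x.
by rewrite /ker2 (ip_conj hW) normcJ. Qed.

Lemma rintg_sqr_ev2 f : rintg mu (fun x => sig x ^+ 2 * ev2 f x).
apply: (rintg_le _ _ (rintgZ (N f ^+ 2) isig2)).
 by apply: mfunM; [exact: mfunX|exact: meas_ev2].
move=> x; rewrite normrM (ger0_norm (sqr_ge0 _)) (ger0_norm (ev2_ge0 _ _)) [leRHS]mulrCA.
by rewrite ler_wpM2l ?sqr_ge0// ev2_le.
Qed.

(** By Tonelli and the symmetry of [ker2], the variable [x] can be integrated first, and the mass of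
    [ker2 y] is [diag y]. *)
Lemma second_moment : rintg mu (fun x => rint mu (fun y => sig y ^+ 2 * ker2 x y)) /\
 rint mu (fun x => rint mu (fun y => sig y ^+ 2 * ker2 x y)) = I2.
pose F (q : X * X) : \bar R := (sig q.2 ^+ 2 * ker2 q.1 q.2)%:E.
have mF : mfun F.
 apply/mEFinP; apply: mfunM; last exact: (rkhs_meas_ker hX). by apply: mfunX; exact: mcomp.
have F0 q : (0 <= F q)%E by rewrite lee_fin mulr_ge0 ?sqr_ge0.
have E x : (\int[mu]_y F (x, y) = (rint mu (fun y => sig y ^+ 2 * ker2 x y))%:E)%E.
 exact: (rintE (rintg_sqr_ev2 (kap x))).
have mH : mfun (fun x => rint mu (fun y => sig y ^+ 2 * ker2 x y)).
 apply/mEFinP; rewrite (_ : _ \o _ = fubini_F mu F). exact: measurable_fun_fubini_tonelli_F.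
 by apply/funext => x /=; rewrite -E.
have T2 : (\int[mu]_x (rint mu (fun y => sig y ^+ 2 * ker2 x y))%:E = I2%:E)%E.
 transitivity (\int[mu]_x \int[mu]_y F (x, y))%E; first by apply: eq_integral => x _; rewrite E.
 rewrite (fubini_tonelli _ mF F0) -rintE//; apply: eq_integral => y _; rewrite /F/=.
 transitivity (\int[mu]_x (sig y ^+ 2 * ev2 (kap y) x)%:E)%E. by apply: eq_integral => x _; rewrite ker2C.
 by rewrite rintE ?rintZ ?rint_ev2//; [exact: rintg_ev2|exact/rintgZ/rintg_ev2].
have H0 x : 0 <= rint mu (fun y => sig y ^+ 2 * ker2 x y).
 by apply: rint_ge0 => y; rewrite mulr_ge0 ?sqr_ge0.
have Hi : rintg mu (fun x => rint mu (fun y => sig y ^+ 2 * ker2 x y)).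
 by apply: (rintg_ge0 mH H0 (v := I2)); rewrite T2.
by split => //; apply/eqP; rewrite -eqe -rintE// T2.
Qed.

(** Expanding the square, the two pure terms give [I2] each and the mixed one gives [- 2 G]; hence
    the factor 1/2. *)
Lemma variance_le v :
 (\int[mu]_x \int[mu]_y ((sig x - sig y) ^+ 2 * ker2 x y)%:E <= v%:E)%E -> I2 - G <= v / 2.
have inner x : rintg mu (fun y => (sig x - sig y) ^+ 2 * ker2 x y) /\
  rint mu (fun y => (sig x - sig y) ^+ 2 * ker2 x y) =
  (sig x ^+ 2 * diag x - 2 * (sig x * rint mu (fun y => sig y * ker2 x y))) +
  rint mu (fun y => sig y ^+ 2 * ker2 x y). have i1 := rintgZ (sig x ^+ 2) (rintg_ev2 (kap x)).
 have i2 := rintgZ (2 * sig x) (rintg_sig_ev2' (kap x)). have i3 := rintg_sqr_ev2 (kap x).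
 have E : (fun y => (sig x - sig y) ^+ 2 * ker2 x y) = fun y =>
   (sig x ^+ 2 * ev2 (kap x) y - 2 * sig x * (sig y * ev2 (kap x) y)) + sig y ^+ 2 * ev2 (kap x) y.
  by apply/funext => y; rewrite ker2_ev2; ring. rewrite E; split; first by apply: rintgD => //; exact: rintgB.
 rewrite rintD//; last exact: rintgB. rewrite rintB// rintZ; last exact: rintg_ev2.
 by rewrite rintZ ?rint_ev2 ?mulrA//; exact: rintg_sig_ev2'.
have [iH EH] := second_moment; have [iG _] := eigenvalue_sqr_cvg.
have iG2 := rintgZ 2 iG.
rewrite (_ : (\int[mu]_x _)%E = (I2 - 2 * G + I2)%:E); first by rewrite lee_fin; lra.
transitivity (\int[mu]_x ((sig x ^+ 2 * diag x - 2 * (sig x * rint mu (fun y => sig y * ker2 x y))) +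
  rint mu (fun y => sig y ^+ 2 * ker2 x y))%:E)%E.
 by apply: eq_integral => x _; rewrite rintE; [rewrite (inner x).2|exact: (inner x).1].
rewrite rintE; last by apply: rintgD => //; exact: rintgB.
by rewrite rintD//; [rewrite rintB// rintZ// EH|exact: rintgB].
Qed.

(** Only one factor is exchanged: [lam k psi (lam k)] is the integral of [sig psi (lam k) p k], so
    the modulus of [psi] is integrated against [|sig| p k]. The parameter [eta] balances the second
    moment against the variance. *)
Lemma trace_estimate (psi : R -> R) (eps K eta v l : R) : 0 <= eps -> 0 <= K -> 0 < eta ->
 mfun (psi \o sig) -> rintg mu (fun x => sig x * psi (sig x) * diag x) ->
 (forall k x, `|psi (lam k) - psi (sig x)| <= eps * (1 + `|lam k| + `|sig x|) + K * `|lam k - sig x|) ->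
 (\int[mu]_x \int[mu]_y ((sig x - sig y) ^+ 2 * ker2 x y)%:E <= v%:E)%E ->
 (fun n => \sum_(0 <= k < n) lam k * psi (lam k)) @ \oo --> l ->
 `|l - rint mu (fun x => sig x * psi (sig x) * diag x)| <=
  eps * (M + 2 * I2) + K * (eta * I2 + v / (8 * eta)).
move=> eps0 K0 eta0 mpsi ipsi psiP hv cl.
pose A k := rint mu (fun x => `|sig x| * p k x); pose B k := rint mu (fun x => sig x ^+ 2 * p k x).
have sA n : \sum_(0 <= k < n) A k <= M.
 rewrite -(rint_sum (F := fun k x => `|sig x| * p k x)); last by move=> k; exact: rintg_sig_ev2.
 apply: rint_le => //; first by apply: rintg_sum => k; exact: rintg_sig_ev2.
 by move=> x; rewrite -mulr_sumr ler_wpM2l// sum_ev2_le.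
have sB n : \sum_(0 <= k < n) B k <= I2.
 rewrite -(rint_sum (F := fun k x => sig x ^+ 2 * p k x)); last by move=> k; exact: rintg_sqr_ev2.
 apply: rint_le => //; first by apply: rintg_sum => k; exact: rintg_sqr_ev2.
 by move=> x; rewrite -mulr_sumr ler_wpM2l ?sqr_ge0// sum_ev2_le.
have i4 k : rintg mu (fun x => (sig x - lam k) ^+ 2 * p k x) /\
  rint mu (fun x => (sig x - lam k) ^+ 2 * p k x) = B k - lam k ^+ 2.
 have i1 := rintgZ (lam k ^+ 2) (rintg_ev2 (u k)). have i2 := rintgZ (2 * lam k) (rintg_sig_ev2' (u k)).
 have i3 := rintg_sqr_ev2 (u k). have E : (fun x => (sig x - lam k) ^+ 2 * p k x) = fun x =>
   (sig x ^+ 2 * p k x - 2 * lam k * (sig x * p k x)) + lam k ^+ 2 * p k x. by apply/funext => y; ring.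
 rewrite E; split; first by apply: rintgD => //; exact: rintgB. rewrite rintD//; last exact: rintgB.
 rewrite rintB// rintZ; last exact: rintg_sig_ev2'. rewrite rintZ ?rint_p//; last exact: rintg_ev2.
 by rewrite -eigenvalueE /B; ring.
have BL k : lam k ^+ 2 <= B k.
 by rewrite -subr_ge0 -(i4 k).2; apply: rint_ge0 => x; rewrite mulr_ge0 ?sqr_ge0 ?ev2_ge0.
have sL n : \sum_(0 <= k < n) lam k ^+ 2 <= I2.
 by apply: le_trans (sB n); apply: ler_sum => k _; exact: BL.
(* The terms are variances, hence nonnegative, so a partial sum is bounded by a later one, where the
   sum of [lam k ^ 2] is already close to [G]. *)
have sV n : \sum_(0 <= k < n) (B k - lam k ^+ 2) <= v / 2.
 apply: le_trans (variance_le hv); have [_ cG] := eigenvalue_sqr_cvg.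
 apply/ler_addgt0Pr => e e0; move/cvgrPdist_le : cG => /(_ e e0) cG.
 have [m [nm hm]] := filter_ex (filterI (nbhs_infty_ge n) cG).
 apply: (@le_trans _ _ (\sum_(0 <= k < m) (B k - lam k ^+ 2))).
  rewrite [leRHS](big_cat_nat (n := n))//= lerDl sumr_ge0// => k _; rewrite subr_ge0; exact: BL.
 rewrite sumrB; have := sB m; move: hm; rewrite /= ler_norml => /andP[h1 h2]; move: h1 h2; lra.
set RHS := (X in _ <= X).
(* From [|sig| |lam| <= (sig^2 + lam^2) / 2] and [|sig| |lam - sig| <= eta sig^2 + (lam - sig)^2 /
   (4 eta)]. *)
pose c2 := 3 / 2 * eps + K * eta; pose c4 := K / (4 * eta).
have c20 : 0 <= c2 by rewrite addr_ge0 ?mulr_ge0// ltW.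
have c40 : 0 <= c4 by rewrite divr_ge0// mulr_ge0// ltW.
pose g k x := (eps * (`|sig x| * p k x) + c2 * (sig x ^+ 2 * p k x)) +
 (eps / 2 * lam k ^+ 2 * p k x + c4 * ((sig x - lam k) ^+ 2 * p k x)).
have j1 k := rintgZ eps (rintg_sig_ev2 (u k)); have j2 k := rintgZ c2 (rintg_sqr_ev2 (u k)).
have j3 k := rintgZ (eps / 2 * lam k ^+ 2) (rintg_ev2 (u k)); have j4 k := rintgZ c4 (i4 k).1.
have ig k : rintg mu (g k) by apply: rintgD; apply: rintgD.
have Eg k : rint mu (g k) = eps * A k + c2 * B k + (eps / 2 * lam k ^+ 2 + c4 * (B k - lam k ^+ 2)).
 rewrite /g rintD; [|exact: rintgD..].
 rewrite rintD// rintD// (rintZ eps (rintg_sig_ev2 (u k))) (rintZ c2 (rintg_sqr_ev2 (u k))).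
 by rewrite (rintZ _ (rintg_ev2 (u k))) (rintZ c4 (i4 k).1) rint_p mulr1 (i4 k).2.
have pt k x : `|sig x * (psi (lam k) - psi (sig x)) * p k x| <= g k x.
 rewrite (_ : g k x = (eps * `|sig x| + c2 * sig x ^+ 2 +
  (eps / 2 * lam k ^+ 2 + c4 * (sig x - lam k) ^+ 2)) * p k x); last by rewrite /g; ring.
 rewrite normrM (ger0_norm (ev2_ge0 _ _)) ler_wpM2r ?ev2_ge0// normrM.
 apply: (le_trans (ler_wpM2l (normr_ge0 _) (psiP k x))); rewrite /c2 /c4.
 rewrite -(real_normK (num_real (sig x))) -(real_normK (num_real (lam k))).
 rewrite [`|lam k - sig x|]distrC -(real_normK (num_real (sig x - lam k))).
 have [a0 [b0 t0]] := (normr_ge0 (sig x), (normr_ge0 (lam k), normr_ge0 (sig x - lam k))).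
 move: `|sig x| `|lam k| `|sig x - lam k| a0 b0 t0 => a b t a0 b0 t0.
 have h1 : 0 <= eps / 2 * (a - b) ^+ 2 by rewrite mulr_ge0 ?sqr_ge0// divr_ge0.
 have h2 : 0 <= K / (4 * eta) * (2 * eta * a - t) ^+ 2.
  by rewrite mulr_ge0 ?sqr_ge0// divr_ge0// mulr_ge0// ltW.
 rewrite -subr_ge0 (_ : _ - _ = eps / 2 * (a - b) ^+ 2 + K / (4 * eta) * (2 * eta * a - t) ^+ 2).
  exact: addr_ge0. by field; rewrite lt0r_neq0.
have iq k : rintg mu (fun x => sig x * (psi (lam k) - psi (sig x)) * p k x).
 apply: (rintg_le _ (pt k) (ig k)); apply: mfunM; last exact: meas_ev2. by apply: mfunM => //; exact: mfunB.
pose a_ n := \sum_(0 <= k < n) lam k * psi (lam k).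
(* The bound holds for each [n]; afterwards [b_ n] converges by domination, as the partial sums of
   [p k] increase to [diag]. *)
pose b_ n := rint mu (fun x => sig x * psi (sig x) * \sum_(0 <= k < n) p k x).
have ip' k : rintg mu (fun x => sig x * psi (sig x) * p k x).
 have h := rintgB (rintgZ (psi (lam k)) (rintg_sig_ev2' (u k))) (iq k).
 by move: h; congr rintg; apply/funext => x; ring.
have ab n : `|a_ n - b_ n| <= RHS.
 have -> : a_ n - b_ n = \sum_(0 <= k < n) rint mu (fun x => sig x * (psi (lam k) - psi (sig x)) * p k x).
  rewrite /b_ (_ : (fun x => _) = fun x => \sum_(0 <= k < n) sig x * psi (sig x) * p k x); last first.
   by apply/funext => x; rewrite mulr_sumr.
  rewrite (rint_sum (F := fun k x => sig x * psi (sig x) * p k x))// -sumrB; apply: eq_bigr => k _.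
  have h := rintgZ (psi (lam k)) (rintg_sig_ev2' (u k)).
  rewrite {1}eigenvalueE mulrC -rintZ; last exact: rintg_sig_ev2'.
  by rewrite -rintB//; apply: eq_rint => x; ring. apply: (@le_trans _ _ (\sum_(0 <= k < n) rint mu (g k))).
  rewrite (le_trans (ler_norm_sum _ _ _))//; apply: ler_sum => k _.
  rewrite (le_trans (rint_abs (iq k)))//; apply: rint_le => //; exact: rintg_abs. under eq_bigr do rewrite Eg.
 rewrite !big_split/= -!mulr_sumr /RHS. have := ler_wpM2l eps0 (sA n); have := ler_wpM2l c20 (sB n).
 have e20 : 0 <= eps / 2 by rewrite divr_ge0. have := ler_wpM2l e20 (sL n); have := ler_wpM2l c40 (sV n).
 have -> : c4 * (v / 2) = K * (v / (8 * eta)) by rewrite /c4; field; rewrite lt0r_neq0. by rewrite /c2; lra.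
have cb : b_ @ \oo --> rint mu (fun x => sig x * psi (sig x) * diag x).
 have [] := @rint_cvg _ _ _ mu (fun n x => sig x * psi (sig x) * \sum_(0 <= k < n) p k x)
  (fun x => sig x * psi (sig x) * diag x) (fun x => `|sig x * psi (sig x) * diag x|).
 - move=> n; apply: mfunM; first exact: mfunM. by apply: measurable_sum => k; exact: meas_ev2.
 - by move=> x; apply: cvgMr; exact: sum_ev2_cvg.
 - move=> n x; rewrite normrM [leRHS]normrM ler_wpM2l// (ger0_norm (diag_ge0 x)).
  by rewrite ger0_norm ?sum_ev2_le// sumr_ge0// => k _; exact: ev2_ge0.
 - exact: rintg_abs. by [].
apply/ler_addgt0Pr => e e0; have e2 := half_gt0 e0.
move/cvgrPdist_le : cb => /(_ _ e2) cb; move/cvgrPdist_le : cl => /(_ _ e2) cl.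
have [n [/= h1 h2]] := filter_ex (filterI cb cl); have h3 := ab n.
rewrite -/(a_ n) in h2; move: h1 h2 h3; set Z := rint _ _.
rewrite !ler_norml => /andP[h1 h2] /andP[h3 h4] /andP[h5 h6].
by apply/andP; split; move: h1 h2 h3 h4 h5 h6; clear; lra.
Qed.

End Eigenbasis.
End Operator.
End Toeplitz.
End RKHS.

Import HBNNSimple.

Lemma sqr_le_norm (R : realDomainType) (a b : R) : `|a| <= b -> a ^+ 2 <= b ^+ 2.
move=> h; rewrite -real_normK ?num_real// ler_pXn2r ?nnegrE//; exact: le_trans (normr_ge0 a) h.
Qed.

(** * Symmetric kernels of fixed mass and symbols of vanishing energy *)

Section ConcentratingKernels.
Variable R : realType.
Context {d : measure_display} {X : measurableType d}.
Variable mu : {sigma_finite_measure set X -> \bar R}.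
Variables (kk : R -> X -> X -> R) (Wt : X -> R).
Implicit Types (a : R) (phi psi theta : X -> R).

(** The mass [Wt] does not depend on [a]. This makes the energy bound of [energy_moment] uniform,
    and makes differences of kernels small. *)
Record kernel_family : Prop := KernelFamily {
 kk_ge0 : forall a x y, -1 < a -> 0 <= kk a x y; kkC : forall a x y, kk a x y = kk a y x;
 kk_meas : forall a, mfun (fun p : X * X => kk a p.1 p.2);
 kk_mass : forall a x, -1 < a -> rintg mu (kk a x) /\ rint mu (kk a x) = Wt x; wt_meas : mfun Wt }.
Hypothesis hk : kernel_family.

Definition energy a (phi : X -> R) : \bar R :=
 (\int[mu \x mu]_p ((phi p.1 - phi p.2) ^+ 2 * kk a p.1 p.2)%:E)%E.

Definition good (phi : X -> R) := mfun phi /\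
 forall e : R, 0 < e -> exists2 A : R, 0 <= A & forall a, A <= a -> (energy a phi <= e%:E)%E.

Lemma gtN1 (A a : R) : 0 <= A -> A <= a -> -1 < a. lra. Qed.

Lemma wt_ge0 x : 0 <= Wt x.
have h : -1 < 0 :> R by lra.
by rewrite -(kk_mass hk x h).2; apply: rint_ge0 => y; exact: (kk_ge0 hk).
Qed.

Lemma meas_energy a phi : mfun phi ->
 mfun (fun p : X * X => (phi p.1 - phi p.2) ^+ 2 * kk a p.1 p.2).
move=> mphi; apply: mfunM; last exact: (kk_meas hk).
by apply: mfunX; apply: mfunB; exact: mcomp.
Qed.

Lemma energy_le (c1 c2 : R) a phi psi theta : -1 < a -> 0 <= c1 -> 0 <= c2 ->
 mfun phi -> mfun psi -> mfun theta ->
 (forall x y, (phi x - phi y) ^+ 2 <= c1 * (psi x - psi y) ^+ 2 + c2 * (theta x - theta y) ^+ 2) ->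
 (energy a phi <= c1%:E * energy a psi + c2%:E * energy a theta)%E.
move=> a1 c10 c20 mphi mpsi mtheta H.
have m1 := (mEFinP _ _).2 (meas_energy a mphi).
have m2 := (mEFinP _ _).2 (meas_energy a mpsi).
have m3 := (mEFinP _ _).2 (meas_energy a mtheta).
have k0 p := kk_ge0 hk p.1 p.2 a1.
have g0 (f : X -> R) p : (0 <= ((f p.1 - f p.2) ^+ 2 * kk a p.1 p.2)%:E)%E.
 by rewrite lee_fin mulr_ge0 ?sqr_ge0.
rewrite /energy -ge0_integralZl_EFin// -ge0_integralZl_EFin//.
rewrite -ge0_integralD//; first last.
- exact: measurable_funeM.
- by move=> p _; rewrite mule_ge0// lee_fin.
- exact: measurable_funeM.
- by move=> p _; rewrite mule_ge0// lee_fin.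
apply: ge0_le_integral => //.
- by apply: emeasurable_funD; exact: measurable_funeM.
move=> p _; rewrite -!EFinM -EFinD lee_fin; apply: (le_trans (ler_wpM2r (k0 p) (H p.1 p.2))).
by rewrite mulrDl -[X in X + _ <= _]mulrA -[X in _ + X <= _]mulrA.
Qed.

(** Used twice: with [k'] the kernel itself and [c = 1] for the uniform bound, and with [k'] a
    difference of two kernels and small [c] for the decay. *)
Lemma energy_dominated a (phi w : X -> R) (k' : X -> X -> R) (B c : R) : -1 < a -> 0 <= B ->
 mfun phi -> mfun w -> mfun (fun p : X * X => k' p.1 p.2) ->
 (forall x, 0 <= w x) -> (forall x y, 0 <= k' x y) -> (forall x y, k' x y = k' y x) ->
 (forall x, rintg mu (k' x) /\ rint mu (k' x) = c * Wt x) -> rintg mu (fun x => w x * Wt x) ->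
 (forall x y, (phi x - phi y) ^+ 2 * kk a x y <= B * (w x * k' x y + w y * k' x y)) ->
 (energy a phi <= (B * (2 * (c * rint mu (fun x => w x * Wt x))))%:E)%E.
move=> a1 B0 mphi mw mk w0 k0 kC kI iw dom.
pose F1 (p : X * X) : \bar R := (w p.1 * k' p.1 p.2)%:E.
pose F2 (p : X * X) : \bar R := (w p.2 * k' p.1 p.2)%:E.
have F10 p : (0 <= F1 p)%E by rewrite lee_fin mulr_ge0.
have F20 p : (0 <= F2 p)%E by rewrite lee_fin mulr_ge0.
have mF1 : mfun F1 by apply/mEFinP/mfunM => //; exact: mcomp.
have mF2 : mfun F2 by apply/mEFinP/mfunM => //; exact: mcomp.
have in1 x : (\int[mu]_y (w x * k' x y)%:E = (c * (w x * Wt x))%:E)%E.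
 have [h1 h2] := kI x; rewrite (rintE (rintgZ _ h1)) rintZ// h2. by congr (_%:E); ring.
have iL := rintgZ c iw.
have E1 : (\int[mu \x mu]_p F1 p = (c * rint mu (fun x => w x * Wt x))%:E)%E.
 by rewrite (fubini_tonelli1 _ mF1 F10) -rintZ// -(rintE iL); apply: eq_integral => x _; exact: in1.
have E2 : (\int[mu \x mu]_p F2 p = (c * rint mu (fun x => w x * Wt x))%:E)%E.
 rewrite (fubini_tonelli2 _ mF2 F20) -rintZ// -(rintE iL); apply: eq_integral => y _; rewrite -in1.
 by apply: eq_integral => x _; rewrite kC.
apply: (@le_trans _ _ (\int[mu \x mu]_p (B%:E * (F1 p + F2 p)))%E).
 apply: ge0_le_integral => //.
 - by move=> p _; rewrite lee_fin mulr_ge0 ?sqr_ge0 ?(kk_ge0 hk).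
 - by apply/mEFinP; exact: meas_energy.
 - by apply: measurable_funeM; exact: emeasurable_funD.
 - by move=> p _; rewrite /F1 /F2 -EFinD -EFinM lee_fin; exact: dom.
rewrite ge0_integralZl_EFin//; [|by move=> p _; rewrite adde_ge0|exact: emeasurable_funD].
by rewrite ge0_integralD// E1 E2 -EFinD -EFinM lee_fin; apply: eqle; ring.
Qed.

Lemma energy_moment a phi : -1 < a -> mfun phi -> rintg mu (fun x => phi x ^+ 2 * Wt x) ->
 (energy a phi <= (4 * rint mu (fun x => (phi x) ^+ 2 * Wt x))%:E)%E.
move=> a1 mphi iphi; have k0 x y := kk_ge0 hk x y a1.
rewrite (_ : 4 * _ = 2 * (2 * (1 * rint mu (fun x => phi x ^+ 2 * Wt x)))); last by ring.
apply: (energy_dominated a1 (k' := kk a) (w := fun x => phi x ^+ 2)).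
- by [].
- exact: mphi.
- exact: mfunX.
- exact: (kk_meas hk).
- by move=> x; exact: sqr_ge0.
- exact: k0.
- exact: (kkC hk).
- by move=> x; rewrite mul1r; exact: (kk_mass hk).
- exact: iphi.
- move=> x y; rewrite -mulrDl mulrA ler_wpM2r//.
 by have := sqr_ge0 (phi x + phi y); rewrite !expr2; lra.
Qed.

Lemma good_le (c1 c2 : R) phi psi theta : 0 <= c1 -> 0 <= c2 -> mfun phi ->
 good psi -> good theta ->
 (forall x y, (phi x - phi y) ^+ 2 <= c1 * (psi x - psi y) ^+ 2 + c2 * (theta x - theta y) ^+ 2) -> good phi.
move=> c10 c20 mphi [mpsi gpsi] [mtheta gtheta] H; split => // e e0.
have c0 : 0 < c1 + c2 + 1 by lra.
have e1 : 0 < e / (c1 + c2 + 1) by rewrite divr_gt0.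
have [A A0 AP] := gpsi _ e1; have [B B0 BP] := gtheta _ e1.
exists (Num.max A B); first by rewrite le_max A0.
move=> a; rewrite ge_max => /andP[Aa Ba].
apply: (le_trans (energy_le (gtN1 A0 Aa) c10 c20 mphi mpsi mtheta H)).
apply: (@le_trans _ _ (c1%:E * (e / (c1 + c2 + 1))%:E + c2%:E * (e / (c1 + c2 + 1))%:E)%E).
 by apply: leeD; apply: lee_wpmul2l; rewrite ?lee_fin//; [exact: AP|exact: BP].
by rewrite -!EFinM -EFinD lee_fin -mulrDl mulrA ler_pdivrMr// mulrC ler_wpM2l ?(ltW e0)//; lra.
Qed.

Lemma goodD phi psi : good phi -> good psi -> good (fun x => phi x + psi x).
move=> g1 g2; apply: (good_le (c1 := 2) (c2 := 2) _ _ _ g1 g2) => //.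
 by apply: measurable_funD; [exact: g1.1|exact: g2.1].
by move=> x y; have := sqr_ge0 ((phi x - phi y) - (psi x - psi y)); rewrite !expr2; lra.
Qed.

Lemma goodZ c phi : good phi -> good (fun x => c * phi x).
move=> g1; apply: (good_le (c1 := c ^+ 2) (c2 := 0) _ _ _ g1 g1) => //; first exact: sqr_ge0.
 by apply: mfunM => //; exact: g1.1.
by move=> x y; rewrite mul0r addr0 -mulrBr exprMn.
Qed.

Lemma goodB phi psi : good phi -> good psi -> good (fun x => phi x - psi x).
move=> g1 g2; have := goodD g1 (goodZ (-1) g2).
by congr good; apply/funext => x; rewrite mulN1r.
Qed.

Lemma goodM phi psi : good phi -> good psi -> (forall x, `|phi x| <= 1) -> (forall x, `|psi x| <= 1) ->
 good (fun x => phi x * psi x).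
move=> g1 g2 b1 b2; apply: (good_le (c1 := 2) (c2 := 2) _ _ _ g1 g2) => //.
 by apply: mfunM; [exact: g1.1|exact: g2.1].
move=> x y; rewrite (_ : _ - _ = (phi x - phi y) * psi x + phi y * (psi x - psi y)); last by ring.
have h1 : psi x ^+ 2 <= 1 by rewrite -real_normK ?num_real// expr_le1.
have h2 : phi y ^+ 2 <= 1 by rewrite -real_normK ?num_real// expr_le1.
have h3 := sqr_ge0 ((phi x - phi y) * psi x - phi y * (psi x - psi y)).
have h4 := ler_wpM2l (sqr_ge0 (phi x - phi y)) h1.
have h5 := ler_wpM2r (sqr_ge0 (psi x - psi y)) h2.
by move: h3 h4 h5; clear; rewrite !expr2; lra.
Qed.

Lemma good0 : good (fun=> 0).
split => // e e0; exists 0 => // a a0; rewrite /energy integral0_eq ?lee_fin ?ltW//.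
by move=> p _; rewrite subrr expr0n mul0r.
Qed.

Lemma good_sum (I : Type) (r : seq I) (F : I -> X -> R) : (forall i, good (F i)) ->
 good (fun x => \sum_(i <- r) F i x).
move=> gF; elim: r => [|i r IH]; first by under eq_fun do rewrite big_nil; exact: good0.
by under eq_fun do rewrite big_cons; exact: goodD.
Qed.

(** The energy of [phi] is at most twice that of [phi_ j] plus twice that of the difference. The
    latter is bounded by a second moment, which tends to 0 by domination and uniformly in [a], so
    [j] can be fixed before [a]. *)
Lemma good_limit (phi_ : nat -> X -> R) phi g : (forall j, good (phi_ j)) ->
 (forall x, phi_ ^~ x @ \oo --> phi x) -> (forall j x, `|phi_ j x| <= g x) ->
 rintg mu (fun x => g x ^+ 2 * Wt x) -> good phi.
move=> gj cphi dg ig; have mj j : mfun (phi_ j) by case: (gj j).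
have mphi : mfun phi by apply: (measurable_fun_cvg mj) => x _; exact: cphi.
have bphi x : `|phi x| <= g x.
 have cn : `|phi_ j x| @[j --> \oo] --> `|phi x| by apply: cvg_norm; exact: cphi. rewrite -(cvg_lim _ cn)//.
 by apply: limr_le; [exact: cvgP cn|apply: nearW => j; exact: dg].
have dom j x : `|(phi_ j x - phi x) ^+ 2 * Wt x| <= 4 * (g x ^+ 2 * Wt x).
 rewrite normrM (ger0_norm (sqr_ge0 _)) (ger0_norm (wt_ge0 x)) mulrA ler_wpM2r ?wt_ge0//.
 have : `|phi_ j x - phi x| <= 2 * g x.
  by rewrite (le_trans (ler_normB _ _))//; have := dg j x; have := bphi x; lra.
 by move=> /sqr_le_norm; rewrite (_ : (2 * g x) ^+ 2 = 4 * g x ^+ 2); last by ring.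
have lim0 : rint mu (fun x => (phi_ j x - phi x) ^+ 2 * Wt x) @[j --> \oo] --> (0 : R).
 have [] := @rint_cvg _ _ _ mu (fun j x => (phi_ j x - phi x) ^+ 2 * Wt x) (fun=> 0)
   (fun x => 4 * (g x ^+ 2 * Wt x)).
 - move=> j; apply: mfunM; last exact: (wt_meas hk). by apply: mfunX; exact: mfunB.
 - move=> x; rewrite -[X in _ --> X](mul0r (Wt x)); apply: cvgMl.
  have c1 : phi_ j x - phi x @[j --> \oo] --> (0 : R).
   by rewrite -(subrr (phi x)); apply: cvgB => //; exact: cvg_cst.
  rewrite (_ : (fun j => _) = (fun j => (phi_ j x - phi x) * (phi_ j x - phi x))); last first.
   by apply/funext => j; rewrite expr2. by rewrite -[X in _ --> X](mulr0 (0 : R)); exact: cvgM.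
 - exact: dom.
 - exact: rintgZ. by move=> _; rewrite rint0.
split => // e e0.
(* [2 (e / 4) + 2 * 4 (e / 16) = e], where 4 is the constant of [energy_moment]. *)
have e16 : 0 < e / 16 by rewrite divr_gt0.
have e4 : 0 < e / 4 by rewrite divr_gt0.
move/cvgrPdist_le : lim0 => /(_ _ e16) /filter_ex[j]; rewrite sub0r normrN => hj.
have [A A0 AP] := (gj j).2 _ e4; exists A => // a Aa.
have a1 := gtN1 A0 Aa.
have mD : mfun (fun x => phi_ j x - phi x) by exact: mfunB.
have iD : rintg mu (fun x => (phi_ j x - phi x) ^+ 2 * Wt x).
 apply: (rintg_le _ _ (rintgZ 4 ig)). by apply: mfunM; [exact: mfunX|exact: (wt_meas hk)]. exact: dom.
have h := @energy_le 2 2 a phi (phi_ j) (fun x => phi_ j x - phi x) a1 ltac:(by []) ltac:(by []) mphi (mj j) mD _.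
apply: (le_trans (h _)).
 by move=> x y; have := sqr_ge0 ((phi_ j x - phi_ j y) + (phi_ j x - phi x - (phi_ j y - phi y))); rewrite !expr2; lra.
apply: (@le_trans _ _ (2%:E * (e / 4)%:E + 2%:E * (4 * (e / 16))%:E)%E).
 apply: leeD; apply: lee_wpmul2l; rewrite ?lee_fin//; first exact: AP.
 apply: (le_trans (energy_moment a1 mD iD)); rewrite lee_fin ler_wpM2l//.
 by apply: le_trans hj; exact: ler_norm.
by rewrite -!EFinM -EFinD lee_fin; lra.
Qed.

End ConcentratingKernels.

(** * The Bergman kernels concentrate on the diagonal *)

Section BergmanKernels.
Variable R : realType.
Variable n : nat.
Notation C := R[i].
Notation RR := (RxR R).
Notation X := (n.-tuple RR).
Implicit Types (x y : X) (rho : R).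

Definition qdist x y : R := normc (1 - dotCn (toCn x) (toCn y)).

(** The squared modulus of the reproducing kernel with the weights at both points, but only one
    factor [cst_alpha]; this normalisation gives it the mass [iwt] for every [a]. *)
Definition bker a x y : R :=
 cst_alpha n a * (pw 1 a (tsq x) * pw 1 a (tsq y)) * (qdist x y `^ (- (n%:R + 1 + a))) ^+ 2.

Definition iwt x : R := if tsq x < 1 then (1 - tsq x) ^- n.+1 else 0.

Hypothesis hk : kernel_family (vol R n) bker iwt.
Notation good := (good (vol R n) bker).

Lemma qdistC x y : qdist x y = qdist y x.
by rewrite /qdist dotCnJ -{1}conjc_one -conjcB normcJ. Qed.
Lemma bkerC a x y : bker a x y = bker a y x.
by rewrite /bker qdistC [pw 1 a (tsq x) * _]mulrC. Qed.

Lemma bker_ge0 a x y : -1 < a -> 0 <= bker a x y.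
move=> a1; rewrite /bker mulr_ge0 ?sqr_ge0// mulr_ge0//; first exact: ltW (cst_alpha_gt0 _ a1).
by rewrite mulr_ge0 ?pw_ge0.
Qed.

Lemma meas_bker a : mfun (fun p : X * X => bker a p.1 p.2).
have mpw : mfun (fun x : X => pw 1 a (tsq x)) by apply/mEFinP; exact: meas_pw_tsq.
apply: mfunM.
 by apply: mfunM => //; apply: mfunM; exact: mcomp mpw _.
apply: mfunX; apply: (mcomp (measurable_powR _)).
apply: cmeas_normc => //; apply: cmeasB => //.
apply: cmeas_sum => // i; apply: cmeasM => //.
 by apply: (cmeas_comp (h := fun x : X => toCn x ord0 i) (g := fst)) => //; exact: cmeas_coord.
apply: cmeasJ => //.
by apply: (cmeas_comp (h := fun x : X => toCn x ord0 i) (g := snd)) => //; exact: cmeas_coord.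
Qed.

Lemma meas_iwt : mfun iwt.
apply: measurable_fun_ifT.
- by apply: measurable_fun_ltr => //; exact: meas_tsq.
- apply: (mcomp (@meas_invR R) (_ : mfun (fun t : X => (1 - tsq t) ^+ n.+1 : mR R))).
 by apply: mfunX; apply: mfunB => //; exact: meas_tsq.
- exact: mcst.
Qed.

(** Both terms on the right are nonnegative in the ball. The left side is thus at least
    [|x - y|^2 (1 - |x|^2)], which is what drives the concentration. *)
Lemma qdist_sqr x y : qdist x y ^+ 2 - (1 - tsq x) * (1 - tsq y) =
 tdist x y * (1 - tsq x) + normc (dotCn (toCn x) (toCn y) - (tsq x)%:C) ^+ 2.
have -> : tdist x y = tsq x - 2 * cRe (dotCn (toCn x) (toCn y)) + tsq y.
 rewrite /tdist -scaleN1r sqnormD sqnormZ normcN normc1 expr1n mul1r !sqnorm_toCn dotCnZr.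
 by rewrite conjcN conjc_one mulN1r ReN; ring.
rewrite /qdist !sqr_normcE !ReD !ImD !ReN !ImN /=; ring.
Qed.

Lemma qdist_bounds x y : tsq x < 1 -> tsq y < 1 -> 0 < qdist x y <= 2.
move=> x1 y1; have c1 : normc (dotCn (toCn x) (toCn y)) < 1.
 rewrite -(@ltr_pXn2r _ 2) ?nnegrE ?nc_ge0// expr1n.
 apply: (le_lt_trans (cauchy_schwarzCn _ _)); rewrite !sqnorm_toCn.
 by have := tsq_ge0 x; have := tsq_ge0 y; move: x1 y1; nra.
rewrite /qdist; apply/andP; split.
 rewrite normc_gt0 subr_eq0; apply/eqP => E; move: c1; by rewrite -E normc1 ltxx.
by rewrite (le_trans (normcBD _ _))// normc1; lra.
Qed.

Lemma tdist_ge0 x y : 0 <= tdist x y. exact: sqnorm_ge0. Qed.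

(** The ratio of normalising constants that leaves [bker_succ] without any further constant. *)
Definition theta a : R := cst_alpha n a / cst_alpha n (a + 1).

Lemma thetaE a : -1 < a -> theta a = (a + 1) / (a + 1 + n%:R).
move=> a1; have a2 : -1 < a + 1 by lra.
rewrite /theta !cst_alphaE// /rising.
have p0 : pi ^+ n != 0 :> R by rewrite expf_neq0// gt_eqF// pi_gt0.
have r0 : \prod_(j < n) (a + 1 + j.+1%:R) != 0 :> R by rewrite gt_eqF// rising_gt0.
have E : (a + 1) * \prod_(j < n) (a + 1 + j.+1%:R) = \prod_(j < n) (a + j.+1%:R) * (a + 1 + n%:R).
 rewrite -(big_mkord xpredT (fun j => a + 1 + j.+1%:R)) -(big_mkord xpredT (fun j => a + j.+1%:R)).
 have E1 : \prod_(0 <= j < n.+1) (a + j.+1%:R) = (\prod_(0 <= j < n) (a + j.+1%:R)) * (a + n.+1%:R) by rewrite big_nat_recr.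
 have E2 : \prod_(0 <= j < n.+1) (a + j.+1%:R) = (a + 1) * (\prod_(0 <= j < n) (a + j.+2%:R)) by rewrite big_nat_recl.
 rewrite (_ : a + 1 + n%:R = a + n.+1%:R); last by rewrite -natr1; ring.
 rewrite -E1 E2; congr (_ * _); apply: eq_big_nat => j _. by rewrite -[in RHS]natr1; ring.
have n0 : a + 1 + n%:R != 0 by rewrite gt_eqF// ltr_wpDr// ?ler0n//; lra.
apply/eqP; rewrite eqr_div ?mulf_neq0 ?invr_eq0//; apply/eqP.
by rewrite mulrAC -E; ring.
Qed.

(** Raising the weight by 1 multiplies the kernel by [(1 - |x|^2) (1 - |y|^2) / |1 - <x, y>|^2], the
    Moebius-invariant quantity [1 - |phi_x(y)|^2]. *)
Lemma bker_succ a x y : -1 < a -> tsq x < 1 -> tsq y < 1 ->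
 theta a * bker (a + 1) x y = bker a x y * ((1 - tsq x) * (1 - tsq y) / qdist x y ^+ 2).
move=> a1 x1 y1; have a2 : -1 < a + 1 by lra.
have pwS z : tsq z < 1 -> pw 1 (a + 1) (tsq z) = pw 1 a (tsq z) * (1 - tsq z).
 move=> z1; rewrite /pw z1 powRD ?powRr1//; first by rewrite subr_ge0 ltW.
 by apply/implyP => _; rewrite subr_eq0 gt_eqF.
have /andP[q0 _] := qdist_bounds x1 y1.
have E : qdist x y `^ (- (n%:R + 1 + (a + 1))) = qdist x y `^ (- (n%:R + 1 + a)) / qdist x y.
 rewrite (_ : - (n%:R + 1 + (a + 1)) = - (n%:R + 1 + a) - 1); last by ring.
 rewrite powRD; first by rewrite powR_inv1// ltW. by apply/implyP => _; rewrite gt_eqF.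
rewrite /theta /bker E !pwS//.
have c0 : cst_alpha n (a + 1) != 0 by rewrite gt_eqF// cst_alpha_gt0.
by field; rewrite c0 gt_eqF.
Qed.

(** By [qdist_sqr] the invariant factor falls short of 1 by at least
    [|x - y|^2 (1 - |x|^2) / |1 - <x, y>|^2], and the denominator is at most 4. The difference on
    the right has mass [(1 - theta a) iwt]. *)
Lemma concentration a x y : -1 < a -> tsq x < 1 -> tsq y < 1 ->
 tdist x y * bker a x y <= 4 / (1 - tsq x) * (bker a x y - theta a * bker (a + 1) x y).
move=> a1 x1 y1; rewrite (bker_succ a1 x1 y1).
have /andP[q0 q2] := qdist_bounds x1 y1.
set B := (_ * _) / _.
rewrite (_ : bker a x y - bker a x y * B = bker a x y * (1 - B)); last by ring.
rewrite [leRHS]mulrCA [leLHS]mulrC ler_wpM2l ?bker_ge0//.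
have xp : 0 < 1 - tsq x by rewrite subr_gt0.
rewrite (_ : 1 - B = (qdist x y ^+ 2 - (1 - tsq x) * (1 - tsq y)) / qdist x y ^+ 2); last first.
 by rewrite /B; field; rewrite gt_eqF.
rewrite qdist_sqr; have q4 : qdist x y ^+ 2 <= 4 by move: q0 q2; nra.
have q20 : 0 < qdist x y ^+ 2 by rewrite exprn_gt0.
have S0 := sqr_ge0 (normc (dotCn (toCn x) (toCn y) - (tsq x)%:C)).
rewrite [leRHS]mulrA ler_pdivlMr//; apply: (@le_trans _ _ (4 * tdist x y)).
 by rewrite mulrC ler_wpM2r// tdist_ge0.
apply: (@le_trans _ _ (4 / (1 - tsq x) * (tdist x y * (1 - tsq x)))).
 by apply: eqle; field; rewrite gt_eqF.
by rewrite ler_wpM2l ?divr_ge0 ?(ltW xp)// lerDl.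
Qed.

Definition ib rho x : R := if tsq x < rho then 1 else 0.

Lemma ib_01 rho x : 0 <= ib rho x <= 1.
by rewrite /ib; case: (_ < _); rewrite ?lexx ?ler01. Qed.

Lemma meas_ib rho : mfun (ib rho).
by apply: measurable_fun_ifT => //; apply: measurable_fun_ltr => //; exact: meas_tsq.
Qed.

Lemma ib_weight rho : rho < 1 -> rintg (vol R n) (fun x => ib rho x * iwt x).
move=> r1; have [r0|r0] := leP rho 0.
 have -> : (fun x => ib rho x * iwt x) = fun=> 0; last exact: rintg0.
 by apply/funext => x; rewrite /ib ltNge (le_trans r0) ?tsq_ge0// mul0r.
have i0 : rintg (vol R n) (fun x => pw 1 0 (tsq x)).
 have z : -1 < 0 :> R by lra. apply: (rintg_ge0 _ _ (_ : _ <= (pi ^+ n * 1 `^ (0 + n%:R) / rising 0 n)%:E)%E).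
 - by apply/mEFinP; exact: meas_pw_tsq.
 - by move=> x; exact: pw_ge0.
 - by rewrite integral_vol_pw.
apply: (rintg_le _ _ (rintgZ ((1 - rho) ^- n.+1) i0)).
 by apply: mfunM; [exact: meas_ib|exact: meas_iwt].
move=> x; rewrite /ib /iwt /pw; have [xr|xr] := ltP (tsq x) rho; last first.
 by rewrite mul0r normr0 mulr_ge0 ?invr_ge0 ?exprn_ge0 ?subr_ge0 ?(ltW r1)//; case: ifP => // _; exact: powR_ge0.
have x1 := lt_trans xr r1; rewrite x1 mul1r powRr0 mulr1.
have h1 : 0 < 1 - rho by rewrite subr_gt0.
have h2 : 1 - rho <= 1 - tsq x by rewrite lerB// ltW.
rewrite ger0_norm ?invr_ge0 ?exprn_ge0 ?(le_trans (ltW h1) h2)//.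
by rewrite lef_pV2 ?posrE ?exprn_gt0 ?(lt_le_trans h1 h2)// ler_pXn2r ?nnegrE ?(ltW h1)// (le_trans (ltW h1) h2).
Qed.

Lemma bker_out a x y : 1 <= tsq x \/ 1 <= tsq y -> bker a x y = 0.
rewrite /bker /pw; case=> h; first by rewrite [tsq x < 1]ltNge h /= mul0r mulr0 mul0r.
by rewrite [tsq y < 1]ltNge h /= !mulr0 mul0r.
Qed.

Lemma concentration_ge0 a x y : -1 < a -> 0 <= bker a x y - theta a * bker (a + 1) x y.
move=> a1; have [x1|x1] := ltP (tsq x) 1; last by rewrite !bker_out ?mulr0 ?subr0//; left.
have [y1|y1] := ltP (tsq y) 1; last by rewrite !bker_out ?mulr0 ?subr0//; right.
have h := concentration a1 x1 y1.
have p0 : 0 < 4 / (1 - tsq x) by rewrite divr_gt0// subr_gt0.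
by rewrite -(pmulr_rge0 _ p0) (le_trans _ h)// mulr_ge0 ?tdist_ge0 ?bker_ge0.
Qed.

(** If the increment of [phi] is not 0, one of the points has squared norm below [rho], so the
    factor [4 / (1 - |x|^2)] of [concentration] is at most [K]. The mass of the difference kernel is
    of order [1 - theta a = n / (a + 1 + n)]. *)
Lemma good_lipschitz (phi : X -> R) (L rho : R) : mfun phi -> 0 <= L -> rho < 1 ->
 (forall x y, tsq x < 1 -> tsq y < 1 -> (phi x - phi y) ^+ 2 <= L * tdist x y) ->
 (forall x, rho <= tsq x -> phi x = 0) -> good phi.
move=> mphi L0 r1 lip supp; split => // e e0.
pose K := 4 / (1 - rho); have K0 : 0 < K by rewrite divr_gt0// subr_gt0.
pose D a x y := bker a x y - theta a * bker (a + 1) x y.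
have DC a x y : D a x y = D a y x by rewrite /D !(bkerC _ x y).
have pt a x y : -1 < a -> (phi x - phi y) ^+ 2 * bker a x y <= L * K * (ib rho x * D a x y + ib rho y * D a x y).
 move=> a1; have D0 : 0 <= D a x y by exact: concentration_ge0.
 have LK : 0 <= L * K by rewrite mulr_ge0// ltW.
 have hx x' y' : tsq x' < rho -> tsq y' < 1 -> (phi x' - phi y') ^+ 2 * bker a x' y' <= L * K * D a x' y'.
  move=> xr y1; have x1 := lt_trans xr r1. apply: (le_trans (ler_wpM2r (bker_ge0 _ _ a1) (lip _ _ x1 y1))).
  have Dp : 0 <= D a x' y' by exact: concentration_ge0. have hK : 4 / (1 - tsq x') <= K.
   by rewrite ler_wpM2l// lef_pV2 ?posrE ?subr_gt0// lerB// ltW.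
  have h2 := le_trans (concentration a1 x1 y1) (ler_wpM2r Dp hK).
  by rewrite -[leLHS]mulrA -[leRHS]mulrA ler_wpM2l.
 have iy : 0 <= ib rho y * D a x y by rewrite mulr_ge0//; have /andP[] := ib_01 rho y.
 have ix : 0 <= ib rho x * D a x y by rewrite mulr_ge0//; have /andP[] := ib_01 rho x.
 have i0 : 0 <= L * K * (ib rho x * D a x y + ib rho y * D a x y) by rewrite mulr_ge0// addr_ge0.
 have [x1|x1] := ltP (tsq x) 1; last by rewrite bker_out ?mulr0//; left.
 have [y1|y1] := ltP (tsq y) 1; last by rewrite bker_out ?mulr0//; right. have [xr|xr] := ltP (tsq x) rho.
  by rewrite (le_trans (hx _ _ xr y1))// ler_wpM2l// /ib xr mul1r lerDl. have [yr|yr] := ltP (tsq y) rho.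
  rewrite bkerC (_ : (phi x - phi y) ^+ 2 = (phi y - phi x) ^+ 2); last by ring.
  by rewrite (le_trans (hx _ _ yr x1))// ler_wpM2l// DC /ib yr mul1r lerDr.
 by rewrite !supp// subrr expr0n mul0r mulr_ge0// addr_ge0.
pose Lam := rint (vol R n) (fun x => ib rho x * iwt x).
have Lam0 : 0 <= Lam.
 by apply: rint_ge0 => x; rewrite mulr_ge0 ?(wt_ge0 hk)//; have /andP[] := ib_01 rho x.
have Ebound a : -1 < a -> (energy (vol R n) bker a phi <= (L * K * (2 * ((1 - theta a) * Lam)))%:E)%E.
 move=> a1; have a2 : -1 < a + 1 by lra. apply: (energy_dominated hk (k' := D a) (w := ib rho) a1) => //.
 - by rewrite mulr_ge0// ltW.
 - exact: meas_ib.
 - by apply: mfunB; [exact: meas_bker|apply: mfunM => //; exact: meas_bker].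
 - by move=> x; have /andP[] := ib_01 rho x.
 - by move=> x y; exact: concentration_ge0.
 - move=> x; have [h1 h2] := kk_mass hk x a1; have [h3 h4] := kk_mass hk x a2.
  have h5 := rintgZ (theta a) h3; split; first exact: rintgB. by rewrite /D rintB// rintZ// h2 h4; ring.
 - exact: ib_weight.
 - by move=> x y; exact: pt.
pose Q := L * K * (2 * (n%:R * Lam)).
have LK0 : 0 <= L * K by rewrite mulr_ge0// ltW.
have Q0 : 0 <= Q by rewrite /Q (mulr_ge0 LK0)// mulr_ge0// mulr_ge0.
(* The energy is at most [Q / (a + 1 + n)]. *)
exists (Q / e); first by rewrite divr_ge0// ltW.
move=> a Qa; have a0 : 0 <= a by apply: le_trans Qa; rewrite divr_ge0// ltW.
have a1 : -1 < a by lra.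
have an : 0 < a + 1 + n%:R by rewrite ltr_wpDr// ?ler0n//; lra.
apply: (le_trans (Ebound a a1)); rewrite lee_fin thetaE//.
rewrite (_ : L * K * _ = Q / (a + 1 + n%:R)); last by rewrite /Q; field; rewrite gt_eqF.
rewrite ler_pdivrMr// mulrC -ler_pdivrMr// (le_trans Qa)//.
by have : 0 <= n%:R :> R by []; lra.
Qed.

(** A Lipschitz function that tends, as the slope [c] grows, to the indicator of [a] and [b] both
    being positive. *)
Definition plateau (c a b : R) : R := Num.min 1 (c * Num.max 0 (Num.min a b)).

Lemma plateau_lip (c a b a' b' : R) : 0 <= c ->
 (plateau c a b - plateau c a' b') ^+ 2 <= c ^+ 2 * (2 * (a - a') ^+ 2 + 2 * (b - b') ^+ 2).
move=> c0; pose m a b : R := Num.max 0 (Num.min a b).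
have h1 : `|m a b - m a' b'| <= `|a - a'| + `|b - b'|.
 have h0 (u v : R) : `|Num.max 0 u - Num.max 0 v| <= `|u - v|.
  have := ler_norm (u - v); have := ler_norm (v - u); rewrite [`|v - u|]distrC.
  have := normr_ge0 (u - v); move: `|u - v| => t t0 k1 k2.
  by rewrite ler_norml; apply/andP; case: (leP 0 u) => ?; case: (leP 0 v) => ?; split; lra.
 apply: (le_trans (h0 _ _)); have := ler_norm (a - a'); have := ler_norm (b - b').
 have := ler_norm (a' - a); have := ler_norm (b' - b). rewrite [`|a' - a|]distrC [`|b' - b|]distrC.
 have := normr_ge0 (a - a'); have := normr_ge0 (b - b'). move: `|a - a'| `|b - b'| => u v v0 u0 h1 h2 h3 h4.
 by rewrite ler_norml; apply/andP; case: (leP a b) => ?; case: (leP a' b') => ?; split; lra.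
have h2 : `|plateau c a b - plateau c a' b'| <= c * (`|a - a'| + `|b - b'|).
 apply: le_trans (ler_wpM2l c0 h1); rewrite /plateau.
 have -> : c * `|m a b - m a' b'| = `|c * m a b - c * m a' b'| by rewrite -mulrBr normrM (ger0_norm c0).
 rewrite -/(m a b) -/(m a' b'); move: (c * m a b) (c * m a' b') => u v; clear.
 have := ler_norm (u - v); have := ler_norm (v - u); rewrite [`|v - u|]distrC.
 have := normr_ge0 (u - v); move: `|u - v| => t t0 k1 k2.
 by rewrite ler_norml; apply/andP; case: (leP 1 u) => ?; case: (leP 1 v) => ?; split; lra.
rewrite -real_normK ?num_real// -(real_normK (num_real (a - a'))) -(real_normK (num_real (b - b'))).
apply: (@le_trans _ _ ((c * (`|a - a'| + `|b - b'|)) ^+ 2)).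
 by rewrite ler_pXn2r ?nnegrE ?mulr_ge0 ?addr_ge0.
rewrite exprMn ler_wpM2l ?sqr_ge0//.
by have := sqr_ge0 (`|a - a'| - `|b - b'|); rewrite !expr2; lra.
Qed.

Lemma tsq_lip x y : tsq x < 1 -> tsq y < 1 -> (tsq x - tsq y) ^+ 2 <= 4 * tdist x y.
move=> x1 y1; have E : tsq x - tsq y = cRe (dotCn (toCn x - toCn y) (toCn x + toCn y)).
 rewrite -!sqnorm_toCn -[- toCn y]scaleN1r !(dotCnDl, dotCnDr) !dotCnZl !dotCnn [dotCn (toCn y) (toCn x)]dotCnJ.
 by rewrite !mulN1r !ReD !ReN ReJ /=; ring.
have h : sqnorm (toCn x + toCn y) <= 4.
 have : sqnorm (toCn x + toCn y) + sqnorm (toCn x - toCn y) = 2 * (tsq x + tsq y).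
  rewrite -[- toCn y]scaleN1r !sqnormD sqnormZ normcN normc1 expr1n mul1r !sqnorm_toCn dotCnZr.
  by rewrite conjcN conjc_one mulN1r ReN; ring. by have := sqnorm_ge0 (toCn x - toCn y); lra.
rewrite E -real_normK ?num_real//.
apply: (@le_trans _ _ (normc (dotCn (toCn x - toCn y) (toCn x + toCn y)) ^+ 2)).
 by rewrite ler_pXn2r ?nnegrE ?nc_ge0// normRe.
by rewrite (le_trans (cauchy_schwarzCn _ _))// mulrC ler_wpM2r// sqnorm_ge0.
Qed.

(** The indicator is the limit of plateaus of slope [j + 1] in [h] and [rho - |x|^2], which are
    Lipschitz and supported in the smaller ball. *)
Lemma good_region (h : X -> R) (L rho : R) : mfun h -> 0 <= L -> rho < 1 ->
 (forall x y, tsq x < 1 -> tsq y < 1 -> (h x - h y) ^+ 2 <= L * tdist x y) ->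
 good (fun x => \1_[set x | 0 < h x] x * ib rho x).
move=> mh L0 r1 lip.
pose phi j x := plateau j.+1%:R (h x) (rho - tsq x).
have m01 j x : 0 <= phi j x <= 1.
 by rewrite /phi /plateau le_min ler01/= mulr_ge0//= ?ge_min ?lexx// le_max lexx.
have out j x : rho <= tsq x -> phi j x = 0.
 move=> hx; have hm : Num.min (h x) (rho - tsq x) <= 0 by rewrite ge_min subr_le0 hx orbT.
 by rewrite /phi /plateau (max_l hm) mulr0 min_r.
apply: (good_limit hk (phi_ := phi) (g := ib rho)).
- move=> j; apply: (good_lipschitz (L := j.+1%:R ^+ 2 * (2 * L + 8)) (rho := rho)) => //.
 + apply: measurable_minr => //; apply: mfunM => //; apply: measurable_maxr => //.
  apply: measurable_minr => //; apply: mfunB => //; exact: meas_tsq.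
 + by rewrite mulr_ge0 ?sqr_ge0// addr_ge0// mulr_ge0.
 + move=> x y x1 y1; rewrite /phi (le_trans (plateau_lip _ _ _ _ _))// -mulrA ler_wpM2l ?sqr_ge0//.
  have := lip _ _ x1 y1; have := tsq_lip x1 y1.
  by rewrite (_ : rho - tsq x - (rho - tsq y) = - (tsq x - tsq y)) ?sqrrN; [lra|ring].
 + by move=> x; exact: out.
- move=> x; rewrite /ib; have [xr|xr] := ltP (tsq x) rho; last first.
  rewrite mulr0; under eq_fun do rewrite out//; exact: cvg_cst.
 rewrite mulr1 indicE; have [h0|h0] := ltP 0 (h x); last first. rewrite memNset/=; last by rewrite ltNge h0.
  rewrite (_ : (fun j => _) = fun=> 0); first exact: cvg_cst.
  have hm : Num.min (h x) (rho - tsq x) <= 0 by rewrite ge_min h0.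
  by apply/funext => j; rewrite /phi /plateau (max_l hm) mulr0 min_r.
 rewrite mem_set//=; have m0 : 0 < Num.min (h x) (rho - tsq x) by rewrite lt_min h0 subr_gt0.
 apply/cvgrPdist_le => e e0; near=> j; rewrite /phi /plateau.
 rewrite (max_r (ltW m0)) min_l ?subrr ?normr0 ?(ltW e0)//. rewrite -ler_pdivrMr// mul1r ltW// -[ltLHS]invrK.
 have m1 : 0 < (Num.min (h x) (rho - tsq x))^-1^-1 by rewrite invrK.
 rewrite -[ltRHS]invrK ltf_pV2 ?posrE ?invr_gt0 ?invrK//.
 by near: j; exact: near_infty_natSinv_lt (PosNum m0).
- move=> j x; have /andP[h0 h1] := m01 j x; rewrite ger0_norm//.
 by rewrite /ib; have [//|xr] := ltP (tsq x) rho; rewrite out.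
- have := ib_weight r1; congr rintg; apply/funext => x; rewrite /ib; case: (_ < _); rewrite ?expr1n ?expr0n//.
Unshelve. all: by end_near. Qed.

Lemma good_ib rho : rho < 1 -> good (ib rho).
move=> r1; have -> : ib rho = fun x => \1_[set x | 0 < (fun=> 1) x :> R] x * ib rho x.
 by apply/funext => x; rewrite indicE mem_set ?mul1r//=.
by apply: (good_region (L := 0)) => // x y _ _; rewrite subrr expr0n mul0r.
Qed.

(** The cut-off at [rho < 1] is essential: the invariant weight has infinite mass on the ball, so
    indicators alone would have no dominating function. *)
Definition good_set (A : set X) := measurable A /\ forall rho, rho < 1 -> good (fun x => \1_A x * ib rho x).

(** Finite unions come from inclusion-exclusion and [goodM], countable ones from [good_limit] with
    [ib rho] as dominating function. *)
Lemma sigma_algebra_good_set : sigma_algebra setT good_set.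
have indic_le (A : set X) x : `|\1_A x : R| <= 1 by rewrite indicE; case: (_ \in _); rewrite ?normr1 ?normr0.
have ib_le rho x : `|ib rho x| <= 1 by have /andP[h1 h2] := ib_01 rho x; rewrite ger0_norm.
have ib_idem rho x : ib rho x * ib rho x = ib rho x.
 by rewrite /ib; case: (_ < _); rewrite ?mulr1 ?mulr0.
have goodU A B : good_set A -> good_set B -> good_set (A `|` B).
 move=> [mA gA] [mB gB]; split; first exact: measurableU.
 move=> rho r1; have gAB := goodM hk (gA _ r1) (gB _ r1).
 have := goodB hk (goodD hk (gA _ r1) (gB _ r1)) (gAB _ _).
 have -> : (fun x => \1_(A `|` B) x * ib rho x) = fun x =>
   \1_A x * ib rho x + \1_B x * ib rho x - \1_A x * ib rho x * (\1_B x * ib rho x).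
  apply/funext => x; rewrite mulrACA ib_idem !indicE in_setU.
  by case: (x \in A); case: (x \in B); rewrite /= ?mul1r ?mul0r; ring.
 by apply => x; rewrite normrM mulr_ile1.
have good0' : good_set set0.
 split => // rho r1; have -> : (fun x => \1_set0 x * ib rho x) = fun=> 0 by apply/funext => x; rewrite indic0 mul0r.
 exact: good0.
split => //.
- move=> A [mA gA]; split; first exact: measurableD.
 move=> rho r1; have -> : (fun x => \1_(setT `\` A) x * ib rho x) = fun x => ib rho x - \1_A x * ib rho x.
  apply/funext => x; rewrite !indicE setTD in_setC; case: (x \in A); rewrite /= ?mul1r ?mul0r ?subrr ?subr0//.
 by apply: (goodB hk); [exact: good_ib|exact: gA].
- move=> F gF; split; first by apply: bigcup_measurable => k _; case: (gF k).
 move=> rho r1; pose U j := \big[setU/set0]_(0 <= k < j) F k. have gU j : good_set (U j).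
  rewrite /U; elim: j => [|j IH]; first by rewrite big_geq. by rewrite big_nat_recr//=; exact: goodU.
 apply: (good_limit hk (phi_ := fun j x => \1_(U j) x * ib rho x) (g := ib rho)).
 + by move=> j; exact: (gU j).2. + move=> x; apply: cvgMl; have [[k _ Fkx]|nx] := pselect ((\bigcup_k F k) x).
   rewrite (_ : \1_(\bigcup_k F k) x = 1); last by rewrite indicE mem_set//; exists k.
   apply/cvgrPdist_le => e e0; near=> j; rewrite indicE mem_set ?subrr ?normr0 ?(ltW e0)//.
   by rewrite /U big_mkord -bigcup_mkord; exists k => //=; near: j; exact: nbhs_infty_gt.
  rewrite (_ : \1_(\bigcup_k F k) x = 0); last by rewrite indicE memNset.
  rewrite (_ : (fun j => _) = fun=> 0); first exact: cvg_cst.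
  apply/funext => j; rewrite indicE memNset// /U big_mkord -bigcup_mkord => -[k _ Fkx].
  by apply: nx; exists k.
 + by move=> j x; rewrite normrM -[leRHS]mul1r ler_pM// ger0_norm//; have /andP[] := ib_01 rho x.
 + have := ib_weight r1; congr rintg; apply/funext => x; rewrite expr2 ib_idem//.
Unshelve. all: by end_near. Qed.

Lemma good_set_coord (c : X -> R) : mfun c ->
 (forall x y, (c x - c y) ^+ 2 <= tdist x y) -> forall a, good_set (c @^-1` `]a, +oo[).
move=> mc lc a; split; first by rewrite -[X in measurable X]setTI; exact: mc.
move=> rho r1; rewrite (_ : c @^-1` `]a, +oo[ = [set x | 0 < c x - a]); last first.
 by apply/seteqP; split => x; rewrite /= in_itv/= andbT subr_gt0.
apply: (good_region (L := 1)) => //; first exact: mfunB.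
by move=> x y _ _; rewrite mul1r (_ : c x - a - (c y - a) = c x - c y)//; ring.
Qed.

Lemma coord_tdist x y i : ((tnth x i).1 - (tnth y i).1) ^+ 2 <= tdist x y /\
 ((tnth x i).2 - (tnth y i).2) ^+ 2 <= tdist x y.
have h : normc ((toCn x - toCn y) ord0 i) ^+ 2 <= tdist x y.
 by rewrite /tdist sqnormE (bigD1 i)//= lerDl sumr_ge0// => j _; rewrite sqr_ge0.
move: h; rewrite sqr_normcE !mxE/= => h.
by split; apply: le_trans h; rewrite ?lerDl ?lerDr sqr_ge0.
Qed.

(* Measurability into a tuple of pairs is tested on coordinates, so it suffices
  that the identity be measurable from the sigma-algebra of good sets. *)
Lemma meas_good_set (A : set X) : measurable A -> good_set A.
move=> mA; have E := sigma_algebra_id sigma_algebra_good_set.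
have idm : measurable_fun [set: g_sigma_algebraType good_set] (idfun : g_sigma_algebraType good_set -> X).
 apply/measurable_fun_tnthP => i; apply/measurable_fun_pairP.
 by split; apply: (measurability _ (RGenOInfty.measurableE R)) => // _ [_ [a ->] <-];
  rewrite setTI; apply: sub_sigma_algebra;
  [apply: (@good_set_coord (fun x => (tnth x i).1))|apply: (@good_set_coord (fun x => (tnth x i).2))];
  (try by move=> x y; have [] := coord_tdist x y i);
  [apply: (mcomp measurable_fst)|apply: (mcomp measurable_snd)]; exact: measurable_tnth.
have := idm measurableT A mA; rewrite setTI preimage_id => h.
by rewrite -E.
Qed.

Lemma good_nnsfun (f : {nnsfun X >-> R}) rho : rho < 1 -> good (fun x => f x * ib rho x).
move=> r1.
have -> : (fun x => f x * ib rho x) = fun x =>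
  \sum_(y <- finmap.enum_fset (fset_set (range f))) y * (\1_(f @^-1` [set y]) x * ib rho x).
 apply/funext => x; rewrite {1}fimfunE fsbig_finite//= mulr_suml. by apply: eq_bigr => y _; rewrite mulrA.
apply: (good_sum hk) => y; apply: (goodZ hk).
have [_] : good_set (f @^-1` [set y]) by exact: meas_good_set.
exact.
Qed.

(** Simple functions, cut off at squared radius [1 - 1 / (j + 1)], tend to [sig] and are dominated
    by [sig] itself, whose square is integrable. *)
Lemma good_nonneg (sig : X -> R) : mfun sig -> (forall x, 0 <= sig x) ->
 (forall x, 1 <= tsq x -> sig x = 0) -> rintg (vol R n) (fun x => sig x ^+ 2 * iwt x) -> good sig.
move=> ms s0 sout si.
have mE : mfun (EFin \o sig) by exact/mEFinP.
pose f := nnsfun_approx measurableT mE.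
have cf x : (f j x) @[j --> \oo] --> sig x.
 have /(_ x I) h := cvg_nnsfun_approx measurableT mE (fun x _ => s0 x). by move: (h) => /fine_cvgP[_]; exact.
have lef j x : f j x <= sig x.
 have nd : {homo f ^~ x : n m / (n <= m)%N >-> n <= m}.
  by move=> k l kl; have /lefP := nd_nnsfun_approx measurableT mE kl; exact.
 by rewrite -(cvg_lim _ (cf x))//; apply: nondecreasing_cvgn_le => //; exact: cvgP (cf x).
have r1 j : 1 - j.+1%:R^-1 < 1 :> R by rewrite gtrBl invr_gt0.
apply: (good_limit hk (phi_ := fun j x => f j x * ib (1 - j.+1%:R^-1) x) (g := sig)) => //.
- by move=> j; exact: good_nnsfun.
- move=> x; have [x1|x1] := ltP (tsq x) 1; last first.
  rewrite (sout _ x1) (_ : (fun j => _) = fun=> 0); first exact: cvg_cst.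
  by apply/funext => j; rewrite /ib ltNge (le_trans (ltW (r1 j)))//= mulr0.
 have d0 : 0 < 1 - tsq x by rewrite subr_gt0. rewrite -[X in _ --> X]mulr1; apply: cvgM; first exact: cf.
 apply/cvgrPdist_le => e e0; near=> j; rewrite /ib ifT ?subrr ?normr0 ?(ltW e0)//.
 have : j.+1%:R^-1 < 1 - tsq x by near: j; exact: near_infty_natSinv_lt (PosNum d0).
 by rewrite ltrBrDr => h; rewrite ltrBrDr addrC.
- move=> j x; have /andP[h0 h1] := ib_01 (1 - j.+1%:R^-1) x.
 rewrite ger0_norm ?mulr_ge0//; apply: le_trans (lef j x). by rewrite ler_piMr.
Unshelve. all: by end_near. Qed.

Lemma berezin_limit (sig : X -> R) : mfun sig ->
 (forall x, 1 <= tsq x -> sig x = 0) -> rintg (vol R n) (fun x => sig x ^+ 2 * iwt x) -> good sig.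
move=> ms sout si.
have H (s : X -> R) : mfun s -> (forall x, s x = sig x) \/ (forall x, s x = - sig x) ->
  good (fun x => Num.max (s x) 0).
 move=> mes hs; have hs2 x : s x ^+ 2 = sig x ^+ 2 by case: hs => ->; rewrite ?sqrrN. apply: good_nonneg.
 - exact: measurable_maxr.
 - by move=> x; rewrite le_max lexx orbT.
 - by move=> x x1; case: hs => ->; rewrite sout// ?oppr0 maxxx.
 - apply: (rintg_le _ _ si). apply: mfunM; last exact: meas_iwt. by apply: mfunX; exact: measurable_maxr.
  move=> x; rewrite normrM (ger0_norm (sqr_ge0 _)) (ger0_norm (wt_ge0 hk x)) ler_wpM2r ?(wt_ge0 hk)// -hs2.
  by have [h|h] := leP (s x) 0; rewrite ?expr0n ?sqr_ge0.
have g1 := H sig ms (or_introl (fun x => erefl)).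
have g2 := H (fun x => - sig x) (mcomp (@oppr_measurable R setT) ms) (or_intror (fun x => erefl)).
have := goodB hk g1 g2; congr good; apply/funext => x.
have [h|h] := leP (sig x) 0; first by rewrite max_l ?sub0r ?opprK// oppr_ge0.
by rewrite max_r ?subr0// oppr_le0 ltW.
Qed.

End BergmanKernels.

(** * Locally bounded limits of holomorphic functions of several variables *)

Section UltraLimit.
Variable R : realType.
Notation C := R[i].
Variables (U : set_system nat).
Hypothesis UU : UltraFilter U.

(** The complex line in direction [h] is rescaled so that its unit disc fills the ball of squared
    radius [d]. The condition [t <= 1 / 4] of [taylor2] becomes [|h|^2 <= d / 16]. *)
Lemma taylor_ball n (G : Cn R n -> cplx R) (w : Cn R n) (c : 'I_n -> C) (B d : R) h :
 0 <= B -> 0 < d -> (forall h, sqnorm h < d -> differentiable G (w + h) /\ normc (G (w + h)) <= B) ->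
 (forall h, cdiff (fun u => G (w + u *: h)) (linform c h) 0) ->
 sqnorm h <= d / 16 -> normc (G (w + h) - G w - linform c h) <= 8 * B / d * sqnorm h.
move=> B0 d0 GB cG hd.
have linZ a k : linform c (a *: k) = a * linform c k.
 by rewrite /linform mulr_sumr; apply: eq_bigr => i _; rewrite mxE mulrA.
have [h0|h0] := eqVneq (sqnorm h) 0.
 rewrite (sqnorm_eq0 h0) addr0 subrr -(scale0r (0 : Cn R n)) linZ mul0r subr0 normc0.
 by rewrite scale0r sqnorm0 mulr0.
have hp : 0 < sqnorm h by rewrite lt_neqAle eq_sym h0 sqnorm_ge0.
pose t := Num.sqrt (sqnorm h / d).
have t0 : 0 < t by rewrite sqrtr_gt0 divr_gt0.
have t2 : t ^+ 2 = sqnorm h / d by rewrite sqr_sqrtr// divr_ge0 ?ltW.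
have t4 : t <= 1 / 4.
 rewrite -(@ler_pXn2r _ 2) ?nnegrE ?(ltW t0)// t2 ler_pdivrMr// (le_trans hd)//. by apply: eqle; field.
pose e := (t^-1)%:C *: h.
have se : sqnorm e = d.
 rewrite /e sqnormZ normcR ger0_norm ?invr_ge0 ?(ltW t0)// exprVn t2 invf_div. by rewrite divfK.
have sue u : normc u < 1 -> sqnorm (u *: e) < d.
 move=> u1; rewrite sqnormZ se -[ltRHS]mul1r ltr_pM2r// expr_lt1 ?nc_ge0//.
have := @taylor2 R (fun u => G (w + u *: e)) B (linform c e) (t%:C) B0 _ _ _ _.
rewrite normcR ger0_norm ?(ltW t0)// t2 scale0r addr0.
have Eh : t%:C *: e = h by rewrite /e scalerA -RCM mulfV ?scale1r// lt0r_neq0.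
have El : linform c e * t%:C = linform c h by rewrite [LHS]mulrC -linZ Eh.
rewrite Eh El.
move=> H; apply: (le_trans (H _ _ _ _)).
- by move=> u u1; apply: differentiable_line; exact: (GB _ (sue u u1)).1.
- by move=> u u1; exact: (GB _ (sue u u1)).2.
- exact: cG.
- exact: t4.
- by apply: eqle; field; rewrite lt0r_neq0.
Qed.

(** The second-order Taylor bound holds with one constant for all [F j]; along the ultrafilter
    values and gradients converge, so it passes to the limit, where [differentiable_taylor]
    applies. *)
Lemma differentiable_ultralimit n (F : nat -> Cn R n -> cplx R) (l : Cn R n -> cplx R) (w : Cn R n) (B d : R) :
 0 <= B -> 0 < d -> (forall j h, sqnorm h < d -> differentiable (F j) (w + h) /\ normc (F j (w + h)) <= B) ->
 (forall h, sqnorm h < d -> forall e : R, 0 < e -> U [set j | normc (F j (w + h) - l (w + h)) <= e]) ->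
 differentiable l w.
move=> B0 d0 FB Fl.
have Fw j : differentiable (F j) w by have [] := FB j 0; rewrite ?addr0 ?sqnorm0.
have /choice[c cP] := fun j => differentiable_direction (Fw j).
have lw e : 0 < e -> U [set j | normc (F j w - l w) <= e].
 by have := Fl 0; rewrite addr0 sqnorm0; apply.
have d16 : 0 < d / 16 by rewrite divr_gt0.
pose t := Num.sqrt (d / 16); have t0 : 0 < t by rewrite sqrtr_gt0.
have tay j h : sqnorm h <= d / 16 -> normc (F j (w + h) - F j w - linform (c j) h) <= 8 * B / d * sqnorm h.
 exact: (taylor_ball B0 d0 (FB j) (cP j)).
(* The Taylor bound at a step of length [t] along each axis shows that the gradients are bounded, by
   [2 B + B / 2 <= 3 B] over [t]. *)
have /choice[k kP] : forall i, exists l, forall e : R, 0 < e -> U [set j | normc (c j i - l) <= e].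
 move=> i; apply: (ultra_bounded_complex (M := (3 * B) / t) UU) => j.
 pose h : Cn R n := t%:C *: delta_mx ord0 i. have sh : sqnorm h = d / 16.
  rewrite sqnormZ normcR ger0_norm ?(ltW t0)// sqr_sqrtr ?(ltW d16)//.
  rewrite sqnormE (bigD1 i)//= mxE !eqxx normc1 expr1n big1 ?addr0 ?mulr1// => j' ij.
  by rewrite mxE (negbTE ij) andbF normc0 expr0n. have lh : linform (c j) h = t%:C * c j i.
  rewrite /linform (bigD1 i)//= !mxE !eqxx mulr1 big1 ?addr0// => j' ij.
  by rewrite !mxE (negbTE ij) andbF mulr0 mul0r. have := tay j h; rewrite sh lexx => /(_ isT) h1.
 have [|_ h2] := FB j h; first by rewrite sh; lra. have [|_ h3] := FB j 0; first by rewrite sqnorm0.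
 rewrite addr0 in h3; rewrite ler_pdivlMr// mulrC. have -> : t * normc (c j i) = normc (linform (c j) h).
  by rewrite lh normcM normcR ger0_norm// ltW.
 rewrite (_ : linform _ _ = (F j (w + h) - F j w) - (F j (w + h) - F j w - linform (c j) h)); last by ring.
 apply: (le_trans (normcBD _ _)); have h4 := normcBD (F j (w + h)) (F j w).
 have E : 8 * B / d * (d / 16) = B / 2 by field; rewrite lt0r_neq0. by rewrite E in h1; lra.
apply: (differentiable_taylor (c := k) (K := 8 * B / d) (d := d / 16)) => //.
 by rewrite divr_ge0 ?(ltW d0)// mulr_ge0.
move=> h /ltW hd.
have lin e : 0 < e -> U [set j | normc (linform (c j) h - linform k h) <= e].
 have H (r : seq 'I_n) e' : 0 < e' ->
   U [set j | normc (\sum_(i <- r) (h ord0 i * c j i) - \sum_(i <- r) (h ord0 i * k i)) <= e'].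
  elim: r e' => [|i r IH] e' e'0. by apply: filterS filterT => j _ /=; rewrite !big_nil subrr normc0 ltW.
  have e2 : 0 < e' / 2 by rewrite divr_gt0. have n0 : 0 < normc (h ord0 i) + 1 by rewrite ltr_wpDl ?nc_ge0.
  apply: filterS2 (IH _ e2) (kP i _ (divr_gt0 e2 n0)) => j /= h1; rewrite ler_pdivlMr// => h2.
  rewrite !big_cons (_ : _ - _ = h ord0 i * (c j i - k i) +
   (\sum_(i <- r) (h ord0 i * c j i) - \sum_(i <- r) (h ord0 i * k i))); last by ring.
  rewrite (le_trans (normcD _ _))// (splitr e') lerD// normcM mulrC (le_trans _ h2)//.
  by rewrite ler_wpM2l ?nc_ge0// lerDl. exact: H.
apply/ler_addgt0Pr => e e0; have e3 : 0 < e / 3 by rewrite divr_gt0.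
have hd' : sqnorm h < d by lra.
have [j [[/= h1 h2] h3]] := filter_ex (filterI (filterI (Fl h hd' _ e3) (lw _ e3)) (lin _ e3)).
rewrite (_ : l (w + h) - l w - linform k h = (F j (w + h) - F j w - linform (c j) h) -
 ((F j (w + h) - l (w + h)) - (F j w - l w) - (linform (c j) h - linform k h))); last by ring.
apply: (le_trans (normcBD _ _)); apply: lerD; first exact: tay.
apply: (le_trans (normcBD _ _)); have := normcBD (F j (w + h) - l (w + h)) (F j w - l w).
by move: h1 h2 h3; lra.
Qed.

End UltraLimit.

(** The expansion of the square norm of [s p^* f + g], where [p = <f, g>], [nf = <f, f>] and
    [k = <g, g>], isolated from the functions for [semi_cauchy_schwarz]. *)
Lemma quadratic_identity (R : realType) (s P nf k : R) (p : R[i]) : p * p^* = P%:C ->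
 s%:C * p^* * (s%:C * p^* * nf%:C + p^*)^* + (s%:C * p^* * p + k%:C)^* =
 (s ^+ 2 * (P * nf) + 2 * s * P + k)%:C.
move=> pp; rewrite !(conjcD, conjcM, conjcR, conjCK) !RCD !RCM -pp (rmorph_nat (real_complex R)).
ring.
Qed.

(** * The weighted Bergman space is a Hilbert space with reproducing kernel *)

Section BergmanSpace.
Variables (R : realType) (m : nat) (a : R).
Hypothesis a1 : -1 < a.
Notation C := R[i].
Notation RR := (RxR R).
Notation n := m.+1.
Notation X := (n.-tuple RR).
Notation mu := (vol R n).
Notation bwt x := (pw 1 a (tsq x)).
Notation cst := (cst_alpha n a).
Implicit Types (f g : Cn R n -> cplx R) (x y : X).

Lemma cst_gt0 : 0 < cst. exact: cst_alpha_gt0. Qed.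

Lemma meas_tball : measurable [set x : X | tsq x < 1].
rewrite (_ : [set _ | _] = (tsq (n := n)) @^-1` `]-oo, 1[); last first.
 by apply/seteqP; split => x; rewrite /= in_itv.
by rewrite -[X in measurable X]setTI; exact: (meas_tsq (n := n)).
Qed.

Lemma ball_coordsE : @ball_coords R n = [set x : X | tsq x < 1].
by apply/seteqP; split => x; rewrite /ball_coords /unit_ball/= sqnorm_toCn. Qed.
Lemma unit_ball_toCn x : unit_ball (toCn x) <-> tsq x < 1.
by rewrite /unit_ball/= sqnorm_toCn. Qed.

Lemma restrict_ball (F : Cn R n -> R) : (EFin \o (fun x : X => F (toCn x))) \_ [set x : X | tsq x < 1] =
 EFin \o (fun x : X => ib 1 x * F (toCn x)).
apply/funext => x; rewrite patchE /ib /=; case: ifPn => [/set_mem/= ->|]; first by rewrite mul1r.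
by move=> /negP h; case: ifPn => [h2|_]; [case: h; exact/mem_set|rewrite mul0r].
Qed.

(** From the completed measure on the ball to the Borel measure on the whole space; the ball
    survives as the factor [ib 1]. *)
Lemma int_ballE (F : Cn R n -> R) : mfun (fun x : X => F (toCn x)) ->
 int_ball F = rint mu (fun x => ib 1 x * F (toCn x)).
move=> mF; rewrite /int_ball /rint /Rintegral; congr fine.
have mF' : measurable_fun [set x : X | tsq x < 1] (EFin \o (fun x : X => F (toCn x))).
 by apply/mEFinP; exact: measurable_funTS.
have := integral_completion mu meas_tball mF'.
rewrite -ball_coordsE => h; rewrite [LHS]h ball_coordsE.
transitivity (\int[mu]_x ((EFin \o (fun x : X => ib 1 x * F (toCn x))%R) x))%E => //.
by rewrite -restrict_ball -integral_mkcond.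
Qed.

Lemma integrable_on_ballE (F : Cn R n -> R) : mfun (fun x : X => F (toCn x)) ->
 integrable_on_ball F <-> rintg mu (fun x => ib 1 x * F (toCn x)).
move=> mF.
have mF' : measurable_fun [set x : X | tsq x < 1] (EFin \o (fun x : X => F (toCn x))).
 by apply/mEFinP; exact: measurable_funTS.
have := integrable_completion mu meas_tball mF'.
rewrite -ball_coordsE => h; rewrite /integrable_on_ball h ball_coordsE /rintg -restrict_ball.
by rewrite -integrable_mkcond//; exact: meas_tball.
Qed.

Lemma weight_bwt x : ib 1 x * weight a (toCn x) = bwt x.
by rewrite /ib /weight /pw sqnorm_toCn; case: ifP; rewrite ?mul1r ?mul0r. Qed.
Lemma meas_bwt : mfun (fun x : X => bwt x).
by apply/mEFinP; exact: meas_pw_tsq. Qed.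

Lemma rintg_bwt : rintg mu (fun x => bwt x).
apply: (rintg_ge0 meas_bwt _ (_ : _ <= (pi ^+ n * 1 `^ (a + n%:R) / rising a n)%:E)%E).
- by move=> x; exact: pw_ge0.
- by rewrite integral_vol_pw.
Qed.

Lemma meas_weight : mfun (fun x : X => weight a (toCn x)).
rewrite /weight; under eq_fun do rewrite sqnorm_toCn.
apply: (mcomp (measurable_powR _)).
by apply: mfunB => //; exact: meas_tsq.
Qed.

Definition hol_ball f := (forall z, unit_ball z -> differentiable (f : Cn R n -> cplx R) z) /\
 forall z, ~ unit_ball z -> f z = 0.

Lemma hol_meas f : hol_ball f -> cmeas setT (fun x : X => f (toCn x)).
move=> [df f0].
have [h1 h2] : cmeas [set x : X | tsq x < 1] (fun x : X => f (toCn x)).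
 by apply: cmeas_tccont => x /= x1; apply: differentiable_tccont; apply: df; exact/unit_ball_toCn.
have E (p : C -> R) : p 0 = 0 -> (fun x : X => p (f (toCn x))) \_ [set x : X | tsq x < 1] = fun x => p (f (toCn x)).
 move=> p0; apply/funext => x; rewrite patchE; case: ifPn => // /negP h.
 by rewrite f0 ?p0// => /unit_ball_toCn h'; apply: h; exact/mem_set.
by split; [rewrite -(E (@complex.Re R))//|rewrite -(E (@complex.Im R))//];
 apply/(measurable_restrictT _ meas_tball).
Qed.

Lemma bergmanP f : bergman a f <-> hol_ball f /\ rintg mu (fun x => normc (f (toCn x)) ^+ 2 * bwt x).
suff H : hol_ball f -> (integrable_on_ball (fun z => complex.Re (f z * (f z)^*) * weight a z) <->
  rintg mu (fun x => normc (f (toCn x)) ^+ 2 * bwt x)).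
 by split=> [[h1 h2 h3]|[[h1 h2] h3]]; [split => //; exact/H|split => //; exact/H].
move=> hf; rewrite integrable_on_ballE; last first.
 apply: mfunM; last exact: meas_weight. under eq_fun do rewrite mulcJ/=.
 by apply: mfunX; apply: cmeas_normc => //; exact: hol_meas.
rewrite (_ : (fun x : X => _) = fun x => normc (f (toCn x)) ^+ 2 * bwt x)//.
by apply/funext => x; rewrite mulcJ mulrCA weight_bwt.
Qed.

Lemma normc_sqr_add (c u v : C) : normc (c * u + v) ^+ 2 <= 2 * normc c ^+ 2 * normc u ^+ 2 + 2 * normc v ^+ 2.
have := normcD (c * u) v; rewrite normcM => h.
have := nc_ge0 (c * u + v); have := mulr_ge0 (nc_ge0 c) (nc_ge0 u); have := nc_ge0 v.
rewrite -[_ * normc u ^+ 2]mulrA -exprMn; move: h; move: (normc c * normc u) (normc v) (normc (_ + _)) => p q r.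
move=> h q0 p0 r0; have : r ^+ 2 <= (p + q) ^+ 2 by rewrite ler_pXn2r ?nnegrE ?addr_ge0.
by have := sqr_ge0 (p - q); rewrite !expr2; lra.
Qed.

Lemma rintg_sqr f : cmeas setT (fun x : X => f (toCn x)) ->
 mfun (fun x : X => normc (f (toCn x)) ^+ 2 * bwt x).
move=> mf; apply: mfunM; last exact: meas_bwt.
by apply: mfunX; apply: cmeas_normc.
Qed.

Lemma bsub : subspace (bergman (n := n) a).
split.
 apply/bergmanP; split; first by split => // z _; exact: differentiable_cst.
 by under eq_fun do rewrite normc0 expr0n mul0r; exact: rintg0.
move=> c f g /bergmanP[[df f0] fi] /bergmanP[[dg g0] gi].
have hol : hol_ball (c *: f + g).
 split => z zb; last first. by have -> : (c *: f + g) z = c * f z + g z by []; rewrite f0// g0// mulr0 addr0.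
 by apply: differentiableD; [apply: differentiableZ; exact: df|exact: dg].
apply/bergmanP; split => //.
apply: (rintg_le (rintg_sqr (hol_meas hol)) _ (rintgD (rintgZ (2 * normc c ^+ 2) fi) (rintgZ 2 gi))).
move=> x; rewrite normrM (ger0_norm (sqr_ge0 _)) (ger0_norm (pw_ge0 _ _ _)).
apply: (@le_trans _ _ ((2 * normc c ^+ 2 * normc (f (toCn x)) ^+ 2 + 2 * normc (g (toCn x)) ^+ 2) * bwt x)).
 by rewrite ler_wpM2r ?pw_ge0// normc_sqr_add.
by apply: eqle; ring.
Qed.

Definition pairing f g := cint mu setT (fun x => f (toCn x) * (g (toCn x))^* * (bwt x)%:C).

Lemma pairing_integrable f g : bergman a f -> bergman a g ->
 cintg mu setT (fun x => f (toCn x) * (g (toCn x))^* * (bwt x)%:C).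
move=> /bergmanP[hf fi] /bergmanP[hg gi].
apply: (le_cintegrable measurableT _ (rintgD (rintgZ (2^-1) fi) (rintgZ (2^-1) gi))).
 apply: cmeasM => //; last exact: cmeasR meas_bwt.
 by apply: cmeasM => //; [exact: hol_meas|apply: cmeasJ => //; exact: hol_meas].
move=> x _; rewrite !normcM normcJ normcR (ger0_norm (pw_ge0 _ _ _)) !mulrA -mulrDl ler_wpM2r ?pw_ge0//.
have := sqr_ge0 (normc (f (toCn x)) - normc (g (toCn x))).
by rewrite !expr2; lra.
Qed.

Lemma bergman_ipE f g : bergman a f -> bergman a g -> bergman_ip a f g = cst%:C * pairing f g.
move=> /bergmanP[hf _] /bergmanP[hg _]; congr (_ * _).
have mfg : cmeas setT (fun x : X => f (toCn x) * (g (toCn x))^* * (weight a (toCn x))%:C).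
 apply: cmeasM => //; last exact: cmeasR meas_weight.
 by apply: cmeasM => //; [exact: hol_meas|apply: cmeasJ => //; exact: hol_meas].
have [m1 m2] := mfg; rewrite /cint_ball.
by apply: eqc; rewrite /= int_ballE//; apply: eq_rint => x;
 rewrite -weight_bwt RCM mulrCA ?ReZ ?ImZ.
Qed.

(** Cut off in [z] because elements of the space vanish off the ball, and in [w] so that it is
    defined for every point of the underlying space. *)
Definition bkernel (w z : Cn R n) : cplx R :=
 if (sqnorm w < 1) && (sqnorm z < 1) then cpow (1 - dotCn z w) (- (n%:R + 1 + a)) else 0.

Lemma bexp_ge0 : 0 <= n%:R + 1 + a.
by have : 1 <= n%:R :> R; [rewrite ler1n|move: a1; lra]. Qed.

Lemma bkernel_bound (w z : Cn R n) : sqnorm w < 1 ->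
 normc (bkernel w z) <= (1 - Num.sqrt (sqnorm w)) `^ (- (n%:R + 1 + a)).
move=> w1; rewrite /bkernel w1/=; case: ifP => [z1|_]; last by rewrite normc0 powR_ge0.
have r1 : Num.sqrt (sqnorm w) < 1 by rewrite -sqrtr1 ltr_sqrt.
apply: (normc_cpow_bound bexp_ge0 _ r1).1.
rewrite -(@ler_pXn2r _ 2) ?nnegrE ?nc_ge0 ?sqrtr_ge0// sqr_sqrtr ?sqnorm_ge0//.
by rewrite (le_trans (cauchy_schwarzCn _ _))// ler_piMl ?sqnorm_ge0// ltW.
Qed.

Lemma dot_lt1 (w z : Cn R n) : sqnorm w < 1 -> sqnorm z < 1 -> normc (dotCn z w) < 1.
move=> w1 z1; rewrite -(@ltr_pXn2r _ 2) ?nnegrE ?nc_ge0// expr1n.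
apply: (le_lt_trans (cauchy_schwarzCn _ _)).
by have := sqnorm_ge0 z; have := sqnorm_ge0 w; move: w1 z1; nra.
Qed.

Lemma sqnorm_triangle (x y : Cn R n) : Num.sqrt (sqnorm (x + y)) <= Num.sqrt (sqnorm x) + Num.sqrt (sqnorm y).
rewrite -(@ler_pXn2r _ 2) ?nnegrE ?addr_ge0 ?sqrtr_ge0// sqr_sqrtr ?sqnorm_ge0// sqnormD sqrrD.
rewrite !sqr_sqrtr ?sqnorm_ge0// lerD2r lerD2l mulr2n.
suff : cRe (dotCn x y) <= Num.sqrt (sqnorm x) * Num.sqrt (sqnorm y) by lra.
rewrite (le_trans (Re_le_normc _))// -(@ler_pXn2r _ 2) ?nnegrE ?nc_ge0 ?mulr_ge0 ?sqrtr_ge0//.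
by rewrite exprMn !sqr_sqrtr ?sqnorm_ge0// cauchy_schwarzCn.
Qed.

Lemma ball_nbhd (w : Cn R n) : sqnorm w < 1 -> exists d r : R, [/\ 0 < d, 0 <= r < 1 &
 forall h, sqnorm h < d -> sqnorm (w + h) <= r ^+ 2].
move=> w1; have r1 : Num.sqrt (sqnorm w) < 1 by rewrite -sqrtr1 ltr_sqrt.
have r0 := sqrtr_ge0 (sqnorm w); set r := Num.sqrt (sqnorm w) in r0 r1 *.
exists (((1 - r) / 2) ^+ 2), ((1 + r) / 2); split.
- by rewrite exprn_gt0// divr_gt0// subr_gt0.
- by apply/andP; split; lra.
- move=> h hd; have hh : Num.sqrt (sqnorm h) <= (1 - r) / 2.
  by rewrite -(@ler_pXn2r _ 2) ?nnegrE ?sqrtr_ge0 ?sqr_sqrtr ?sqnorm_ge0 ?(ltW hd)//; lra.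
 rewrite -[leLHS]sqr_sqrtr ?sqnorm_ge0// ler_pXn2r ?nnegrE ?sqrtr_ge0//; last lra.
 by rewrite (le_trans (sqnorm_triangle _ _))// -/r; lra.
Qed.

(** The difference vanishes near [w], a case of [differentiable_quadratic] with [K = 0]; this
    removes the effect of the extension by 0. *)
Lemma differentiable_on_ball f g (w : Cn R n) : sqnorm w < 1 ->
 (forall z, sqnorm z < 1 -> f z = g z) -> differentiable (g : Cn R n -> cplx R) w ->
 differentiable (f : Cn R n -> cplx R) w.
move=> w1 fg dg; have [d [r [d0 /andP[r0 r1] dP]]] := ball_nbhd w1.
have z0 : differentiable (fun z => f z - g z : cplx R) w.
 apply: (@differentiable_quadratic _ _ _ _ 0 d) => // h hd.
 have wh : sqnorm (w + h) < 1 by rewrite (le_lt_trans (dP h hd))// expr_lt1.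
 by rewrite !fg// !subrr ?subr0 normc0 mul0r.
rewrite (_ : f = (fun z => f z - g z) + g); first exact: differentiableD.
by apply/funext => z /=; rewrite /GRing.add/= subrK.
Qed.

Lemma differentiable_dotl (w z : Cn R n) : differentiable (fun z : Cn R n => dotCn z w : cplx R) z.
rewrite (_ : (fun z => _) = \sum_(i < n) (fun z : Cn R n => z ord0 i * (w ord0 i)^* : cplx R)); last first.
 by apply/funext => y; rewrite fct_sumE.
apply: differentiable_sum => i.
apply: (@differentiableM _ _ (fun z : Cn R n => z ord0 i : cplx R) (fun=> (w ord0 i)^*)).
 exact: differentiable_coord.
exact: differentiable_cst.
Qed.

Lemma bkernel_bergman (w : Cn R n) : sqnorm w < 1 -> bergman a (bkernel w).
move=> w1; have hol : hol_ball (bkernel w).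
 split => z zb; last by rewrite /bkernel; case: (sqnorm z < 1) / idP => // _; rewrite andbF.
 apply: (@differentiable_on_ball _ (fun z => cpow (1 - dotCn z w) (- (n%:R + 1 + a)))) => //.
  by move=> y y1; rewrite /bkernel w1 y1. have re : 0 < cRe (1 - dotCn z w).
  have := dot_lt1 w1 zb; have := Re_le_normc (dotCn z w). by rewrite ReD ReN /=; lra.
 have d1 : differentiable ((fun=> 1 : cplx R) \- (fun z : Cn R n => dotCn z w : cplx R)) z.
  by apply: differentiableB; [exact: differentiable_cst|exact: differentiable_dotl].
 have d2 : differentiable ((fun u => cpow u (- (n%:R + 1 + a))) : cplx R -> cplx R) (1 - dotCn z w : cplx R).
  by apply/holoP; exact: cdiff_cpow. exact: (differentiable_comp d1 d2).
apply/bergmanP; split => //.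
pose B := ((1 - Num.sqrt (sqnorm w)) `^ (- (n%:R + 1 + a))) ^+ 2.
apply: (rintg_le (rintg_sqr (hol_meas hol)) _ (rintgZ B rintg_bwt)).
move=> x; rewrite normrM (ger0_norm (sqr_ge0 _)) (ger0_norm (pw_ge0 _ _ _)) ler_wpM2r ?pw_ge0//.
by rewrite /B ler_pXn2r ?nnegrE ?nc_ge0 ?powR_ge0// bkernel_bound.
Qed.

Lemma bergman_repro f (w : Cn R n) : bergman a f -> sqnorm w < 1 -> f w = bergman_ip a f (bkernel w).
move=> Hf w1; have [hf fi] := (bergmanP _).1 Hf.
rewrite bergman_ipE//; last exact: bkernel_bergman.
rewrite (repro a1 (f := f)) //.
- congr (_ * _); apply: eq_cint => x _; rewrite /bkernel w1 sqnorm_toCn /=.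
 rewrite /pw; case: ifP => x1; last by rewrite !mulr0. by rewrite -cpowJ conjcB conjc_one -dotCnJ.
- move=> p q u pq; apply: differentiable_line; exact: hf.1.
- exact: hol_meas.
- apply: (le_cintegrable measurableT _ (rintgD (rintgZ (2^-1) fi) (rintgZ (2^-1) rintg_bwt))).
  by apply: cmeasM => //; [exact: hol_meas|exact: cmeasR meas_bwt].
 move=> x _; rewrite normcM normcR (ger0_norm (pw_ge0 _ _ _)) mulrA -mulrDl ler_wpM2r ?pw_ge0//.
 by have := sqr_ge0 (normc (f (toCn x)) - 1); rewrite !expr2; lra.
Qed.

Definition sqmass f : R := rint mu (fun x => normc (f (toCn x)) ^+ 2 * bwt x).

Lemma bergman_ip_self f : bergman a f -> bergman_ip a f f = (cst * sqmass f)%:C.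
move=> Hf; rewrite bergman_ipE// RCM; congr (_ * _).
rewrite /sqmass /rint -cintR; apply: eq_cint => x _.
by rewrite mulcJ -RCM.
Qed.

Lemma sqmass_ge0 f : 0 <= sqmass f.
by apply: rint_ge0 => x; rewrite mulr_ge0 ?sqr_ge0 ?pw_ge0. Qed.

Lemma bergman_ip_linear c f g h : bergman a f -> bergman a g -> bergman a h ->
 bergman_ip a (c *: f + g) h = c * bergman_ip a f h + bergman_ip a g h.
move=> Hf Hg Hh; have Hv := subspaceP bsub c Hf Hg.
rewrite (bergman_ipE Hv Hh) (bergman_ipE Hf Hh) (bergman_ipE Hg Hh).
have i1 := pairing_integrable Hf Hh; have i2 := pairing_integrable Hg Hh.
have -> : pairing (c *: f + g) h = c * pairing f h + pairing g h.
 rewrite /pairing -cintZ// -cintD//; last exact: cintgZ.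
 apply: eq_cint => x _; have -> : (c *: f + g) (toCn x) = c * f (toCn x) + g (toCn x) by []. by ring.
by ring.
Qed.

Lemma bergman_ipC f g : bergman a f -> bergman a g -> bergman_ip a g f = (bergman_ip a f g)^*.
move=> Hf Hg; rewrite !bergman_ipE// conjcM conjcR; congr (_ * _).
rewrite /pairing -cintJ//; last exact: pairing_integrable.
by apply: eq_cint => x _; rewrite !conjcM conjcR conjCK; ring.
Qed.

(** Definiteness is not yet known: that a function of norm 0 vanishes is deduced from
    [bergman_bound], which rests on this inequality. Hence the argument by a quadratic polynomial in
    [s], with the degenerate case apart. *)
Lemma semi_cauchy_schwarz f g : bergman a f -> bergman a g ->
 normc (bergman_ip a f g) ^+ 2 <= (cst * sqmass f) * (cst * sqmass g).
move=> Hf Hg; set p := bergman_ip a f g; set nf := cst * sqmass f; set k := cst * sqmass g.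
have c0 := cst_gt0.
have nf0 : 0 <= nf by rewrite mulr_ge0 ?sqmass_ge0// ltW.
have k0 : 0 <= k by rewrite mulr_ge0 ?sqmass_ge0// ltW.
have quad (s : R) : 0 <= s ^+ 2 * (normc p ^+ 2 * nf) + 2 * s * normc p ^+ 2 + k.
 pose c := s%:C * p^*; pose v := c *: f + g. have Hv : bergman a v by exact: (subspaceP bsub).
 have := bergman_ip_self Hv; rewrite bergman_ip_linear//.
 rewrite (bergman_ipC Hv Hf) (bergman_ipC Hv Hg) !bergman_ip_linear//.
 rewrite (bergman_ipC Hf Hg) !bergman_ip_self// -/p -/nf -/k => E.
 have h0 : 0 <= cst * sqmass v by rewrite mulr_ge0 ?sqmass_ge0// ltW. have pp := mulcJ p.
 have E2 : (s ^+ 2 * (normc p ^+ 2 * nf) + 2 * s * normc p ^+ 2 + k)%:C = (cst * sqmass v)%:C :> C.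
  by rewrite -E; apply/esym; exact: quadratic_identity. by case: E2 => ->.
have [nf00|nfn] := eqVneq nf 0.
 rewrite nf00 mul0r leNgt; apply/negP => pp0.
 (* If [nf = 0] the polynomial is affine in [s], and this [s] gives it the value [-1]. *)
 have := quad (- (k + 1) / (2 * normc p ^+ 2)); rewrite nf00 !mulr0 add0r. move: (normc p ^+ 2) pp0 => P P0.
 have -> : 2 * (- (k + 1) / (2 * P)) * P + k = -1 by field; rewrite gt_eqF. by rewrite oppr_ge0 ler10.
have nfp : 0 < nf by rewrite lt_neqAle eq_sym nfn.
(* The minimum of the quadratic. *)
have := quad (- nf^-1).
have -> : (- nf^-1) ^+ 2 * (normc p ^+ 2 * nf) + 2 * - nf^-1 * normc p ^+ 2 + k = k - normc p ^+ 2 / nf.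
 by field; rewrite gt_eqF.
by rewrite subr_ge0 ler_pdivrMr// mulrC.
Qed.

Lemma sqmass_bkernel (w : Cn R n) : sqnorm w < 1 -> (cst * sqmass (bkernel w)) = (1 - sqnorm w) `^ (- (n%:R + 1 + a)).
move=> w1; have Hk := bkernel_bergman w1.
have := bergman_repro Hk w1; rewrite bergman_ip_self// /bkernel w1 /= dotCnn.
by rewrite -RCB cpowR ?subr_gt0// => -[].
Qed.

Lemma bergman_bound f (w : Cn R n) : bergman a f -> sqnorm w < 1 ->
 normc (f w) ^+ 2 <= (cst * sqmass f) * (1 - sqnorm w) `^ (- (n%:R + 1 + a)).
move=> Hf w1; rewrite {1}(bergman_repro Hf w1) -sqmass_bkernel//.
by apply: semi_cauchy_schwarz => //; exact: bkernel_bergman.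
Qed.

(** A bounded sequence converges along an ultrafilter finer than [\oo]; the Cauchy condition turns
    this into convergence. *)
Lemma cauchy_complex (x : nat -> C) :
 (forall e : R, 0 < e -> exists N, forall i j, (N <= i)%N -> (N <= j)%N -> normc (x i - x j) <= e) ->
 exists l, forall e : R, 0 < e -> exists N, forall j, (N <= j)%N -> normc (x j - l) <= e.
move=> xc; have [N1 N1P] := xc 1 ltr01.
have [U [UU Uoo]] := ultraFilterLemma (eventually_filter : ProperFilter (\oo : set_system nat)).
have [|l lP] := @ultra_bounded_complex _ U UU (fun j => x (N1 + j)%N) (normc (x N1) + 1).
 move=> j; rewrite (_ : x (N1 + j)%N = x N1 + (x (N1 + j)%N - x N1)); last by ring.
 by rewrite (le_trans (normcD _ _))// lerD2l N1P// leq_addr.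
exists l => e e0; have e2 := half_gt0 e0.
have [N2 N2P] := xc _ e2; exists N2 => j N2j.
have [i [/= h1 h2]] := filter_ex (filterI (lP _ e2) (Uoo _ (nbhs_infty_ge N2))).
rewrite (_ : x j - l = (x j - x (N1 + i)%N) + (x (N1 + i)%N - l)); last by ring.
rewrite (le_trans (normcD _ _))// (splitr e) lerD// N2P//.
by rewrite (leq_trans h2)// leq_addl.
Qed.

Notation W := (subspace_type bsub).
Definition bip : W -> W -> C := sub_ip (bergman_ip a).

Lemma sub_bergman (w : W) : bergman a (sub_val w). exact: sub_valH. Qed.

Lemma hnorm_bip (w : W) : hnorm bip w ^+ 2 = cst * sqmass (sub_val w).
have h := bergman_ip_self (sub_bergman w).
rewrite /hnorm /bip /sub_ip h sqr_sqrtr//= mulr_ge0 ?sqmass_ge0// ltW// cst_gt0//.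
Qed.

Lemma bip_pointwise (v w : W) z (e : R) : sqnorm z < 1 -> hnorm bip (v - w) <= e -> 0 <= e ->
 normc (sub_val v z - sub_val w z) <= e * Num.sqrt ((1 - sqnorm z) `^ (- (n%:R + 1 + a))).
move=> z1 vw e0; rewrite -(@ler_pXn2r _ 2) ?nnegrE ?nc_ge0 ?mulr_ge0 ?sqrtr_ge0//.
rewrite exprMn sqr_sqrtr ?powR_ge0//.
apply: (le_trans (bergman_bound (sub_bergman (v - w)) z1)); rewrite ler_wpM2r ?powR_ge0// -hnorm_bip.
by rewrite ler_pXn2r ?nnegrE ?sqrtr_ge0.
Qed.

(** Point evaluations are bounded, so a Cauchy sequence converges at each point and is locally
    bounded; the limit is holomorphic by [differentiable_ultralimit], and Fatou's lemma gives
    convergence in norm. *)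
Lemma bip_complete (u : nat -> W) :
 (forall e, 0 < e -> exists N, forall i j, (N <= i)%N -> (N <= j)%N -> hnorm bip (u i - u j) <= e) ->
 exists l, forall e, 0 < e -> exists N, forall j, (N <= j)%N -> hnorm bip (u j - l) <= e.
move=> uc; pose F j := sub_val (u j); have HF j : bergman a (F j) by exact: sub_bergman.
have holF j : hol_ball (F j) by have /bergmanP[] := HF j.
pose k z := Num.sqrt ((1 - sqnorm (z : Cn R n)) `^ (- (n%:R + 1 + a))).
have k0 z : 0 <= k z by exact: sqrtr_ge0.
have /choice[l lP] : forall z : Cn R n, exists l, (~ unit_ball z -> l = 0) /\
  (sqnorm z < 1 -> forall e : R, 0 < e -> exists N, forall j, (N <= j)%N -> normc (F j z - l) <= e).
 move=> z; have [z1|z1] := ltP (sqnorm z) 1; last by exists 0; split.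
 have [|l lP] := @cauchy_complex (fun j => F j z); last by exists l; split => // zb; case: zb.
 move=> e e0; have kp : 0 < k z + 1 by rewrite ltr_wpDl. have e1 : 0 < e / (k z + 1) by rewrite divr_gt0.
 have [N NP] := uc _ e1; exists N => i j Ni Nj. apply: (le_trans (bip_pointwise z1 (NP i j Ni Nj) (ltW e1))).
 by rewrite -/(k z) mulrAC ler_pdivrMr// ler_wpM2l ?(ltW e0)// lerDl.
have [N1 N1P] := uc 1 ltr01.
have holl : hol_ball l.
 split => [w w1|z zb]; last exact: (lP z).1. have [d [r [d0 /andP[r0 r1] dP]]] := ball_nbhd w1.
 have [U [UU Uoo]] := ultraFilterLemma (eventually_filter : ProperFilter (\oo : set_system nat)).
 have r21 : r ^+ 2 < 1 by rewrite expr_lt1. pose M := Num.sqrt ((1 - r ^+ 2) `^ (- (n%:R + 1 + a))).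
 pose B := (hnorm bip (u N1) + 1) * M. have kM z : sqnorm z <= r ^+ 2 -> k z <= M.
  move=> zr; rewrite /k /M ler_sqrt ?powR_ge0// !powRN lef_pV2 ?posrE ?powR_gt0 ?subr_gt0 ?(le_lt_trans zr)//.
  by rewrite ge0_ler_powR ?nnegrE ?bexp_ge0 ?subr_ge0 ?(ltW r21) ?(ltW (le_lt_trans zr _))// lerB.
 have B0 : 0 <= B by rewrite mulr_ge0 ?sqrtr_ge0// addr_ge0// sqrtr_ge0.
 apply: (@differentiable_ultralimit R U UU n (fun j => F (N1 + j)%N) l w B d) => //.
  move=> j h hd; have zr := dP h hd; have z1 := le_lt_trans zr r21. split; first exact: (holF _).1.
  rewrite (_ : F (N1 + j)%N (w + h) = (F (N1 + j)%N (w + h) - F N1 (w + h)) + F N1 (w + h)); last by ring.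
  have h1 := bip_pointwise z1 (N1P (N1 + j)%N N1 (leq_addr _ _) (leqnn _)) ler01.
  have h2 : hnorm bip (u N1 - 0) <= hnorm bip (u N1) by rewrite subr0.
  have h3 := bip_pointwise z1 h2 (sqrtr_ge0 _). have h4 := kM _ zr; rewrite -/(k _) in h1 h3.
  have E0 : sub_val (u N1) (w + h) - sub_val (0 : W) (w + h) = F N1 (w + h) by rewrite subr0.
  rewrite E0 in h3. rewrite (le_trans (normcD _ _))// /B mulrDl addrC lerD//.
   by rewrite (le_trans h3)// ler_wpM2l ?sqrtr_ge0. by apply: (le_trans h1); rewrite ler_wpM2l.
 move=> h hd e e0; have z1 := le_lt_trans (dP h hd) r21.
 have [N NP] := (lP _).2 z1 e e0; apply: filterS (Uoo _ (nbhs_infty_ge N)) => j /= Nj.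
 by apply: NP; rewrite (leq_trans Nj)// leq_addl.
pose S (g : Cn R n -> C) (x : X) := normc (g (toCn x)) ^+ 2 * bwt x.
have S0 g x : 0 <= S g x by rewrite mulr_ge0 ?sqr_ge0 ?pw_ge0.
have holD j : hol_ball (F j - l).
 split => z zb; first by apply: differentiableB; [exact: (holF j).1|exact: holl.1].
 by rewrite (_ : (F j - l) z = F j z - l z)// (holF j).2// holl.2// subrr.
(* Fatou is applied in the first index with the second fixed, which yields membership of the limit
   and the rate at once. *)
have fatou_bound e : 0 < e -> exists N, forall j, (N <= j)%N ->
  rintg mu (S (F j - l)) /\ cst * sqmass (F j - l) <= e ^+ 2.
 move=> e0; have [N NP] := uc e e0; exists N => j Nj. pose f i x : \bar R := (S (F (N + i)%N - F j) x)%:E.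
 have Hd i := (bergmanP _).1 (sub_bergman (u (N + i)%N - u j)).
 have fi i : (\int[mu]_x f i x <= (e ^+ 2 / cst)%:E)%E.
  rewrite (rintE (Hd i).2) lee_fin ler_pdivlMr ?cst_gt0// mulrC -(hnorm_bip (u (N + i)%N - u j)).
  by rewrite ler_pXn2r ?nnegrE ?sqrtr_ge0 ?(ltW e0)//; apply: NP => //; exact: leq_addr.
 have mD := rintg_sqr (hol_meas (holD j)). have cf x : f i x @[i --> \oo] --> (S (F j - l) x)%:E.
  apply: cvg_EFin; first exact: nearW. have [x1|x1] := ltP (tsq x) 1; last first.
   rewrite (_ : _ \o _ = fun=> 0); last by apply/funext => i /=; rewrite /S /pw ltNge x1 mulr0.
   by rewrite /S /pw ltNge x1 mulr0; exact: cvg_cst.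
  have c1 : normc ((F (N + i)%N - F j) (toCn x)) @[i --> \oo] --> normc ((F j - l) (toCn x)).
   apply/cvgrPdist_le => t t0; have z1 : sqnorm (toCn x) < 1 by rewrite sqnorm_toCn.
   have [K KP] := (lP (toCn x)).2 z1 t t0. near=> i; have Ki : (K <= N + i)%N.
    by rewrite (@leq_trans i) ?leq_addl//; near: i; exact: nbhs_infty_ge.
   rewrite -[normc ((F j - l) _)]normcN (le_trans (normc_dist _ _))//.
   rewrite (_ : - _ - _ = - (F (N + i)%N (toCn x) - l (toCn x))) ?normcN ?KP//.
   rewrite (_ : (F j - l) (toCn x) = F j (toCn x) - l (toCn x))//.
   by rewrite (_ : (F (N + i)%N - F j) (toCn x) = F (N + i)%N (toCn x) - F j (toCn x))//; ring.
  by apply: cvgMl; exact: (cvgM c1 c1). have bound : (\int[mu]_x (S (F j - l) x)%:E <= (e ^+ 2 / cst)%:E)%E.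
  have := @fatou _ _ _ mu setT measurableT f _ _.
  under eq_integral => x _ do rewrite (cvg_limn_einf_sup (cf x)).1. move=> H; apply: (le_trans (H _ _)).
  - by move=> i; apply/mEFinP; exact: rintg_sqr (hol_meas (Hd i).1).
  - by move=> i x _; rewrite lee_fin.
  - rewrite limn_einf_lim; apply: lime_le; first exact: is_cvg_einfs.
   apply: nearW => i; apply: le_trans (fi i); apply: ereal_inf_lbound; exists i => //=.
 have iD := rintg_ge0 mD (S0 _) bound.
 by split => //; rewrite mulrC -ler_pdivlMr ?cst_gt0// -lee_fin -(rintE iD).
have Hl : bergman a l.
 have [N /(_ N (leqnn _))[h1 _]] := fatou_bound 1 ltr01. have HD : bergman a (F N - l) by apply/bergmanP.
 rewrite (_ : l = (-1) *: (F N - l) + F N); first exact: (subspaceP bsub). by rewrite scaleN1r opprB subrK.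
exists (to_sub bsub Hl) => e e0; have [N NP] := fatou_bound e e0.
exists N => j /NP[_ h]; rewrite -(@ler_pXn2r _ 2) ?nnegrE ?sqrtr_ge0 ?(ltW e0)//.
by rewrite hnorm_bip.
Unshelve. all: by end_near. Qed.

Lemma hilbert_bergman : hilbert bip.
split.
- move=> h c f g; rewrite /bip /sub_ip sub_val_lin.
 exact: (bergman_ip_linear c (sub_bergman f) (sub_bergman g) (sub_bergman h)).
- by move=> f g; exact: (bergman_ipC (sub_bergman f) (sub_bergman g)).
- move=> f; rewrite /bip /sub_ip (bergman_ip_self (sub_bergman f)) /=.
 by rewrite mulr_ge0 ?sqmass_ge0// ltW// cst_gt0.
- move=> f; rewrite /bip /sub_ip (bergman_ip_self (sub_bergman f)) /= => f0.
 apply: sub_val_inj; apply/funext => z. have [z1|z1] := ltP (sqnorm z) 1; last first.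
  have /bergmanP[[_ ->]//] := sub_bergman f; by rewrite /unit_ball/= ltNge z1.
 have := bergman_bound (sub_bergman f) z1; rewrite f0 mul0r => h.
 have : normc (sub_val f z) ^+ 2 = 0 by apply/eqP; rewrite eq_le h sqr_ge0.
 by move/eqP; rewrite sqrf_eq0 normc_eq0 => /eqP.
- exact: bip_complete.
Qed.

End BergmanSpace.

(** * The Bergman space as an instance of the abstract setting *)

Section BergmanRKHS.
Variables (R : realType) (m : nat) (a : R).
Hypothesis a1 : -1 < a.
Notation C := R[i].
Notation RR := (RxR R).
Notation n := m.+1.
Notation X := (n.-tuple RR).
Notation mu := (vol R n).
Notation bwt x := (pw 1 a (tsq x)).
Notation cst := (cst_alpha n a).
Notation W := (subspace_type (bsub m a)).
Notation ip := (bip (m := m) (a := a)).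
Implicit Types (x y : X) (f : W).

Let hW : hilbert ip := hilbert_bergman m a1.

Definition ksub (w : Cn R n) : W :=
 if pselect (sqnorm w < 1) is left h then to_sub (bsub m a) (bkernel_bergman a1 h) else 0.

Lemma sub_val_ksub w : sub_val (ksub w) = bkernel a w.
rewrite /ksub; case: pselect => // h; apply/funext => z; rewrite /bkernel.
by case: (sqnorm w < 1) / idP h.
Qed.

Lemma ip_ksub f w : ip f (ksub w) = sub_val f w.
have Hf := sub_bergman f; have [w1|w1] := ltP (sqnorm w) 1.
 by rewrite [RHS](bergman_repro a1 Hf w1) /bip /sub_ip sub_val_ksub.
have /bergmanP[[_ f0] _] := Hf; rewrite f0; last by rewrite /unit_ball/= ltNge w1.
rewrite /ksub; case: pselect => [h|_]; last by rewrite (ip0r hW).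
by exfalso; move: h; rewrite ltNge w1.
Qed.

Definition dsqrt x : R := Num.sqrt (cst * bwt x).

Lemma dsqrt_sqr x : dsqrt x ^+ 2 = cst * bwt x.
by rewrite sqr_sqrtr// mulr_ge0 ?pw_ge0// ltW// cst_gt0. Qed.

(** The root of the density is absorbed into the kernel vector, so that Lebesgue measure on the
    whole space serves for every [a]. *)
Definition kap x : W := (dsqrt x)%:C *: ksub (toCn x).

Lemma evl_kap f x : evl ip kap f x = (dsqrt x)%:C * sub_val f (toCn x).
by rewrite /evl /kap (ipZr hW) conjcR ip_ksub. Qed.

Lemma ev2_kap f x : ev2 ip kap f x = cst * (normc (sub_val f (toCn x)) ^+ 2 * bwt x).
rewrite /ev2 evl_kap normcM normcR exprMn real_normK ?num_real// dsqrt_sqr.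
by rewrite -mulrA [bwt x * _]mulrC.
Qed.

Lemma diag_kap x : diag ip kap x = cst * iwt x.
have E := hnorm_bip a1 (ksub (toCn x)); rewrite sub_val_ksub in E.
rewrite /diag /kap (hnormZ hW) exprMn normcR real_normK ?num_real// dsqrt_sqr E.
rewrite /iwt /pw; have [x1|x1] := ltP (tsq x) 1; last by rewrite !(mulr0, mul0r).
have w1 : sqnorm (toCn x) < 1 by rewrite sqnorm_toCn.
rewrite sqmass_bkernel// sqnorm_toCn -mulrA; congr (_ * _).
have p0 : 1 - tsq x != 0 by rewrite subr_eq0 gt_eqF.
rewrite -powRD; last by rewrite p0 implybT.
rewrite (_ : a + - (n%:R + 1 + a) = - n.+1%:R); last by rewrite -natr1; ring.
by rewrite powRN powR_mulrn// subr_ge0 ltW.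
Qed.

Lemma bkernelE (w z : Cn R n) : sqnorm w < 1 -> sqnorm z < 1 ->
 bkernel a w z = cpow (1 - dotCn z w) (- (n%:R + 1 + a)).
by rewrite /bkernel => -> ->. Qed.

Lemma ker2_kap x y : ker2 ip kap x y = cst * bker a x y.
rewrite ker2_ev2 ev2_kap /kap.
have -> : sub_val ((dsqrt x)%:C *: ksub (toCn x)) (toCn y) = (dsqrt x)%:C * bkernel a (toCn x) (toCn y).
 by rewrite -(sub_val_ksub (toCn x)).
rewrite normcM normcR exprMn real_normK ?num_real// dsqrt_sqr /bker.
have [x1|x1] := ltP (tsq x) 1; last by rewrite /pw [tsq x < 1]ltNge x1 /= !(mulr0, mul0r).
have [y1|y1] := ltP (tsq y) 1; last by rewrite /pw [tsq y < 1]ltNge y1 /= !(mulr0, mul0r).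
have hx : sqnorm (toCn x) < 1 by rewrite sqnorm_toCn.
have hy : sqnorm (toCn y) < 1 by rewrite sqnorm_toCn.
rewrite bkernelE// normc_cpow.
 by rewrite -/(qdist y x) qdistC; ring.
have := dot_lt1 hx hy; have := Re_le_normc (dotCn (toCn y) (toCn x)).
by rewrite ReD ReN /=; lra.
Qed.

(** Kernels at grid points: a function orthogonal to all of them vanishes on a dense set, hence
    everywhere by continuity. *)
Lemma bergman_sep : exists g, total ip g.
pose g j : W := if unpickle j is Some (k, v) then ksub (toCn (@unrnd R n k v)) else 0.
exists g => f fg; apply: sub_val_inj; apply/funext => z.
have f0 k v : sub_val f (toCn (@unrnd R n k v)) = 0.
 by have := fg (pickle (k, v)); rewrite /g pickleK ip_ksub.
have /bergmanP[[df fout] _] := sub_bergman f.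
have [z1|z1] := ltP (sqnorm z) 1; last by rewrite fout// /unit_ball/= ltNge z1.
apply: normc_small => e e0.
have tz : differentiable (sub_val f : Cn R n -> cplx R) (toCn (ofCn z)) by rewrite ofCnK; exact: df.
have [d d0 dP] := differentiable_tccont tz e0.
have q0 : 0 < d / (n%:R * 2) by rewrite divr_gt0// mulr_gt0// ltr0n.
have [k hk] : exists k : nat, k.+1%:R^-1 < d / (n%:R * 2).
 by have [k _ /(_ k (leqnn _))] := near_infty_natSinv_lt (PosNum q0); exists k.
have := dP (unrnd R k (trnd k (ofCn z))); rewrite f0 ofCnK sub0r normcN => H; apply/ltW/H.
apply: (le_lt_trans (tdist_unrnd _ _)).
by rewrite mulrC -ltr_pdivlMr// mulr_gt0// ltr0n.
Qed.

Definition mono j (z : Cn R n) : cplx R := if sqnorm z < 1 then z ord0 ord0 ^+ j else 0.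

Lemma mono_bergman j : bergman a (mono j).
have hol : hol_ball (mono j).
 split => z zb; last by rewrite /mono; case: (sqnorm z < 1) / idP.
 apply: (@differentiable_on_ball R m (mono j) (fun z => z ord0 ord0 ^+ j : cplx R)) => //.
  by move=> y y1; rewrite /mono y1.
 elim: j => [|j IH]; first by under eq_fun do rewrite expr0; exact: differentiable_cst.
 under eq_fun do rewrite exprS.
 apply: (@differentiableM _ _ (fun z : Cn R n => z ord0 ord0 : cplx R) (fun z => z ord0 ord0 ^+ j : cplx R)) => //.
 exact: differentiable_coord.
apply/bergmanP; split => //.
have ms := rintg_sqr a (hol_meas hol).
apply: (rintg_le ms _ (rintg_bwt m a1)).
move=> x; rewrite normrM (ger0_norm (sqr_ge0 _)) (ger0_norm (pw_ge0 _ _ _)) ler_piMl ?pw_ge0//.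
rewrite expr_le1// ?nc_ge0// /mono; case: ifP => z1; last by rewrite normc0.
rewrite normcX exprn_ile1 ?nc_ge0//.
rewrite -(@ler_pXn2r _ 2) ?nnegrE ?nc_ge0// expr1n (le_trans _ (ltW z1))//.
by rewrite sqnormE (bigD1 ord0)//= lerDl sumr_ge0// => i _; rewrite sqr_ge0.
Qed.

(** Among the powers of the first coordinate, one more than the number of conditions always leaves a
    combination satisfying them all. It is not 0, since a nonzero polynomial has no more roots than
    its degree. *)
Lemma bergman_infdim (s : seq W) : exists2 f : W, f != 0 & forall g, g \in s -> ip f g = 0.
pose d := size s; pose M j : W := to_sub (bsub m a) (mono_bergman j).
pose A : 'M[C]_(d.+1, d) := \matrix_(j, i) ip (M j) (nth 0 s i).
have kA : kermx A != 0.
 rewrite kermx_eq0 /row_free; apply/negP => /eqP E. by have := rank_leq_col A; rewrite E ltnn.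
have [v /sub_kermxP vA v0] := rowV0Pn kA.
pose f : W := \sum_(j < d.+1) v ord0 j *: M j.
exists f; last first.
 move=> g gs; have i1 : (index g s < d)%N by rewrite index_mem.
 have := congr1 (fun B : 'rV_d => B ord0 (Ordinal i1)) vA; rewrite !mxE => E.
 rewrite /f (ip_suml hW) -[RHS]E; apply: eq_bigr => j _. by rewrite (ipZl hW) mxE nth_index.
apply: contra_neq v0 => f0.
pose p : {poly C} := \poly_(j < d.+1) (v ord0 (inord j)).
(* Distinct points [1 / (k + 2)] of the open disc; on the axis through them [f] is the polynomial
   [p]. *)
pose t k : C := ((k.+2%:R : R)^-1)%:C.
have rt k : root p (t k).
 have nt : normc (t k) < 1. by rewrite normcR ger0_norm ?invr_ge0// invf_lt1// ltr1n.
 have t1 : sqnorm (axis m (t k)) < 1 by rewrite sqnorm_axis expr_lt1 ?nc_ge0.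
 rewrite /root horner_poly; apply/eqP. have : sub_val f (axis m (t k)) = 0 by rewrite f0.
 rewrite /f sub_val_sum fct_sumE => E; rewrite -[RHS]E; apply: eq_bigr => j _.
 rewrite inord_val; have -> : sub_val (v ord0 j *: M j) (axis m (t k)) = v ord0 j * mono j (axis m (t k)) by [].
 by rewrite /mono t1 mxE eqxx.
have p0 : p = 0.
 apply: contraTeq isT => pn0; apply/negP => _.
 have := max_poly_roots (rs := [seq t k | k <- iota 0 d.+1]) pn0.
 have -> : all (root p) [seq t k | k <- iota 0 d.+1] by apply/allP => _ /mapP[k _ ->].
 have -> : uniq [seq t k | k <- iota 0 d.+1].
  rewrite map_inj_uniq ?iota_uniq// => k l [/invr_inj /eqP]; rewrite eqr_nat => /eqP[]. by [].
 rewrite size_map size_iota => /(_ isT isT) h. by have := leq_trans h (size_poly _ _); rewrite ltnn.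
apply/matrixP => i j; rewrite (ord1 i) mxE.
have : p`_j = 0 by rewrite p0 coef0.
by rewrite coef_poly ltn_ord inord_val.
Qed.

Lemma rkhs_bergman : rkhs ip mu kap.
split.
- move=> f; rewrite (_ : evl ip kap f = fun x => (dsqrt x)%:C * sub_val f (toCn x)); last first.
  by apply/funext => x; exact: evl_kap.
 apply: cmeasM => //; last by apply: hol_meas; have /bergmanP[] := sub_bergman f.
 apply: cmeasR; rewrite (_ : dsqrt = fun x => (cst * bwt x) `^ 2^-1); last first.
  by apply/funext => x; rewrite powR12_sqrt// mulr_ge0 ?pw_ge0// ltW// cst_gt0.
 apply: (mcomp (measurable_powR _)). by apply: mfunM => //; exact: meas_bwt.
- rewrite (_ : diag ip kap = fun x => cst * iwt x); last by apply/funext => x; exact: diag_kap.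
 by apply: mfunM => //; exact: meas_iwt.
- rewrite (_ : (fun p => _) = fun p : X * X => cst * bker a p.1 p.2); last by apply/funext => p; exact: ker2_kap.
 by apply: mfunM => //; exact: meas_bker.
- move=> f; have /bergmanP[_ fi] := sub_bergman f.
 transitivity (\int[mu]_x (cst * (normc (sub_val f (toCn x)) ^+ 2 * bwt x))%:E)%E.
  by rewrite hnorm_bip// (rintE (rintgZ cst fi)) rintZ. by apply: eq_integral => x _; rewrite ev2_kap.
- exact: bergman_sep.
- exact: bergman_infdim.
Qed.

(** This is [||kap x||^2] computed in two ways: by the reproducing property and by integration. *)
Lemma bker_mass x : rintg mu (bker a x) /\ rint mu (bker a x) = iwt x.
have h1 := rintg_ev2 rkhs_bergman (kap x); have h2 := rint_ev2 rkhs_bergman (kap x).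
have c0 : cst != 0 by rewrite gt_eqF// cst_gt0.
have E : bker a x = fun y => cst^-1 * ev2 ip kap (kap x) y.
 by apply/funext => y; rewrite -ker2_ev2 ker2_kap mulKf.
rewrite E; split; first exact: rintgZ.
by rewrite rintZ// h2 -/(diag ip kap x) diag_kap mulKf.
Qed.

End BergmanRKHS.

Lemma kernel_family_bergman (R : realType) m : kernel_family (vol R m.+1) (@bker R m.+1) (@iwt R m.+1).
split.
- by move=> a x y a1; exact: bker_ge0.
- by move=> a x y; exact: bkerC.
- by move=> a; exact: meas_bker.
- by move=> a x a1; exact: bker_mass.
- exact: meas_iwt.
Qed.

(** * Moduli of continuity with linear growth, and polynomial approximation *)

Section Tame.
Variable R : realType.
Implicit Types psi : R -> R.

(** Close points differ by at most [e], distant ones by at most twice a bound of [psi], which a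
    large slope absorbs. Compactness is used in covering form, the slope being a parameter near
    infinity. *)
Lemma compact_modulus psi (A B e : R) : {within `[A, B], continuous psi} -> 0 < e ->
 exists2 K, 0 <= K & forall x y, A <= x <= B -> A <= y <= B -> `|psi x - psi y| <= e + K * `|x - y|.
move=> cpsi e0; have cI : compact (`[A, B] : set R) by exact: segment_compact.
have [P [_ bP]] := compact_bounded (continuous_compact cpsi cI).
have {}bP x : A <= x <= B -> `|psi x| <= `|P| + 1.
 move=> xI; apply: (bP (`|P| + 1)); first by rewrite (le_lt_trans (ler_norm _))// ltrDl.
 by exists x => //; rewrite /= in_itv.
have Q0 : 0 < `|P| + 1 by rewrite ltr_wpDl.
pose G (K x : R) := A <= x <= B -> forall y, A <= y <= B -> `|psi x - psi y| <= e + K * `|x - y|.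
have [|M [_ HM]] := (compact_near_coveringP _).1 cI R (pinfty_nbhs R) G _; last first.
 exists (`|M| + 1); first by rewrite addr_ge0. move=> x y xI; apply: (HM (`|M| + 1)) => //.
 by rewrite (le_lt_trans (ler_norm _))// ltrDl.
move=> z zI; have e2 := half_gt0 e0.
have /cvgrPdist_le/(_ _ e2) := (subspace_continuousP _ _).1 cpsi z zI.
rewrite near_withinE => -[d /= d0 dP].
(* For distant points [|x - y| >= d / 2], and [K0 * (d / 2)] is twice the bound of [psi]. *)
pose K0 := 4 * (`|P| + 1) / d.
exists (ball z (d / 2), [set K | K0 < K]).
 by split; [apply: nbhsx_ballx; rewrite divr_gt0|exists K0; split => //; exact: num_real].
move=> [x K] [/= zx KK] xI y yI.
rewrite /ball/= in zx.
have Kp : 0 <= K by rewrite (le_trans _ (ltW KK))// /K0 divr_ge0 ?mulr_ge0 ?(ltW Q0) ?(ltW d0).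
have xz : `|psi z - psi x| <= e / 2.
 by apply: dP; rewrite /= ?in_itv// (lt_trans zx)// ltr_pdivrMr// ltr_pMr// ltr1n.
have [zy|zy] := ltP `|z - y| d.
 have yz : `|psi z - psi y| <= e / 2 by apply: dP; rewrite /= ?in_itv.
 have := ler_normB (psi z - psi y) (psi z - psi x).
 rewrite (_ : psi z - psi y - (psi z - psi x) = psi x - psi y); last by ring.
 have Kn : 0 <= K * `|x - y| by rewrite mulr_ge0. by lra.
have h1 : d / 2 <= `|x - y|.
 have := ler_normD (z - x) (x - y); rewrite (_ : z - x + (x - y) = z - y); last by ring. by lra.
have h2 : 2 * (`|P| + 1) <= K * `|x - y|.
 apply: (@le_trans _ _ (K0 * (d / 2))); last by rewrite ler_pM ?(ltW KK)// ?divr_ge0 ?mulr_ge0 ?(ltW Q0) ?(ltW d0).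
 by rewrite /K0; apply: eqle; field; rewrite gt_eqF.
have := ler_normB (psi x) (psi y); have := bP _ xI; have := bP _ yI; lra.
Qed.

(** The error may grow linearly: multiplied by [|sig|] it is still controlled by the first and
    second moments of the symbol. This covers functions that behave like a line at infinity. *)
Definition tame psi := forall e : R, 0 < e -> exists2 K, 0 <= K &
 forall x y, `|psi x - psi y| <= e * (1 + `|x| + `|y|) + K * `|x - y|.

Lemma tame_continuous psi : tame psi -> continuous psi.
move=> tp x; apply/cvgrPdist_le => e e0.
have q0 : 0 < 2 * (2 + 2 * `|x|) by rewrite mulr_gt0// ltr_wpDr// mulr_ge0.
have [K K0 KP] := tp (e / (2 * (2 + 2 * `|x|))) (divr_gt0 e0 q0).
have K1 : 0 < K + 1 by rewrite ltr_wpDl.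
exists (Num.min 1 (e / 2 / (K + 1))); first by rewrite /= lt_min ltr01 !divr_gt0.
move=> y /=; rewrite lt_min => /andP[y1 y2].
have h1 : K * `|x - y| <= e / 2.
 rewrite ltr_pdivlMr// in y2; apply: le_trans (ltW y2); rewrite mulrC ler_wpM2l//; lra.
have h2 : `|y| <= 1 + `|x|.
 have := ler_normB x (x - y); rewrite (_ : x - (x - y) = y); [lra|ring].
have h3 : e / (2 * (2 + 2 * `|x|)) * (1 + `|x| + `|y|) <= e / 2.
 apply: (@le_trans _ _ (e / (2 * (2 + 2 * `|x|)) * (2 + 2 * `|x|))).
  by rewrite ler_wpM2l ?divr_ge0 ?(ltW e0) ?(ltW q0)//; lra. apply: eqle; field.
 by have : 0 <= `|x| by []; lra.
by have := KP x y; lra.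
Qed.

Definition clamp (A B x : R) : R := Num.max A (Num.min B x).

Lemma clamp_itv A B x : A <= B -> A <= clamp A B x <= B.
by move=> AB; rewrite /clamp le_max lexx ge_max AB ge_min lexx. Qed.
Lemma clamp_id A B x : A <= x <= B -> clamp A B x = x.
by case/andP=> Ax xB; rewrite /clamp (min_idPr xB) (max_idPr Ax). Qed.

Lemma max_lip (A x y : R) : `|Num.max A x - Num.max A y| <= `|x - y|.
by rewrite ler_norml; case: (leP A x); case: (leP A y) => h1 h2;
 have := ler_norm (x - y); have := ler_norm (y - x); rewrite (distrC y); have := normr_ge0 (x - y); lra.
Qed.

Lemma clamp_lip A B x y : `|clamp A B x - clamp A B y| <= `|x - y|.
apply: (le_trans (max_lip _ _ _)); have := max_lip (- B) (- x) (- y).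
by rewrite -!oppr_min -!opprD !normrN.
Qed.

Lemma tame_clamp psi A B : A <= B -> {within `[A, B], continuous psi} -> tame (psi \o clamp A B).
move=> AB cpsi e e0; have [K K0 KP] := compact_modulus cpsi e0; exists K => // x y.
apply: (le_trans (KP _ _ (clamp_itv x AB) (clamp_itv y AB))); apply: lerD.
 by rewrite ler_pMr// -addrA lerDl addr_ge0.
by rewrite ler_wpM2l// clamp_lip.
Qed.

(** Up to [X] the compact modulus applies; beyond it [psi] is within a small multiple of [x] of the
    line [l x], whose slope is added to [K]. Pairs on both sides of [X] are split there. *)
Lemma tame_halfline (psi : R -> R) (l : R) : {within `[0, +oo[, continuous psi} ->
 psi x / x @[x --> +oo] --> l -> tame (psi \o Num.max 0).
move=> cpsi /cvgrPdist_le cl e e0.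
have e2 := half_gt0 e0.
have e4 : 0 < e / 4 by rewrite divr_gt0.
have [X0 [_ X0P]] := cl _ e4.
(* Past this point the ratio [psi x / x] is within [e / 4] of [l]; the absolute value makes [X]
   positive. *)
pose X := `|X0| + 1.
have X0' : 0 < X by rewrite /X ltr_wpDl.
have big x : X <= x -> `|psi x - l * x| <= e / 4 * x.
 move=> Xx; have x0 : 0 < x by exact: lt_le_trans Xx.
 have := X0P x; rewrite (lt_le_trans _ Xx); last by rewrite /X (le_lt_trans (ler_norm _))// ltrDl.
 move=> /(_ isT) h; apply: le_trans (ler_wpM2r (ltW x0) h).
 by rewrite -[X in _ <= _ * X](ger0_norm (ltW x0)) -normrM mulrBl divfK ?gt_eqF// distrC.
have cX : {within `[0, X], continuous psi}.
 by apply: continuous_subspaceW cpsi => x; rewrite /= !in_itv/= => /andP[->].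
have [K K0 KP] := compact_modulus cX e2.
exists (K + `|l|); first by rewrite addr_ge0.
have main x y : 0 <= x -> x <= y -> `|psi x - psi y| <= e * (1 + x + y) + (K + `|l|) * (y - x).
 move=> x0 xy; have y0 := le_trans x0 xy. have ex : 0 <= e * x by rewrite mulr_ge0 ?(ltW e0).
 have ey : 0 <= e * y by rewrite mulr_ge0 ?(ltW e0).
 have lxy : 0 <= `|l| * (y - x) by rewrite mulr_ge0// subr_ge0.
 have kxy : 0 <= K * (y - x) by rewrite mulr_ge0// subr_ge0.
 have farfar u : X <= u -> u <= y -> `|psi u - psi y| <= e / 2 * y + `|l| * (y - u).
  move=> Xu uy; have := big _ Xu; have := big _ (le_trans Xu uy).
  rewrite (_ : psi u - psi y = (psi u - l * u) - (psi y - l * y) - l * (y - u)); last by ring.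
  move=> h1 h2; apply: (le_trans (ler_normB _ _)); rewrite normrM (ger0_norm (_ : 0 <= y - u)) ?subr_ge0//.
  apply: lerD => //; apply: (le_trans (ler_normB _ _)).
  have : e / 4 * u <= e / 4 * y by rewrite ler_wpM2l ?(ltW e4). by lra. have [yX|Xy] := leP y X.
  have dxy : `|x - y| = y - x by rewrite distrC ger0_norm ?subr_ge0.
  by have := KP x y; rewrite x0 y0 yX (le_trans xy yX) dxy => /(_ isT isT); lra.
 have [xX|Xx] := leP x X; last first. by have := farfar x (ltW Xx) xy; lra.
 have h1 := farfar X (lexx _) (ltW Xy). have dxX : `|x - X| = X - x by rewrite distrC ger0_norm ?subr_ge0.
 have := KP x X; rewrite x0 xX lexx (ltW X0') dxX => /(_ isT isT) h2.
 have h3 := ler_normD (psi x - psi X) (psi X - psi y).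
 rewrite (_ : psi x - psi X + (psi X - psi y) = psi x - psi y) in h3; last by ring.
 have h4 : `|l| * (y - X) <= `|l| * (y - x) by rewrite ler_wpM2l// lerB.
 have h5 : K * (X - x) <= K * (y - x) by rewrite ler_wpM2l// lerB// ltW. by lra.
have mx0 (x : R) : `|Num.max 0 x| <= `|x| by have := max_lip 0 x 0; rewrite maxxx !subr0.
have fin (x y : R) : `|psi (Num.max 0 x) - psi (Num.max 0 y)| <=
  e * (1 + Num.max 0 x + Num.max 0 y) + (K + `|l|) * `|Num.max 0 x - Num.max 0 y|.
 have px : 0 <= Num.max 0 x by rewrite le_max lexx. have py : 0 <= Num.max 0 y by rewrite le_max lexx.
 have [xy|/ltW xy] := leP (Num.max 0 x) (Num.max 0 y).
  have -> : `|Num.max 0 x - Num.max 0 y| = Num.max 0 y - Num.max 0 x by rewrite distrC ger0_norm ?subr_ge0.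
  exact: main.
 have -> : `|Num.max 0 x - Num.max 0 y| = Num.max 0 x - Num.max 0 y by rewrite ger0_norm ?subr_ge0.
 by rewrite distrC; have := main _ _ py xy; lra.
move=> x y; apply: (le_trans (fin x y)); apply: lerD.
 rewrite ler_wpM2l ?(ltW e0)//. by rewrite lerD ?lerD// (le_trans (ler_norm _)).
by rewrite ler_wpM2l ?addr_ge0// max_lip.
Qed.

(* Expectation of [g] at a binomial random variable, as a polynomial in the success probability. *)
Fixpoint bernstein (n : nat) (g : nat -> R) : {poly R} :=
 if n is m.+1 then 'X * bernstein m (g \o S) + (1 - 'X) * bernstein m g else (g 0%N)%:P.

Lemma bernsteinS n g t :
 (bernstein n.+1 g).[t] = t * (bernstein n (g \o S)).[t] + (1 - t) * (bernstein n g).[t].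
by rewrite /= !hornerE. Qed.

Lemma bernstein_le n g h t : 0 <= t <= 1 -> (forall j, g j <= h j) ->
 (bernstein n g).[t] <= (bernstein n h).[t].
move=> /andP[t0 t1]; elim: n g h => [|n IH] g h gh; first by rewrite /= !hornerC.
by rewrite !bernsteinS lerD// ler_wpM2l ?subr_ge0// IH// => j; exact: gh.
Qed.

Lemma bernstein_lin n (a b : R) g h t : (bernstein n (fun j => a * g j + b * h j)).[t] =
 a * (bernstein n g).[t] + b * (bernstein n h).[t].
elim: n g h => [|n IH] g h; first by rewrite /= !hornerC.
rewrite !bernsteinS IH -[X in t * X]/(bernstein n (fun j => a * (g \o S) j + b * (h \o S) j)).[t] IH.
by ring.
Qed.

Lemma bernstein_cst n c t : (bernstein n (fun=> c)).[t] = c.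
elim: n => [|n IH]; first by rewrite /= hornerC.
by rewrite bernsteinS -[X in t * X]/(bernstein n (fun=> c)).[t] IH; ring.
Qed.

(** Conditioning on one trial, a success moves the centre to [c - 1]; the induction therefore needs
    an arbitrary centre, although [c = n t] is the case of interest. *)
Lemma bernstein_variance n c t : (bernstein n (fun j => (j%:R - c) ^+ 2)).[t] =
 (n%:R * t - c) ^+ 2 + n%:R * (t * (1 - t)).
elim: n c => [|n IH] c; first by rewrite /= hornerC; ring.
rewrite bernsteinS IH.
rewrite (_ : (fun j => (j%:R - c) ^+ 2) \o S = fun j => (j%:R - (c - 1)) ^+ 2); last first.
 by apply/funext => j /=; rewrite -natr1; ring.
by rewrite IH -natr1; ring.
Qed.

(** Chebyshev's argument for Bernstein polynomials: the modulus is bounded by a constant plus a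
    multiple of the squared deviation, for every index [j], and the binomial variance is of order
    [n]. *)
Lemma weierstrass psi a b : tame psi -> exists p : nat -> {poly R},
 forall e, 0 < e -> \forall k \near \oo, forall x, a <= x <= b -> `|(p k).[x] - psi x| <= e.
(* The maximum with 1 keeps the length positive when [b <= a]. *)
move=> tp; pose L := Num.max (b - a) 1; have L0 : 0 < L by rewrite lt_max ltr01 orbT.
pose pt (k j : nat) := a + L * (j%:R / k.+1%:R).
exists (fun k => bernstein k.+1 (psi \o pt k) \Po (L^-1 *: ('X - a%:P))) => e e0.
pose Q := `|a| + L; have Q0 : 0 < Q by rewrite /Q ltr_wpDl.
pose d := e / (4 * (1 + 2 * Q)).
have d0 : 0 < d by rewrite divr_gt0// mulr_gt0// ltr_wpDr// mulr_ge0// ltW.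
have [K K0 KP] := tp _ d0.
have Kd0 : 0 < K + d by rewrite ltr_wpDl.
pose eta := e / (4 * (K + d)); have eta0 : 0 < eta by rewrite divr_gt0// mulr_gt0.
have N0 : 0 < e / 2 / ((K + d) / eta * L ^+ 2) by rewrite !divr_gt0// mulr_gt0 ?exprn_gt0// divr_gt0.
near=> k.
have kN : k.+1%:R^-1 < e / 2 / ((K + d) / eta * L ^+ 2) by near: k; exact: near_infty_natSinv_lt (PosNum N0).
move=> x /andP[ax xb]; rewrite horner_comp.
rewrite (_ : (_ *: _).[x] = L^-1 * (x - a)); last by rewrite !hornerE.
set t := L^-1 * (x - a); set n := k.+1.
have n0 : 0 < n%:R :> R by rewrite ltr0n.
have xt : x = a + L * t by rewrite /t mulVKf ?gt_eqF//; ring.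
have t0 : 0 <= t by rewrite /t mulr_ge0 ?invr_ge0 ?(ltW L0)// subr_ge0.
have t1 : t <= 1 by rewrite /t mulrC ler_pdivrMr// mul1r /L le_max lerB.
have t01 : 0 <= t <= 1 by rewrite t0.
have xQ : `|x| <= Q.
 rewrite xt /Q (le_trans (ler_normD _ _))// lerD2l normrM (ger0_norm t0) (ger0_norm (ltW L0)).
 by rewrite ler_piMr// ltW.
(* [c0] consists of two terms equal to [e / 4]; [c1] carries the quadratic part of
   [|D| <= eta + D^2 / eta]. *)
pose c0 := d * (1 + 2 * Q) + (K + d) * eta; pose c1 := (K + d) / eta * (L / n%:R) ^+ 2.
have ptP j : `|psi (pt k j) - psi x| <= c0 + c1 * (j%:R - n%:R * t) ^+ 2.
 set D := pt k j - x. have hD : `|pt k j| <= Q + `|D|.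
  have := ler_normD x D; rewrite (_ : x + D = pt k j); [lra|by rewrite /D; ring].
 have E : c1 * (j%:R - n%:R * t) ^+ 2 = (K + d) / eta * D ^+ 2.
  rewrite /c1 -mulrA -exprMn /D /pt xt; congr (_ * _ ^+ 2). by rewrite -/n; field; rewrite gt_eqF.
 rewrite E; have := KP (pt k j) x; rewrite -/D => h. have am : `|D| <= eta + D ^+ 2 / eta.
  rewrite -(ler_pM2r eta0) mulrDl divfK ?gt_eqF// -(real_normK (num_real D)).
  have := sqr_ge0 (`|D| - eta); have := normr_ge0 D; nra.
 have am2 : (K + d) * `|D| <= (K + d) * (eta + D ^+ 2 / eta) by rewrite ler_wpM2l// ltW.
 have h2 : d * (1 + `|pt k j| + `|x|) <= d * (1 + 2 * Q + `|D|) by rewrite ler_wpM2l ?(ltW d0)//; lra.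
 rewrite /c0 (_ : (K + d) / eta * D ^+ 2 = (K + d) * (D ^+ 2 / eta)); last by ring. by lra.
have var : c1 * (bernstein n (fun j => (j%:R - n%:R * t) ^+ 2)).[t] <= e / 2.
 rewrite bernstein_variance subrr expr0n add0r /c1. apply: (@le_trans _ _ ((K + d) / eta * L ^+ 2 / n%:R)).
  rewrite (_ : _ * (n%:R * _) = (K + d) / eta * L ^+ 2 / n%:R * (t * (1 - t))); last first.
   by field; rewrite !gt_eqF. apply: ler_piMr; last by nra.
  by rewrite divr_ge0 ?(ltW n0)// mulr_ge0 ?sqr_ge0// divr_ge0// ltW.
 rewrite mulrC -ler_pdivlMr; last by rewrite mulr_gt0 ?exprn_gt0// divr_gt0. exact/ltW.
have ub : (bernstein n (psi \o pt k)).[t] <= psi x + c0 + c1 * (bernstein n (fun j => (j%:R - n%:R * t) ^+ 2)).[t].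
 rewrite -[X in X + _ * _](bernstein_cst n _ t) -[X in X + _]mul1r -bernstein_lin.
 apply: bernstein_le => // j; have := ptP j; rewrite ler_norml => /andP[_]; rewrite /= mul1r; lra.
have lb : psi x - c0 - c1 * (bernstein n (fun j => (j%:R - n%:R * t) ^+ 2)).[t] <= (bernstein n (psi \o pt k)).[t].
 rewrite -mulNr -[X in X + _ * _](bernstein_cst n _ t) -[X in X + _]mul1r -bernstein_lin.
 apply: bernstein_le => // j; have := ptP j; rewrite ler_norml => /andP[+ _]; rewrite /= mul1r; lra.
have c0e : c0 <= e / 2.
 have h1 : d * (1 + 2 * Q) = e / 4 by rewrite /d; field; lra.
 have h2 : (K + d) * eta = e / 4 by rewrite /eta; field; rewrite gt_eqF. by rewrite /c0 h1 h2; lra.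
by rewrite ler_norml; lra.
Unshelve. all: by end_near. Qed.
End Tame.

Lemma tame_growth (R : realType) (phi : R -> R) : tame phi ->
 exists2 c, 0 <= c & forall x, `|phi x| <= c * (1 + `|x|).
move=> /(_ 1 ltr01)[K K0 KP]; exists (`|phi 0| + 1 + K); first by rewrite !addr_ge0.
move=> x; have := KP x 0; rewrite normr0 subr0 => h.
have := ler_normD (phi x - phi 0) (phi 0); rewrite subrK.
have := normr_ge0 x; have := normr_ge0 (phi 0); move=> p0 x0 h2.
have : 0 <= `|phi 0| * `|x| by rewrite mulr_ge0.
by nra.
Qed.

(** * Monotonicity of almost-everywhere statements *)

Section AlmostEverywhere.
Context d (T : measurableType d) (R : realType) (mu : {measure set T -> \bar R}).
Variables P Q S : T -> Prop.

Lemma aeS : {ae mu, forall x, P x} -> (forall x, P x -> Q x) -> {ae mu, forall x, Q x}.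
by move=> h H; apply: (@filterS _ _ (ae_filter_ringOfSetsType mu) _ _ _ h). Qed.

Lemma aeS2 : {ae mu, forall x, P x} -> {ae mu, forall x, Q x} -> (forall x, P x -> Q x -> S x) ->
 {ae mu, forall x, S x}.
by move=> h k H; apply: (@filterS2 _ _ (ae_filter_ringOfSetsType mu) _ _ _ _ h k). Qed.

End AlmostEverywhere.

(** * From a Lebesgue measurable symbol to the limit theorem *)

Section Symbol.
Variables (R : realType) (m : nat).
Notation C := R[i].
Notation RR := (RxR R).
Notation n := m.+1.
Notation X := (n.-tuple RR).
Notation mu := (vol R n).
Notation lam := (@lebesgueCn R n).
Notation aeq F G := {ae lam, forall x, tsq x < 1 -> F (toCn x) = G x}.
Implicit Types (F : Cn R n -> R) (G : X -> R).

(** The completed measure is complete, so a function equal almost everywhere to a Borel one is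
    measurable and has the same integral. *)
Lemma ball_ae F G : mfun G -> aeq F G ->
 int_ball F = rint mu (fun x => ib 1 x * G x) /\ (integrable_on_ball F <-> rintg mu (fun x => ib 1 x * G x)).
move=> mG aeq; pose G' z := G (ofCn z).
have Ex (x : X) : G' (toCn x) = G x by rewrite /G' toCnK.
have E : (fun x : X => G' (toCn x)) = G by apply/funext => x; rewrite /G' toCnK.
have mG' : mfun (fun x : X => G' (toCn x)) by rewrite E.
have e : ae_eq lam (@ball_coords R n) (fun x => (G' (toCn x))%:E) (fun x => (F (toCn x))%:E).
 apply: (aeS aeq) => x h /unit_ball_toCn x1. exact: (congr1 EFin (etrans (Ex x) (esym (h x1)))).
have m1 : measurable_fun (@ball_coords R n) (fun x => (G' (toCn x))%:E).
 rewrite ball_coordsE; apply: meas_fun_completion; first exact: meas_tball.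
 by apply/mEFinP; exact: measurable_funS mG'.
have m2 := ae_measurable_fun (@measure_is_complete_caratheodory _ _ _) e m1.
have mB := @measurable_ball_coords R n.
have E2 : (fun x : X => ib 1 x * G' (toCn x)) = fun x => ib 1 x * G x by apply/funext => x; rewrite Ex.
rewrite -E2 -(int_ballE mG') -(integrable_on_ballE mG'); split; first by congr fine; apply/esym/ae_eq_integral.
have ea := ae_eq_abse e.
have Ei := ae_eq_integral _ _ mB (mcomp (@abse_measurable R setT) m1) (mcomp (@abse_measurable R setT) m2) ea.
by split => /integrableP[_ h]; apply/integrableP; split => //; rewrite ?Ei// -Ei.
Qed.

(** The conclusion shared by the two cases. Well-posedness is part of it, because [toeplitz],
    [funcalc] and [op_trace] fall back on default values otherwise. *)
Definition toeplitz_trace_limit (sigma : Cn R n -> R) (psi : R -> R) : Prop :=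
 (forall alpha : R, -1 < alpha ->
  let T := toeplitz alpha sigma in let S := funcalc (bergman (n := n) alpha) (bergman_ip alpha) psi T in
  [/\ is_toeplitz alpha sigma T, selfadjoint (bergman alpha) (bergman_ip alpha) T,
   is_funcalc (bergman alpha) (bergman_ip alpha) psi T S &
   exists t, has_trace (bergman alpha) (bergman_ip alpha) (T \o S) t]) /\
 (((pi ^+ n * Gamma (alpha + 1) / Gamma (n%:R + alpha + 1))%:C *
  op_trace (bergman alpha) (bergman_ip alpha) (toeplitz alpha sigma \o
   funcalc (bergman (n := n) alpha) (bergman_ip alpha) psi (toeplitz alpha sigma)) : cplx R)
  @[alpha --> +oo] --> ((int_ball (fun z => sigma z * psi (sigma z) * inv_density z))%:C : cplx R)).

(** * The Toeplitz operator and its calculus for a fixed weight *)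

Section Calculus.
Variable a : R.
Hypothesis a1 : -1 < a.
Notation cst := (cst_alpha n a).
Notation ip := (bergman_ip (n := n) a).
Notation W := (subspace_type (bsub m a)).
Notation bip := (@bip R m a).
Notation kap := (kap a1).

Lemma normalized_kernelE (z : Cn R n) : sqnorm z < 1 -> exists2 c : R,
 normalized_kernel a z = c%:C *: bkernel a z & c ^+ 2 = (1 - sqnorm z) `^ (n%:R + 1 + a).
move=> z1; pose p := 1 - sqnorm z; have p0 : 0 < p by rewrite subr_gt0.
pose c := (p `^ (n%:R + 1 + a)) `^ 2^-1; exists c; last first.
 by rewrite /c powR12_sqrt ?powR_ge0// sqr_sqrtr ?powR_ge0.
have c0 : 0 < c by rewrite /c !powR_gt0.
have c2 : c ^+ 2 = p `^ (n%:R + 1 + a) by rewrite /c powR12_sqrt ?powR_ge0// sqr_sqrtr ?powR_ge0.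
apply/funext => w; rewrite /normalized_kernel /bkernel z1 /=.
have -> : (c%:C *: (fun z0 : Cn R n => if sqnorm z0 < 1 then cpow (1 - dotCn z0 z) (- (n%:R + 1 + a)) else 0)) w
 = c%:C * (if sqnorm w < 1 then cpow (1 - dotCn w z) (- (n%:R + 1 + a)) else 0) by [].
have -> : (w \in unit_ball) = (sqnorm w < 1).
 by apply/idP/idP => [/set_mem//|w1]; apply/mem_set.
case: ifP => w1; last by rewrite mulr0.
rewrite mulrC /bergman_kernel dotCnn -RCB cpowR// powRN -c2 -exprVn [_ ^+ 2]expr2 RCM -expr2.
by rewrite sqrCK ?ler0c ?invr_ge0 ?(ltW c0)// RCV invrK.
Qed.

Variables (sigma : Cn R n -> R) (sig : X -> R).
Hypotheses (msig : mfun sig)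
 (ae_sig : aeq sigma sig) (isig : rintg mu (fun x => `|sig x| * diag bip kap x)).

Let hW : hilbert bip := hilbert_bergman m a1.

(** The reproducing property evaluates both products, and the squared normalising factor
    [(1 - |z|^2) ^ (n + 1 + a)] times the invariant density is the Bergman weight. *)
Lemma toeplitz_integrand f g z : bergman a f -> bergman a g -> sqnorm z < 1 ->
 (sigma z)%:C * ip f (normalized_kernel a z) * ip (normalized_kernel a z) g * (inv_density z)%:C =
 (sigma z * weight a z)%:C * (f z * (g z)^*).
move=> Hf Hg z1; have [c -> c2] := normalized_kernelE z1.
have Hk := bkernel_bergman a1 z1.
have Hck : bergman a (c%:C *: bkernel a z) by rewrite -[_ *: _]addr0; apply: (subspaceP (bsub m a)) => //; exact: (subspace0 (bsub m a)).
have ckg h : bergman a h -> ip (c%:C *: bkernel a z) h = c%:C * (h z)^*.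
 move=> Hh; have H0 := subspace0 (bsub m a). have := bergman_ip_linear c%:C Hk H0 Hh; rewrite addr0 => ->.
 have -> : ip (0 : Cn R n -> cplx R) h = 0.
  by have := bergman_ip_linear 1 H0 H0 Hh; rewrite scale1r addr0 mul1r => /eqP; rewrite -subr_eq0 opprD addNKr oppr_eq0 => /eqP.
 by rewrite addr0 (bergman_ipC Hh Hk) -(bergman_repro a1 Hh z1).
have ckf : ip f (c%:C *: bkernel a z) = c%:C * f z.
 by rewrite (bergman_ipC Hck Hf) ckg// conjcM conjcR; congr (_ * _); exact: conjcK.
rewrite ckf ckg//.
have p0 : 0 < 1 - sqnorm z by rewrite subr_gt0.
have E : weight a z = c ^+ 2 * inv_density z.
 rewrite c2 /weight /inv_density -powR_mulrn ?(ltW p0)// -powRN -powRD; last by rewrite (gt_eqF p0) implybT.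
 by congr (_ `^ _); rewrite -natr1; ring.
by rewrite E [c ^+ 2]expr2 !RCM; ring.
Qed.

Lemma toeplitz_formE (f g : W) : cst%:C * cint_ball (fun z => (sigma z)%:C * ip (sub_val f) (normalized_kernel a z) *
  ip (normalized_kernel a z) (sub_val g) * (inv_density z)%:C) = form bip mu kap sig f g.
have c0 : cst != 0 by rewrite gt_eqF// cst_gt0.
set F := fun z => _; pose h x := sub_val f (toCn x) * (sub_val g (toCn x))^*.
have Hf := sub_bergman f; have Hg := sub_bergman g.
have mh : cmeas setT h.
 have /bergmanP[hf _] := Hf; have /bergmanP[hg _] := Hg.
 by apply: cmeasM => //; [exact: hol_meas|apply: cmeasJ => //; exact: hol_meas].
have [m1 m2] := mh.
have mw : mfun (fun x : X => weight a (toCn x)) by exact: meas_weight.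
have aeq (p : C -> R) (pZ : forall (t : R) u, p (t%:C * u) = t * p u) :
  {ae lam, forall x, tsq x < 1 -> p (F (toCn x)) = sig x * weight a (toCn x) * p (h x)}.
 apply: (aeS ae_sig) => x hx x1. rewrite /F toeplitz_integrand//; last by rewrite sqnorm_toCn.
 by rewrite pZ (hx x1).
have [i1 i2] := form_integrable hW (rkhs_bergman m a1) msig isig f g.
have E x : (sig x)%:C * evl bip kap f x * (evl bip kap g x)^* = (cst * (ib 1 x * (sig x * weight a (toCn x))))%:C * h x.
 rewrite !evl_kap conjcM conjcR /h. rewrite (_ : cst * _ = sig x * (dsqrt a x ^+ 2)).
  by rewrite [_ ^+ 2]expr2 !RCM; ring. by rewrite dsqrt_sqr// -weight_bwt; ring.
have fin (p : C -> R) (pZ : forall (t : R) u, p (t%:C * u) = t * p u) :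
  mfun (fun x => p (h x)) -> rintg mu (fun x => p ((sig x)%:C * evl bip kap f x * (evl bip kap g x)^*)) ->
  cst * int_ball (fun z => p (F z)) = rint mu (fun x => p ((sig x)%:C * evl bip kap f x * (evl bip kap g x)^*)).
 move=> mp ip1; have mG : mfun (fun x => sig x * weight a (toCn x) * p (h x)).
  by apply: mfunM => //; apply: mfunM. rewrite (ball_ae mG (aeq p pZ)).1.
 rewrite (_ : (fun x => ib 1 x * _) = fun x => cst^-1 * p ((sig x)%:C * evl bip kap f x * (evl bip kap g x)^*)).
  by rewrite rintZ// mulVKf. by apply/funext => x; rewrite E pZ; field.
have ReP (t : R) (u : C) : cRe (t%:C * u) = t * cRe u by rewrite ReZ.
have ImP (t : R) (u : C) : cIm (t%:C * u) = t * cIm u by rewrite ImZ.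
rewrite /form /cint; apply: eqc.
 by rewrite ReZ; exact: (fin (@cRe R) ReP m1 i1).
by rewrite ImZ; exact: (fin (@cIm R) ImP m2 i2).
Qed.

Lemma is_toeplitz_restrict (T : (Cn R n -> cplx R) -> (Cn R n -> cplx R)) (T' : W -> W) :
 (forall w, sub_val (T' w) = T (sub_val w)) ->
 is_toeplitz a sigma T <-> bounded_op setT bip T' /\ forall f g, bip (T' f) g = form bip mu kap sig f g.
move=> TT; split=> -[bT fT]; (split; first exact/(bounded_op_iff _ TT)).
 by move=> f g; rewrite /bip /sub_ip TT fT ?toeplitz_formE//; exact: sub_bergman.
move=> f g Hf Hg; have := fT (to_sub (bsub m a) Hf) (to_sub (bsub m a) Hg).
by rewrite -toeplitz_formE /bip /sub_ip TT.
Qed.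

Lemma toeplitzP : is_toeplitz a sigma (toeplitz a sigma).
apply: xgetPex; have [T0 [Tl TB TM]] := toeplitz_exists hW (rkhs_bergman m a1) msig isig.
have bT : bounded_op setT bip T0.
 by split => //; exists (rint mu (fun x => `|sig x| * diag bip kap x)) => f _; exact: TM.
have [T [TT _]] := bounded_op_extend bT.
by exists T; apply/(is_toeplitz_restrict TT).
Qed.

Variables (A : R) (B : \bar R) (psi phi : R -> R).
Hypotheses (sigJ : forall x, (A%:E <= (sig x)%:E <= B)%E)
 (tphi : tame phi) (phiE : forall x, (A%:E <= x%:E <= B)%E -> phi x = psi x)
 (isig2 : rintg mu (fun x => sig x ^+ 2 * diag bip kap x)).
Notation I1 := (rint mu (fun x => `|sig x| * diag bip kap x)).
Notation I2 := (rint mu (fun x => sig x ^+ 2 * diag bip kap x)).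

Lemma meas_psi_sig : mfun (fun x => psi (sig x)).
rewrite (_ : (fun x => _) = phi \o sig).
 exact: (mcomp (continuous_measurable_fun (tame_continuous tphi)) msig).
by apply/funext => x /=; rewrite phiE.
Qed.

Lemma rintg_psi_sig (w : X -> R) : mfun w -> (forall x, 0 <= w x) ->
 rintg mu (fun x => `|sig x| * w x) -> rintg mu (fun x => sig x ^+ 2 * w x) ->
 rintg mu (fun x => sig x * psi (sig x) * w x).
move=> mw w0 i1 i2; have [c c0 cP] := tame_growth tphi.
apply: (rintg_le _ _ (rintgZ c (rintgD i1 i2))).
 by do 2!apply: mfunM => //; exact: meas_psi_sig.
move=> x; rewrite !normrM (ger0_norm (w0 x)) -mulrDl mulrA ler_wpM2r//.
have := cP (sig x); rewrite phiE// => h.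
rewrite -(real_normK (num_real (sig x))).
have := ler_wpM2l (normr_ge0 (sig x)) h; nra.
Qed.

(** [phi] extends [psi] tamely from the interval between [A] and [B], with [B = +oo] for nonnegative
    symbols. Eigenvalues are means of [sig], so they stay in this interval and the calculus sees
    [psi] only where it equals [phi]. The modulus is left free in the last clause, to be chosen
    after [e]. *)
Lemma toeplitz_calculus (T := toeplitz a sigma) (S := funcalc (bergman (n := n) a) ip psi T) :
 [/\ is_toeplitz a sigma T, selfadjoint (bergman a) ip T, is_funcalc (bergman a) ip psi T S &
  exists l : R, [/\ has_trace (bergman a) ip (T \o S) l%:C, op_trace (bergman a) ip (T \o S) = l%:C &
   forall eps K eta v : R, 0 <= eps -> 0 <= K -> 0 < eta ->
    (forall x y, `|phi x - phi y| <= eps * (1 + `|x| + `|y|) + K * `|x - y|) ->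
    (\int[mu]_x \int[mu]_y ((sig x - sig y) ^+ 2 * ker2 bip kap x y)%:E <= v%:E)%E ->
    `|l - rint mu (fun x => sig x * psi (sig x) * diag bip kap x)| <=
     eps * (I1 + 2 * I2) + K * (eta * I2 + v / (8 * eta))]].
have hR := rkhs_bergman m a1; have tT : is_toeplitz a sigma T := toeplitzP.
have [T' [TT bT]] := bounded_op_restrict (bsub m a) tT.1.
have [_ TB] := (is_toeplitz_restrict TT).1 tT.
have Tl b f g : T' (b *: f + g) = b *: T' f + T' g by have [_ lT _] := bT; exact: lT.
have Ts := toeplitz_selfadjoint hW hR msig isig TB.
have [u [lm [ou tu Tu]]] := toeplitz_eigenbasis hW hR msig isig Tl TB.
have lA := eigenvalue_lower hW hR msig isig TB ou Tu (fun x => (andP (sigJ x)).1).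
have lM k : lm k <= I1 by apply: (le_trans (ler_norm _)); exact: (eigenvalue_le hW hR msig isig TB ou Tu).
(* When [B = +oo], the mass [I1] bounds the eigenvalues, and the calculus takes place on the compact
   interval [[A, I1]]. *)
have [b [lb bJ]] : exists b, (forall k, lm k <= b) /\ forall x, A <= x <= b -> (A%:E <= x%:E <= B)%E.
 have [s0 s1] := andP (sigJ (ofCn 0)). case: B sigJ s1 => [B' sJ _|_ _|//].
  exists B'; split; last by move=> x; rewrite !lee_fin.
  by apply: (eigenvalue_upper hW hR msig isig TB ou Tu) => x; have /andP[_] := sJ x; rewrite lee_fin.
 by exists I1; split => // x /andP[Ax _]; rewrite lee_fin Ax leey.
have lab k : A <= lm k <= b by rewrite lb andbT; exact: lA.
have lJ k := bJ _ (lab k).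
have [c c0 cP] := tame_growth tphi.
pose P := c * (1 + (`|A| + `|b|)).
have psiP x : A <= x <= b -> `|psi x| <= P.
 move=> xab; rewrite -phiE ?bJ// (le_trans (cP _))// ler_wpM2l// lerD2l.
 have /andP[Ax xb] := xab; rewrite ler_norml.
 have := ler_norm A; have := ler_norm (- A); have := ler_norm b; have := normr_ge0 A; have := normr_ge0 b.
 by rewrite normrN; lra.
have [p pP] := weierstrass A b tphi.
have [S' fS'] : exists S', is_funcalc setT bip psi T' S'.
 apply: (funcalc_exists hW ou tu Ts Tu lab psiP (p := p)) => e e0.
 apply: filterS (pP e e0) => k h x xab; rewrite -phiE ?bJ//; exact: h.
have fS : is_funcalc (bergman a) ip psi T S.
 apply: xgetPex; have [S0 [SS _]] := bounded_op_extend fS'.1.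
 by exists S0; exact: (proj2 (is_funcalc_restrict ip psi TT SS) fS').
have [S'' [SS bS]] := bounded_op_restrict (bsub m a) fS.1.
have fS'' := (is_funcalc_restrict ip psi TT SS).1 fS.
have Su k := funcalc_eigen hW ou tu Ts Tu k fS''.
pose D := T' \o S''.
have bD : bounded_op setT bip D.
 have [_ lS [M2 hM2]] := bS; have [_ lT [M1 hM1]] := bT; split => //.
  by move=> t f g _ _; rewrite /D /= lS// lT.
 exists (`|M1| * M2) => f _; rewrite -mulrA (le_trans (hM1 _ _))//.
 apply: (@le_trans _ _ (`|M1| * hnorm bip (S'' f))); first by rewrite ler_wpM2r ?sqrtr_ge0// ler_norm.
 by rewrite ler_wpM2l// hM2.
have Du k : D (u k) = (lm k * psi (lm k))%:C *: u k.
 have T'Z z f : T' (z *: f) = z *: T' f.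
  have T0 : T' 0 = 0 by have := Tl 1 0 0; rewrite !scale1r addr0 => /eqP; rewrite -subr_eq0 opprD addNKr oppr_eq0 => /eqP.
  by have := Tl z f 0; rewrite !addr0 T0 addr0. by rewrite /D /= Su T'Z Tu scalerA -RCM mulrC.
have tr n0 : \sum_(0 <= k < n0) `|lm k * psi (lm k)| <= I1 * P.
 apply: (@le_trans _ _ (\sum_(0 <= k < n0) `|lm k| * P)).
  by apply: ler_sum => k _; rewrite normrM ler_wpM2l ?psiP.
 rewrite -mulr_suml ler_wpM2r//; first by rewrite /P mulr_ge0// !addr_ge0.
 exact: (eigenvalue_sum hW hR msig isig TB ou Tu).
have [l [cl hD]] := has_trace_diagonal hW ou tu bD Du tr.
have TSD w : sub_val (D w) = (T \o S) (sub_val w) by rewrite /D /= TT SS.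
have hTS := (has_trace_restrict ip l%:C TSD).2 hD.
have sT : selfadjoint (bergman a) ip T.
 move=> f g Hf Hg; have := Ts (to_sub (bsub m a) Hf) (to_sub (bsub m a) Hg). by rewrite /bip /sub_ip !TT.
split => //; exists l; split => //.
 exact: (op_traceE (proj2 (onb_restrict ip u) (conj ou tu)) hTS).
move=> eps K eta v e0 K0 eta0 mod var.
apply: (trace_estimate hW hR msig isig Tl TB ou tu Tu isig2 e0 K0 eta0 meas_psi_sig _ _ var cl).
 by apply: rintg_psi_sig => //; [exact: (rkhs_meas_diag hR)|move=> x; exact: sqr_ge0].
by move=> k x; rewrite -!phiE.
Qed.

End Calculus.

(* Over an orthonormal basis, the norms [|e_k(x)|^2] add up to at most the kernel on the diagonal, each with integral 1. *)
Lemma iwt_not_integrable : ~ rintg mu (@iwt R n).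
move=> iw; have a1 : -1 < (0 : R) by lra.
have hW := hilbert_bergman m a1; have hR := rkhs_bergman m a1.
have [e [oe _]] := onb_exists hW hR.
have id : rintg mu (diag (@bip R m 0) (kap a1)).
 rewrite (_ : diag _ _ = fun x => cst_alpha n 0 * iwt x); first exact: rintgZ.
 by apply/funext => x; rewrite diag_kap.
have le k : k%:R <= rint mu (diag (@bip R m 0) (kap a1)).
 have -> : k%:R = rint mu (fun x => \sum_(0 <= j < k) ev2 (@bip R m 0) (kap a1) (e j) x).
  rewrite rint_sum; last by move=> j; exact: rintg_ev2.
  under eq_bigr do rewrite (rint_ev2 hR) (hnorm_onb oe) expr1n. by rewrite sumr_const_nat subn0.
 apply: rint_le => //; first by apply: rintg_sum => j; exact: rintg_ev2.
 move=> x; have := bessel hW oe (kap a1 x) k; apply: le_trans.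
 by apply: ler_sum => j _; rewrite /ev2 /evl (ip_conj hW) normcJ.
have := le (Num.truncn (rint mu (diag (@bip R m 0) (kap a1)))).+1.
by have := truncnS_gt (rint mu (diag (@bip R m 0) (kap a1))); rewrite ltNge => /negP.
Qed.

Lemma iwt_ge0 (x : X) : 0 <= iwt x.
by rewrite /iwt; case: ltP => // x1; rewrite invr_ge0 exprn_ge0// subr_ge0 ltW. Qed.
Lemma inv_density_weight (x : X) : tsq x < 1 -> inv_density (toCn x) = iwt x.
by move=> x1; rewrite /inv_density /iwt x1 sqnorm_toCn. Qed.
Lemma meas_iw : mfun (@iwt R n).
exact: meas_iwt. Qed.

Lemma ball_weighted (F : Cn R n -> R) (G : X -> R) : mfun G ->
 aeq F G -> int_ball (fun z => F z * inv_density z) = rint mu (fun x => G x * iwt x) /\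
 (integrable_on_ball (fun z => F z * inv_density z) <-> rintg mu (fun x => G x * iwt x)).
move=> mG FG; rewrite -(_ : (fun x => ib 1 x * (G x * iwt x)) = fun x => G x * iwt x).
 apply: ball_ae; first by apply: mfunM => //; exact: meas_iw. apply: (aeS FG) => x h x1.
 by rewrite (h x1) (inv_density_weight x1).
by apply/funext => x; rewrite /ib /iwt; case: ifP => _; rewrite ?mul1r// mul0r mulr0.
Qed.

(** * The limit for a Borel symbol and a tame function *)

Section Limit.
Variables (sigma : Cn R n -> R) (sig : X -> R).
Hypotheses (msig : mfun sig)
 (sig0 : forall x, 1 <= tsq x -> sig x = 0) (ae_sig : aeq sigma sig)
 (isig : rintg mu (fun x => `|sig x| * iwt x)) (isig2 : rintg mu (fun x => sig x ^+ 2 * iwt x)).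
Variables (A : R) (B : \bar R) (psi phi : R -> R).
Hypotheses (sigJ : forall x, (A%:E <= (sig x)%:E <= B)%E)
 (tphi : tame phi) (phiE : forall x, (A%:E <= x%:E <= B)%E -> phi x = psi x).
Notation I1 := (rint mu (fun x => `|sig x| * iwt x)).
Notation I2 := (rint mu (fun x => sig x ^+ 2 * iwt x)).
Notation I := (rint mu (fun x => sig x * psi (sig x) * iwt x)).

Lemma symbol_integral : int_ball (fun z => sigma z * psi (sigma z) * inv_density z) = I.
have mp := meas_psi_sig msig sigJ tphi phiE.
apply: (ball_weighted (F := fun z => sigma z * psi (sigma z)) (G := fun x => sig x * psi (sig x)) _ _).1.
 exact: mfunM.
by apply: (aeS ae_sig) => x h x1; rewrite (h x1).
Qed.

Lemma rintg_diag a (a1 : -1 < a) (G : X -> R) : rintg mu (fun x => G x * iwt x) ->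
 rintg mu (fun x => G x * diag (@bip R m a) (kap a1) x) /\
 rint mu (fun x => G x * diag (@bip R m a) (kap a1) x) = cst_alpha n a * rint mu (fun x => G x * iwt x).
move=> iG; rewrite (_ : (fun x => _) = fun x => cst_alpha n a * (G x * iwt x)); last first.
 by apply/funext => x; rewrite diag_kap; ring.
by split; [exact: rintgZ|exact: rintZ].
Qed.

Lemma energy_iterated a (a1 : -1 < a) v : (energy mu (@bker R n) a sig <= v%:E)%E ->
 (\int[mu]_x \int[mu]_y ((sig x - sig y) ^+ 2 * ker2 (@bip R m a) (kap a1) x y)%:E <=
  (cst_alpha n a * v)%:E)%E.
move=> ev; have c0 := cst_alpha_gt0 n a1.
have md : mfun (fun p : X * X => (sig p.1 - sig p.2) ^+ 2 * bker a p.1 p.2).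
 apply: mfunM; last exact: meas_bker. by apply: mfunX; apply: mfunB;
  [apply: (mcomp msig measurable_fst)|apply: (mcomp msig measurable_snd)].
have := fubini_tonelli1 (m1 := mu) (m2 := mu) (fun p : X * X => (cst_alpha n a * ((sig p.1 - sig p.2) ^+ 2 * bker a p.1 p.2))%:E).
move=> /(_ _ _)/wrap[||]; first by apply/mEFinP; exact: mfunM.
 by move=> p; rewrite lee_fin mulr_ge0 ?(ltW c0)// mulr_ge0 ?sqr_ge0// bker_ge0.
rewrite /fubini_F /= => E.
have -> : (\int[mu]_x \int[mu]_y ((sig x - sig y) ^+ 2 * ker2 (@bip R m a) (kap a1) x y)%:E =
  \int[mu]_x \int[mu]_y (cst_alpha n a * ((sig x - sig y) ^+ 2 * bker a x y))%:E)%E.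
 by apply: eq_integral => x _; apply: eq_integral => y _; rewrite ker2_kap; congr (_ %:E); ring.
rewrite -E; under eq_integral => p _ do rewrite EFinM.
rewrite ge0_integralZl//; last by rewrite lee_fin ltW.
- by rewrite [leRHS]EFinM; apply: lee_wpmul2l => //; rewrite lee_fin ltW.
- exact/mEFinP.
- by move=> p _; rewrite lee_fin mulr_ge0 ?sqr_ge0// bker_ge0.
Qed.

(** Division by [cst_alpha] removes [alpha] from the bound of [toeplitz_calculus] except through the
    normalised energy, which [berezin_limit] makes small. *)
Theorem toeplitz_limit : toeplitz_trace_limit sigma psi.
rewrite /toeplitz_trace_limit.
have main (alpha : R) (a1 : -1 < alpha) := toeplitz_calculus msig ae_sig (rintg_diag a1 isig).1 sigJ tphi phiE (rintg_diag a1 isig2).1.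
split.
 by move=> alpha a1; have [h1 h2 h3 [l [h4 _ _]]] := main alpha a1; split => //; exists l%:C.
rewrite symbol_integral.
set f := (fun alpha : R => _ : cplx R).
have near_f e : 0 < e -> \forall alpha \near +oo, exists2 r : R, f alpha = r%:C & `|I - r| <= e.
 move=> e0. have I10 : 0 <= I1 by apply: rint_ge0 => x; rewrite mulr_ge0 ?iwt_ge0.
 have I20 : 0 <= I2 by apply: rint_ge0 => x; rewrite mulr_ge0 ?sqr_ge0 ?iwt_ge0.
 (* The order of choice is [eps], its slope [K], then [eta], then the energy [v]; each of the three
    terms is then at most [e / 4]. *)
 pose q := 4 * (I1 + 2 * I2 + 1); have q0 : 0 < q by rewrite /q; lra.
 pose eps := e / q; have eps0 : 0 < eps by rewrite divr_gt0. have [K K0 KP] := tphi eps0.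
 pose q2 := 4 * (K * I2 + 1). have KI : 0 <= K * I2 by rewrite mulr_ge0.
 have q20 : 0 < q2 by rewrite /q2; lra. pose eta := e / q2; have eta0 : 0 < eta by rewrite divr_gt0.
 pose v := e * eta / (K + 1). have K1 : 0 < K + 1 by lra. have v0 : 0 < v by rewrite divr_gt0// mulr_gt0.
 have [A0 A00 A0P] := (berezin_limit (kernel_family_bergman R m) msig sig0 isig2).2 v v0.
 exists A0; split; first exact: num_real. move=> alpha A0a; have a1 : -1 < alpha by lra.
 have c0 := cst_alpha_gt0 n a1. have [_ _ _ [l [_ El hl]]] := main alpha a1.
 have H := hl eps K eta (cst_alpha n alpha * v) (ltW eps0) K0 eta0 KP (energy_iterated a1 (A0P _ (ltW A0a))).
 exists (l / cst_alpha n alpha). rewrite /f El -RCM; congr (_%:C); rewrite mulrC; congr (_ * _).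
  by rewrite /cst_alpha invf_div. rewrite (rintg_diag a1 isig).2 (rintg_diag a1 isig2).2 in H.
 rewrite (rintg_diag a1 (rintg_psi_sig msig sigJ tphi phiE meas_iw iwt_ge0 isig isig2)).2 in H.
 have -> : I - l / cst_alpha n alpha = - (cst_alpha n alpha)^-1 * (l - cst_alpha n alpha * I).
  by field; rewrite gt_eqF. rewrite normrM normrN (ger0_norm (_ : 0 <= _^-1)) ?invr_ge0 ?(ltW c0)//.
 rewrite mulrC ler_pdivrMr// (le_trans H)//.
 have -> : eps * (cst_alpha n alpha * I1 + 2 * (cst_alpha n alpha * I2)) +
   K * (eta * (cst_alpha n alpha * I2) + cst_alpha n alpha * v / (8 * eta)) =
   (eps * (I1 + 2 * I2) + eta * (K * I2) + K * v / (8 * eta)) * cst_alpha n alpha. by field; rewrite gt_eqF.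
 rewrite ler_wpM2r ?(ltW c0)//. have b1 : eps * (I1 + 2 * I2) <= e / 4.
  rewrite /eps /q (_ : e / 4 = e / (4 * (I1 + 2 * I2 + 1)) * (I1 + 2 * I2 + 1)); last by field; lra.
  by rewrite ler_wpM2l ?(ltW eps0)//; lra. have b2 : eta * (K * I2) <= e / 4.
  rewrite /eta /q2 (_ : e / 4 = e / (4 * (K * I2 + 1)) * (K * I2 + 1)); last by field; lra.
  by rewrite ler_wpM2l ?(ltW eta0)//; lra. have b3 : K * v / (8 * eta) <= e / 4.
  rewrite ler_pdivrMr; last by rewrite mulr_gt0. rewrite /v mulrA ler_pdivrMr//.
  have w0 := mulr_gt0 e0 eta0; have kw := mulr_ge0 K0 (ltW w0).
  have -> : e / 4 * (8 * eta) * (K + 1) = 2 * (K * (e * eta)) + 2 * (e * eta) by field. by lra. by lra.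
apply/cvgrPdist_le => e e0.
have [Er _] := normC_real (ltW e0).
have r0 : 0 < cRe e by move: e0; rewrite {1}Er ltcR.
apply: filterS (near_f _ r0) => alpha [s -> sr].
by rewrite Er -RCB normr_normc normcR lecR.
Qed.

End Limit.

Variables (sigma : Cn R n -> R) (psi : R -> R).
Hypothesis msigma : measurable_on_ball sigma.

Lemma meas_ib1 : mfun (fun x : X => ib 1 x).
exact: meas_ib. Qed.

Lemma borel_version : exists2 g : X -> R, mfun g & aeq sigma g.
have ms := msigma; rewrite /measurable_on_ball ball_coordsE in ms.
by have [g mg gE] := completion_borel_fun (@meas_tball R m) ms; exists g.
Qed.

Lemma ae_mrestr (P : X -> Prop) :
 (\forall x \ae mrestr lam (@measurable_ball_coords R n), P x) <-> {ae lam, forall x, tsq x < 1 -> P x}.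
have mB := @measurable_ball_coords R n.
split=> -[N [mN N0 PN]].
 exists (N `&` @ball_coords R n); split; first exact: measurableI. exact: N0.
 move=> x /= /not_implyP[x1 nP]; split; first exact: PN. by rewrite /ball_coords; apply/unit_ball_toCn.
exists (N `|` ~` @ball_coords R n); split; first by apply: measurableU => //; exact: measurableC.
 rewrite /mrestr setIUl setICl setU0; apply/eqP; rewrite -measure_le0 -N0.
 by apply: le_measure => //; rewrite inE//; exact: measurableI.
move=> x /= nP; have [x1|x1] := pselect (@ball_coords R n x); last by right.
by left; apply: PN => /= h; apply: nP; apply: h; apply/unit_ball_toCn.
Qed.

Lemma abs_integrable (sig : X -> R) : rintg mu (fun x => sig x * iwt x) ->
 rintg mu (fun x => `|sig x| * iwt x).
move=> ig; have := rintg_abs ig; congr rintg; apply/funext => x.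
by rewrite normrM (ger0_norm (iwt_ge0 x)).
Qed.

(** Otherwise [iwt] would be dominated by [|g| iwt / r], against [iwt_not_integrable]. This places 0
    between the essential bounds of the symbol. *)
Lemma not_bounded_below (g : X -> R) r : mfun g -> rintg mu (fun x => g x * iwt x) ->
 0 < r -> ~ {ae lam, forall x, tsq x < 1 -> r <= `|g x|}.
move=> mg ig r0 rg.
pose F z := `|g (ofCn z)|.
have mag : mfun (fun x => `|g x|) by apply: mcomp.
have Ea : {ae lam, forall x, tsq x < 1 -> F (toCn x) = `|g x|}.
 by apply: (aeS rg) => x h x1; rewrite /F toCnK.
have mM : mfun (fun x => Num.max r `|g x|) by exact: measurable_maxr.
have Eb : {ae lam, forall x, tsq x < 1 -> F (toCn x) = Num.max r `|g x|}.
 apply: (aeS rg) => x h x1. by rewrite /F toCnK (max_idPr (h x1)).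
have i3 := (ball_weighted mM Eb).2.1 ((ball_weighted mag Ea).2.2 (abs_integrable ig)).
apply: iwt_not_integrable.
apply: (rintg_le meas_iw _ (rintgZ r^-1 i3)) => x.
rewrite (ger0_norm (iwt_ge0 x)) mulrA ler_peMl ?iwt_ge0//.
by rewrite ler_pdivlMl// mulr1 le_max lexx.
Qed.

(** The Borel version is made nonnegative everywhere and 0 off the ball, and [psi] is continued by
    [psi 0] to the negative axis. *)
Theorem toeplitz_limit_nonneg (l : R) : (forall z, unit_ball z -> 0 <= sigma z) ->
 integrable_on_ball (fun z => sigma z * inv_density z) ->
 integrable_on_ball (fun z => sigma z ^+ 2 * inv_density z) ->
 {within `[0, +oo[, continuous psi} -> psi x / x @[x --> +oo] --> l -> toeplitz_trace_limit sigma psi.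
move=> s0 i1 i2 cpsi cl; have [g mg gE] := borel_version.
pose sig x := ib 1 x * Num.max 0 (g x).
have msig : mfun sig.
 by apply: mfunM; [exact: meas_ib1|exact: measurable_maxr].
have sigE : aeq sigma sig.
 apply: (aeS gE) => x h x1. have := s0 (toCn x) ((unit_ball_toCn x).2 x1).
 by rewrite /sig /ib x1 mul1r (h x1) => /max_idPr ->.
have sigE2 : {ae lam, forall x, tsq x < 1 -> sigma (toCn x) ^+ 2 = sig x ^+ 2}.
 by apply: (aeS sigE) => x h x1; rewrite h.
apply: (@toeplitz_limit sigma sig msig _ sigE _ _ 0 +oo%E psi (psi \o Num.max 0)).
- by move=> x x1; rewrite /sig /ib ltNge x1 mul0r.
- exact/abs_integrable/(ball_weighted msig sigE).2.
- by apply/(ball_weighted (F := fun z => sigma z ^+ 2) _ sigE2).2 => //; exact: mfunX.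
- by move=> x; rewrite leey andbT lee_fin /sig /ib; case: ifP; rewrite ?mul0r// mul1r le_max lexx.
- exact: tame_halfline cpsi cl.
- by move=> x /=; rewrite leey andbT lee_fin => /max_idPr ->.
Qed.

(** The symbol is clamped to its essential range and [psi] is frozen outside it. Boundedness
    supplies the second moment from the first. *)
Theorem toeplitz_limit_bounded : (exists M : R, forall z, unit_ball z -> `|sigma z| <= M) ->
 integrable_on_ball (fun z => sigma z * inv_density z) ->
 {within [set x : R | (ess_inf_ball sigma <= x%:E <= ess_sup_ball sigma)%E], continuous psi} -> toeplitz_trace_limit sigma psi.
move=> [M sM] i1; have [g mg gE] := borel_version.
have ig := (ball_weighted mg gE).2.1 i1.
have hi : {ae lam, forall x, tsq x < 1 -> (ess_inf_ball sigma <= (sigma (toCn x))%:E)%E}.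
 by apply/ae_mrestr; exact: ess_inf_le.
have hs : {ae lam, forall x, tsq x < 1 -> ((sigma (toCn x))%:E <= ess_sup_ball sigma)%E}.
 by apply/ae_mrestr; exact: ess_sup_ge.
have li : ((- M)%:E <= ess_inf_ball sigma)%E.
 apply/ess_infP/ae_mrestr/aeW => x x1.
 by rewrite lee_fin; have := sM _ ((unit_ball_toCn x).2 x1); rewrite ler_norml => /andP[].
have ls : (ess_sup_ball sigma <= M%:E)%E.
 apply/ess_supP/ae_mrestr/aeW => x x1.
 by rewrite lee_fin; have := sM _ ((unit_ball_toCn x).2 x1); rewrite ler_norml => /andP[].
(* [sig] is 0 off the ball, so its values stay in [[A, B]] only because this interval contains 0. *)
have i0 : (ess_inf_ball sigma <= 0)%E.
 rewrite leNgt; apply/negP => h. have [r r0 rh] : exists2 r : R, 0 < r & (r%:E <= ess_inf_ball sigma)%E.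
  by case: (ess_inf_ball sigma) h => [r|_|//]; [rewrite lte_fin; exists r|exists 1; rewrite ?leey].
 apply: (not_bounded_below mg ig r0). apply: (aeS2 gE hi) => x e h1 x1.
 by have := le_trans rh (h1 x1); rewrite lee_fin e// => h2; rewrite (le_trans h2)// ler_norm.
have s0 : (0 <= ess_sup_ball sigma)%E.
 rewrite leNgt; apply/negP => h. have [r r0 rh] : exists2 r : R, 0 < r & (ess_sup_ball sigma <= (- r)%:E)%E.
  case: (ess_sup_ball sigma) h => [r|//|_]; last by exists 1; rewrite ?leNye.
  by rewrite lte_fin => r0; exists (- r); rewrite ?oppr_gt0 ?opprK. apply: (not_bounded_below mg ig r0).
 apply: (aeS2 gE hs) => x e h1 x1.
 by have := le_trans (h1 x1) rh; rewrite lee_fin e// => h2; rewrite -normrN (le_trans _ (ler_norm _))// lerNr.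
case: (ess_inf_ball sigma) li i0 hi => [A||] //.
case: (ess_sup_ball sigma) ls s0 hs => [B||] //.
rewrite !lee_fin => _ B0 hs _ A0 hi cpsi.
have AB := le_trans A0 B0.
have {}cpsi : {within `[A, B], continuous psi}.
 by rewrite (_ : [set` `[A, B]] = [set x | (A%:E <= x%:E <= B%:E)%E]).
pose sig x := ib 1 x * clamp A B (g x).
have msig : mfun sig.
 apply: mfunM; first exact: meas_ib1. by apply: measurable_maxr => //; exact: measurable_minr.
have sigE : aeq sigma sig.
 apply: (@filterS3 _ _ (ae_filter_ringOfSetsType lam) _ _ _ _ _ gE hi hs) => x e h1 h2 x1.
 by rewrite /sig /ib x1 mul1r clamp_id -e// -!lee_fin h1//= h2.
have sigJ x : A <= sig x <= B.
 by rewrite /sig /ib; case: ifP => _; rewrite ?mul0r ?mul1r ?clamp_itv// A0.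
have is1 := abs_integrable ((ball_weighted msig sigE).2.1 i1).
apply: (@toeplitz_limit sigma sig msig _ sigE is1 _ A B%:E psi (psi \o clamp A B)).
- by move=> x x1; rewrite /sig /ib ltNge x1 mul0r.
- apply: (rintg_le _ _ (rintgZ (`|A| + `|B|) is1)).
  by apply: mfunM; [exact: mfunX|exact: meas_iw].
 move=> x; rewrite normrM (ger0_norm (iwt_ge0 x)) mulrA ler_wpM2r ?iwt_ge0//.
 rewrite normrX expr2 ler_wpM2r//. have /andP[h1 h2] := sigJ x; rewrite ler_norml.
 have := ler_norm (- A); have := ler_norm B; have := normr_ge0 A; have := normr_ge0 B. by rewrite normrN; lra.
- by move=> x; rewrite !lee_fin.
- exact: tame_clamp.
- by move=> x /=; rewrite !lee_fin => /clamp_id ->.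
Qed.

End Symbol.

Theorem theorem1p1 (R : realType) (n : nat) (n_gt0 : (0 < n)%N)
 (sigma : Cn R n -> R) (psi : R -> R) (msigma : measurable_on_ball sigma)
 (hyp :
  [/\ exists M : R, forall z, unit_ball z -> `|sigma z| <= M,
    integrable_on_ball (fun z => sigma z * inv_density z) &
    {within [set x : R | (ess_inf_ball sigma <= x%:E <= ess_sup_ball sigma)%E],
     continuous psi}]
  \/
  [/\ forall z, unit_ball z -> 0 <= sigma z,
    integrable_on_ball (fun z => sigma z * inv_density z),
    integrable_on_ball (fun z => sigma z ^+ 2 * inv_density z),
    {within `[0, +oo[, continuous psi} &
    exists l : R, psi x / x @[x --> +oo] --> l]) :
 let H := fun alpha : R => @bergman R n alpha in
 let ip := fun alpha : R => @bergman_ip R n alpha in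
 let T := fun alpha : R => toeplitz alpha sigma in
 let psiT := fun alpha : R => funcalc (H alpha) (ip alpha) psi (T alpha) in
 let TpsiT := fun alpha : R => T alpha \o psiT alpha in
 (forall alpha : R, -1 < alpha ->
   [/\ is_toeplitz alpha sigma (T alpha),
     selfadjoint (H alpha) (ip alpha) (T alpha),
     is_funcalc (H alpha) (ip alpha) psi (T alpha) (psiT alpha) &
     exists t, has_trace (H alpha) (ip alpha) (TpsiT alpha) t]) /\
 ((pi ^+ n * Gamma (alpha + 1) / Gamma (n%:R + alpha + 1))%:C *
    op_trace (H alpha) (ip alpha) (TpsiT alpha) : cplx R)
  @[alpha --> +oo] -->
 ((int_ball (fun z => sigma z * psi (sigma z) * inv_density z))%:C : cplx R).
case: n n_gt0 sigma msigma hyp => [//|m] _ {}sigma {}msigma hyp.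
case: hyp => [[bs i1 cp]|[s0 i1 i2 cp [l cl]]].
 exact: toeplitz_limit_bounded.
exact: toeplitz_limit_nonneg s0 i1 i2 cp cl.
Qed.
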